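(* Let $\Lambda Z$ be a Sullivan algebra and let $\Lambda V=\Lambda Z\otimes\Lambda W$ (with $V=Z\oplus W$) be a relative Sullivan algebra with base $\Lambda Z$ and fiber $(\Lambda W,\bar d)$, and let $P$ be a semifree $\Lambda V$-module. Regard $P$ as a $\Lambda Z$-module via $\Lambda Z\subset\Lambda V$ and assume $e_{\Lambda Z}(P)=m$, where $m$ is a non-negative integer. Let $n$ be a non-negative integer such that $e_{\Lambda W}(P^{p,\geq q})\leq n$ for all integers $p,q\geq 0$, where $P^{p,\ge q}$ is the DG module over $(\Lambda W,\bar d)$ defined in the context. Then $e_{\Lambda V}(P)\leq (m+1)(n+2)-2$. Moreover, if $\Lambda V$ itself is a minimal Sullivan algebra, then $e_{\Lambda V}(P)\leq (m+1)(n+1)-1$.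
   Context: The ground ring is a field $\mathbf{k}$ of characteristic $0$. A CDGA is a (graded-)commutative differential graded $\mathbf{k}$-algebra, non-negatively graded, with differential of degree $+1$; it is connected if $H^0=\mathbf{k}$. DG modules over a CDGA may be $\mathbb{Z}$-graded. For a non-negatively graded vector space $V$, $\Lambda V$ is the free graded commutative algebra on $V$, $\Lambda^mV$ is the subspace of elements of wordlength $m$, and $\Lambda^{>m}V$, $\Lambda^{\ge m}V$ are defined analogously. A KS complex is a CDGA $(\Lambda V,d)$ such that $V$ is the union of increasing subspaces $0=V(-1)\subset V(0)\subset V(1)\subset\cdots$ with $dV(k)\subset\Lambda V(k-1)$. A Sullivan algebra is a KS complex with $V$ concentrated in degrees $\ge1$. A Sullivan algebra is minimal if $dV\subset\Lambda^{\ge2}V$. Relative Sullivan algebras: let $B$ be a connected CDGA. A CDGA $B\otimes\Lambda W$, with $W$ concentrated in degrees $\ge1$, is a relative Sullivan algebra with base $B$ if $B\to B\otimes\Lambda W$, $b\mapsto b\otimes1$ is a CDGA morphism and $W$ is the union of increasing subspaces $0=W(-1)\subset W(0)\subset\cdots$ with $d(1\otimes W(k))\subset(\mathbf{k}\oplus B^{\ge1})\otimes\Lambda W(k-1)$. Its fiber is $(\Lambda W,\bar d)$, where $\bar d$ is the $\mathbf{k}\otimes\Lambda W$ component of $d$. A DG module $P$ over a CDGA $A$ is semifree if it is the union of an increasing sequence of DG submodules $0=P(-1)\subset P(0)\subset P(1)\subset\cdots$ such that $P(k)/P(k-1)\cong A\otimes Y(k)$ with $dY(k)=0$ for a graded vector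 space $Y(k)$. Equivalently, $P=A\otimes U$ as a graded module, with $U=\bigcup_kU(k)$ an increasing union, $U(-1)=0$ and $dU(k)\subset A\otimes U(k-1)$. A semifree resolution of a DG module $M$ is a quasi-isomorphism $P\to M$ of $A$-modules with $P$ semifree. Toomer invariant: for a connected KS complex $\Lambda V$ and a semifree $\Lambda V$-module $P$, $e_{\Lambda V}(P)$ is the least integer $m\ge0$ (or $\infty$ if none exists) such that the projection $P\to P/(\Lambda^{>m}V\cdot P)$ is injective on cohomology. For a general $\Lambda V$-module $M$, $e_{\Lambda V}(M)$ is defined as $e_{\Lambda V}$ of a semifree resolution of $M$. The modules $P^{p,\ge q}$: write $P=\Lambda V\otimes U=\Lambda Z\otimes\Lambda W\otimes U$ as graded module, and for $p,q\ge0$ let $P^{\ge p,\ge q}=\Lambda^{\ge p}Z\otimes\Lambda^{\ge q}W\otimes U\subset P$. Then $P^{\ge p,\ge0}$ is a DG submodule of $P$, and $P^{\ge p,\ge0}/P^{\ge p+1,\ge0}$ is a DG module over $\Lambda V$ on which $Z$ acts trivially, hence a DG module over $(\Lambda W,\bar d)$. Set $P^{p,\ge q}=P^{\ge p,\ge q}/P^{\ge p+1,\ge q}$, with the DG $(\Lambda W,\bar d)$-module structure obtained by identifying it with the image of $P^{\ge p,\ge q}$ in $P^{\ge p,\ge0}/P^{\ge p+1,\ge0}$, which is a DG $\Lambda W$-submodule. *)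

(* Defs.v *)
From HB Require Import structures.
From mathcomp Require Import all_boot all_order all_algebra.
From mathcomp Require Import boolp classical_sets.

Set Implicit Arguments.
Unset Strict Implicit.
Unset Printing Implicit Defensive.

Import GRing.Theory.
Local Open Scope classical_set_scope.
Local Open Scope ring_scope.

(* Gradings are internal: a graded vector space is an lmodType together with  *)
(* a family of subspaces (the homogeneous elements of each degree) of which   *)
(* it is the direct sum.  No finiteness or decidability is assumed.           *)

Section Linear.
Variable k : fieldType.
Implicit Types M N E : lmodType k.

Definition submod M (S : set M) : Prop :=
  S 0 /\ forall (a : k) x y, S x -> S y -> S (a *: x + y).

Definition lspan M (X : set M) : set M := smallest (@submod M) X.

Definition linear_on M N (S : set M) (f : M -> N) : Prop :=
  forall (a : k) x y, S x -> S y -> f (a *: x + y) = a *: f x + f y.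

(* [mul] exhibits [E] as the tensor product of [M] and the subspace [T] of    *)
(* [N]: every bilinear map on M x T factors uniquely through [mul].           *)
Definition is_tensor M N E (T : set N) (mul : M -> N -> E) : Prop :=
  forall (X : lmodType k) (f : M -> N -> X),
    (forall y, T y -> linear (f ^~ y)) -> (forall x, linear_on T (f x)) ->
  exists g : {linear E -> X},
    (forall x y, T y -> g (mul x y) = f x y) /\
    (forall g' : {linear E -> X},
       (forall x y, T y -> g' (mul x y) = f x y) -> g' =1 g).

Variable I : eqType.

Definition homogeneous M (deg : I -> set M) : set M :=
  [set x | exists i, deg i x].

Definition graded_sub M (deg : I -> set M) (S : set M) : Prop :=
  submod S /\ S `<=` lspan (S `&` homogeneous deg).

Definition is_grading M (deg : I -> set M) : Prop :=
  [/\ forall i, submod (deg i),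
      forall x, lspan (homogeneous deg) x &
      forall (s : seq I) (c : I -> M), uniq s -> (forall i, deg i (c i)) ->
        \sum_(i <- s) c i = 0 -> forall i, i \in s -> c i = 0].

(* Exhaustive increasing filtration of [S] by graded subspaces; the index is  *)
(* shifted by one, [F k.+1] being the usual stage k and [F 0] stage -1.       *)
Definition filtration M (deg : I -> set M) (S : set M) (F : nat -> set M) :
    Prop :=
  [/\ F 0%N = [set 0],
      forall r, graded_sub deg (F r),
      forall r, F r `<=` F r.+1 &
      S = \bigcup_r F r].

End Linear.

Section Algebras.
Variable k : fieldType.

Record gca := Gca {
  gca_alg :> algType k;
  adeg : nat -> set gca_alg;
  adeg_grading : is_grading adeg;
  adeg1 : adeg 0 1;
  adegM : forall m n x y, adeg m x -> adeg n y -> adeg (m + n) (x * y);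
  adegC : forall m n x y, adeg m x -> adeg n y ->
    y * x = (-1) ^+ (m * n) *: (x * y) }.

Record cdga := Cdga {
  cdga_gca :> gca;
  ad : cdga_gca -> cdga_gca;
  ad_linear : linear ad;
  ad_deg : forall n x, adeg n x -> adeg n.+1 (ad x);
  ad_ad : forall x, ad (ad x) = 0;
  adM : forall n x y, adeg n x -> ad (x * y) = ad x * y + (-1) ^+ n *: (x * ad y) }.

Record gca_hom (A B : gca) := GcaHom {
  gca_fun :> {lrmorphism A -> B};
  gca_hom_deg : forall n x, adeg n x -> adeg n (gca_fun x) }.

Record cdga_hom (A B : cdga) := CdgaHom {
  cdga_fun :> gca_hom A B;
  cdga_hom_d : forall x, cdga_fun (ad x) = ad (cdga_fun x) }.

Definition connected (A : cdga) : Prop :=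
  forall x : A, adeg 0 x -> ad x = 0 -> exists c : k, x = c *: 1.

Definition posdeg (A : gca) : set A :=
  lspan [set x | exists2 n, (0 < n)%N & adeg n x].

Definition in_posdeg (A : gca) (V : set A) : Prop :=
  forall x, V x -> adeg 0 x -> x = 0.

(* Elements of wordlength >= m in V, that is Lambda^{>= m} V.                 *)
Definition word_ge (A : gca) (V : set A) (m : nat) : set A :=
  lspan [set x | exists s : seq A,
    [/\ (m <= size s)%N, forall v, v \in s -> V v & x = \prod_(v <- s) v]].

(* The subalgebra Lambda S generated by a subspace S of V.                    *)
Definition subalg (A : gca) (S : set A) : set A := word_ge S 0.

(* [A] is the free graded commutative algebra Lambda V.                       *)
Definition free_gca (A : gca) (V : set A) : Prop :=
  graded_sub (@adeg A) V /\
  forall (C : gca) (f : A -> C), linear_on V f ->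
    (forall n x, V x -> adeg n x -> adeg n (f x)) ->
  exists g : gca_hom A C,
    (forall x, V x -> g x = f x) /\
    (forall g' : gca_hom A C, (forall x, V x -> g' x = f x) -> g' =1 g).

Definition ks_complex (A : cdga) (V : set A) : Prop :=
  free_gca V /\
  exists F : nat -> set A, filtration (@adeg A) V F /\
    forall r x, F r.+1 x -> subalg (F r) (ad x).

Definition sullivan (A : cdga) (V : set A) : Prop :=
  ks_complex V /\ in_posdeg V.

Definition minimal_sullivan (A : cdga) (V : set A) : Prop :=
  sullivan V /\ forall x, V x -> word_ge V 2 (ad x).

(* [E] is a relative Sullivan algebra B (x) Lambda W with inclusions [i] and  *)
(* [j] of B and of the graded algebra [L] = Lambda W; the differential of [L] *)
(* is that of the fiber.  Since b (x) l = i b * j l, the last two conditions  *)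
(* bound d(1 (x) W(k)) and identify the k (x) Lambda W component of d.        *)
Definition relative_sullivan (B E L : cdga) (W : set L)
    (i : cdga_hom B E) (j : gca_hom L E) : Prop :=
  [/\ connected B,
      free_gca W /\ in_posdeg W,
      is_tensor setT (fun (b : B) (l : L) => i b * j l : E),
      exists F : nat -> set L, filtration (@adeg L) W F /\
        forall r w, F r.+1 w ->
          lspan [set x | exists (c : k) (b : B) (l : L),
            [/\ posdeg b, subalg (F r) l & x = i (c *: 1 + b) * j l]]
          (ad (j w)) &
      forall l : L,
        lspan [set x | exists (b : B) (l' : L), posdeg b /\ x = i b * j l']
        (ad (j l) - j (ad l))].

(* The generating space V = Z (+) W of Lambda Z (x) Lambda W.                 *)
Definition sum_gens (B E L : cdga) (i : B -> E) (j : L -> E)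
    (Z : set B) (W : set L) : set E :=
  [set x | exists z w, [/\ Z z, W w & x = i z + j w]].

End Algebras.

Section Modules.
Variable k : fieldType.

Record dgmod (A : cdga k) := Dgmod {
  dg_mod :> lmodType k;
  mdeg : int -> set dg_mod;
  act : A -> dg_mod -> dg_mod;
  md : dg_mod -> dg_mod;
  mdeg_grading : is_grading mdeg;
  act_linearl : forall x, linear (act ^~ x);
  act_linearr : forall a, linear (act a);
  act1 : forall x, act 1 x = x;
  actM : forall a b x, act (a * b) x = act a (act b x);
  act_deg : forall n i a x, adeg n a -> mdeg i x -> mdeg (n%:Z + i) (act a x);
  md_linear : linear md;
  md_deg : forall i x, mdeg i x -> mdeg (i + 1) (md x);
  md_md : forall x, md (md x) = 0;
  md_act : forall n a x, adeg n a ->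
    md (act a x) = act (ad a) x + (-1) ^+ n *: act a (md x) }.

Record dg_hom (A : cdga k) (P Q : dgmod A) := DgHom {
  dg_fun :> P -> Q;
  dg_hom_linear : linear dg_fun;
  dg_hom_deg : forall i x, mdeg i x -> mdeg i (dg_fun x);
  dg_hom_act : forall a x, dg_fun (act a x) = act a (dg_fun x);
  dg_hom_d : forall x, dg_fun (md x) = md (dg_fun x) }.

(* Bijectivity of f on cohomology, spelled out on cocycles.                   *)
Definition quasi_iso (A : cdga k) (P Q : dgmod A) (f : dg_hom P Q) : Prop :=
  (forall x, md x = 0 -> (exists y, f x = md y) -> exists z, x = md z) /\
  (forall y, md y = 0 -> exists x, md x = 0 /\ exists z, y = f x + md z).

(* P = A (x) U as a graded module, with U the union of the U(k).              *)
Definition semifree_on (A : cdga k) (P : dgmod A) (U : set P) : Prop :=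
  [/\ graded_sub (@mdeg A P) U,
      is_tensor U (@act A P) &
      exists F : nat -> set P, filtration (@mdeg A P) U F /\
        forall r u, F r.+1 u ->
          lspan [set x | exists a v, F r v /\ x = act a v] (md u)].

Definition semifree (A : cdga k) (P : dgmod A) : Prop :=
  exists U : set P, semifree_on U.

Definition semifree_resolution (A : cdga k) (M P : dgmod A) (f : dg_hom P M) :
    Prop :=
  semifree P /\ quasi_iso f.

Section Restriction.
Variables (A B : cdga k) (f : cdga_hom A B) (P : dgmod B).

Let ract (a : A) (x : P) : P := act (f a) x.

Fact ract_linearl x : linear (ract ^~ x).
Proof. by move=> c a b; rewrite /ract linearP act_linearl. Qed.
Fact ract_linearr a : linear (ract a).
Proof. exact: act_linearr. Qed.
Fact ract1 x : ract 1 x = x.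
Proof. by rewrite /ract rmorph1 act1. Qed.
Fact ractM a b x : ract (a * b) x = ract a (ract b x).
Proof. by rewrite /ract rmorphM actM. Qed.
Fact ract_deg n i a x : adeg n a -> mdeg i x -> mdeg (n%:Z + i) (ract a x).
Proof. by move=> /(gca_hom_deg f); apply: act_deg. Qed.
Fact rmd_act n a x : adeg n a ->
  md (ract a x) = ract (ad a) x + (-1) ^+ n *: ract a (md x).
Proof. by move=> /(gca_hom_deg f) ha; rewrite /ract (md_act _ ha) cdga_hom_d. Qed.

Definition restrict : dgmod A :=
  Dgmod (mdeg_grading P) ract_linearl ract_linearr ract1 ractM ract_deg
    (@md_linear _ P) (@md_deg _ P) (@md_md _ P) rmd_act.

End Restriction.

(* Lambda^{>m} V . P                                                          *)
Definition word_gt_mod (A : cdga k) (V : set A) (P : dgmod A) (m : nat) :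
    set P :=
  lspan [set x | exists a y, word_ge V m.+1 a /\ x = act a y].

(* Injectivity of H(P) -> H(P / Lambda^{>m} V . P), on cocycles.              *)
Definition toomer_inj (A : cdga k) (V : set A) (P : dgmod A) (m : nat) : Prop :=
  forall x : P, md x = 0 -> (exists y, word_gt_mod V m (x - md y)) ->
  exists z, x = md z.

(* Toomer invariant of a semifree module, [None] standing for infinity.       *)
Definition toomer_semifree (A : cdga k) (V : set A) (P : dgmod A) :
    option nat :=
  if pselect (exists m, `[< toomer_inj V P m >]) is left h
  then Some (ex_minn h) else None.

(* e_{Lambda V}(M) = e for an arbitrary module; e does not depend on the      *)
(* choice of the semifree resolution.                                         *)
Definition toomer (A : cdga k) (V : set A) (M : dgmod A) (e : option nat) :
    Prop :=
  exists (P : dgmod A) (f : dg_hom P M),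
    semifree_resolution f /\ toomer_semifree V P = e.

Definition enat_le (e : option nat) (n : nat) : Prop :=
  exists2 m, e = Some m & (m <= n)%N.

(* P^{>= p, >= q} = Lambda^{>= p} Z (x) Lambda^{>= q} W (x) U                 *)
Definition Pge (B E L : cdga k) (i : cdga_hom B E) (j : gca_hom L E)
    (Z : set B) (W : set L) (P : dgmod E) (U : set P) (p q : nat) : set P :=
  lspan [set x | exists z w u,
    [/\ word_ge Z p z, word_ge W q w, U u & x = act (i z * j w) u]].

End Modules.

Section SpanFacts.
Variable k : fieldType.
Implicit Types M N E : lmodType k.

Lemma submodD M (S : set M) x y : submod S -> S x -> S y -> S (x + y).
Proof. by case=> _ h hx hy; rewrite -[x]scale1r; apply: h. Qed.

Lemma submodZ M (S : set M) (a : k) x : submod S -> S x -> S (a *: x).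
Proof. by case=> h0 h hx; rewrite -[_ *: _]addr0; apply: h. Qed.

Lemma submodN M (S : set M) x : submod S -> S x -> S (- x).
Proof. by move=> hS hx; rewrite -scaleN1r; apply: submodZ. Qed.

Lemma submodB M (S : set M) x y : submod S -> S x -> S y -> S (x - y).
Proof. by move=> hS hx hy; apply: submodD => //; apply: submodN. Qed.

Lemma submod_sum M (S : set M) (J : Type) (s : seq J) (c : J -> M) :
  submod S -> (forall i, S (c i)) -> S (\sum_(i <- s) c i).
Proof.
move=> hS hc; apply: (big_ind S) => [|x y|//]; first by case: hS.
exact: submodD.
Qed.

Lemma lspan_submod M (X : set M) : submod (lspan X).
Proof.
split=> [S [[S0 _] _] //|a x y hx hy S hS].
by case: (hS) => -[_ hl] _; apply: hl; [apply: hx|apply: hy].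
Qed.

Lemma lspan_gen M (X : set M) : X `<=` lspan X.
Proof. exact: sub_gen_smallest. Qed.

Lemma lspan_min M (X S : set M) : submod S -> X `<=` S -> lspan X `<=` S.
Proof. by move=> hS hX x; apply. Qed.

Lemma lspan_sub M (X Y : set M) : X `<=` lspan Y -> lspan X `<=` lspan Y.
Proof. by move=> h; apply: lspan_min => //; apply: lspan_submod. Qed.

Lemma submod_preim M N (S : set N) (f : M -> N) :
  linear f -> submod S -> submod (f @^-1` S).
Proof.
move=> hf hS; split=> [|a x y hx hy] /=; last first.
  by rewrite hf; case: hS => _; apply.
have := hf (-1) 0 0; rewrite scaler0 addr0 scaleN1r addNr => ->.
by case: hS.
Qed.

Lemma lspan_lin M N (X : set M) (S : set N) (f : M -> N) :
  linear f -> submod S -> (forall x, X x -> S (f x)) ->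
  forall x, lspan X x -> S (f x).
Proof.
by move=> hf hS h; apply: (lspan_min (submod_preim hf hS)) => x; apply: h.
Qed.

Lemma lspan_bilin M N E (X : set M) (Y : set N) (S : set E)
    (f : M -> N -> E) :
    (forall y, linear (f ^~ y)) -> (forall x, linear (f x)) -> submod S ->
    (forall x y, X x -> Y y -> S (f x y)) ->
  forall x y, lspan X x -> lspan Y y -> S (f x y).
Proof.
move=> hl hr hS h x y hx hy; move: x hx; apply: (lspan_lin (hl y)) => // x hx.
by move: y hy; apply: (lspan_lin (hr x)) => // y; apply: h.
Qed.

Lemma submodI M (S T : set M) : submod S -> submod T -> submod (S `&` T).
Proof.
move=> [S0 hS] [T0 hT]; split=> // a x y [xS xT] [yS yT].
by split; [apply: hS|apply: hT].
Qed.

Definition setaddm M (S T : set M) : set M :=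
  [set x | exists y z, [/\ S y, T z & x = y + z]].

Lemma setaddm_submod M (S T : set M) :
  submod S -> submod T -> submod (setaddm S T).
Proof.
move=> hS hT; split; first by exists 0, 0; rewrite addr0; case: hS hT => ? _ [].
move=> a _ _ [y [z [hy hz ->]]] [y' [z' [hy' hz' ->]]].
exists (a *: y + y'), (a *: z + z'); split.
- by case: hS => _; apply.
- by case: hT => _; apply.
- by rewrite scalerDr addrACA.
Qed.

Lemma setaddml M (S T : set M) : submod T -> S `<=` setaddm S T.
Proof. by move=> [T0 _] x hx; exists x, 0; rewrite addr0. Qed.

Lemma setaddmr M (S T : set M) : submod S -> T `<=` setaddm S T.
Proof. by move=> [S0 _] x hx; exists 0, x; rewrite add0r. Qed.

Lemma setaddm_min M (S T R : set M) :
  submod R -> S `<=` R -> T `<=` R -> setaddm S T `<=` R.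
Proof. by move=> hR hS hT _ [y [z [/hS hy /hT hz ->]]]; apply: submodD. Qed.

Section Graded.
Variables (I : eqType) (M : lmodType k) (deg : I -> set M).
Hypothesis hdeg : is_grading deg.

Lemma deg_submod i : submod (deg i).
Proof. by case: hdeg. Qed.

Lemma graded_decomp (Q : I -> set M) : (forall i, submod (Q i)) ->
  forall x, lspan [set x | exists i, Q i x] x ->
  exists (s : seq I) (c : I -> M),
    [/\ uniq s, forall i, Q i (c i) & x = \sum_(i <- s) c i].
Proof.
move=> hQ.
pose R : set M := [set x | exists (s : seq I) (c : I -> M),
   [/\ uniq s, forall i, Q i (c i), forall i, i \notin s -> c i = 0
     & x = \sum_(i <- s) c i]].
have widen (s t : seq I) (c : I -> M) : uniq s -> uniq t ->
    {subset s <= t} -> (forall i, i \notin s -> c i = 0) ->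
    \sum_(i <- s) c i = \sum_(i <- t) c i.
  move=> us ut st c0; rewrite [RHS](bigID (mem s)) /=.
  rewrite [X in _ + X]big1 => [|i /c0//]; rewrite addr0 -[RHS]big_filter.
  apply: perm_big; apply: uniq_perm; rewrite ?filter_uniq // => i.
  by rewrite mem_filter; case: (boolP (i \in s)) => // /st ->.
have RQ : submod R.
  split.
    by exists [::], (fun=> 0); split=> // [i|]; [case: (hQ i)|rewrite big_nil].
  move=> a x y [s [c [us hc c0 ->]]] [t [e [ut he e0 ->]]].
  exists (undup (s ++ t)), (fun i => a *: c i + e i); split.
  - exact: undup_uniq.
  - by move=> i; case: (hQ i) => _; apply.
  - move=> i; rewrite mem_undup mem_cat negb_or => /andP[/c0 -> /e0 ->].
    by rewrite scaler0 addr0.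
  - rewrite big_split /= -scaler_sumr.
    by congr (_ *: _ + _); apply: widen; rewrite ?undup_uniq // => i hi;
      rewrite mem_undup mem_cat hi ?orbT.
suff h : lspan [set x | exists i, Q i x] `<=` R.
  by move=> x /h [s [c [us hc _ ->]]]; exists s, c.
apply: lspan_min => // x [i hx].
exists [:: i], (fun j => if j == i then x else 0); split=> //.
- by move=> j; case: eqP => [->//|_]; case: (hQ j).
- by move=> j; rewrite inE => /negPf ->.
- by rewrite big_seq1 eqxx.
Qed.

Lemma graded_components (S : set M) (s : seq I) (c : I -> M) :
    graded_sub deg S -> uniq s -> (forall i, deg i (c i)) ->
    S (\sum_(i <- s) c i) ->
  forall i, i \in s -> S (c i).
Proof.
move=> [hS hSg] us hc hx i hi.
have [||t [e [ut he]]] := @graded_decomp (fun i => deg i `&` S) _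
    (\sum_(i <- s) c i).
- by move=> j; apply: submodI => //; apply: deg_submod.
- move/hSg: hx; apply: lspan_sub => x [hxS [j hj]].
  by apply: lspan_gen; exists j.
move=> hst.
have us' : uniq (undup (s ++ t)) by exact: undup_uniq.
pose c' j := if j \in s then c j else 0.
pose e' j := if j \in t then e j else 0.
have sum1 (r r' : seq I) (b : I -> M) : uniq r -> uniq r' ->
    {subset r <= r'} ->
    \sum_(j <- r) b j = \sum_(j <- r') (if j \in r then b j else 0).
  move=> ur ur' rr'; rewrite -big_mkcond -[RHS]big_filter.
  apply: perm_big; apply: uniq_perm; rewrite ?filter_uniq // => j.
  by rewrite mem_filter; case: (boolP (j \in r)) => // /rr' ->.
have e1 := sum1 s _ c us us'; have e2 := sum1 t _ e ut us'.
have : \sum_(j <- undup (s ++ t)) (c' j - e' j) = 0.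
  rewrite sumrB -e1 ?hst -?e2 ?subrr // => j hj.
    by rewrite mem_undup mem_cat hj orbT.
  by rewrite mem_undup mem_cat hj.
case: hdeg => _ _ hind hsum.
have : c' i - e' i = 0.
  apply: (hind _ _ us' _ hsum); last by rewrite mem_undup mem_cat hi.
  move=> j; apply: submodB; first exact: deg_submod.
    by rewrite /c'; case: ifP => // _; case: (deg_submod j).
  by rewrite /e'; case: ifP => // _; case: (he j) => //; case: (deg_submod j).
rewrite /c' hi => /subr0_eq ->; rewrite /e'; case: ifP => _.
  by case: (he i).
by case: hS.
Qed.

Lemma lspan_graded (X : set M) : X `<=` lspan (lspan X `&` homogeneous deg) ->
  graded_sub deg (lspan X).
Proof. by move=> h; split; [exact: lspan_submod|exact: lspan_sub]. Qed.

Lemma lspan_homogeneous_graded (X : set M) :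
  X `<=` homogeneous deg -> graded_sub deg (lspan X).
Proof.
move=> h; apply: lspan_graded => x hx; apply: lspan_gen; split; last exact: h.
exact: lspan_gen.
Qed.

Lemma setaddm_graded (S T : set M) :
  graded_sub deg S -> graded_sub deg T -> graded_sub deg (setaddm S T).
Proof.
move=> [hS hSg] [hT hTg]; split; first exact: setaddm_submod.
apply: setaddm_min => [|x /hSg|x /hTg]; first exact: lspan_submod.
  by apply: lspan_sub => y [hy hd]; apply: lspan_gen; split=> //; exact: setaddml.
by apply: lspan_sub => y [hy hd]; apply: lspan_gen; split=> //; exact: setaddmr.
Qed.

End Graded.

End SpanFacts.

(* The image of a subspace T of M in the quotient space M / N, as a set of    *)
(* cosets.                                                                    *)

Section Subquotient.
Variables (k : fieldType) (M : lmodType k) (T N : set M).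

Definition coset (x : M) : set M := [set y | N (y - x)].

Definition subquot of submod T & submod N :=
  {C : set M | `[< exists2 x, T x & C = coset x >]}.

Hypotheses (hT : submod T) (hN : submod N).
Let Q := subquot hT hN.

HB.instance Definition _ := Choice.on Q.

Lemma coset_eq x y : N (x - y) -> coset x = coset y.
Proof.
move=> h; apply/seteqP; split=> z; rewrite /coset /= => hz.
  have -> : z - y = (z - x) + (x - y) by rewrite addrA subrK.
  exact: submodD.
have -> : z - x = (z - y) - (x - y) by rewrite opprB addrA subrK.
exact: submodB.
Qed.

Lemma cosetP x y : coset x = coset y -> N (x - y).
Proof. move=> h; have : coset x x by rewrite /coset /= subrr; case: hN.
by rewrite h. Qed.

Let inT x : T (if pselect (T x) then x else 0).
Proof. by case: pselect => //; case: hT. Qed.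

(* The projection T -> T / N, extended by 0 outside T.                        *)
Definition sqproj (x : M) : Q :=
  exist _ (coset (if pselect (T x) then x else 0))
    (introT (asboolP _) (ex_intro2 _ _ _ (inT x) erefl)).

Definition sqrep (C : Q) : M := xget 0 [set x | T x /\ val C = coset x].

Let sqrepP C : T (sqrep C) /\ val C = coset (sqrep C).
Proof.
rewrite /sqrep; case: xgetP => [x _ []//|].
by have /asboolP [x hx he] := valP C => /(_ x) [].
Qed.

Lemma sqrep_in C : T (sqrep C). Proof. by case: (sqrepP C). Qed.

Lemma sqprojE x : T x -> val (sqproj x) = coset x.
Proof. by rewrite /sqproj /=; case: pselect. Qed.

Lemma sqrepK C : sqproj (sqrep C) = C.
Proof.
by apply: val_inj; rewrite sqprojE ?(proj2 (sqrepP C)) //; apply: sqrep_in.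
Qed.

Lemma sqproj_eq x y : T x -> T y -> N (x - y) -> sqproj x = sqproj y.
Proof. by move=> hx hy h; apply: val_inj; rewrite !sqprojE // (coset_eq h). Qed.

Lemma sqproj_eqP x y : T x -> T y -> sqproj x = sqproj y -> N (x - y).
Proof. by move=> hx hy /(congr1 val); rewrite !sqprojE //; apply: cosetP. Qed.

Lemma sqprojK x : T x -> N (sqrep (sqproj x) - x).
Proof. by move=> hx; apply: sqproj_eqP; rewrite ?sqrepK //; apply: sqrep_in. Qed.

Let sqadd (C D : Q) : Q := sqproj (sqrep C + sqrep D).
Let sqopp (C : Q) : Q := sqproj (- sqrep C).
Let sqscale (a : k) (C : Q) : Q := sqproj (a *: sqrep C).

Let projD x y : T x -> T y -> sqproj (x + y) = sqadd (sqproj x) (sqproj y).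
Proof.
move=> hx hy; apply: sqproj_eq; try by apply: submodD => //; apply: sqrep_in.
by rewrite -opprB; apply: submodN => //; rewrite opprD addrACA;
  apply: submodD => //; apply: sqprojK.
Qed.

Let projZ a x : T x -> sqproj (a *: x) = sqscale a (sqproj x).
Proof.
move=> hx; apply: sqproj_eq; try by apply: submodZ => //; apply: sqrep_in.
by rewrite -opprB; apply: submodN => //; rewrite -scalerBr;
  apply: submodZ => //; apply: sqprojK.
Qed.

Let projN x : T x -> sqproj (- x) = sqopp (sqproj x).
Proof.
move=> hx; apply: sqproj_eq; try by apply: submodN => //; apply: sqrep_in.
by rewrite opprK addrC; apply: sqprojK.
Qed.

Let T0 : T 0. Proof. by case: hT. Qed.

Let sqaddA : associative sqadd.
Proof.
move=> C D E; rewrite -[C]sqrepK -[D]sqrepK -[E]sqrepK.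
by rewrite -!projD ?addrA //; do ?apply: submodD => //; apply: sqrep_in.
Qed.

Let sqaddC : commutative sqadd.
Proof. by move=> C D; rewrite /sqadd addrC. Qed.

Let sqadd0 : left_id (sqproj 0) sqadd.
Proof.
by move=> C; rewrite -[C]sqrepK -projD ?add0r //; apply: sqrep_in.
Qed.

Let sqaddN : left_inverse (sqproj 0) sqopp sqadd.
Proof.
move=> C; rewrite -[C]sqrepK -projN; last exact: sqrep_in.
by rewrite -projD ?addNr //; do ?apply: submodN => //; apply: sqrep_in.
Qed.

HB.instance Definition _ := GRing.isZmodule.Build Q sqaddA sqaddC sqadd0 sqaddN.

Let sqscaleA a b C : sqscale a (sqscale b C) = sqscale (a * b) C.
Proof.
rewrite -[C]sqrepK -!projZ ?scalerA //; try exact: sqrep_in.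
by apply: submodZ => //; apply: sqrep_in.
Qed.

Let sqscale1 : left_id 1 sqscale.
Proof. by move=> C; rewrite /sqscale scale1r sqrepK. Qed.

Let sqscaleDr : right_distributive sqscale +%R.
Proof.
move=> a C D; rewrite -[C]sqrepK -[D]sqrepK.
have hC := sqrep_in C; have hD := sqrep_in D.
rewrite -[X in sqscale a X]projD // -!projZ //; last exact: submodD.
by rewrite scalerDr projD //; apply: submodZ.
Qed.

Let sqscaleDl C : {morph sqscale^~ C : a b / a + b}.
Proof.
move=> a b; rewrite -[C]sqrepK; have hC := sqrep_in C.
by rewrite -!projZ // scalerDl projD //; apply: submodZ.
Qed.

HB.instance Definition _ := GRing.Zmodule_isLmodule.Build k Q
  sqscaleA sqscale1 sqscaleDr sqscaleDl.

Lemma sqproj_linear : linear_on T sqproj.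
Proof.
move=> a x y hx hy; rewrite projD ?projZ //; exact: submodZ.
Qed.

Lemma sqproj_eq0 x : T x -> sqproj x = 0 <-> N x.
Proof.
move=> hx; split=> [|h]; last by apply: sqproj_eq; rewrite ?subr0.
by move=> /(sqproj_eqP hx T0); rewrite subr0.
Qed.

End Subquotient.

(* If T and N are stable under d and under L, and the curvature               *)
(* d(j l) - j(d l) maps T to N, then T / N is a DG module over L even though  *)
(* j : L -> E is not a morphism of complexes.                                 *)

Record dg_pair (k : fieldType) (E L : cdga k) (j : gca_hom L E) (P : dgmod E)
    (T N : set P) : Prop := DgPair {
  dgpT : graded_sub (@mdeg k E P) T;
  dgpN : graded_sub (@mdeg k E P) N;
  dgp_dT : forall x, T x -> T (md x);
  dgp_dN : forall x, N x -> N (md x);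
  dgp_actT : forall l x, T x -> T (act (j l) x);
  dgp_actN : forall l x, N x -> N (act (j l) x);
  dgp_curv : forall l x, T x -> N (act (ad (j l) - j (ad l)) x) }.

Section SubquotientModule.
Variables (k : fieldType) (E L : cdga k) (j : gca_hom L E) (P : dgmod E).
Variables (T N : set P) (h : dg_pair j T N).

Let hT : submod T. Proof. by case: (dgpT h). Qed.
Let hN : submod N. Proof. by case: (dgpN h). Qed.
Let Q : lmodType k := subquot hT hN.
Let pi (x : P) : Q := sqproj hT hN x.
Let rep (C : Q) : P := sqrep C.

Let repT C : T (rep C). Proof. exact: sqrep_in. Qed.
#[local] Hint Resolve repT : core.
Let repK C : pi (rep C) = C. Proof. exact: sqrepK. Qed.
Let piK x : T x -> N (rep (pi x) - x). Proof. exact: sqprojK. Qed.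
Let pi_eq x y : T x -> T y -> N (x - y) -> pi x = pi y.
Proof. exact: sqproj_eq. Qed.
Let pi_lin a x y : T x -> T y -> pi (a *: x + y) = a *: pi x + pi y.
Proof. exact: sqproj_linear. Qed.
Let pi0 : pi 0 = 0.
Proof. by apply/sqproj_eq0; [case: hT|case: hN]. Qed.

Let piZ a x : T x -> pi (a *: x) = a *: pi x.
Proof.
by move=> hx; rewrite -[a *: x]addr0 pi_lin ?pi0 ?addr0 //; case: hT.
Qed.
Let piD x y : T x -> T y -> pi (x + y) = pi x + pi y.
Proof. by move=> hx hy; rewrite -[x in LHS]scale1r pi_lin // scale1r. Qed.

Let qdeg (i : int) : set Q := [set C | exists x, [/\ T x, mdeg i x & C = pi x]].
Let qact (l : L) (C : Q) : Q := pi (act (j l) (rep C)).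
Let qd (C : Q) : Q := pi (md (rep C)).

Let aT l x : T x -> T (act (j l) x). Proof. exact: (dgp_actT h). Qed.
Let dT x : T x -> T (md x). Proof. exact: (dgp_dT h). Qed.

Let actB a x y : act a (x - y) = act a x - act a y :> P.
Proof.
by rewrite -scaleN1r addrC act_linearr scaleN1r addrC.
Qed.
Let actBl a b x : act (a - b) x = act a x - act b x :> P.
Proof.
have -> : a - b = -1 *: b + a by rewrite scaleN1r addrC.
by rewrite act_linearl scaleN1r addrC.
Qed.

Let mdB x y : md (x - y) = md x - md y :> P.
Proof. by rewrite -scaleN1r addrC md_linear scaleN1r addrC. Qed.

Let qact_pi l x : T x -> qact l (pi x) = pi (act (j l) x).
Proof.
move=> hx; apply: pi_eq; try by apply: aT.
by rewrite -actB; apply: (dgp_actN h); apply: piK.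
Qed.

Let qd_pi x : T x -> qd (pi x) = pi (md x).
Proof.
move=> hx; apply: pi_eq; try by apply: dT.
by rewrite -mdB; apply: (dgp_dN h); apply: piK.
Qed.

Let qdeg_grading : is_grading qdeg.
Proof.
split.
- move=> i; have [d0 dl] := deg_submod (mdeg_grading P) i; split.
    by exists 0; split; rewrite ?pi0 //; case: hT.
  move=> a _ _ [x [hx dx ->]] [y [hy dy ->]]; exists (a *: x + y).
  by split; [case: hT => _; apply|exact: dl|rewrite pi_lin].
- move=> C; rewrite -[C]repK.
  suff H : T `<=` [set x | T x /\ lspan (homogeneous qdeg) (pi x)].
    by case: (H _ (repT C)).
  case: (dgpT h) => _ /subset_trans; apply; apply: lspan_min.
    split=> [|a x y [hx sx] [hy sy]].
      by split; [case: hT|rewrite pi0; case: (lspan_submod (homogeneous qdeg))].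
    split; first by case: hT => _; apply.
    by rewrite pi_lin //; case: (lspan_submod (homogeneous qdeg)) => _; apply.
  move=> x [hx [i di]]; split=> //; apply: lspan_gen.
  by exists i, x.
- move=> s c us hc hs i hi.
  pose c' i := xget 0 [set x | [/\ T x, mdeg i x & c i = pi x]].
  have hc' l : [/\ T (c' l), mdeg l (c' l) & c l = pi (c' l)].
    by rewrite /c'; case: xgetP => [x _ //|] e; case: (hc l) => x /e.
  have T' l : T (c' l) by case: (hc' l).
  have e : \sum_(l <- s) c l = pi (\sum_(l <- s) c' l).
    elim: (s) => [|l t IH]; first by rewrite !big_nil pi0.
    rewrite !big_cons piD //; last exact: submod_sum.
    by rewrite IH; case: (hc' l) => _ _ <-.
  have : N (\sum_(l <- s) c' l).
    by apply/(sqproj_eq0 hT hN); [exact: submod_sum|rewrite -/(pi _) -e].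
  move/(graded_components (mdeg_grading P) (dgpN h) us).
  move=> /(_ (fun l => let: And3 _ d _ := hc' l in d) i hi) hN'.
  by case: (hc' i) => _ _ ->; apply/sqproj_eq0.
Qed.

Let qact_linearl C : linear (qact ^~ C).
Proof.
move=> a l l'; rewrite /qact linearP act_linearl pi_lin //; exact: aT.
Qed.

Let qact_linearr l : linear (qact l).
Proof.
move=> a C D; rewrite -[C]repK -[D]repK -pi_lin // !qact_pi //.
  by rewrite act_linearr pi_lin //; apply: aT.
by case: hT => _; apply.
Qed.

Let qact1 C : qact 1 C = C.
Proof. by rewrite /qact rmorph1 act1 repK. Qed.

Let qactM l l' C : qact (l * l') C = qact l (qact l' C).
Proof.
rewrite -[C]repK !qact_pi //; last by apply: aT.
by rewrite rmorphM actM.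
Qed.

Let qact_deg n i l C : adeg n l -> qdeg i C -> qdeg (n%:Z + i) (qact l C).
Proof.
move=> hl [x [hx dx ->]]; exists (act (j l) x); split.
- by apply: aT.
- by apply: act_deg => //; apply: gca_hom_deg.
- by rewrite qact_pi.
Qed.

Let qd_linear : linear qd.
Proof.
move=> a C D; rewrite -[C]repK -[D]repK -pi_lin // !qd_pi //.
  by rewrite md_linear pi_lin //; apply: dT.
by case: hT => _; apply.
Qed.

Let qd_deg i C : qdeg i C -> qdeg (i + 1) (qd C).
Proof.
move=> [x [hx dx ->]]; exists (md x); split.
- by apply: dT.
- exact: md_deg.
- by rewrite qd_pi.
Qed.

Let qd_qd C : qd (qd C) = 0.
Proof.
rewrite -[C]repK !qd_pi //; last by apply: dT.
by rewrite md_md pi0.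
Qed.

Let qd_act n l C : adeg n l ->
  qd (qact l C) = qact (ad l) C + (-1) ^+ n *: qact l (qd C).
Proof.
move=> hl; rewrite -[C]repK; move: (rep C) (repT C) => x hx.
have hdx := dgp_dT h hx.
have hjx l' : T (act (j l') x) by apply: aT.
rewrite qact_pi // !qd_pi // !qact_pi // -piZ -?piD //; last first.
- by apply: aT.
- by apply: submodZ => //; apply: aT.
apply: pi_eq; first by apply/dT/aT.
  by apply: submodD => //; apply: submodZ => //; apply: aT.
rewrite (md_act _ (gca_hom_deg j hl)) opprD addrACA subrr addr0.
by rewrite -actBl; apply: (dgp_curv h).
Qed.

Definition subquot_dgmod : dgmod L :=
  Dgmod qdeg_grading qact_linearl qact_linearr qact1 qactM qact_deg
    qd_linear qd_deg qd_qd qd_act.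

End SubquotientModule.

Section Words.
Variables (k : fieldType) (A : gca k) (V : set A).

Lemma word_ge_sub m n : (m <= n)%N -> word_ge V n `<=` word_ge V m.
Proof.
move=> mn; apply: lspan_sub => _ [s [hs hV ->]]; apply: lspan_gen.
by exists s; split=> //; apply: leq_trans hs.
Qed.

Lemma word_ge1 : word_ge V 0 1.
Proof. by apply: lspan_gen; exists [::]; rewrite big_nil; split. Qed.

Lemma word_geV v : V v -> word_ge V 1 v.
Proof.
move=> hv; apply: lspan_gen; exists [:: v]; rewrite big_seq1; split=> // w.
by rewrite inE => /eqP ->.
Qed.

Lemma mul_linearl (y : A) : linear (fun x : A => x * y).
Proof. by move=> a u v; rewrite mulrDl scalerAl. Qed.

Lemma mul_linearr (x : A) : linear (fun y : A => x * y).
Proof. by move=> a u v; rewrite mulrDr scalerAr. Qed.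

Lemma word_geM m n x y :
  word_ge V m x -> word_ge V n y -> word_ge V (m + n) (x * y).
Proof.
apply: lspan_bilin => [||| _ _ [s [hs sV ->]] [t [ht tV ->]]].
- exact: mul_linearl.
- exact: mul_linearr.
- exact: lspan_submod.
apply: lspan_gen; exists (s ++ t); rewrite big_cat size_cat leq_add //; split=> //.
by move=> v; rewrite mem_cat => /orP[/sV|/tV].
Qed.

Hypothesis Vg : graded_sub (@adeg k A) V.

Lemma word_ge_graded m : graded_sub (@adeg k A) (word_ge V m).
Proof.
apply: lspan_graded => _ [s [hs sV ->]].
suff : lspan (word_ge V (size s) `&` homogeneous (@adeg k A)) (\prod_(v <- s) v).
  apply: lspan_sub => x [hx dx]; apply: lspan_gen; split=> //.
  exact: word_ge_sub hs _ hx.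
elim: s sV {m hs} => [_|v s IH sV].
  rewrite big_nil; apply: lspan_gen; split; first exact: word_ge1.
  by exists 0%N; apply: adeg1.
rewrite big_cons /=.
have hv := (proj2 Vg) _ (sV v (mem_head _ _)).
have {}IH : lspan (word_ge V (size s) `&` homogeneous (@adeg k A))
              (\prod_(j <- s) j).
  by apply: IH => w hw; apply: sV; rewrite inE hw orbT.
move: hv IH; apply: lspan_bilin => [||| x y [xV [i hi]] [ys [i' hi']]].
- exact: mul_linearl.
- exact: mul_linearr.
- exact: lspan_submod.
apply: lspan_gen; split; last by exists (i + i')%N; apply: adegM.
by rewrite -add1n; apply: word_geM => //; apply: word_geV.
Qed.

End Words.

Definition subalg_type (k : fieldType) (A : gca k) (V : set A) :=
  {x : A | `[< word_ge V 0 x >]}.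

Section SubalgType.
Variables (k : fieldType) (A : gca k) (V : set A).
Let S : {pred A} := fun x => `[< word_ge V 0 x >].
Let B := subalg_type V.

HB.instance Definition _ := SubChoice.copy B {x : A | S x}.

Let memS x : x \in S <-> word_ge V 0 x.
Proof. by split=> [/asboolP|h]; last exact/asboolP. Qed.

Let S_closed : GRing.subsemialg_closed S.
Proof.
have hS : submod (word_ge V 0) by exact: lspan_submod.
split.
- by apply/memS; apply: word_ge1.
- split; first by apply/memS; case: hS.
  by move=> x y /memS hx /memS hy; apply/memS; exact: (submodD hS hx hy).
- by move=> a x /memS hx; apply/memS; exact: (submodZ a hS hx).
- by move=> x y /memS hx /memS hy; apply/memS; have := word_geM hx hy.
Qed.

HB.instance Definition _ := GRing.SubChoice_isSubAlgebra.Build k A S B S_closed.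

Definition subalg_incl (x : B) : A := val x.
HB.instance Definition _ := GRing.RMorphism.copy subalg_incl (val : B -> A).
HB.instance Definition _ := GRing.Linear.copy subalg_incl (val : B -> A).

Hypothesis Vg : graded_sub (@adeg k A) V.

Let bdeg n : set B := [set x | adeg n (val x)].

Let val_inB (x : A) (hx : word_ge V 0 x) : exists y : B, val y = x.
Proof. by exists (exist _ x (introT (asboolP _) hx)). Qed.

Let bdeg_grading : is_grading bdeg.
Proof.
have [hd _ hi] := adeg_grading A; split.
- move=> n; split; first by rewrite /bdeg /mkset raddf0; case: (hd n).
  move=> a x y hx hy; rewrite /bdeg /mkset linearP.
  by case: (hd n) => _; apply.
- move=> x; have /asboolP hx := valP x.
  suff H : word_ge V 0 `<=`
      [set y | exists z : B, val z = y /\ lspan (homogeneous bdeg) z].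
    by case: (H _ hx) => z [/val_inj <-].
  have hl := lspan_submod (homogeneous bdeg).
  case: (word_ge_graded Vg 0) => _ /subset_trans; apply; apply: lspan_min.
    split; first by exists 0; rewrite raddf0; split=> //; case: hl.
    move=> a _ _ [y [<- hy]] [z [<- hz]]; exists (a *: y + z).
    by rewrite linearP; split=> //; case: hl => _; apply.
  move=> y [hy [n dy]]; have [z hz] := val_inB hy.
  by exists z; split=> //; apply: lspan_gen; exists n; rewrite /bdeg /= hz.
- move=> s c us hc hs i si; apply: val_inj; rewrite raddf0.
  apply: (hi s (fun i => val (c i)) us hc) => //.
  by rewrite -raddf_sum hs raddf0.
Qed.

Let bdeg1 : bdeg 0 1.
Proof. by rewrite /bdeg /mkset rmorph1; apply: adeg1. Qed.
Let bdegM m n x y : bdeg m x -> bdeg n y -> bdeg (m + n) (x * y).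
Proof. by rewrite /bdeg /mkset rmorphM; apply: adegM. Qed.
Let bdegC m n x y : bdeg m x -> bdeg n y ->
  y * x = (-1) ^+ (m * n) *: (x * y).
Proof.
move=> hx hy; apply: val_inj; rewrite linearZ !rmorphM /=.
exact: adegC.
Qed.

Definition subalg_gca : gca k := Gca bdeg_grading bdeg1 bdegM bdegC.

Definition subalg_val : gca_hom subalg_gca A :=
  @GcaHom k subalg_gca A subalg_incl (fun n x h => h).

End SubalgType.

Section FreeFacts.
Variables (k : fieldType) (A : gca k) (V : set A).
Hypothesis Vfree : free_gca V.

Lemma free_gen (x : A) : word_ge V 0 x.
Proof.
have [Vg huniv] := Vfree.
have hin v : V v -> word_ge V 0 v.
  by move=> /word_geV; apply: (word_ge_sub (m := 0)).
pose f (v : A) : subalg_gca Vg :=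
  if pselect (V v) is left h
  then exist _ v (introT (asboolP _) (hin _ h)) : subalg_type V else 0.
have fE v : V v -> val (f v : subalg_type V) = v.
  by rewrite /f; case: pselect.
have fl : linear_on V f.
  move=> a u v hu hv; apply: val_inj; rewrite fE; last first.
    by have [[_ h] _] := Vg; apply: h.
  rewrite -[u in LHS](fE u hu) -[v in LHS](fE v hv).
  exact: (esym (linearP (val : subalg_type V -> A) a (f u) (f v))).
have fd n v : V v -> adeg n v -> adeg n (f v).
  by move=> hv hn; rewrite /= /mkset fE.
have [g [gV _]] := huniv _ f fl fd.
have [g0 [_ g0u]] := huniv A idfun (fun a u v _ _ => erefl) (fun n v _ h => h).
have hd n y : adeg n y -> adeg n ((subalg_val Vg \o g) y).
  by move=> hy; apply: gca_hom_deg (gca_hom_deg g hy).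
have h1 v : V v -> GcaHom hd v = idfun v.
  by move=> hv; rewrite /= gV //; apply: fE.
have e1 := g0u (GcaHom hd) h1 x.
have e2 := g0u (@GcaHom k A A idfun (fun n y h => h)) (fun v hv => erefl) x.
move: (etrans e1 (esym e2)) => /= <-.
by have /asboolP := valP (g x : subalg_type V).
Qed.

Lemma homog_span (x : A) : lspan (homogeneous (@adeg k A)) x.
Proof. by case: (adeg_grading A). Qed.

Lemma posdeg_deg0 (x : A) : posdeg x -> adeg 0 x -> x = 0.
Proof.
have dS := deg_submod (adeg_grading A).
move=> hx hx0.
have [||s [c [us hc e]]] := @graded_decomp k _ A
    (fun n => if (0 < n)%N then adeg n else [set 0]) _ x.
- move=> n; case: ifP => // _; split=> // a u v -> ->.
  by rewrite /= scaler0 addr0.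
- move: hx; apply: lspan_sub => u [n n0 hu]; apply: lspan_gen; exists n.
  by rewrite n0.
have c0 : c 0%N = 0 by exact: (hc 0%N).
pose t := 0%N :: filter (fun n => 0 < n)%N s.
pose b n := if n is 0%N then - x else c n.
have ut : uniq t by rewrite /= filter_uniq // mem_filter.
suff : b 0%N = 0 by move/eqP; rewrite oppr_eq0 => /eqP.
case: (adeg_grading A) => _ _ /(_ t b ut); apply; rewrite ?mem_head //.
  case=> [|n] /=; first by apply: submodN.
  exact: (hc n.+1).
rewrite big_cons big_filter [X in - X + _]e.
rewrite [X in - X + _](bigID (fun n => 0 < n)%N) /=.
rewrite [X in - (_ + X)]big1 => [|[|n] //]; rewrite addr0.
rewrite [X in _ + X](eq_bigr c) ?addNr // => -[|n] //.
Qed.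

Lemma posdegMl (x y : A) : posdeg x -> posdeg (x * y).
Proof.
move=> hx; have hy := homog_span y; move: x y hx hy.
apply: lspan_bilin => [||| x y [n n0 hx] [m hy]].
- exact: mul_linearl.
- exact: mul_linearr.
- exact: lspan_submod.
by apply: lspan_gen; exists (n + m)%N; rewrite ?addn_gt0 ?n0 //; apply: adegM.
Qed.

Hypothesis Vpos : in_posdeg V.

Lemma gen_posdeg v : V v -> posdeg v.
Proof.
case: Vfree => -[_ hV] _ /hV; apply: lspan_sub => u [uV [[|n] hn]].
  by rewrite (Vpos uV hn); case: (lspan_submod
    [set x : A | exists2 n, (0 < n)%N & adeg n x]).
by apply: lspan_gen; exists n.+1.
Qed.

Lemma word1_posdeg : word_ge V 1 `<=` @posdeg k A.
Proof.
apply: lspan_sub => _ [[|v s] [//= _ sV ->]]; rewrite big_cons.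
by apply: posdegMl; apply: gen_posdeg; apply: sV; apply: mem_head.
Qed.

Lemma posdeg_word1 : @posdeg k A `<=` word_ge V 1.
Proof.
apply: lspan_min; first exact: lspan_submod.
move=> x [n n0 hx].
have [c [y [hy e]]] : exists (c : k) (y : A), word_ge V 1 y /\ x = c *: 1 + y.
  have := free_gen x.
  pose R : set A := [set x | exists (c : k) (y : A), word_ge V 1 y /\ x = c *: 1 + y].
  have hw := lspan_submod [set x : A | exists s : seq A,
    [/\ (1 <= size s)%N, forall v, v \in s -> V v & x = \prod_(v <- s) v]].
  suff : word_ge V 0 `<=` R by apply.
  apply: lspan_min; first split.
  - by exists 0, 0; rewrite scale0r addr0; split=> //; case: hw.
  - move=> a _ _ [c [u [hu ->]]] [c' [u' [hu' ->]]].
    exists (a * c + c'), (a *: u + u'); split; first by case: hw => _; apply.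
    by rewrite scalerDl scalerDr scalerA addrACA.
  move=> _ [[|v s] [_ sV ->]].
    exists 1, 0; rewrite big_nil scale1r addr0; split=> //; by case: hw.
  exists 0, (\prod_(w <- v :: s) w); rewrite scale0r add0r; split=> //.
  by apply: lspan_gen; exists (v :: s).
suff c0 : c *: (1 : A) = 0 by rewrite e c0 add0r.
apply: posdeg_deg0; last first.
  by apply: submodZ; [apply: (deg_submod (adeg_grading A))|apply: adeg1].
have -> : c *: 1 = x - y by rewrite e addrK.
have hS : submod (@posdeg k A) by exact: lspan_submod.
apply: (submodB hS); first by apply: lspan_gen; exists n.
exact: word1_posdeg.
Qed.

End FreeFacts.

Section DifferentialFacts.
Variables (k : fieldType) (A : cdga k) (V : set A).
Hypotheses (Vfree : free_gca V) (Vpos : in_posdeg V).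

Lemma ad_posdeg (x : A) : posdeg (ad x).
Proof.
have := homog_span x; apply: lspan_lin => [||y [n hy]].
- exact: ad_linear.
- exact: lspan_submod.
by apply: lspan_gen; exists n.+1 => //; apply: ad_deg.
Qed.

Lemma ad_word1 (x : A) : word_ge V 1 (ad x).
Proof. by apply: (posdeg_word1 Vfree Vpos); apply: ad_posdeg. Qed.

Lemma ad1 : ad 1 = 0 :> A.
Proof.
have := adM 1 (adeg1 A); rewrite expr0 scale1r !mulr1 mul1r.
by move=> h; apply: (@addrI A (ad 1)); rewrite addr0 -h.
Qed.

Lemma ad_word m (x : A) : word_ge V m x -> word_ge V m (ad x).
Proof.
apply: lspan_lin => [||_ [s [hs sV ->]]]; first exact: ad_linear.
  exact: lspan_submod.
apply: (word_ge_sub hs).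
elim: s sV {hs} => [_|v s IH sV].
  by rewrite big_nil ad1; case: (lspan_submod [set x | exists s : seq A,
    [/\ (0 <= size s)%N, forall v, v \in s -> V v & x = \prod_(v <- s) v]]).
rewrite big_cons /= -add1n.
have {}IH : word_ge V (size s) (ad (\prod_(w <- s) w)).
  by apply: IH => w hw; apply: sV; rewrite inE hw orbT.
have hp : word_ge V (size s) (\prod_(w <- s) w).
  apply: lspan_gen; exists s; split=> // w hw.
  by apply: sV; rewrite inE hw orbT.
move: (\prod_(w <- s) w) hp IH => y hy hdy.
have [[_ hV] _] := Vfree.
have := hV v (sV v (mem_head _ _)).
apply: (@lspan_lin k A A _ (word_ge V (1 + size s)) (fun v => ad (v * y))).
- by move=> a u w; rewrite mulrDl -scalerAl ad_linear.
- exact: lspan_submod.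
move=> u [uV [n un]]; rewrite (adM _ un).
have hS : submod (word_ge V (1 + size s)) by exact: lspan_submod.
apply: (submodD hS); first by apply: word_geM => //; apply: ad_word1.
apply: (submodZ _ hS).
by apply: word_geM => //; apply: word_geV.
Qed.

End DifferentialFacts.

Section TensorFacts.
Variable k : fieldType.

Lemma tensor_gen (M N E : lmodType k) (T : set N) (mul : M -> N -> E) :
    submod T -> (forall y, linear (mul ^~ y)) -> (forall x, linear (mul x)) ->
    is_tensor T mul ->
  forall e, lspan [set e | exists x y, T y /\ e = mul x y] e.
Proof.
move=> hT hl hr h e; set S := lspan _.
have hS : submod S by exact: lspan_submod.
have tS : submod [set: E] by split.
pose X : lmodType k := subquot tS hS.
have z1 y : T y -> linear ((fun (_ : M) (_ : N) => 0 : X) ^~ y).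
  by move=> _ a u v; rewrite scaler0 addr0.
have z2 x : linear_on T ((fun (_ : M) (_ : N) => 0 : X) x).
  by move=> a u v _ _; rewrite scaler0 addr0.
have [g0 [_ u]] := h X _ z1 z2.
have pl : linear (sqproj tS hS : E -> X).
  by move=> a x y; apply: sqproj_linear.
pose pl' := GRing.isLinear.Build _ _ _ _ _ pl.
pose g : {linear E -> X} := HB.pack (sqproj tS hS : E -> X) pl'.
apply/(sqproj_eq0 tS hS) => //.
have e1 : g =1 g0.
  by apply: u => x y hy; apply/sqproj_eq0 => //; apply: lspan_gen; exists x, y.
have e2 : (\0 : E -> X) =1 g0 by apply: (u \0) => x y _.
by rewrite -[LHS]/(g e) e1 -e2.
Qed.

End TensorFacts.

Section FiltrationFacts.
Variables (k : fieldType) (B E L : cdga k) (i : cdga_hom B E) (j : gca_hom L E).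
Variables (Z : set B) (W : set L) (P : dgmod E) (U : set P).
Hypotheses (hZ : sullivan Z) (hE : relative_sullivan W i j).
Hypothesis hU : semifree_on U.

Let F := Pge i j Z W U.

Let Zf : free_gca Z. Proof. by case: hZ => -[]. Qed.
Let Zp : in_posdeg Z. Proof. by case: hZ. Qed.
Let Wf : free_gca W. Proof. by case: hE => _ []. Qed.
Let Wp : in_posdeg W. Proof. by case: hE => _ []. Qed.
Let Zg p : graded_sub (@adeg k B) (word_ge Z p).
Proof. by apply: word_ge_graded; case: Zf. Qed.
Let Wg q : graded_sub (@adeg k L) (word_ge W q).
Proof. by apply: word_ge_graded; case: Wf. Qed.
Let Ug : graded_sub (@mdeg k E P) U. Proof. by case: hU. Qed.
Let Fs p q : submod (F p q). Proof. exact: lspan_submod. Qed.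

Let act_sub (S : set P) x : submod S -> submod [set a : E | S (act a x)].
Proof. by move=> hS; apply: (submod_preim (act_linearl x)). Qed.

Let linZ (w : L) (x : P) : linear (fun z : B => act (i z * j w) x).
Proof. by move=> a z z'; rewrite linearP mulrDl -scalerAl act_linearl. Qed.
Let linW (z : B) (x : P) : linear (fun w : L => act (i z * j w) x).
Proof. by move=> a w w'; rewrite linearP mulrDr -scalerAr act_linearl. Qed.

(* To check a linear condition on P^{>= p, >= q} homogeneous generators are   *)
(* enough.                                                                    *)
Let F_ind p q (S : set P) : submod S ->
  (forall z w u m n r, word_ge Z p z -> adeg m z -> word_ge W q w ->
     adeg n w -> U u -> mdeg r u -> S (act (i z * j w) u)) ->
  F p q `<=` S.
Proof.
move=> hS h; apply: lspan_min => // _ [z [w [u [hz hw hu ->]]]].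
have /(lspan_lin (act_linearr (i z * j w)) hS) := (proj2 Ug) _ hu; apply.
move=> {hu}u [hu [r du]].
have /(lspan_lin (linW z u) hS) := (proj2 (Wg q)) _ hw; apply.
move=> {hw}w [hw [n dw]].
have /(lspan_lin (linZ w u) hS) := (proj2 (Zg p)) _ hz; apply.
by move=> {hz}z [hz [m dz]]; exact: (h _ _ _ _ _ _ hz dz hw dw hu du).
Qed.

Let F_gen p q z w u : word_ge Z p z -> word_ge W q w -> U u ->
  F p q (act (i z * j w) u).
Proof. by move=> hz hw hu; apply: lspan_gen; exists z, w, u. Qed.

Lemma Pge_sub p q p' q' : (p' <= p)%N -> (q' <= q)%N -> F p q `<=` F p' q'.
Proof.
move=> hp hq; apply: F_ind => // z w u _ _ _ hz _ hw _ hu _.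
by apply: F_gen => //; [apply: word_ge_sub hz|apply: word_ge_sub hw].
Qed.

Lemma Pge_act p q p' q' z w x : word_ge Z p z -> word_ge W q w ->
  F p' q' x -> F (p + p') (q + q') (act (i z * j w) x).
Proof.
move=> hz hw; pose S := F (p + p') (q + q').
suff : F p' q' `<=` (act (i z * j w)) @^-1` S by move=> H /H.
apply: F_ind; first exact/(submod_preim (act_linearr _))/Fs.
move=> z' w' u m n r hz' dz' hw' _ hu _ /=.
have hS : submod S by exact: Fs.
have /(lspan_lin (linW z (act (i z' * j w') u)) hS) := (proj2 (Wg q)) _ hw.
apply => {hw}w [hw [n' dw]].
rewrite -actM mulrA -[i z * j w * i z']mulrA.
rewrite (adegC (gca_hom_deg i dz') (gca_hom_deg j dw)).
rewrite -scalerAr -scalerAl mulrA -rmorphM -mulrA -rmorphM.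
rewrite -[_ *: _]addr0 act_linearl.
have -> : act 0 u = 0.
  by have := act_linearl u (-1) 0 0; rewrite scaler0 addr0 scaleN1r addNr.
rewrite addr0; apply: (submodZ _ hS).
by apply: F_gen => //; apply: word_geM.
Qed.

Let genE (a : E) : lspan [set e | exists b l, setT l /\ e = i b * j l] a.
Proof.
have [_ _ hT _ _] := hE.
apply: (tensor_gen _ _ _ hT); first by split.
- by move=> l c b b'; rewrite linearP mulrDl -scalerAl.
- by move=> b c l l'; rewrite linearP mulrDr -scalerAr.
Qed.

Lemma Pge_total x : F 0 0 x.
Proof.
have [[hUs _] hT _] := hU.
have := tensor_gen hUs (@act_linearl _ _ P) (@act_linearr _ _ P) hT x.
apply: lspan_min => // {x} _ [a [u [hu ->]]].
move: (genE a); apply: (lspan_min (act_sub u (Fs 0 0))) => {a} _ [b [l [_ ->]]].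
by apply: F_gen => //; apply: free_gen.
Qed.

Lemma Pge_act_any p q l x : F p q x -> F p q (act (j l) x).
Proof.
have -> : j l = i 1 * j l by rewrite rmorph1 mul1r.
have := @Pge_act 0 0 p q 1 l x (@word_ge1 k B Z) (free_gen Wf l).
by [].
Qed.

Lemma Pge_act_base p q b l x :
  posdeg b -> F p q x -> F p.+1 q (act (i b * j l) x).
Proof.
move=> hb.
exact: (@Pge_act 1 0 p q b l x (posdeg_word1 Zf Zp hb) (free_gen Wf l)).
Qed.

Lemma Pge_curv p q l x : F p q x -> F p.+1 q (act (ad (j l) - j (ad l)) x).
Proof.
move=> hx; have [_ _ _ _ hfib] := hE.
move: (hfib l); apply: (lspan_min (act_sub x (Fs p.+1 q))) => _ [b [l' [hb ->]]].
exact: Pge_act_base.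
Qed.

Let T p q : set P := setaddm (F p q) (F p.+1 0).

Let Ts p q : submod (T p q).
Proof. exact: setaddm_submod. Qed.

Lemma Pge_md p q x : F p q x -> T p q (md x).
Proof.
move=> hx; suff : F p q `<=` (@md _ _ P) @^-1` T p q by move=> H; apply: H.
apply: F_ind => {x hx}; first exact/(submod_preim (@md_linear _ _ P))/Ts.
move=> z w u m n r hz dz hw dw hu du /=.
have dzw := adegM (gca_hom_deg i dz) (gca_hom_deg j dw).
rewrite (md_act _ dzw) (adM _ (gca_hom_deg i dz)).
have linact a b c x : act (a + c *: b) x = act a x + c *: act b x :> P.
  by rewrite addrC act_linearl addrC.
rewrite linact -cdga_hom_d.
have hFT : F p q `<=` T p q by apply: setaddml.
have hFT' : F p.+1 0 `<=` T p q by apply: setaddmr.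
apply: submodD => //; last first.
  apply: submodZ => //; apply: hFT.
  by rewrite -[p]addn0 -[q]addn0; apply: Pge_act => //; apply: Pge_total.
apply: submodD => //.
  by apply: hFT; apply: F_gen => //; apply: ad_word.
apply: submodZ => //.
have -> : ad (j w) = (ad (j w) - j (ad w)) + j (ad w) by rewrite subrK.
rewrite mulrDr addrC -[i z * (_ - _)]scale1r linact scale1r.
apply: submodD => //; first by apply: hFT; apply: F_gen => //; apply: ad_word.
apply: hFT'; rewrite actM -add1n addnC -[0%N]addn0 -[i z]mulr1 -[1](rmorph1 j).
apply: Pge_act => //; first exact: word_ge1.
exact: (Pge_curv w (Pge_total u)).
Qed.

Lemma Pge_graded p q : graded_sub (@mdeg k E P) (F p q).
Proof.
split=> //; apply: F_ind; first exact: lspan_submod.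
move=> z w u m n r hz dz hw dw hu du; apply: lspan_gen; split.
  exact: F_gen.
exists ((m + n)%N%:Z + r); apply: act_deg => //.
by apply: adegM; apply: gca_hom_deg.
Qed.

Lemma Ppq_pair p q : dg_pair j (setaddm (F p q) (F p.+1 0)) (F p.+1 0).
Proof.
have Tp1 r : T r 0 `<=` F r 0.
  by apply: setaddm_min => //; apply: Pge_sub.
have dF r x : F r 0 x -> F r 0 (md x) by move=> /Pge_md/Tp1.
split.
- by apply: setaddm_graded; apply: Pge_graded.
- exact: Pge_graded.
- move=> _ [y [z [hy hz ->]]].
  have -> : md (y + z) = md y + md z.
    by rewrite -[y in LHS]scale1r md_linear scale1r.
  apply: submodD; [exact: Ts|exact: Pge_md|].
  by apply: setaddmr => //; apply: dF.
- by move=> x; apply: dF.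
- move=> l _ [y [z [hy hz ->]]].
  have -> : act (j l) (y + z) = act (j l) y + act (j l) z.
    by rewrite -[y in LHS]scale1r act_linearr scale1r.
  have h1 := Pge_act_any l hy; have h2 := Pge_act_any l hz.
  by exists (act (j l) y), (act (j l) z).
- by move=> l x hx; exact: (Pge_act_any l hx).
- move=> l _ [y [z [hy hz ->]]].
  rewrite -[y]scale1r act_linearr scale1r; apply: (submodD (Fs p.+1 0)).
    exact: (Pge_sub (leqnn _) (leq0n _) (Pge_curv l hy)).
  exact: (Pge_sub (leqnSn _) (leqnn _) (Pge_curv l hz)).
Qed.

(* P^{p, >= q} = P^{>= p, >= q} / P^{>= p + 1, >= q}, realized as the image   *)
(* of P^{>= p, >= q} in P^{>= p, >= 0} / P^{>= p + 1, >= 0}.  The subspace    *)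
(* P^{>= p, >= q} itself need not be stable under d, but its sum with         *)
(* P^{>= p + 1, >= 0}, which has the same image, is.                          *)
Definition Ppq (p q : nat) : dgmod L := subquot_dgmod (Ppq_pair p q).

End FiltrationFacts.

(* Main.v *)
From HB Require Import structures.
From mathcomp Require Import all_boot all_order all_algebra.
From mathcomp Require Import boolp classical_sets functions.
Require Import Defs.

(** Write L for the fiber algebra, F(p, q) for P^(>= p, >= q), and G(p, q) for
    the sum of the F(p + s, q - s): the part of F(p, 0) of total wordlength at
    least p + q.

    The curvature of w in W is the difference of its differentials in LV and in
    the fiber.  It lies in total wordlength >= 2 - c, where c = 1 in general
    ([curv_general]) and c = 0 if LV is minimal ([curv_minimal]).  Hence d maps
    F(p, q) into F(p, q) + G(p + 1, q - c) ([Pge_md_GP]).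

    A cocycle of P which is a boundary modulo words of length > N is cohomologous
    to a cocycle in G(0, N + 1).  It is then pushed from column to column: a
    cocycle in G(p, n + 1 + q) is cohomologous to one in G(p + 1, q - c)
    ([column_step]).  If (m + 1)(n + 1 + c) <= N + 1 + c, then m + 1 such steps
    lead into F(m + 1, 0), the span of the products of words of length > m in Z
    with P.  There the cocycle is a boundary because the Toomer invariant of P
    over the base is m ([toomer_restrict]).  The two bounds of the theorem are the
    least N for c = 1 and for c = 0.

    What makes a step possible is the exactness of the columns ([column_exact]): in
    the column M = P^(p, >= 0), a cocycle x of wordlength >= n + 1 + b in W is the
    differential of an element of wordlength >= b.  Let Q be a resolution of
    P^(p, >= b).  The cocycles of Q that are combinations of words of length > n
    are boundaries, so it suffices to lift x to such a cocycle.  Although x is a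
    combination of words of length n + 1 applied to elements of wordlength b, the
    corresponding tensor in L (x) M need not be a cocycle, and this is the
    difficulty.

    The remedy is a Koszul module K = L (x) M (x) F.  Only finitely many letters
    w_j of W matter for x ([column_eventually]), and F is the algebra of
    polynomials in one variable sigma_j of the opposite parity for each of them.
    Let l_j be the multiplication by w_j on L and r_j its action on M.  The
    differential of K sends sigma_j to r_j - l_j, up to a correction.  The
    derivations of L dual to the letters act on M, and contracting them with the
    sigma_j gives an operator gamma with [gamma, r_j] = sigma_j.  The Laplacian
    theta = [d, gamma] kills l_j and fixes sigma_j, and it has positive integral
    eigenvalues on r_j - l_j.  In characteristic 0 it can be inverted there
    ([eig_inverse]).  This is used twice: to build the corrections that make the
    differential of K square to zero ([perturbation]), and to replace in a cocycle
    of K right letters by left letters, one at a time ([descent]).  So 1 (x) x (x) 1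
    is cohomologous to a cocycle t of K in which n + 1 letters act on L.  As K is
    semifree over L, its map to M lifts to Q up to homotopy ([lift_cocycle]), and
    it sends t to a cocycle of Q made of words of length > n. *)

Set Implicit Arguments.
Unset Strict Implicit.
Unset Printing Implicit Defensive.

Import GRing.Theory.
Local Open Scope classical_set_scope.
Local Open Scope ring_scope.

(** * Linear algebra *)

Section LinearBasics.
Variable k : fieldType.

Lemma lin0 (M N : lmodType k) (f : M -> N) : linear f -> f 0 = 0.
Proof. by move=> hf; have := hf (-1) 0 0; rewrite scaler0 addr0 scaleN1r addNr. Qed.

Lemma linD (M N : lmodType k) (f : M -> N) x y :
  linear f -> f (x + y) = f x + f y.
Proof. by move=> hf; rewrite -[x in LHS]scale1r hf scale1r. Qed.

Lemma linZ (M N : lmodType k) (f : M -> N) (a : k) x :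
  linear f -> f (a *: x) = a *: f x.
Proof. by move=> hf; rewrite -[_ *: x]addr0 hf lin0 // addr0. Qed.

Lemma linN (M N : lmodType k) (f : M -> N) x : linear f -> f (- x) = - f x.
Proof. by move=> hf; rewrite -scaleN1r linZ // scaleN1r. Qed.

Lemma linB (M N : lmodType k) (f : M -> N) x y :
  linear f -> f (x - y) = f x - f y.
Proof. by move=> hf; rewrite linD // linN. Qed.

Lemma submod0 (M : lmodType k) (S : set M) : submod S -> S 0.
Proof. by case. Qed.

Lemma submod_zero (M : lmodType k) : submod [set (0 : M)].
Proof. by split=> // a x y -> ->; rewrite /= scaler0 addr0. Qed.

Lemma submod_ker (M N : lmodType k) (f : M -> N) :
  linear f -> submod [set x | f x = 0].
Proof. by move=> hf; apply: (submod_preim hf (submod_zero N)). Qed.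

Lemma submod_big (M : lmodType k) (S : set M) (J : Type) (s : seq J)
    (P : pred J) (c : J -> M) :
  submod S -> (forall i, P i -> S (c i)) -> S (\sum_(i <- s | P i) c i).
Proof.
move=> hS hc; apply: (big_ind S) => [|x y|//]; first by case: hS.
exact: submodD.
Qed.

Lemma submod_eq_lin (M N : lmodType k) (f g : M -> N) :
  linear f -> linear g -> submod [set x | f x = g x].
Proof.
move=> hf hg; split=> /=; first by rewrite !lin0.
by move=> a x y ex ey; rewrite hf hg ex ey.
Qed.

Lemma lin_ext_span (M N : lmodType k) (X : set M) (f g : M -> N) :
  linear f -> linear g -> (forall x, X x -> f x = g x) ->
  forall x, lspan X x -> f x = g x.
Proof. by move=> hf hg h; apply: lspan_min => //; apply: submod_eq_lin. Qed.

Lemma linear_comp2 (X Y T : lmodType k) (f : Y -> T) (g : X -> Y) :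
  linear f -> linear g -> linear (fun x => f (g x)).
Proof. by move=> hf hg a x y; rewrite hg hf. Qed.

Lemma linear_scale2 (X Y : lmodType k) (c : k) (f : X -> Y) :
  linear f -> linear (fun x => c *: f x).
Proof. by move=> hf a x y; rewrite hf scalerDr !scalerA mulrC. Qed.

Lemma linear_add2 (X Y : lmodType k) (f g : X -> Y) :
  linear f -> linear g -> linear (fun x => f x + g x).
Proof. by move=> hf hg a x y; rewrite hf hg scalerDr addrACA. Qed.

End LinearBasics.

(** * Linear selections *)

(** The property may fail for the empty set, which is why only nonempty chains
    have unions in P. *)
Lemma zorn_nonempty (T : Type) (P : set (set T)) (G0 : set T) : P G0 ->
    (forall F, F `<=` P -> F !=set0 -> total_on F subset -> P (\bigcup_(X in F) X)) ->
  exists A, P A /\ forall B, A `<=` B -> P B -> B `<=` A.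
Proof.
move=> P0 hP; pose P' : set (set T) := [set G | G = set0 \/ P G].
have [|A [hA maxA]] := @Zorn_bigcup T P'.
  move=> F hF tF; have [[G [FG G0']]|hn] := pselect (exists G, F G /\ P G); last first.
    left; apply/seteqP; split=> // x [G FG Gx].
    have [e|pg] := hF _ FG; first by rewrite e in Gx.
    by apply: hn; exists G.
  right; have -> : \bigcup_(X in F) X = \bigcup_(X in F `&` P) X.
    apply/seteqP; split=> x [X]; last by move=> [FX _] Xx; exists X.
    move=> FX Xx; exists X => //; split=> //.
    by have [e|//] := hF _ FX; rewrite e in Xx.
  apply: hP; [by move=> X []|by exists G|].
  by move=> X Y [FX _] [FY _]; apply: tF.
have {}hA : P A.
  case: hA => // e; have [[x Gx]|hn] := pselect (G0 !=set0).
    have := maxA G0; rewrite e; case; last by right.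
    by split=> // /(_ _ Gx).
  suff -> : A = G0 by [].
  rewrite e; apply/seteqP; split=> // x Gx; case: hn; by exists x.
exists A; split=> // B AB PB; apply: contrapT => nBA.
by apply: (maxA B); [split=> //|right].
Qed.

Lemma submod_bigcup_chain (k : fieldType) (M : lmodType k) (F : set (set M)) :
  (forall X, F X -> submod X) -> F !=set0 -> total_on F subset ->
  submod (\bigcup_(X in F) X).
Proof.
move=> hF [X0 FX0] tF; split; first by exists X0 => //; case: (hF _ FX0).
move=> a x y [X FX Xx] [Y FY Yy].
have [XY|YX] := tF _ _ FX FY.
  by exists Y => //; case: (hF _ FY) => _; apply => //; apply: XY.
by exists X => //; case: (hF _ FX) => _; apply => //; apply: YX.
Qed.

Section Selection.
Variables (k : fieldType) (M N : lmodType k).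
Implicit Types (G R : set (M * N)%type).

Definition single_valued G : Prop := forall v, G (0, v) -> v = 0.

Lemma single_valuedP G x v v' : submod G -> single_valued G ->
  G (x, v) -> G (x, v') -> v = v'.
Proof.
move=> hG h h1 h2; apply/eqP; rewrite -subr_eq0; apply/eqP; apply: h.
by have := submodB hG h1 h2; rewrite -[(x, v) - (x, v')]/(x - x, v - v') subrr.
Qed.

Lemma adjoin_submod G x0 v0 : submod G ->
  submod [set p | exists c : k, G (p.1 - c *: x0, p.2 - c *: v0)].
Proof.
move=> hG; split=> /=.
  by exists 0; rewrite !scale0r !subr0; case: hG.
move=> a [x v] [y w] /= [c hc] [e he]; exists (a * c + e).
case: hG => _ hl; have := hl a _ _ hc he.
have E (X : lmodType k) (p q p0 : X) :
    a *: (p - c *: p0) + (q - e *: p0) = a *: p + q - (a * c + e) *: p0.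
  by rewrite scalerBr scalerDl scalerA opprD addrACA.
by rewrite -(E _ x y) -(E _ v w).
Qed.

Lemma adjoin_single_valued G x0 v0 : submod G -> single_valued G ->
  ~ (exists v, G (x0, v)) ->
  single_valued [set p | exists c : k, G (p.1 - c *: x0, p.2 - c *: v0)].
Proof.
move=> hG sG nx v /= [c]; rewrite sub0r; have [->|c0] := eqVneq c 0.
  by rewrite !scale0r oppr0 subr0; apply: sG.
move=> h; case: nx; exists (- c^-1 *: (v - c *: v0)).
have := submodZ (- c^-1) hG h.
rewrite -[_ *: (_, _)]/(- c^-1 *: - (c *: x0), - c^-1 *: (v - c *: v0)).
by rewrite scalerN scaleNr opprK scalerA mulVf // scale1r.
Qed.

(** Bases are never chosen: Zorn's lemma for single-valued subspaces takes
    their place. Extensions of linear maps, functionals and projections are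
    obtained by special choices of R and G0. *)
Lemma linear_selection R G0 : submod R -> submod G0 -> G0 `<=` R ->
    single_valued G0 -> (forall x, exists v, R (x, v)) ->
  exists phi : M -> N, [/\ linear phi, forall x, R (x, phi x) &
    forall x v, G0 (x, v) -> phi x = v].
Proof.
move=> hR hG0 GR sG0 tR.
pose P : set (set (M * N)%type) :=
  [set G | [/\ submod G, G `<=` R, G0 `<=` G & single_valued G]].
have [||G [[hG GR' G0G sG] maxG]] := @zorn_nonempty _ P G0; first by split.
  move=> F hF [X0 FX0] tF; split.
  - by apply: submod_bigcup_chain => //; [move=> X /hF []|exists X0].
  - by move=> p [X /hF [_ XR _ _]]; apply: XR.
  - by move=> p hp; exists X0 => //; case: (hF _ FX0) => _ _ h _; apply: h.
  - by move=> v [X /hF [_ _ _ sX]]; apply: sX.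
have tot x : exists v, G (x, v).
  apply: contrapT => nx; have [v0 hv0] := tR x.
  pose G' : set (M * N)%type := [set p | exists c : k, G (p.1 - c *: x, p.2 - c *: v0)].
  have GG' : G `<=` G' by move=> [y w] h; exists 0; rewrite !scale0r !subr0.
  have : G' `<=` G.
    apply: maxG => //; split; [exact: adjoin_submod| |by move=> p /G0G/GG'|
      exact: adjoin_single_valued].
    move=> [y w] /= [c /GR'] h.
    have := submodD hR h (submodZ c hR hv0).
    rewrite -[_ + _ *: _]/(y - c *: x + c *: x, w - c *: v0 + c *: v0).
    by rewrite !subrK.
  move/(_ (x, v0)) => h; apply: nx; exists v0; apply: h; exists 1 => /=.
  by rewrite !scale1r !subrr; case: hG.
have /choice [phi hphi] := tot; exists phi; split.
- move=> a x y; apply: (single_valuedP hG sG (hphi _)).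
  by have := (proj2 hG) a _ _ (hphi x) (hphi y).
- by move=> x; apply: GR'.
- by move=> x v /G0G; apply: (single_valuedP hG sG).
Qed.

Lemma linear_extension G : submod G -> single_valued G ->
  exists phi : M -> N, linear phi /\ forall x v, G (x, v) -> phi x = v.
Proof.
move=> hG sG.
have [|||phi [h1 _ h2]] := @linear_selection [set: (M * N)%type] G _ hG _ sG.
- by [].
- by [].
- by move=> x; exists 0.
- by exists phi.
Qed.

End Selection.

Section SelectionCorollaries.
Variables (k : fieldType) (M : lmodType k).

Lemma functional_separates (x : M) :
  (forall xi : M -> k^o, linear xi -> xi x = 0) -> x = 0.
Proof.
move=> h; apply: contrapT => x0.
pose G : set (M * k^o)%type := [set p | p.1 = p.2 *: x].
have hG : submod G.
  split; first exact: (esym (scale0r x)).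
  by move=> a [y v] [z w]; rewrite /G /mkset /= => -> ->; rewrite scalerDl scalerA.
have sG : single_valued G.
  move=> v /= /esym/eqP; rewrite scaler_eq0 => /orP[/eqP//|/eqP].
  by [].
have [xi [hxi hx]] := linear_extension hG sG.
have := hx x 1 (esym (scale1r x)).
by rewrite (h xi) // => /eqP; rewrite eq_sym oner_eq0.
Qed.

Lemma linear_projection (S : set M) : submod S ->
  exists psi : M -> M, [/\ linear psi, forall x, S (psi x) & forall x, S x -> psi x = x].
Proof.
move=> hS.
pose R : set (M * M)%type := [set p | S p.2].
pose G : set (M * M)%type := [set p | S p.1 /\ p.2 = p.1].
have hR : submod R.
  by split=> [|a x y]; [case: hS|case: hS => _; apply].
have hG : submod G.
  split=> [|a [x v] [y w]] /=; first by case: hS.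
  by rewrite /G /mkset /= => -[hx ->] [hy ->]; split=> //; case: hS => _; apply.
have [|||psi [h1 h2 h3]] := linear_selection hR hG.
- by rewrite /G /R => -[x v] [/= hx ->].
- by move=> v [].
- by move=> x; exists 0; case: hS.
by exists psi; split=> // x hx; apply: h3.
Qed.

End SelectionCorollaries.

(** * Tensor products *)

Section Tensor.
Variables (k : fieldType) (M N : lmodType k).

Let V : lmodType k := ((M -> N -> k^o) -> k^o).
Let bil (b : M -> N -> k^o) : Prop :=
  (forall n, linear (b ^~ n)) /\ (forall m, linear (b m)).
Let ev (m : M) (n : N) : V := fun b => if pselect (bil b) then b m n else 0.
Let T : set V := lspan [set x | exists m n, x = ev m n].
Let hT : submod T. Proof. exact: lspan_submod. Qed.
Let h0 : submod [set (0 : V)]. Proof. exact: submod_zero. Qed.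

(** Tensors are realized as functionals on the bilinear forms on M x N: no
    relations have to be divided out, and vanishing can be tested on bilinear
    forms. *)
Definition tens : lmodType k := subquot hT h0.
Definition tp (m : M) (n : N) : tens := sqproj hT h0 (ev m n).

Let evT m n : T (ev m n). Proof. by apply: lspan_gen; exists m, n. Qed.

Lemma tp_linearl n : linear (tp ^~ n).
Proof.
move=> a m m'; rewrite /tp -sqproj_linear //; congr sqproj.
apply/funext => b.
change (ev (a *: m + m') n b = a *: ev m n b + ev m' n b).
rewrite /ev; case: (pselect (bil b)) => [h|nb] /=; first exact: h.1.
by rewrite scaler0 addr0.
Qed.

Lemma tp_linearr m : linear (tp m).
Proof.
move=> a n n'; rewrite /tp -sqproj_linear //; congr sqproj.
apply/funext => b.
change (ev m (a *: n + n') b = a *: ev m n b + ev m n' b).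
rewrite /ev; case: (pselect (bil b)) => [h|nb] /=; first exact: h.2.
by rewrite scaler0 addr0.
Qed.

Lemma tens_span (x : tens) : lspan [set x | exists m n, x = tp m n] x.
Proof.
rewrite -[x](@sqrepK _ _ _ _ hT h0); have := @sqrep_in _ _ _ _ hT h0 x.
move: (sqrep x) => v hv; suff : T `<=` [set v | T v /\
    lspan [set x | exists m n, x = tp m n] (sqproj hT h0 v)] by move=> /(_ v hv) [].
have hL := lspan_submod [set x : tens | exists m n, x = tp m n].
apply: lspan_min; last by move=> _ [m [n ->]]; split=> //; apply: lspan_gen; exists m, n.
split.
  split; first by case: hT.
  suff -> : sqproj hT h0 0 = 0 by case: hL.
  by apply/sqproj_eq0; [case: hT|].
move=> a u w [Tu Lu] [Tw Lw]; split; first by case: hT => _; apply.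
by rewrite sqproj_linear //; case: hL => _; apply.
Qed.

Lemma tens_ind (S : set tens) : submod S -> (forall m n, S (tp m n)) ->
  forall x, S x.
Proof. by move=> hS h x; apply: (lspan_min hS _ (tens_span x)) => _ [m [n ->]]. Qed.

Lemma tens_eq (X : lmodType k) (f g : tens -> X) : linear f -> linear g ->
  (forall m n, f (tp m n) = g (tp m n)) -> f =1 g.
Proof. by move=> hf hg h; apply: tens_ind => //; apply: submod_eq_lin. Qed.

(** A relation between tensors holds between the values of every bilinear
    form, and linear functionals separate the vectors of X. *)
Lemma tens_lift (X : lmodType k) (f : M -> N -> X) :
    (forall n, linear (f ^~ n)) -> (forall m, linear (f m)) ->
  exists g : tens -> X, linear g /\ forall m n, g (tp m n) = f m n.
Proof.
move=> hl hr.
pose G : set (tens * X)%type := lspan [set p | exists m n, p = (tp m n, f m n)].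
have hG : submod G by exact: lspan_submod.
have [v h|g [hg hgG]] := linear_extension hG; last first.
  by exists g; split=> // m n; apply: hgG; apply: lspan_gen; exists m, n.
apply: functional_separates => xi hxi.
pose b m n : k^o := xi (f m n).
have hb : bil b.
  by split=> [n|m] a x y; rewrite /b ?hl ?hr hxi.
have hpr : forall p, G p -> exists w, [/\ T w, p.1 = sqproj hT h0 w & w b = xi p.2].
  apply: lspan_min.
    split.
      exists 0; split; [by case: hT| |by rewrite /= lin0].
      by symmetry; apply/sqproj_eq0; [case: hT|].
    move=> a p q [w [Tw ew hw]] [w' [Tw' ew' hw']]; exists (a *: w + w'); split.
    - by case: hT => _; apply.
    - by rewrite sqproj_linear // -ew -ew'.
    - by rewrite /= hxi -hw -hw'.
  move=> _ [m [n ->]]; exists (ev m n); split=> //=.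
  by rewrite /ev; case: pselect.
have [w [Tw /= ew <-]] := hpr _ h.
have : sqproj hT h0 w = 0 by rewrite -ew.
by move/(sqproj_eq0 hT h0 Tw) => ->.
Qed.

End Tensor.

Section TensorMap.
Variables (k : fieldType) (M N M' N' : lmodType k).

(** The junk value 0 for maps that are not linear makes [tmap] total, and
    linear in all cases. *)
Definition tmap (f : M -> M') (g : N -> N') : tens M N -> tens M' N' :=
  if pselect (linear f /\ linear g) is left h then
    sval (cid (@tens_lift _ _ _ _ (fun m n => tp (f m) (g n))
      (fun n a x y => etrans (congr1 (fun z => tp z (g n)) (h.1 a x y)) (tp_linearl _ _ _ _))
      (fun m a x y => etrans (congr1 (tp (f m)) (h.2 a x y)) (tp_linearr _ _ _ _))))
  else fun=> 0.

Lemma tmap_linear f g : linear (tmap f g).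
Proof.
rewrite /tmap; case: pselect => [h|nh] a x y; last by rewrite scaler0 addr0.
by case: cid => u [hu hu'] /=; apply: hu.
Qed.

Lemma tmapE f g m n : linear f -> linear g -> tmap f g (tp m n) = tp (f m) (g n).
Proof.
move=> hf hg; rewrite /tmap; case: pselect => [h|[]//].
by case: cid => u [hu hu'] /=.
Qed.

End TensorMap.

(** * Generalized eigenspaces with integral eigenvalues *)

Section Spectrum.
Variable k : fieldType.

Section OneOperator.
Variables (V : lmodType k) (T : V -> V).
Hypothesis hT : linear T.
Implicit Types (v : V) (ls : seq nat).

Fixpoint kill ls v : V :=
  if ls is a :: ls' then kill ls' (T v - a%:R *: v) else v.

Lemma shift_linear (a : nat) : linear (fun v => T v - a%:R *: v).
Proof.
move=> c x y; rewrite hT scalerDr !scalerA mulrC -scalerA scalerBr.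
by rewrite opprD addrACA.
Qed.

Lemma kill_linear ls : linear (kill ls).
Proof.
elim: ls => //= a ls IH c x y; rewrite -IH; congr kill.
exact: (shift_linear a c x y).
Qed.

Lemma kill_cat ls ls' v : kill (ls ++ ls') v = kill ls' (kill ls v).
Proof. by elim: ls v => //= a ls IH v. Qed.

Lemma kill_stable ls (S : set V) : submod S -> (forall v, S v -> S (T v)) ->
  forall v, S v -> S (kill ls v).
Proof.
move=> hS h; elim: ls => //= a ls IH v hv; apply: IH.
by apply: (submodB hS); [exact: h|exact: submodZ].
Qed.

Lemma kill_comm_shift ls (a : nat) v :
  kill ls (T v - a%:R *: v) = T (kill ls v) - a%:R *: kill ls v.
Proof.
elim: ls v => //= b ls IH v; rewrite -IH; congr kill.
rewrite !(linB _ _ hT) !(linZ _ _ hT) !scalerBr.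
rewrite !opprB addrACA [RHS]addrACA !scalerA mulrC; congr (_ + _).
exact: addrC.
Qed.

Lemma kill_comm ls ls' v : kill ls (kill ls' v) = kill ls' (kill ls v).
Proof.
elim: ls' v => //= a ls' IH v.
by rewrite IH kill_comm_shift.
Qed.

(** The generalized eigenspaces for the integers >= 0, or > 0 if b, modulo D:
    the product of the T - a, for a in ls, maps the vector into D. *)
Definition eig (b : bool) (D : set V) v : Prop :=
  exists2 ls, all (fun a => b ==> (0 < a)%N) ls & D (kill ls v).

Lemma eig_submod b D : submod D -> (forall v, D v -> D (T v)) -> submod (eig b D).
Proof.
move=> hD TD; split; first by exists [::] => //; case: hD.
move=> c x y [ls hls hx] [ls' hls' hy]; exists (ls ++ ls').
  by rewrite all_cat hls.
rewrite kill_linear; case: (hD) => _; apply.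
  by rewrite kill_cat; apply: kill_stable.
by rewrite kill_cat kill_comm; apply: kill_stable.
Qed.

Lemma eig_cons b D (a : nat) v : (b ==> (0 < a)%N) ->
  eig b D (T v - a%:R *: v) -> eig b D v.
Proof. by move=> ha [ls hls h]; exists (a :: ls); rewrite //= ha. Qed.

Lemma eig_mod b (D D' : set V) v : D `<=` D' -> eig b D v -> eig b D' v.
Proof. by move=> h [ls hls hv]; exists ls => //; apply: h. Qed.

Lemma eig_weaken D v : eig true D v -> eig false D v.
Proof. by case=> ls _ h; exists ls => //; apply/allP. Qed.

(** T is invertible on its generalized eigenspaces with positive eigenvalues;
    a preimage is a polynomial in T of the vector, so that it satisfies every
    T-stable linear condition which the vector satisfies. *)
Lemma eig_inverse (char0 : [pchar k] =i pred0) (S D : set V) v :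
    submod S -> submod D -> (forall v, S v -> S (T v)) -> S v ->
    eig true D v ->
  exists v', S v' /\ D (v - T v').
Proof.
move=> hS hD TS Sv [ls hls hv].
(* Expanding the product of the T - a leaves c v + T w, where c is up to sign
   the product of the eigenvalues: this is where characteristic 0 is used. *)
suff [c [w [c0 Sw e]]] : exists c w, [/\ c != 0 :> k, S w & kill ls v = c *: v + T w].
  exists (- c^-1 *: w); split; first exact: submodZ.
  have := submodZ c^-1 hD hv; rewrite e scalerDr scalerA mulVf // scale1r.
  by rewrite (linZ _ _ hT) scaleNr opprK.
elim/last_ind: ls hls {hv} => [_|ls a IH].
  exists 1, 0; rewrite oner_eq0 lin0 // scale1r addr0; split=> //; exact: submod0.
rewrite all_rcons => /andP[/= a0 /IH [c [w [c0 Sw e]]]].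
exists (- a%:R * c), (kill ls v - a%:R *: w); split.
- rewrite mulf_neq0 // oppr_eq0; have /pcharf0P -> := char0.
  by rewrite -lt0n.
- by apply: (submodB hS); [exact: kill_stable|exact: submodZ].
rewrite -cats1 kill_cat /= {2}e (linB _ _ hT) (linZ _ _ hT) scalerDr opprD scalerA.
by rewrite mulNr scaleNr addrCA.
Qed.

End OneOperator.

(** Eigenvalues add up in products on which the operators act as a
    derivation. *)
Lemma eig_bilinear (V1 V2 V3 : lmodType k) (T1 : V1 -> V1) (T2 : V2 -> V2)
    (T3 : V3 -> V3) (beta : V1 -> V2 -> V3) b u v :
    linear T1 -> linear T2 -> linear T3 ->
    (forall y, linear (beta ^~ y)) -> (forall x, linear (beta x)) ->
    (forall x y, T3 (beta x y) = beta (T1 x) y + beta x (T2 y)) ->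
    eig T1 b [set 0] u -> eig T2 false [set 0] v ->
  eig T3 b [set 0] (beta u v).
Proof.
move=> h1 h2 h3 hl hr hT [ls1 hls1 +] [ls2 _ +].
have h0 : submod [set (0 : V3)] by exact: submod_zero.
have hst w : [set 0] w -> [set 0] (T3 w) by move=> ->; rewrite /= lin0.
have [n] := ubnP (size ls1 + size ls2).
elim: n u v ls1 hls1 ls2 => // n IH u v [|a ls1] hls1 [|c ls2] hn e1 e2.
- exists [::] => //=; rewrite -[u]/(kill T1 [::] u) e1; exact: (lin0 (hl v)).
- exists [::] => //=; rewrite -[u]/(kill T1 [::] u) e1; exact: (lin0 (hl v)).
- exists [::] => //=; rewrite -[v]/(kill T2 [::] v) e2; exact: (lin0 (hr u)).
have /andP[a0 hls1'] := hls1.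
apply: (@eig_cons _ _ _ _ (a + c)); first by rewrite addn_gt0; case: b a0 {IH hls1 hls1'} => //= ->.
have -> : T3 (beta u v) - (a + c)%:R *: beta u v =
    beta (T1 u - a%:R *: u) v + beta u (T2 v - c%:R *: v).
  rewrite hT (linB _ _ (hl v)) (linB _ _ (hr u)) (linZ _ _ (hl v)) (linZ _ _ (hr u)).
  by rewrite natrD scalerDl opprD addrACA.
have hE : submod (eig T3 b [set 0]) by exact: eig_submod.
apply: (submodD hE).
  by apply: (IH _ _ ls1 _ (c :: ls2)) => //; rewrite -ltnS (leq_trans _ hn) // !addSn.
apply: (IH _ _ (a :: ls1) _ ls2) => //.
by rewrite -ltnS (leq_trans _ hn) //= !addnS.
Qed.

(** Likewise for maps intertwining two operators. *)
Lemma eig_map (V1 V2 : lmodType k) (T1 : V1 -> V1) (T2 : V2 -> V2)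
    (f : V1 -> V2) b u :
    linear f -> T2 \o f =1 f \o T1 ->
  eig T1 b [set 0] u -> eig T2 b [set 0] (f u).
Proof.
move=> hf hfT [ls hls h]; exists ls => //.
suff -> : kill T2 ls (f u) = f (kill T1 ls u) by rewrite h; exact: lin0.
elim: ls u {hls h} => //= a ls IH u; rewrite -IH; congr kill.
by rewrite (linB _ _ hf) (linZ _ _ hf) -[T2 _]/((T2 \o f) u) hfT.
Qed.

End Spectrum.

(** * Sign involutions *)

Section Signs.
Variable k : fieldType.

(** Serves both for the sign involutions and for the projections onto one
    degree. *)
Lemma grading_scaling (I : eqType) (M : lmodType k) (deg : I -> set M)
    (s : I -> k) : is_grading deg ->
  exists e : M -> M, linear e /\ forall i x, deg i x -> e x = s i *: x.
Proof.
move=> hdeg; pose Q i : set (M * M)%type := [set p | deg i p.1 /\ p.2 = s i *: p.1].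
have dS := deg_submod hdeg.
have hQ i : submod (Q i).
  split; first by split; [case: (dS i)|exact: (esym (scaler0 _ _))].
  move=> a [x v] [y w]; rewrite /Q /mkset /= => -[hx ->] [hy ->]; split.
    by case: (dS i) => _; apply.
  by rewrite scalerDr !scalerA mulrC.
pose G := lspan [set p : (M * M)%type | exists i, Q i p].
have hG : submod G by exact: lspan_submod.
have [v h|e [he heG]] := linear_extension hG; last first.
  by exists e; split=> // i x hx; apply: heG; apply: lspan_gen; exists i.
have [t [c [ut hc e]]] := graded_decomp hQ h.
have e1 : 0 = \sum_(i <- t) (c i).1 by rewrite -(raddf_sum fst) -e.
have e2 : v = \sum_(i <- t) (c i).2 by rewrite -(raddf_sum snd) -e.
case: hdeg => _ _ /(_ t (fun i => (c i).1) ut) hi.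
rewrite e2 big_seq big1 // => i it; case: (hc i) => _ ->.
by rewrite hi ?scaler0 // => j; case: (hc j).
Qed.

(** Koszul signs are carried by this involution, so that formulas need not
    refer to the degrees of their arguments. *)
Definition eps (A : gca k) : A -> A :=
  sval (cid (grading_scaling (fun n => (-1) ^+ n) (adeg_grading A))).

Section EpsFacts.
Variable A : gca k.

Lemma eps_linear : linear (@eps A).
Proof. by rewrite /eps; case: cid => e [h1 h2] /=. Qed.

Lemma epsE n (x : A) : adeg n x -> eps x = (-1) ^+ n *: x.
Proof. by rewrite /eps; case: cid => e [h1 h2] /=; exact: h2. Qed.

Lemma gca_ind (S : set A) : submod S -> (forall n x, adeg n x -> S x) ->
  forall x, S x.
Proof.
move=> hS h x; have [_ /(_ x) hx _] := adeg_grading A.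
by apply: (lspan_min hS _ hx) => y [n]; apply: h.
Qed.

Lemma eps_eps (x : A) : eps (eps x) = x.
Proof.
move: x; apply: gca_ind => [|n x hx].
  by apply: submod_eq_lin => // a x y; rewrite !eps_linear.
by rewrite (epsE hx) (linZ _ _ eps_linear) (epsE hx) scalerA -exprD -signr_odd oddD addbb scale1r.
Qed.

Lemma eps1 : eps 1 = 1 :> A.
Proof. by rewrite (epsE (adeg1 A)) scale1r. Qed.

Lemma epsM (x y : A) : eps (x * y) = eps x * eps y.
Proof.
move: x; apply: gca_ind => [|m x hx].
  apply: submod_eq_lin => a x x'; first by rewrite mulrDl -scalerAl eps_linear.
  by rewrite eps_linear mulrDl -scalerAl.
move: y; apply: gca_ind => [|n y hy].
  apply: submod_eq_lin => a y y'; first by rewrite mulrDr -scalerAr eps_linear.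
  by rewrite eps_linear mulrDr -scalerAr.
rewrite (epsE (adegM hx hy)) (epsE hx) (epsE hy) -scalerAl -scalerAr scalerA.
by rewrite exprD.
Qed.

End EpsFacts.

Lemma ad_eps (A : cdga k) (x : A) : ad (eps x) = - eps (ad x).
Proof.
move: x; apply: gca_ind => [|n x hx].
  apply: submod_eq_lin => a x y; first by rewrite eps_linear ad_linear.
  by rewrite ad_linear eps_linear scalerN opprD.
rewrite (epsE hx) (linZ _ _ (@ad_linear _ A)) (epsE (ad_deg hx)).
by rewrite exprS mulN1r scaleNr opprK.
Qed.

Lemma ad_mul (A : cdga k) (x y : A) : ad (x * y) = ad x * y + eps x * ad y.
Proof.
move: x; apply: gca_ind => [|n x hx].
  apply: submod_eq_lin => a x x'; first by rewrite mulrDl -scalerAl ad_linear.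
  rewrite ad_linear eps_linear !mulrDl -!scalerAl scalerDr.
  by rewrite addrACA.
by rewrite (adM _ hx) (epsE hx) scalerAl.
Qed.

Lemma gca_homog_eps (A : gca k) m (x y : A) : adeg m x ->
  y * x = x * iter m (@eps A) y.
Proof.
move=> hx; move: y; apply: gca_ind => [|n y hy].
  apply: submod_eq_lin => a y y'; first by rewrite mulrDl -scalerAl.
  suff -> : iter m (@eps A) (a *: y + y') = a *: iter m (@eps A) y + iter m (@eps A) y'.
    by rewrite mulrDr -scalerAr.
  by elim: (m) => //= q ->; rewrite eps_linear.
rewrite (adegC hx hy); have -> : iter m (@eps A) y = (-1) ^+ (m * n) *: y.
  elim: (m) => [|q /= ->]; first by rewrite mul0n scale1r.
  by rewrite (linZ _ _ (@eps_linear A)) (epsE hy) scalerA mulSn exprD mulrC.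
by rewrite scalerAr.
Qed.

Section Modules.
Variables (A : cdga k) (P : dgmod A).

Definition meps : P -> P :=
  sval (cid (grading_scaling (fun i : int => (-1) ^ i) (mdeg_grading P))).

Lemma meps_linear : linear meps.
Proof. by rewrite /meps; case: cid => e [h1 h2] /=. Qed.

Lemma mepsE i (x : P) : mdeg i x -> meps x = (-1) ^ i *: x.
Proof. by rewrite /meps; case: cid => e [h1 h2] /=; exact: h2. Qed.

Lemma dgmod_ind (S : set P) : submod S -> (forall i x, mdeg i x -> S x) ->
  forall x, S x.
Proof.
move=> hS h x; have [_ /(_ x) hx _] := mdeg_grading P.
by apply: (lspan_min hS _ hx) => y [i]; apply: h.
Qed.

Lemma meps_meps x : meps (meps x) = x.
Proof.
move: x; apply: dgmod_ind => [|n x hx].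
  by apply: submod_eq_lin => // a x y; rewrite !meps_linear.
rewrite (mepsE hx) (linZ _ _ meps_linear) (mepsE hx) scalerA.
by rewrite -expfzMl mulrNN mulr1 exp1rz scale1r.
Qed.

Lemma md_meps x : md (meps x) = - meps (md x).
Proof.
move: x; apply: dgmod_ind => [|n x hx].
  apply: submod_eq_lin => a x y; first by rewrite meps_linear md_linear.
  by rewrite md_linear meps_linear scalerN opprD.
rewrite (mepsE hx) (linZ _ _ (@md_linear _ _ P)) (mepsE (md_deg hx)).
rewrite expfzDr ?oppr_eq0 ?oner_eq0 // expr1z mulrN1 scaleNr opprK //.
Qed.

Lemma meps_act a x : meps (act a x) = act (eps a) (meps x).
Proof.
move: a; apply: gca_ind => [|m a ha].
  apply: submod_eq_lin => c a b; first by rewrite act_linearl meps_linear.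
  by rewrite eps_linear act_linearl.
move: x; apply: dgmod_ind => [|n x hx].
  apply: submod_eq_lin => c x y; first by rewrite act_linearr meps_linear.
  by rewrite meps_linear act_linearr.
rewrite (mepsE (act_deg ha hx)) (epsE ha) (mepsE hx).
rewrite (linZ _ _ (act_linearr _)) (linZ _ _ (act_linearl _)) scalerA.
by rewrite expfzDr ?oppr_eq0 ?oner_eq0 // -exprnP mulrC.
Qed.

Lemma md_actE a (x : P) : md (act a x) = act (ad a) x + act (eps a) (md x).
Proof.
move: a; apply: gca_ind => [|m a ha].
  apply: submod_eq_lin => c a b; first by rewrite act_linearl md_linear.
  by rewrite ad_linear eps_linear !act_linearl scalerDr addrACA.
by rewrite (md_act _ ha) (epsE ha) (linZ _ _ (act_linearl _)).
Qed.

End Modules.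
End Signs.

(** * Lifting along quasi-isomorphisms *)

(* T is a module over A and phi : T -> M a map of DG modules which sends the
   generators Y0 into J; f : Q -> M is a quasi-isomorphism onto J. The last
   hypothesis on Y0 is the form in which semifreeness is used: Y0 is exhausted
   by adjoining again and again elements whose differential lies in the
   submodule generated so far. *)
Section Lifting.
Variables (k : fieldType) (A : cdga k) (T : lmodType k).
Variables (aT : A -> T -> T) (dT : T -> T).
Hypothesis aTr : forall a, linear (aT a).
Hypothesis aTM : forall a b x, aT (a * b) x = aT a (aT b x).
Hypothesis dTl : linear dT.
Hypothesis dTdT : forall x, dT (dT x) = 0.
Hypothesis dTa : forall a x, dT (aT a x) = aT (ad a) x + aT (eps a) (dT x).

Variables (Q M : dgmod A) (f : Q -> M) (J : set M).
Hypothesis fl : linear f.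
Hypothesis fa : forall a q, f (act a q) = act a (f q).
Hypothesis fd : forall q, f (md q) = md (f q).
Hypothesis hJ : submod J.
Hypothesis Ja : forall a m, J m -> J (act a m).
Hypothesis fJ : forall q, J (f q).
Hypothesis finj : forall q, md q = 0 -> (exists m, J m /\ f q = md m) ->
  exists z, q = md z.
Hypothesis fsurj : forall m, J m -> md m = 0 ->
  exists q, md q = 0 /\ exists m', J m' /\ m = f q + md m'.

Variables (Y Y0 : set T) (phi : T -> M).
Hypothesis hY : is_tensor Y aT.
Hypothesis hY0 : submod Y0.
Hypothesis Y0Y : Y0 `<=` Y.
Hypothesis phil : linear phi.
Hypothesis phia : forall a x, phi (aT a x) = act a (phi x).
Hypothesis phid : forall x, phi (dT x) = md (phi x).
Hypothesis phiJ : forall y, Y0 y -> J (phi y).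
Hypothesis Yclosed : forall S : set T, submod S -> S `<=` Y0 ->
  (forall y, Y0 y -> lspan [set x | exists a v, S v /\ x = aT a v] (dT y) -> S y) ->
  Y0 `<=` S.

Let X : lmodType k := (Q * M)%type.
Implicit Types G : set (T * X)%type.

(* G is the graph of a pair of a partial lift and a partial homotopy, defined
   on a subspace of Y0; hull G is the graph of their extensions to A (x) Y0,
   which are A-linear up to signs. *)
Let hull G : set (T * X)%type := lspan [set p | exists a y q m,
  G (y, (q, m)) /\ p = (aT a y, (act a q, act (eps a) m))].

Let hull_sub G : submod (hull G). Proof. exact: lspan_submod. Qed.

Let hull_gen G a y q m : G (y, (q, m)) -> hull G (aT a y, (act a q, act (eps a) m)).
Proof. by move=> h; apply: lspan_gen; exists a, y, q, m. Qed.

Let hull_act G b x q m : hull G (x, (q, m)) ->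
  hull G (aT b x, (act b q, act (eps b) m)).
Proof.
pose h (p : (T * X)%type) : (T * X)%type := (aT b p.1, (act b p.2.1, act (eps b) p.2.2)).
have hl : linear h.
  by move=> c [x1 [q1 m1]] [x2 [q2 m2]]; rewrite /h /= aTr !act_linearr.
suff H : forall p, hull G p -> hull G (h p) by move=> /H.
apply: (lspan_lin hl) => // _ [a [y [q1 [m1 [Gy ->]]]]].
by rewrite /h /= -aTM -!actM -epsM; apply: hull_gen.
Qed.

Let hull_mono G G' : G `<=` G' -> hull G `<=` hull G'.
Proof.
move=> h; apply: lspan_sub => _ [a [y [q [m [Gy ->]]]]]; apply: hull_gen.
exact: h.
Qed.

Let good G : Prop := [/\ submod G, forall p, G p -> Y0 p.1, single_valued G &
  forall y q m, G (y, (q, m)) -> J m /\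
    exists m', hull G (dT y, (md q, m')) /\ phi y - f q = md m + m'].

Let hull_single G : good G -> single_valued (hull G).
Proof.
move=> [hG GY sG _] v hv.
have [g [hg gG]] := linear_extension hG sG.
pose f' (a : A) (y : T) : X := (act a (g y).1, act (eps a) (g y).2).
have l1 y : Y y -> linear (f' ^~ y).
  by move=> _ c a b; rewrite /f' eps_linear !act_linearl.
have l2 a : linear_on Y (f' a).
  by move=> c y z _ _; rewrite /f' hg /= !act_linearr.
have [F [FE _]] := hY l1 l2.
suff H : forall p, hull G p -> p.2 = F p.1 by rewrite -[v]/((0 : T, v).2) (H _ hv) /= linear0.
apply: lspan_min => [|_ [a [y [q [m [Gy ->]]]]] /=]; last first.
  by rewrite FE ?/f' ?(gG _ _ Gy) //; apply: Y0Y; apply: (GY _ Gy).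
split=> [|c [x1 w1] [x2 w2] /= -> ->]; first exact: (esym (linear0 F)).
by rewrite linearP.
Qed.

Let hull_d G : good G -> forall x q m, hull G (x, (q, m)) ->
  J m /\ exists m', hull G (dT x, (md q, m')) /\ phi x - f q = md m + m'.
Proof.
move=> [hG GY sG Gd] x q m hx.
suff H : hull G `<=` [set p | J p.2.2 /\ exists m', hull G (dT p.1, (md p.2.1, m')) /\
    phi p.1 - f p.2.1 = md p.2.2 + m'] by apply: (H _ hx).
apply: lspan_min => {x q m hx} [|_ [a [y [q [m [Gy ->]]]]] /=].
  split=> /=.
    split; first by case: hJ.
    exists 0; rewrite (lin0 dTl) (lin0 phil) (lin0 fl) !(lin0 (@md_linear _ _ _)).
    by split; [case: (hull_sub G)|rewrite subr0 addr0].
  move=> c [x1 [q1 m1]] [x2 [q2 m2]] /= [J1 [n1 [h1 e1]]] [J2 [n2 [h2 e2]]].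
  split; first by case: hJ => _; apply.
  exists (c *: n1 + n2); split.
    rewrite dTl !md_linear.
    exact: (proj2 (hull_sub G) c _ _ h1 h2).
  rewrite phil fl md_linear addrACA -scalerDr -e1 -e2.
  by rewrite scalerBr opprD addrACA.
have [Jm [m' [hm' e]]] := Gd _ _ _ Gy.
split; first exact: Ja.
exists (act (eps (ad a)) m + act a m'); split.
  rewrite dTa md_actE; have := submodD (hull_sub G) (hull_gen (ad a) Gy) (hull_act (eps a) hm').
  by rewrite eps_eps.
rewrite phia fa -(linB _ _ (act_linearr a)) e (linD _ _ (act_linearr a)) md_actE.
by rewrite eps_eps ad_eps (linN _ (act_linearl m)) addrACA addNr add0r.
Qed.

Let extend G y0 : good G -> Y0 y0 ->
    lspan [set x | exists a v, (exists w, G (v, w)) /\ x = aT a v] (dT y0) ->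
  ~ (exists w, G (y0, w)) ->
  exists q0 m0, good [set p | exists c : k, G (p.1 - c *: y0, p.2 - c *: (q0, m0))].
Proof.
move=> gG Yy0 hy0 ny0; have [hG GY sG Gd] := gG.
have [q' [m' hqm]] : exists q' m', hull G (dT y0, (q', m')).
  suff H : forall x, lspan [set x | exists a v, (exists w, G (v, w)) /\ x = aT a v] x ->
    exists w, hull G (x, w) by have [[q' m'] h] := H _ hy0; exists q', m'.
  apply: lspan_min.
    split=> [|c x1 x2 [w1 h1] [w2 h2]]; first by exists 0; case: (hull_sub G).
    by exists (c *: w1 + w2); apply: (proj2 (hull_sub G) c _ _ h1 h2).
  by move=> _ [a [v [[[q m] h] ->]]]; exists (act a q, act (eps a) m); apply: hull_gen.
have [Jm' [n' [hn' en']]] := hull_d gG hqm.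
have [e1 e2] : md q' = 0 /\ n' = 0.
  by rewrite dTdT in hn'; have := hull_single gG hn'; case.
rewrite e2 addr0 phid in en'.
(* The lift of y0 is q1 + q2: first q1 makes the lift compatible with the
   differentials, then q2 corrects the class of phi y0 - m' - f q1. *)
have [|q1 eq1] := finj e1.
  exists (phi y0 - m'); split; first by apply: (submodB hJ) => //; apply: phiJ.
  rewrite (linB _ _ (@md_linear _ _ _)) -en'.
  by rewrite opprB addrC subrK.
have Jc : J (phi y0 - m' - f q1).
  by apply: (submodB hJ) => //; apply: (submodB hJ) => //; apply: phiJ.
have dc : md (phi y0 - m' - f q1) = 0.
  rewrite !(linB _ _ (@md_linear _ _ _)) -fd -eq1 -en'.
  by rewrite opprB addrCA subrr addr0 subrr.
have [q2 [dq2 [m0 [Jm0 em0]]]] := fsurj Jc dc.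
exists (q1 + q2), m0.
set G' := [set p | _].
have GG' : G `<=` G' by move=> [y w] h; exists 0; rewrite !scale0r !subr0.
have hG' : submod G' by exact: adjoin_submod.
split=> //.
- move=> [y w] /= [c /GY] /= h.
  by have := submodD hY0 h (submodZ c hY0 Yy0); rewrite subrK.
- exact: adjoin_single_valued.
move=> y q m [c h].
have [/= Jm [n [hn en]]] := Gd _ _ _ h.
split.
  by have := submodD hJ Jm (submodZ c hJ Jm0); rewrite subrK.
have e0 : phi y0 - f (q1 + q2) = md m0 + m'.
  apply: (addIr (- m')); rewrite addrK (linD _ _ fl) opprD addrAC !addrA em0.
  by rewrite addrAC subrr add0r.
have dq : md (q1 + q2) = q' by rewrite (linD _ _ (@md_linear _ _ _)) dq2 addr0 -eq1.
exists (n + c *: m'); split.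
  apply: (hull_mono GG').
  have := submodD (hull_sub G) hn (submodZ c (hull_sub G) hqm).
  rewrite -[_ + _ *: _]/(dT (y - c *: y0) + c *: dT y0,
    (md (q - c *: (q1 + q2)) + c *: q', n + c *: m')).
  rewrite (linB _ _ dTl) (linZ _ _ dTl) subrK.
  by rewrite (linB _ _ (@md_linear _ _ _)) (linZ _ _ (@md_linear _ _ _)) dq subrK.
rewrite -[y in LHS](subrK (c *: y0)) -[q in LHS](subrK (c *: (q1 + q2))).
rewrite (linD _ _ phil) (linD _ _ fl) opprD addrACA.
rewrite [X in X + _]en (linZ _ _ phil) (linZ _ _ fl) -scalerBr e0.
rewrite scalerDr addrACA -(linZ _ _ (@md_linear _ _ _)) -(linD _ _ (@md_linear _ _ _)).
by rewrite subrK.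
Qed.

(** The lift and the homotopy are built on larger and larger subspaces of Y0;
    they extend to any y in Y0 whose differential lies where they are defined
    already. Since the lift is A-linear, it maps combinations with
    coefficients in I to such combinations. *)
Lemma lift_cocycle (I : set A) (t : T) :
    lspan [set x | exists a y, [/\ I a, Y0 y & x = aT a y]] t -> dT t = 0 ->
  exists q m, [/\ lspan [set x | exists a q', I a /\ x = act a q'] q,
    md q = 0, J m & phi t - f q = md m].
Proof.
move=> ht dt.
have g0 : good [set 0].
  split; first exact: submod_zero.
  - by move=> _ -> /=; case: hY0.
  - by move=> v [].
  - move=> y q m [-> -> ->]; split; first by case: hJ.
    exists 0; rewrite (lin0 dTl) (lin0 phil) (lin0 fl) !(lin0 (@md_linear _ _ _)).
    by split; [case: (hull_sub [set 0])|rewrite subr0 addr0].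
have [|G [gG maxG]] := zorn_nonempty g0.
  move=> C hC [G0 CG0] tC; split.
  - by apply: submod_bigcup_chain => //; [move=> G /hC []|exists G0].
  - by move=> p [G /hC [_ GY _ _]]; apply: GY.
  - by move=> v [G /hC [_ _ sG _]]; apply: sG.
  - move=> y q m [G CG Gy]; have [_ _ _ /(_ _ _ _ Gy) [Jm [m' [h e]]]] := hC _ CG.
    split=> //; exists m'; split=> //; apply: hull_mono h => p Gp; by exists G.
have [hG GY sG Gd] := gG.
have dom : Y0 `<=` [set y | exists w, G (y, w)].
  apply: Yclosed.
  - split=> [|c y z [w h] [w' h']]; first by exists 0; case: hG.
    by exists (c *: w + w'); apply: (proj2 hG c _ _ h h').
  - by move=> y [w /GY].
  - move=> y0 Yy0 hy0; apply: contrapT => ny0.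
    have [q0 [m0 g']] := extend gG Yy0 hy0 ny0.
    have : [set p : (T * X)%type | exists c : k, G (p.1 - c *: y0, p.2 - c *: (q0, m0))] `<=` G.
      by apply: maxG => // -[y w] h; exists 0; rewrite !scale0r !subr0.
    move=> /(_ (y0, (q0, m0))) h; apply: ny0; exists (q0, m0); apply: h.
    by exists 1; rewrite /= !scale1r !subrr; case: hG.
have [q [m [hq hm]]] : exists q m, lspan [set x | exists a q', I a /\ x = act a q'] q /\
    hull G (t, (q, m)).
  pose H := [set x | exists q m, lspan [set x | exists a q', I a /\ x = act a q'] q /\
    hull G (x, (q, m))].
  suff : lspan [set x | exists a y, [/\ I a, Y0 y & x = aT a y]] `<=` H by move=> /(_ t ht).
  have hL := lspan_submod [set x : Q | exists a q', I a /\ x = act a q'].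
  apply: lspan_min.
    split; first by exists 0, 0; split; [case: hL|case: (hull_sub G)].
    move=> c x1 x2 [q1 [m1 [h1 h1']]] [q2 [m2 [h2 h2']]].
    exists (c *: q1 + q2), (c *: m1 + m2); split; first by case: hL => _; apply.
    exact: (proj2 (hull_sub G) c _ _ h1' h2').
  move=> _ [a [y [Ia /dom [[q m] Gy] ->]]].
  exists (act a q), (act (eps a) m); split; last exact: hull_gen.
  by apply: lspan_gen; exists a, q.
have [Jm [m' [hm' e]]] := hull_d gG hm.
rewrite dt in hm'; have [e1 e2] := hull_single gG hm'.
by exists q, m; split=> //; rewrite e e2 addr0.
Qed.

End Lifting.

(** * Graded commutators *)

(** Left letters act on L, right letters on the module; the odd letters are
    the Koszul variables that kill the differences between the former. *)
Inductive letter := LL of nat | RR of nat | SS of nat.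

Definition letter_idx x := match x with LL j => j | RR j => j | SS j => j end.
Definition letter_lr x := if x is SS _ then false else true.

Section SuperAlgebra.
Variables (k : fieldType) (E : algType k) (ep : E).
Hypothesis epep : ep * ep = 1.

(** The involution ep represents the grading of E: an element x is even or odd
    according to whether ep x ep is x or - x. *)
Definition tau (x : E) : E := ep * x * ep.
Definition twist (b : bool) (x : E) : E := if b then tau x else x.
(** The graded commutator with an odd element D; that with an even element is
    the usual one. *)
Definition ad_odd (D x : E) : E := D * x - tau x * D.
Definition ad_even (D x : E) : E := D * x - x * D.

Lemma tau_linear : linear tau.
Proof. by move=> a x y; rewrite /tau mulrDr mulrDl -scalerAr -scalerAl. Qed.

Lemma twist_linear b : linear (twist b).
Proof. by case: b => //; apply: tau_linear. Qed.

Lemma tauM x y : tau (x * y) = tau x * tau y.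
Proof. by rewrite /tau !mulrA -(mulrA (ep * x) ep ep) epep mulr1. Qed.

Lemma tau1 : tau 1 = 1. Proof. by rewrite /tau mulr1. Qed.

Lemma tau_tau x : tau (tau x) = x.
Proof. by rewrite /tau !mulrA epep mul1r -mulrA epep mulr1. Qed.

Lemma twistM b x y : twist b (x * y) = twist b x * twist b y.
Proof. by case: b => //=; apply: tauM. Qed.

Lemma twist_sign b (c : bool) x : tau x = (-1) ^+ c *: x -> twist b x = (-1) ^+ (b && c) *: x.
Proof. by case: b => //= _; rewrite scale1r. Qed.

Lemma twist_tau b x : twist b (twist (~~ b) x) = tau x.
Proof. by case: b. Qed.

Lemma mul_linear_l (y : E) : linear (fun x => x * y).
Proof. by move=> a x z; rewrite mulrDl scalerAl. Qed.

Lemma mul_linear_r (x : E) : linear (fun y => x * y).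
Proof. by move=> a y z; rewrite mulrDr scalerAr. Qed.

Lemma ad_odd_linear D : linear (ad_odd D).
Proof.
move=> a x y; rewrite /ad_odd tau_linear mulrDr mulrDl -scalerAr -scalerAl.
by rewrite scalerBr opprD addrACA.
Qed.

Lemma ad_odd_linearl x : linear (ad_odd ^~ x).
Proof.
move=> a D D'; rewrite /ad_odd mulrDr mulrDl -scalerAr -scalerAl.
by rewrite scalerBr opprD addrACA.
Qed.

Lemma ad_even_linear D : linear (ad_even D).
Proof.
move=> a x y; rewrite /ad_even mulrDr mulrDl -scalerAr -scalerAl.
by rewrite scalerBr opprD addrACA.
Qed.

Lemma ad_oddM D x y : ad_odd D (x * y) = ad_odd D x * y + tau x * ad_odd D y.
Proof.
by rewrite /ad_odd tauM mulrBl mulrBr !mulrA [RHS]addrA subrK.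
Qed.

Lemma ad_evenM D x y : ad_even D (x * y) = ad_even D x * y + x * ad_even D y.
Proof. by rewrite /ad_even mulrBl mulrBr !mulrA [RHS]addrA subrK. Qed.

Lemma ad_odd1 D : ad_odd D 1 = 0.
Proof. by rewrite /ad_odd tau1 mulr1 mul1r subrr. Qed.

Lemma tau_ad_odd D x : tau D = - D -> tau (ad_odd D x) = - ad_odd D (tau x).
Proof.
move=> hD; rewrite /ad_odd (linB _ _ tau_linear) (tauM D) (tauM (tau x)) tau_tau hD.
by rewrite mulNr mulrN opprB opprK addrC.
Qed.

(** The graded Jacobi identity, for two odd elements. *)
Lemma ad_odd_odd d g x : tau d = - d -> tau g = - g ->
  ad_even (d * g + g * d) x = ad_odd d (ad_odd g x) + ad_odd g (ad_odd d x).
Proof.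
move=> hd hg.
have aux a b : tau b = - b ->
    ad_odd a (ad_odd b x) = a * b * x - a * tau x * b + b * tau x * a - x * b * a.
  move=> hb; rewrite -[ad_odd a _]/(a * ad_odd b x - tau (ad_odd b x) * a).
  rewrite tau_ad_odd // /ad_odd tau_tau mulrBr mulNr opprK.
  by rewrite mulrBl !mulrA addrA.
rewrite (aux d g) // (aux g d) // /ad_even; move: (tau x) => y.
rewrite mulrDl mulrDr !mulrA opprD.
set dgx := d * g * x; set gdx := g * d * x; set xdg := x * d * g; set xgd := x * g * d.
set p := d * y * g; set q := g * y * d.
have -> : dgx - p + q - xgd + (gdx - q + p - xdg) =
    (dgx + gdx + (- xdg - xgd)) + ((p - p) + (q - q)).
  by rewrite [LHS](AC (4*4) (1*5*8*4*(7*2)*(3*6)))/= !addrA.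
by rewrite !subrr !addr0.
Qed.

Lemma ad_odd_sq g x : tau g = - g -> g * g = 0 -> ad_odd g (ad_odd g x) = 0.
Proof.
move=> hg gg; rewrite -[LHS]/(g * ad_odd g x - tau (ad_odd g x) * g).
rewrite tau_ad_odd // /ad_odd tau_tau; move: (tau x) => y; rewrite mulrBr mulNr opprK.
by rewrite mulrBl !mulrA gg mul0r sub0r -(mulrA x) gg mulr0 subr0 addNr.
Qed.

Lemma ad_even_odd_comm d t x : tau t = t -> d * t = t * d ->
  ad_odd d (ad_even t x) = ad_even t (ad_odd d x).
Proof.
move=> ht hdt; rewrite /ad_odd /ad_even (linB _ _ tau_linear) (tauM t) (tauM x) ht.
move: (tau x) => y.
rewrite !mulrBr !mulrBl !mulrA hdt -!mulrA hdt !mulrA.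
by rewrite !opprB addrACA [RHS]addrACA; congr (_ + _); rewrite addrC.
Qed.

End SuperAlgebra.

(** * Words in the letters *)

Section Words.
Opaque tau.
Variables (k : fieldType) (E : algType k) (ep : E).
Hypothesis epep : ep * ep = 1.
Notation tau := (tau ep).
Notation twist := (twist ep).
Notation ad_odd := (ad_odd ep).
Let ltau := tau_linear ep.
Let lad := ad_odd_linear ep.

Variables (l r sig : nat -> E) (e : nat -> bool).

Definition letter_op x := match x with LL j => l j | RR j => r j | SS j => sig j end.
Definition letter_parity x := match x with LL j => e j | RR j => e j | SS j => ~~ e j end.

Hypothesis lop_comm : forall x y,
  letter_op x * letter_op y = (-1) ^+ (letter_parity x && letter_parity y) *: (letter_op y * letter_op x).
Hypothesis tau_lop : forall x, tau (letter_op x) = (-1) ^+ letter_parity x *: letter_op x.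

Definition word_op (w : seq letter) : E := \prod_(x <- w) letter_op x.
Definition wpar (w : seq letter) : bool := foldr (fun x b => letter_parity x (+) b) false w.

Implicit Types (P : pred letter) (X Y Z : E).

Definition words P : set E := lspan [set X | exists w, all P w /\ X = word_op w].
Definition words_lr P : set E :=
  lspan [set X | exists w, [/\ all P w, has letter_lr w & X = word_op w]].

Lemma W_submod P : submod (words P). Proof. exact: lspan_submod. Qed.
Lemma Wp_submod P : submod (words_lr P). Proof. exact: lspan_submod. Qed.
Hint Resolve W_submod Wp_submod : core.

Lemma W_gen P w : all P w -> words P (word_op w).
Proof. by move=> h; apply: lspan_gen; exists w. Qed.

Lemma Wp_gen P w : all P w -> has letter_lr w -> words_lr P (word_op w).
Proof. by move=> h h'; apply: lspan_gen; exists w. Qed.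

Lemma wop1 x : word_op [:: x] = letter_op x. Proof. by rewrite /word_op big_seq1. Qed.
Lemma wop_cons x w : word_op (x :: w) = letter_op x * word_op w. Proof. by rewrite /word_op big_cons. Qed.
Lemma wop_cat w w' : word_op (w ++ w') = word_op w * word_op w'. Proof. by rewrite /word_op big_cat. Qed.

Lemma W_lop P x : P x -> words P (letter_op x).
Proof. by move=> h; rewrite -wop1; apply: W_gen; rewrite /= h. Qed.

Lemma Wp_lop P x : P x -> letter_lr x -> words_lr P (letter_op x).
Proof. by move=> h h'; rewrite -wop1; apply: Wp_gen; rewrite /= ?h ?h'. Qed.

Lemma W1 P : words P 1.
Proof. by have := @W_gen P [::] isT; rewrite /word_op big_nil. Qed.

Lemma W_mono P P' : (forall x, P x -> P' x) -> words P `<=` words P'.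
Proof.
by move=> h; apply: lspan_sub => _ [w [hw ->]]; apply: W_gen; apply: sub_all hw.
Qed.

Lemma Wp_mono P P' : (forall x, P x -> P' x) -> words_lr P `<=` words_lr P'.
Proof.
move=> h; apply: lspan_sub => _ [w [hw hw' ->]]; apply: Wp_gen => //.
by apply: sub_all hw.
Qed.

Lemma Wp_W P : words_lr P `<=` words P.
Proof. by apply: lspan_sub => _ [w [hw _ ->]]; apply: W_gen. Qed.

Lemma W_mul P X Y : words P X -> words P Y -> words P (X * Y).
Proof.
apply: lspan_bilin => [y|x||_ _ [w [hw ->]] [w' [hw' ->]]] //.
- exact: mul_linear_l.
- exact: mul_linear_r.
by rewrite -wop_cat; apply: W_gen; rewrite all_cat hw.
Qed.

Lemma Wp_mull P X Y : words_lr P X -> words P Y -> words_lr P (X * Y).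
Proof.
apply: lspan_bilin => [y|x||_ _ [w [hw h ->]] [w' [hw' ->]]] //.
- exact: mul_linear_l.
- exact: mul_linear_r.
by rewrite -wop_cat; apply: Wp_gen; rewrite ?all_cat ?has_cat ?hw ?h.
Qed.

Lemma Wp_mulr P X Y : words P X -> words_lr P Y -> words_lr P (X * Y).
Proof.
apply: lspan_bilin => [y|x||_ _ [w [hw ->]] [w' [hw' h ->]]] //.
- exact: mul_linear_l.
- exact: mul_linear_r.
by rewrite -wop_cat; apply: Wp_gen; rewrite ?all_cat ?has_cat ?hw ?h ?orbT.
Qed.

Lemma tau_wop w : tau (word_op w) = (-1) ^+ wpar w *: word_op w.
Proof.
elim: w => [|x w IH]; first by rewrite /word_op big_nil tau1 // scale1r.
by rewrite wop_cons tauM // IH tau_lop -scalerAl -scalerAr scalerA signr_addb.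
Qed.

Lemma W_tau P X : words P X -> words P (tau X).
Proof.
apply: lspan_lin => [||_ [w [hw ->]]] //; rewrite tau_wop.
by apply: (submodZ _ (W_submod P)); apply: W_gen.
Qed.

Lemma Wp_tau P X : words_lr P X -> words_lr P (tau X).
Proof.
apply: lspan_lin => [||_ [w [hw h ->]]] //; rewrite tau_wop.
by apply: (submodZ _ (Wp_submod P)); apply: Wp_gen.
Qed.

Lemma W_twist P b X : words P X -> words P (twist b X).
Proof. by case: b => //; apply: W_tau. Qed.

Lemma supercomm_W P (B : E) b :
    (forall x, P x -> B * letter_op x = (-1) ^+ (b && letter_parity x) *: (letter_op x * B)) ->
  forall X, words P X -> B * X = twist b X * B.
Proof.
move=> hB; suff H : words P `<=` [set X | B * X = twist b X * B] by move=> X /H.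
apply: lspan_min.
  apply: submod_eq_lin => a x y; first by rewrite mulrDr -scalerAr.
  by rewrite twist_linear mulrDl -scalerAl.
move=> _ [w [hw ->]] /=; elim: w hw => [_|x w IH /= /andP[hx hw]].
  by rewrite /word_op big_nil mulr1 (_ : twist b 1 = 1) ?mul1r //; case: b hB => //= _; exact: (tau1 epep).
rewrite wop_cons mulrA hB // -scalerAl -mulrA IH // twistM // !mulrA.
by rewrite (twist_sign b (tau_lop x)) -!scalerAl.
Qed.

Lemma wop_comm P w X : words P X -> word_op w * X = twist (wpar w) X * word_op w.
Proof.
move=> hX; elim: w => [|x w IH]; first by rewrite /word_op big_nil mulr1 mul1r.
have h := @supercomm_W P (letter_op x) (letter_parity x) (fun y _ => lop_comm x y) _ (W_twist (wpar w) hX).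
have T b c Y : twist b (twist c Y) = twist (b (+) c) Y.
  by case: b; case: c => //; exact: (tau_tau epep).
by rewrite wop_cons -mulrA IH mulrA h -mulrA T.
Qed.

Hypothesis char0 : [pchar k] =i pred0.

Let two_neq0 : (2%:R : k) != 0.
Proof. by have /pcharf0P -> := char0. Qed.

Lemma add_self_eq0 X : X + X = 0 -> X = 0.
Proof.
move=> h; have : 2%:R *: X = 0 by rewrite scaler_nat mulr2n.
by move/eqP; rewrite scaler_eq0 (negPf two_neq0) => /eqP.
Qed.

(** X is a combination of words of both parities, but 2 X = X + (-1)^b tau X
    involves only those of parity b. *)
Lemma W_supercomm P P' (b : bool) X Z : words P X -> words P' Z -> tau X = (-1) ^+ b *: X ->
  X * Z = twist b Z * X.
Proof.
move=> hX hZ hb.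
suff h : (X + (-1) ^+ b *: tau X) * Z = twist b Z * (X + (-1) ^+ b *: tau X).
  rewrite hb scalerA -signr_addb addbb scale1r mulrDl mulrDr in h.
  apply/eqP; rewrite -subr_eq0; apply/eqP; apply: add_self_eq0.
  by rewrite addrACA -opprD h subrr.
have lb : linear (fun X => X + (-1) ^+ b *: tau X).
  by move=> a x y; rewrite ltau scalerDr scalerDr !scalerA (mulrC a) addrACA.
suff H : words P `<=` [set X | (X + (-1) ^+ b *: tau X) * Z = twist b Z * (X + (-1) ^+ b *: tau X)].
  exact: H.
apply: lspan_min.
  apply: submod_eq_lin => a x y; first by rewrite lb mulrDl -scalerAl.
  by rewrite lb mulrDr -scalerAr.
move=> _ [w [hw ->]] /=; rewrite tau_wop scalerA -signr_addb.
rewrite mulrDl mulrDr -scalerAl -scalerAr (wop_comm _ hZ).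
case: {lb hb} b (wpar w) => -[] //=; rewrite ?expr0 ?expr1 ?scale1r ?scaleN1r //.
  by rewrite !subrr.
by rewrite !subrr.
Qed.

Lemma W_odd_sq P X : words P X -> tau X = - X -> X * X = 0.
Proof.
move=> hX hb; apply: add_self_eq0.
have := W_supercomm (b := true) hX hX; rewrite expr1 scaleN1r => /(_ hb) /= h.
by rewrite {1}h hb mulNr addNr.
Qed.

Lemma ad_odd_W P P' D : (forall x, P x -> P' x) ->
  (forall x, P x -> words P' (ad_odd D (letter_op x))) ->
  forall X, words P X -> words P' (ad_odd D X).
Proof.
move=> PP' hD X; apply: lspan_lin => [||_ [w [hw ->]]] //.
elim: w hw => [_|x w IH /= /andP[hx hw]].
  by rewrite /word_op big_nil ad_odd1 //; case: (W_submod P').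
rewrite wop_cons ad_oddM //; apply: (submodD (W_submod _)); apply: W_mul.
- exact: hD.
- by apply: W_gen; apply: sub_all hw.
- by rewrite tau_lop; apply: (submodZ _ (W_submod P')); apply: W_lop; apply: PP'.
- exact: IH.
Qed.

Lemma ad_even_W P D : (forall x, P x -> words P (ad_even D (letter_op x))) ->
  forall X, words P X -> words P (ad_even D X).
Proof.
move=> hD X; apply: lspan_lin => [||_ [w [hw ->]]] //; first exact: ad_even_linear.
elim: w hw => [_|x w IH /= /andP[hx hw]].
  by rewrite /word_op big_nil /ad_even mulr1 mul1r subrr; case: (W_submod P).
rewrite wop_cons ad_evenM; apply: (submodD (W_submod _)); apply: W_mul.
- exact: hD.
- exact: W_gen.
- exact: W_lop.
- exact: IH.
Qed.

Lemma ad_even_Wp P D : (forall x, P x -> words P (ad_even D (letter_op x))) ->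
    (forall x, P x -> letter_lr x -> words_lr P (ad_even D (letter_op x))) ->
  forall X, words_lr P X -> words_lr P (ad_even D X).
Proof.
move=> hD hDp X; apply: lspan_lin => [||_ [w [hw h ->]]] //; first exact: ad_even_linear.
elim: w hw h => [//|x w IH /= /andP[hx hw] /orP hxw].
rewrite wop_cons ad_evenM; apply: (submodD (Wp_submod P)).
  case: hxw => hxw; first by apply: Wp_mull; [exact: hDp|exact: W_gen].
  by apply: Wp_mulr; [exact: hD|exact: Wp_gen].
case: hxw => hxw; last by apply: Wp_mulr; [exact: W_lop|exact: IH].
apply: Wp_mull; first exact: Wp_lop.
by apply: ad_even_W => //; apply: W_gen.
Qed.

End Words.

(** * The perturbed Koszul differential *)

Definition below (i : nat) : pred letter := fun x => (letter_idx x < i)%N.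

Definition sig_below (j : nat) : pred letter :=
  fun x => if x is SS a then (a < j)%N else true.

(** A differential is encoded by a list of coefficients and words, which can
    be evaluated at the left letters as well as at the right letters. *)
Definition evalw (k : fieldType) (E : algType k) (f : nat -> E)
    (D : seq (k * seq nat)) : E :=
  \sum_(p <- D) p.1 *: \prod_(a <- p.2) f a.

Definition words_below (k : fieldType) (j : nat) (D : seq (k * seq nat)) : bool :=
  all (fun p => (p.2 != [::]) && all (fun a => a < j)%N p.2) D.

Section Perturbation.
Opaque tau.
Variables (k : fieldType) (E : algType k) (ep : E).
Hypothesis epep : ep * ep = 1.
Hypothesis char0 : [pchar k] =i pred0.
Notation tau := (tau ep).
Notation twist := (twist ep).
Notation ad_odd := (ad_odd ep).
Let ltau := tau_linear ep.
Let lad := ad_odd_linear ep.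
Let lev := @ad_even_linear k E.

Variables (l r sig : nat -> E) (e : nat -> bool).
Notation lop := (letter_op l r sig).
Notation lpar := (letter_parity e).
Notation W := (words l r sig).
Notation Wp := (words_lr l r sig).
Hypothesis lop_comm : forall x y,
  lop x * lop y = (-1) ^+ (lpar x && lpar y) *: (lop y * lop x).
Hypothesis tau_lop : forall x, tau (lop x) = (-1) ^+ lpar x *: lop x.

(* gam is the contraction operator, d0 the differential of L (x) N (x) F
   without perturbation, dd j the derivative with respect to the j-th odd
   variable, and D j encodes the differential of the j-th letter. *)
Variables (gam d0 : E) (dd : nat -> E) (D : nat -> seq (k * seq nat)) (s : nat).
Hypothesis tau_gam : tau gam = - gam.
Hypothesis gam_sq : gam * gam = 0.
Hypothesis gam_l : forall j, ad_odd gam (l j) = 0.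
Hypothesis gam_r : forall j, ad_odd gam (r j) = sig j.
Hypothesis gam_sig : forall j, ad_odd gam (sig j) = 0.
Hypothesis tau_d0 : tau d0 = - d0.
Hypothesis d0_sq : d0 * d0 = 0.
Hypothesis d0_l : forall j, ad_odd d0 (l j) = evalw l (D j).
Hypothesis d0_r : forall j, ad_odd d0 (r j) = evalw r (D j).
Hypothesis d0_sig : forall j, ad_odd d0 (sig j) = 0.
Hypothesis d0_dd : forall j, ad_odd d0 (dd j) = 0.
Hypothesis hD : forall j, words_below j (D j).
Hypothesis tau_dd : forall j, tau (dd j) = (-1) ^+ (~~ e j) *: dd j.
Hypothesis dd_lop : forall j x, (if x is SS i then i != j else true) ->
  dd j * lop x = (-1) ^+ (~~ e j && lpar x) *: (lop x * dd j).
Hypothesis dd_sig : forall j, (j < s)%N ->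
  dd j * sig j = 1 + (-1) ^+ (~~ e j) *: (sig j * dd j).
Hypothesis dd_dd : forall i j,
  dd i * dd j = (-1) ^+ (~~ e i && ~~ e j) *: (dd j * dd i).

Let hW P : submod (W P). Proof. exact: W_submod. Qed.
Let hWp P : submod (Wp P). Proof. exact: Wp_submod. Qed.
#[local] Hint Resolve hW hWp : core.

Let zset : submod [set (0 : E)]. Proof. exact: submod_zero. Qed.

Lemma evalw_Wp (P : pred letter) (c : nat -> letter) j : (forall a, (a < j)%N -> P (c a)) ->
  (forall a, letter_lr (c a)) -> Wp P (evalw (fun a => lop (c a)) (D j)).
Proof.
move=> hP hc; rewrite /evalw big_seq; apply: submod_big => // p pD.
apply: (submodZ _ (hWp P)); have /allP/(_ p pD)/andP[] := hD j.
case: p.2 => // a w _ /= /andP[ha hw]; rewrite big_cons.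
apply: Wp_mull; first by apply: Wp_lop => //; apply: hP.
elim: w hw => [_|b w IH /= /andP[hb hw]]; first by rewrite big_nil; apply: W1.
by rewrite big_cons; apply: W_mul; [apply: W_lop; exact: hP|exact: IH].
Qed.

Let gam_lop x : ad_odd gam (lop x) = if x is RR j then sig j else 0.
Proof. by case: x => j /=. Qed.

Lemma gam_W i X : W (below i) X -> W (below i) (ad_odd gam X).
Proof.
apply: ad_odd_W => // x hx; rewrite gam_lop; case: x hx => j hj; try by case: (hW (below i)).
by apply: (W_lop (x := SS j)).
Qed.

(* At stage i, the differential d0 has been perturbed in the variables of
   index < i. *)
Section Stage.
Variables (i : nat) (om Yv : nat -> E).
Hypothesis i_le : (i <= s)%N.
Hypothesis YvW : forall j, (j < i)%N -> W (below j) (Yv j).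
Hypothesis tau_Yv : forall j, (j < i)%N -> tau (Yv j) = (-1) ^+ (~~ e j) *: Yv j.
Hypothesis omE : forall j, (j < i)%N -> om j = r j - l j - ad_odd gam (Yv j).

Variables d theta : E.
Hypothesis dE : d = d0 + \sum_(j < i) om j * dd j.
Hypothesis thetaE : theta = d * gam + gam * d.

Lemma om_W j : (j < i)%N -> W (below j.+1) (om j).
Proof.
move=> ji; rewrite omE //; apply: (submodB (hW _)); first apply: (submodB (hW _)).
- by apply: (W_lop (x := RR j)); rewrite /below /=.
- by apply: (W_lop (x := LL j)); rewrite /below /=.
apply: gam_W; apply: (@W_mono _ _ _ _ _ (below j)) (YvW ji) => x; rewrite /below => h; exact: ltnW.
Qed.

Lemma om_sig_below j : (j < i)%N -> W (sig_below j) (om j).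
Proof.
move=> ji; rewrite omE //; apply: (submodB (hW _)); first apply: (submodB (hW _)).
- by apply: (W_lop (x := RR j)).
- by apply: (W_lop (x := LL j)).
by apply: (@W_mono _ _ _ _ _ (below j)) (gam_W (YvW ji)) => -[].
Qed.

Lemma tau_om j : (j < i)%N -> tau (om j) = (-1) ^+ e j *: om j.
Proof.
move=> ji; rewrite omE // (linB _ _ ltau) (linB (r j) _ ltau) tau_ad_odd // tau_Yv //.
rewrite (linZ _ _ (lad _)) -[in tau (r j)]/(lop (RR j)) -[in tau (l j)]/(lop (LL j)).
rewrite !tau_lop /= (scalerBr _ (r j - l j)) (scalerBr _ (r j)); congr (_ - _).
by case: (e j); rewrite /= ?expr0 ?expr1 ?scale1r ?scaleN1r ?opprK.
Qed.

Let Bt j : E := om j * dd j.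

Lemma tau_Bt j : (j < i)%N -> tau (Bt j) = - Bt j.
Proof.
move=> ji; rewrite /Bt tauM // tau_om // tau_dd -scalerAl -scalerAr scalerA -signr_addb.
by case: (e j); rewrite /= expr1 scaleN1r.
Qed.

Lemma tau_d : tau d = - d.
Proof.
rewrite dE (linD _ _ ltau) tau_d0 opprD; congr (_ + _).
rewrite -sumrN; have : forall j : 'I_i, tau (om j * dd j) = - (om j * dd j).
  by move=> j; apply: tau_Bt.
move=> h; have -> : tau (\sum_(j < i) om j * dd j) = \sum_(j < i) tau (om j * dd j).
  by apply: (big_morph tau (fun x y => linD x y ltau) (lin0 ltau)).
exact: eq_bigr.
Qed.

Lemma dd_W j (P : pred letter) X : (forall x, P x -> if x is SS a then a != j else true) ->
  W P X -> dd j * X = twist (~~ e j) X * dd j.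
Proof.
move=> hP; apply: (supercomm_W epep tau_lop) => x /hP; exact: dd_lop.
Qed.

(** Both factors of om j * dd j supercommute with words that do not contain
    the j-th odd letter. *)
Lemma Bt_W j (P : pred letter) X : (j < i)%N -> (forall x, P x -> if x is SS a then a != j else true) ->
  W P X -> ad_odd (Bt j) X = 0.
Proof.
move=> ji hP hX; rewrite /ad_odd /Bt -mulrA (dd_W hP hX) mulrA.
have hZ : W P (twist (~~ e j) X) by apply: (W_twist epep tau_lop).
rewrite (W_supercomm epep lop_comm tau_lop char0 (om_W ji) hZ (tau_om ji)) twist_tau //.
by rewrite -mulrA subrr.
Qed.

Lemma sum_ad X : ad_odd d X = ad_odd d0 X + \sum_(j < i) ad_odd (om j * dd j) X.
Proof.
have hl := ad_odd_linearl ep X.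
rewrite dE (linD _ _ hl); congr (_ + _).
exact: (big_morph (ad_odd ^~ X) (fun x y => linD x y hl) (lin0 hl)).
Qed.

Lemma d_l j : ad_odd d (l j) = evalw l (D j).
Proof.
rewrite sum_ad d0_l big1 ?addr0 // => a _.
apply: (Bt_W (P := fun x => letter_lr x)) => //; first by case.
exact: (W_lop (x := LL j)).
Qed.

Lemma d_r j : ad_odd d (r j) = evalw r (D j).
Proof.
rewrite sum_ad d0_r big1 ?addr0 // => a _.
apply: (Bt_W (P := fun x => letter_lr x)) => //; first by case.
exact: (W_lop (x := RR j)).
Qed.

Let Bt_sig a j : (a < i)%N -> a != j -> ad_odd (Bt a) (sig j) = 0.
Proof.
move=> ai aj; apply: (Bt_W (P := fun x => if x is SS b then b == j else false)) => //.
  by case=> // b /eqP ->; rewrite eq_sym.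
by apply: (W_lop (x := SS j)) => /=.
Qed.

Lemma d_sig j : (j < i)%N -> ad_odd d (sig j) = om j.
Proof.
move=> ji; rewrite sum_ad d0_sig add0r (bigD1 (Ordinal ji)) //= big1 => [|a ha]; last first.
  by apply: Bt_sig => //; apply: contraNneq ha => aj; apply/eqP/val_inj.
rewrite addr0 /ad_odd /Bt -mulrA dd_sig ?(leq_trans ji) //.
rewrite mulrDr mulr1 -scalerAr -[sig j]/(lop (SS j)) tau_lop /= -scalerAl !mulrA.
have -> : lop (SS j) * om j = om j * lop (SS j).
  have hs : W predT (lop (SS j)) by apply: W_lop.
  rewrite (W_supercomm epep lop_comm tau_lop char0 (om_W ji) hs (tau_om ji)).
  rewrite (twist_sign (e j) (tau_lop (SS j))) /=; case: (e j); rewrite /= scale1r //.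
by rewrite addrK.
Qed.

Lemma gam_om j : (j < i)%N -> ad_odd gam (om j) = sig j.
Proof.
move=> ji; rewrite omE // (linB _ _ (lad _)) (linB (r j) _ (lad _)) gam_r gam_l subr0.
by rewrite ad_odd_sq // subr0.
Qed.

Lemma ad_theta X : ad_even theta X = ad_odd d (ad_odd gam X) + ad_odd gam (ad_odd d X).
Proof. by rewrite thetaE; apply: ad_odd_odd => //; apply: tau_d. Qed.

Lemma evalw_map (f : nat -> E) (Dj : seq (k * seq nat)) (T : E -> E) :
  linear T -> T (evalw f Dj) = \sum_(p <- Dj) p.1 *: T (\prod_(a <- p.2) f a).
Proof.
move=> hT; rewrite /evalw (big_morph T (fun x y => linD x y hT) (lin0 hT)).
by apply: eq_bigr => p _; rewrite (linZ _ _ hT).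
Qed.

Lemma gam_evalw_l j : ad_odd gam (evalw l (D j)) = 0.
Proof.
rewrite evalw_map // big1 // => p _.
suff -> : ad_odd gam (\prod_(a <- p.2) l a) = 0 by rewrite scaler0.
elim: p.2 => [|a w IH]; first by rewrite big_nil ad_odd1.
by rewrite big_cons ad_oddM // IH gam_l mul0r mulr0 addr0.
Qed.

Lemma theta_l j : ad_even theta (l j) = 0.
Proof. by rewrite ad_theta gam_l d_l gam_evalw_l (lin0 (lad _)) addr0. Qed.

Lemma theta_sig j : (j < i)%N -> ad_even theta (sig j) = sig j.
Proof. by move=> ji; rewrite ad_theta gam_sig d_sig // gam_om // (lin0 (lad _)) add0r. Qed.

Lemma theta_r j : ad_even theta (r j) = ad_odd d (sig j) + ad_odd gam (evalw r (D j)).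
Proof. by rewrite ad_theta gam_r d_r. Qed.

Lemma theta_r_lt j : (j < i)%N ->
  ad_even theta (r j) = om j + ad_odd gam (evalw r (D j)).
Proof. by move=> ji; rewrite theta_r d_sig. Qed.

Hypothesis d_sq : d * d = 0.
Hypothesis theta_rl : forall j, (j < i)%N -> eig (ad_even theta) true [set 0] (r j - l j).
Hypothesis theta_rp : forall j, (j < i)%N -> Wp (below j.+1) (ad_even theta (r j)).

Let lth := lev theta.

Lemma tau_theta : tau theta = theta.
Proof. by rewrite thetaE (linD _ _ ltau) !tauM // tau_d tau_gam !mulrNN. Qed.

Lemma d_theta : d * theta = theta * d.
Proof. by rewrite thetaE mulrDl mulrDr !mulrA d_sq mul0r add0r -!mulrA d_sq mulr0 addr0. Qed.

Lemma gam_theta : gam * theta = theta * gam.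
Proof. by rewrite thetaE mulrDl mulrDr !mulrA gam_sq mul0r addr0 -!mulrA gam_sq mulr0 add0r. Qed.

Let below_S j a : (j < a)%N -> forall x, below j.+1 x -> below a x.
Proof. by move=> ja x; rewrite /below => h; apply: leq_trans h ja. Qed.

Lemma theta_W_lop x : below i x -> W (below i) (ad_even theta (lop x)).
Proof.
case: x => j hj /=.
- by rewrite theta_l; case: (hW (below i)).
- by apply: (Wp_W (P := below i)); apply: (@Wp_mono _ _ _ _ _ (below j.+1)) (theta_rp hj); exact: below_S.
- by rewrite theta_sig //; apply: (W_lop (x := SS j)).
Qed.

Lemma theta_Wp_lop x : below i x -> letter_lr x -> Wp (below i) (ad_even theta (lop x)).
Proof.
case: x => j hj //= _.
- by rewrite theta_l; case: (hWp (below i)).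
- by apply: (@Wp_mono _ _ _ _ _ (below j.+1)) (theta_rp hj); exact: below_S.
Qed.

Lemma theta_W X : W (below i) X -> W (below i) (ad_even theta X).
Proof. by apply: ad_even_W; apply: theta_W_lop. Qed.

Lemma theta_Wp X : Wp (below i) X -> Wp (below i) (ad_even theta X).
Proof. by apply: ad_even_Wp; [exact: theta_W_lop|exact: theta_Wp_lop]. Qed.

Let hE b : submod (eig (ad_even theta) b [set 0]).
Proof. by apply: eig_submod => // x ->; rewrite /= lin0. Qed.

Lemma eig_lop x : below i x -> eig (ad_even theta) false [set 0] (lop x).
Proof.
have el j : eig (ad_even theta) false [set 0] (l j).
  by exists [:: 0%N] => //=; rewrite theta_l scale0r subr0.
case: x => j hj //=.
- rewrite -[r j](subrK (l j)); apply: (submodD (hE _)) => //.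
  exact/eig_weaken/theta_rl.
- by exists [:: 1%N] => //=; rewrite theta_sig // scale1r subrr.
Qed.

Lemma eig_mul b X Y : eig (ad_even theta) b [set 0] X ->
  eig (ad_even theta) false [set 0] Y -> eig (ad_even theta) b [set 0] (X * Y).
Proof.
apply: eig_bilinear => //; [exact: mul_linear_l|exact: mul_linear_r|exact: ad_evenM].
Qed.

Lemma eig_mul' X Y : eig (ad_even theta) false [set 0] X ->
  eig (ad_even theta) true [set 0] Y -> eig (ad_even theta) true [set 0] (X * Y).
Proof.
move=> hX hY; apply: (eig_bilinear (beta := fun x y => y * x) lth lth) hY hX => //.
- exact: mul_linear_r.
- exact: mul_linear_l.
- by move=> x y; rewrite ad_evenM addrC.
Qed.

Lemma eig_W X : W (below i) X -> eig (ad_even theta) false [set 0] X.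
Proof.
apply: lspan_min => // _ [w [hw ->]].
elim: w hw => [_|x w IH /= /andP[hx hw]].
  rewrite /word_op big_nil; exists [:: 0%N] => //=.
  by rewrite /ad_even mulr1 mul1r subrr scale0r subr0.
by rewrite wop_cons; apply: eig_mul; [exact: eig_lop|exact: IH].
Qed.

(* The obstruction to be killed at this stage. It is a combination of products
   that contain a difference r a - l a, so that theta has positive eigenvalues
   on it. *)
Let X0 := evalw r (D i) - evalw l (D i).

Lemma eig_X0 : eig (ad_even theta) true [set 0] X0.
Proof.
rewrite /X0 /evalw -sumrB big_seq; apply: submod_big => // p pD.
rewrite -scalerBr; apply: (submodZ _ (hE _)).
have /allP/(_ p pD)/andP[_] := hD i.
elim: p.2 => [_|a w IH /= /andP[ha hw]].
  by rewrite !big_nil subrr; case: (hE true).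
rewrite !big_cons.
have -> : r a * \prod_(b <- w) r b - l a * \prod_(b <- w) l b =
    (r a - l a) * \prod_(b <- w) r b + l a * (\prod_(b <- w) r b - \prod_(b <- w) l b).
  by rewrite mulrBl mulrBr addrA subrK.
apply: (submodD (hE _)).
  apply: eig_mul; first exact: theta_rl.
  apply: eig_W; elim: w hw {IH} => [_|b w IH /= /andP[hb hw]]; first by rewrite big_nil; apply: W1.
  by rewrite big_cons; apply: W_mul; [apply: (W_lop (x := RR b))|exact: IH].
by apply: eig_mul'; [apply: (@eig_lop (LL a))|exact: IH].
Qed.

(* The contribution of the words of length one to [gam, D_i(r)]. *)
Let sl := \sum_(p <- D i) if p.2 is [:: a] then p.1 *: sig a else 0.

Lemma theta_sl : ad_even theta sl = sl.
Proof.
rewrite /sl (big_morph _ (fun x y => linD x y lth) (lin0 lth)) big_seq [RHS]big_seq.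
apply: eq_bigr => p pD; have /allP/(_ p pD)/andP[_] := hD i.
case: p.2 => [|a [|b w]]; try by move=> _; apply: lin0.
by rewrite /= andbT => ha; rewrite (linZ _ _ lth) theta_sig.
Qed.

Lemma gam_evalw_r : Wp (below i) (ad_odd gam (evalw r (D i)) - sl).
Proof.
rewrite evalw_map // /sl -sumrB big_seq; apply: submod_big => // p pD.
have /allP/(_ p pD)/andP[] := hD i.
case: p {pD} => c [|a [|b w]] //= _.
  by move=> _; rewrite big_seq1 gam_r subrr; case: (hWp (below i)).
move=> /and3P[ha hb hw]; rewrite subr0; apply: (submodZ _ (hWp _)).
have hrw v : all (fun a => a < i)%N v -> W (below i) (\prod_(c <- v) r c).
  elim: v => [_|c' v IH /= /andP[hc hv]]; first by rewrite big_nil; apply: W1.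
  by rewrite big_cons; apply: W_mul; [apply: (W_lop (x := RR c'))|exact: IH].
have hbw : W (below i) (\prod_(c <- b :: w) r c) by apply: hrw; rewrite /= hb.
rewrite big_cons ad_oddM // gam_r; apply: (submodD (hWp _)).
  apply: Wp_mulr; first by apply: (W_lop (x := SS a)).
  rewrite big_cons; apply: Wp_mull; last exact: hrw.
  by apply: (Wp_lop (x := RR b)).
apply: Wp_mull; last exact: gam_W.
apply: (Wp_tau epep tau_lop).
by apply: (Wp_lop (x := RR a)).
Qed.

(** The inverse of theta stays in every theta-stable subspace that contains
    X0; S collects the properties of X0 that the solution Y of X0 = [theta, Y]
    has to inherit. The last of them controls [gam, Y] up to words which
    contain a left or a right letter. *)
Lemma stage_solve : exists Y, [/\ W (below i) Y, tau Y = (-1) ^+ (~~ e i) *: Y,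
  X0 = ad_even theta Y, ad_odd d Y = 0 & eig (ad_even theta) true [set 0] Y] /\
  Wp (below i) (ad_odd gam (evalw r (D i)) - ad_odd gam Y).
Proof.
pose S : set E := [set Y | [/\ Wp (below i) Y, tau Y = (-1) ^+ (~~ e i) *: Y,
  ad_odd d Y = 0, eig (ad_even theta) true [set 0] Y &
  exists c : k, Wp (below i) (ad_odd gam Y - c *: sl)]].
have tau_ad_r j x : ad_odd d (lop x) = j -> lpar x = e i ->
    tau j = (-1) ^+ (~~ e i) *: j.
  move=> <- ex; rewrite tau_ad_odd ?tau_d // tau_lop (linZ _ _ (lad _)) ex.
  by case: (e i); rewrite /= ?expr0 ?expr1 ?scale1r ?scaleN1r ?opprK.
have hS : submod S.
  split.
    split; try by [case: (hWp (below i))|case: (hE true)|rewrite lin0 ?scaler0].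
    by exists 0; rewrite scale0r subr0 (lin0 (lad _)); case: (hWp (below i)).
  move=> a x y [x1 x2 x3 x4 [c x5]] [y1 y2 y3 y4 [c' y5]]; split.
  - by case: (hWp (below i)) => _; apply.
  - by rewrite ltau x2 y2 scalerDr !scalerA mulrC.
  - by rewrite lad x3 y3 scaler0 addr0.
  - by case: (hE true) => _; apply.
  - exists (a * c + c'); have [_ /(_ a _ _ x5 y5)] := hWp (below i).
    by rewrite lad scalerBr scalerDl scalerA opprD addrACA.
have TS Y : S Y -> S (ad_even theta Y).
  move=> [y1 y2 y3 y4 [c y5]]; split.
  - exact: theta_Wp.
  - rewrite /ad_even (linB _ _ ltau) !tauM // tau_theta y2 -scalerAr -scalerAl.
    by rewrite scalerBr.
  - by rewrite ad_even_odd_comm ?tau_theta ?d_theta // y3 lin0.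
  - exact: (eig_map lth (fun _ => erefl) y4).
  - exists c; have := theta_Wp y5.
    rewrite (linB _ _ lth) (linZ _ _ lth) theta_sl ad_even_odd_comm ?tau_theta ?gam_theta //.
have SX : S X0.
  split.
  - apply: (submodB (hWp _)).
      by apply: (evalw_Wp (c := RR)).
    by apply: (evalw_Wp (c := LL)).
  - rewrite /X0 (linB _ _ ltau) scalerBr.
    rewrite (tau_ad_r _ (RR i)) //; last exact: d_r.
    by rewrite (tau_ad_r _ (LL i)) //; exact: d_l.
  - rewrite /X0 (linB _ _ (lad _)) -d_r -d_l !ad_odd_sq ?subrr //; exact: tau_d.
  - exact: eig_X0.
  - by exists 1; rewrite scale1r (linB _ _ (lad _)) gam_evalw_l subr0; exact: gam_evalw_r.
have [Y [[y1 y2 y3 y4 [c y5]] /eqP]] := eig_inverse lth char0 hS zset TS SX eig_X0.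
rewrite subr_eq0 => /eqP eX; exists Y; split; first by split=> //; exact: Wp_W.
have g1 := gam_evalw_r.
have g2 : Wp (below i) (ad_odd gam X0 - c *: sl).
  have := theta_Wp y5; rewrite (linB _ _ lth) (linZ _ _ lth) theta_sl.
  by rewrite -ad_even_odd_comm ?tau_theta ?gam_theta // -eX.
(* Computing [gam, X0] directly and through X0 = [theta, Y] shows that (1 - c)
   sl is a combination of words with a left or a right letter too. *)
have g3 : Wp (below i) ((1 - c) *: sl).
  rewrite /X0 (linB _ _ (lad _)) gam_evalw_l subr0 in g2.
  have -> : (1 - c) *: sl = ad_odd gam (evalw r (D i)) - c *: sl - (ad_odd gam (evalw r (D i)) - sl).
    by rewrite opprB [RHS]addrC addrA subrK scalerBl scale1r.
  exact: (submodB (hWp _) g2 g1).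
have -> : ad_odd gam (evalw r (D i)) - ad_odd gam Y =
  ad_odd gam (evalw r (D i)) - sl - (ad_odd gam Y - c *: sl) + (1 - c) *: sl.
  rewrite (opprB (ad_odd gam Y)) scalerBl scale1r [RHS](AC (2*2*2) (1*4*(5*2)*(3*6)))/=.
  by rewrite !subrr !addr0.
by apply: (submodD (hWp _)) => //; apply: (submodB (hWp _)).
Qed.

End Stage.
Lemma Bt_dd om Yv i j a :
    (forall j, (j < i)%N -> W (below j) (Yv j)) ->
    (forall j, (j < i)%N -> tau (Yv j) = (-1) ^+ (~~ e j) *: Yv j) ->
    (forall j, (j < i)%N -> om j = r j - l j - ad_odd gam (Yv j)) ->
  (j < i)%N -> (j <= a)%N -> ad_odd (om j * dd j) (dd a) = 0.
Proof.
move=> h1 h2 h3 ji ja; rewrite /ad_odd tau_dd -scalerAl !mulrA.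
have hs x : sig_below j x -> if x is SS b then b != a else true.
  by case: x => // b /= bj; rewrite neq_ltn (leq_trans bj ja).
rewrite (dd_W hs (om_sig_below h1 h3 ji)) (twist_sign _ (tau_om h2 h3 ji)).
rewrite -!scalerAl -!mulrA (dd_dd j a) -!scalerAr !scalerA -scalerBl.
by case: (e a); case: (e j); rewrite /= ?expr0 ?expr1 ?mulr1 ?mul1r ?mulrNN ?mulr1 ?subrr ?scale0r.
Qed.

(** The terms om j * dd j are added one after the other. The square of the
    differential remains zero if the new om i commutes with it, that is, if
    [d, [gam, Y]] is the obstruction D_i(r) - D_i(l); the inverse of theta on
    the variables that have been treated provides this Y. The new theta has
    positive eigenvalues on r i - l i = om i + [gam, Y], for om i is an
    eigenvector for 1, and bracketing with gam preserves those of Y. *)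
Lemma perturbation : exists om Yv d theta,
  [/\ forall j, (j < s)%N -> W (below j) (Yv j),
      forall j, (j < s)%N -> tau (Yv j) = (-1) ^+ (~~ e j) *: Yv j,
      forall j, (j < s)%N -> om j = r j - l j - ad_odd gam (Yv j),
      d = d0 + \sum_(j < s) om j * dd j &
      theta = d * gam + gam * d] /\
  [/\ d * d = 0,
      forall j, (j < s)%N -> eig (ad_even theta) true [set 0] (r j - l j) &
      forall j, (j < s)%N -> Wp (below j.+1) (ad_even theta (r j))].
Proof.
suff H i : (i <= s)%N -> exists om Yv d theta,
  [/\ forall j, (j < i)%N -> W (below j) (Yv j),
      forall j, (j < i)%N -> tau (Yv j) = (-1) ^+ (~~ e j) *: Yv j,
      forall j, (j < i)%N -> om j = r j - l j - ad_odd gam (Yv j),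
      d = d0 + \sum_(j < i) om j * dd j &
      theta = d * gam + gam * d] /\
  [/\ d * d = 0,
      forall j, (j < i)%N -> eig (ad_even theta) true [set 0] (r j - l j) &
      forall j, (j < i)%N -> Wp (below j.+1) (ad_even theta (r j))].
  exact: (H s (leqnn s)).
elim: i => [_|i IH si].
  exists (fun=> 0), (fun=> 0), d0, (d0 * gam + gam * d0).
  by rewrite big_ord0 addr0; split.
have [om [Yv [d [theta [[h1 h2 h3 dE tE] [dsq h4 h5]]]]]] := IH (ltnW si).
have [Y [[y1 y2 y3 y4 y5] y6]] := stage_solve (ltnW si) h1 h2 h3 dE tE dsq h4 h5.
pose om' j := if j == i then r i - l i - ad_odd gam Y else om j.
pose Yv' j := if j == i then Y else Yv j.
have om'i : om' i = r i - l i - ad_odd gam Y by rewrite /om' eqxx.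
have lt_neq j : (j < i)%N -> (j == i) = false by move=> /ltn_eqF.
have h1' j : (j < i.+1)%N -> W (below j) (Yv' j).
  by rewrite ltnS leq_eqVlt /Yv' => /orP[/eqP ->|ji]; rewrite ?eqxx // lt_neq //; apply: h1.
have h2' j : (j < i.+1)%N -> tau (Yv' j) = (-1) ^+ (~~ e j) *: Yv' j.
  by rewrite ltnS leq_eqVlt /Yv' => /orP[/eqP ->|ji]; rewrite ?eqxx // lt_neq //; apply: h2.
have h3' j : (j < i.+1)%N -> om' j = r j - l j - ad_odd gam (Yv' j).
  by rewrite ltnS leq_eqVlt /Yv' /om' => /orP[/eqP ->|ji]; rewrite ?eqxx // lt_neq //; apply: h3.
pose B := om' i * dd i.
pose d' := d + B; pose theta' := d' * gam + gam * d'.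
have dE' : d' = d0 + \sum_(j < i.+1) om' j * dd j.
  rewrite big_ord_recr /= addrA /d' dE; congr (_ + _ + _).
  by apply: eq_bigr => j _; rewrite /om' lt_neq.
have tE' : theta' = d' * gam + gam * d' by [].
have ii : (i < i.+1)%N by [].
have tau_B : tau B = - B := tau_Bt h2' h3' ii.
have tau_dd' : tau d' = - d' := tau_d h2' h3' dE'.
have d_om : ad_odd d (om' i) = 0.
  rewrite om'i (linB _ _ (lad _)) (linB (r i) _ (lad _)) (d_r h1 h2 h3 dE) (d_l h1 h2 h3 dE) y3.
  by rewrite (ad_theta h2 h3 dE tE) y4 (lin0 (lad _)) addr0 subrr.
have dB : d * B + B * d = 0.
  have -> : d * B + B * d = ad_odd d B by rewrite /ad_odd tau_B mulNr opprK.
  rewrite /B ad_oddM // d_om mul0r add0r (sum_ad dE) d0_dd add0r big1 ?mulr0 // => j _.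
  by rewrite (Bt_dd h1 h2 h3) // ltnW.
have BB : B * B = 0.
  have hs x : sig_below i x -> if x is SS b then b != i else true.
    by case: x => // b /= bi; rewrite neq_ltn bi.
  rewrite /B mulrA -(mulrA _ (dd i)) (dd_W hs (om_sig_below h1' h3' ii)) mulrA -mulrA.
  have := tau_om h2' h3' ii; have := dd_dd i i.
  case: (e i) => /= [_ h|h _].
    by rewrite (W_odd_sq epep lop_comm tau_lop char0 (om_W h1' h3' ii)) ?mul0r // h expr1 scaleN1r.
  have -> : dd i * dd i = 0; last by rewrite mulr0.
  by apply: (add_self_eq0 char0); rewrite {1}h expr1 scaleN1r addNr.
have dsq' : d' * d' = 0.
  by rewrite /d' mulrDl !mulrDr dsq BB addr0 add0r dB.
have Bt0 X : W (below i) X -> ad_odd B X = 0.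
  apply: (Bt_W h1' h2' h3' ii) => -[] // a; rewrite /below /= => ai.
  by rewrite neq_ltn ai.
have theta_eq X : W (below i) X -> ad_even theta' X = ad_even theta X.
  move=> hX; rewrite (ad_theta h2' h3' dE' tE') (ad_theta h2 h3 dE tE).
  have adE Z : W (below i) Z -> ad_odd d' Z = ad_odd d Z.
    by move=> hZ; rewrite /d' (linD _ _ (ad_odd_linearl ep Z)) Bt0 // addr0.
  by rewrite !adE //; apply: gam_W.
have eig_eq b X : W (below i) X -> eig (ad_even theta) b [set 0] X ->
    eig (ad_even theta') b [set 0] X.
  move=> hX [ls hls h]; exists ls => //.
  suff -> : kill (ad_even theta') ls X = kill (ad_even theta) ls X by [].
  elim: ls X hX {hls h} => //= a ls IHl X hX; rewrite IHl; last first.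
    apply: (submodB (hW _)); last exact: (submodZ _ (hW _)).
    by rewrite theta_eq //; apply: (theta_W (ltnW si) h1 h2 h3 dE tE h5).
  by rewrite theta_eq.
exists om', Yv', d', theta'; split; first by [].
split=> // j; rewrite ltnS leq_eqVlt => /orP[/eqP ->|ji].
- have -> : r i - l i = om' i + ad_odd gam Y by rewrite om'i subrK.
  have hE : submod (eig (ad_even theta') true [set 0]).
    by apply: eig_submod => // x ->; rewrite /= lin0.
  apply: (submodD hE).
    exists [:: 1%N] => //=; rewrite (ad_theta h2' h3' dE' tE') (gam_om h3' ii).
    have eo := d_sig si h1' h2' h3' dE' ii.
    have -> : ad_odd d' (om' i) = 0 by rewrite -eo (ad_odd_sq epep).
    by rewrite eo (lin0 (lad _)) addr0 scale1r subrr.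
  apply: (eig_map (T1 := ad_even theta') (lad gam)); last exact: eig_eq.
  move=> X /=; rewrite (ad_even_odd_comm epep) //.
    exact: (tau_theta h2' h3' dE' tE').
  exact: (gam_theta tE').
- apply: eig_eq; last exact: h4.
  by apply: (submodB (hW _)); [apply: (W_lop (x := RR j))|apply: (W_lop (x := LL j))].
- rewrite (theta_r_lt si h1' h2' h3' dE' tE' ii) om'i.
  have -> : r i - l i - ad_odd gam Y + ad_odd gam (evalw r (D i)) =
     r i - l i + (ad_odd gam (evalw r (D i)) - ad_odd gam Y).
    by rewrite [LHS]addrAC [RHS](addrA (r i - l i)).
  apply: (submodD (hWp _)).
    apply: (submodB (hWp _)).
      by apply: (Wp_lop (x := RR i)) ; rewrite /below /= ?ltnSn.
    by apply: (Wp_lop (x := LL i)) ; rewrite /below /= ?ltnSn.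
  by apply: (@Wp_mono _ _ _ _ _ (below i)) y6 => x; rewrite /below => /ltnW.
- by rewrite theta_eq; [exact: h5|apply: (W_lop (x := RR j))].
Qed.

Hypothesis big0 : forall j, (s <= j)%N -> [/\ l j = 0, r j = 0 & sig j = 0].

Lemma W_all X : W predT X -> W (below s) X.
Proof.
apply: lspan_min => // _ [w [_ ->]]; case: (boolP (all (below s) w)) => hw.
  exact: W_gen.
suff -> : word_op l r sig w = 0 by case: (hW (below s)).
elim: w hw => //= x w IH; rewrite negb_and wop_cons => /orP[hx|/IH ->]; last by rewrite mulr0.
suff -> : lop x = 0 by rewrite mul0r.
by case: x hx => j; rewrite /below /= -leqNgt => /big0[].
Qed.

(** The letters of index >= s vanish, so that most restrictions on the indices
    can be dropped. *)
Lemma perturbed_differential : exists (om Yv : nat -> E) (d theta : E),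
  [/\ [/\ d = d0 + \sum_(j < s) om j * dd j, theta = d * gam + gam * d & d * d = 0],
      [/\ forall j, (j < s)%N -> W (below j.+1) (om j),
          forall j, (j < s)%N -> W (sig_below j) (om j),
          forall j, (j < s)%N -> tau (om j) = (-1) ^+ e j *: om j,
          forall j, (j < s)%N -> om j = r j - l j - ad_odd gam (Yv j) &
          forall j, (j < s)%N -> W (below j) (Yv j)],
      [/\ forall j, ad_odd d (l j) = evalw l (D j),
          forall j, ad_odd d (r j) = evalw r (D j) &
          forall j, W predT (ad_odd d (sig j))] &
      [/\ forall j, ad_even theta (l j) = 0,
          forall j, Wp predT (ad_even theta (r j)),
          forall j, ad_even theta (sig j) = sig j,
          forall j, eig (ad_even theta) true [set 0] (r j - l j) &
          forall X, W predT X -> eig (ad_even theta) false [set 0] X]].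
Proof.
have [om [Yv [d [theta [[h1 h2 h3 dE tE] [dsq h4 h5]]]]]] := perturbation.
have ss := leqnn s.
exists om, Yv, d, theta; split; first by split.
- split=> //.
  + exact: (om_W h1 h3).
  + exact: (om_sig_below h1 h3).
  + exact: (tau_om h2 h3).
- split.
  + exact: (d_l h1 h2 h3 dE).
  + exact: (d_r h1 h2 h3 dE).
  + move=> j; have [sj|js] := leqP s j.
      have [_ _ ->] := big0 sj; rewrite (lin0 (lad d)); by case: (hW predT).
    rewrite (d_sig ss h1 h2 h3 dE js); apply: (@W_mono _ _ _ _ _ (sig_below j)) => //.
    exact: (om_sig_below h1 h3).
- have z X : X = 0 -> ad_even theta X = 0 by move=> ->; exact: (lin0 (lev theta)).
  split.
  + exact: (theta_l h1 h2 h3 dE tE).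
  + move=> j; have [sj|js] := leqP s j.
      by rewrite z; [case: (hWp predT)|case: (big0 sj)].
    by apply: (@Wp_mono _ _ _ _ _ (below j.+1)) (h5 j js).
  + move=> j; have [sj|js] := leqP s j; last exact: (theta_sig ss h1 h2 h3 dE tE).
    by have [_ _ ->] := big0 sj; rewrite z.
  + move=> j; have [sj|js] := leqP s j; last exact: h4.
    by exists [::] => //=; have [-> -> _] := big0 sj; rewrite subrr.
  + move=> X /W_all hX; move: hX; apply: eig_W; try eassumption.
Qed.

End Perturbation.

(** * Koszul variables *)

Section KoszulVariables.
Variable k : fieldType.

(** Polynomials in one variable of parity p: sg is the multiplication by the
    variable, dd the derivative, t the parity involution, o the constant 1 and
    vac the evaluation at 0. *)
Definition one_variable (p : bool) (G : lmodType k) (o : G) (sg dd t : G -> G)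
    (vac : G -> k^o) : Prop :=
  [/\ [/\ linear sg, linear dd, linear t & linear vac],
      [/\ forall x, t (t x) = x, t o = o,
          forall x, t (sg x) = (-1) ^+ p *: sg (t x) &
          forall x, t (dd x) = (-1) ^+ p *: dd (t x)],
      [/\ p -> forall x, sg (sg x) = 0, p -> forall x, dd (dd x) = 0,
          forall x, dd (sg x) = x + (-1) ^+ p *: sg (dd x) & dd o = 0],
      vac o = 1 /\ forall x, vac (sg x) = 0 &
      forall x, lspan [set y | exists n, y = iter n sg o] x].

Lemma one_even_variable : exists (G : lmodType k) o sg dd t vac,
  @one_variable false G o sg dd t vac.
Proof.
exists {poly k}, 1, (fun q => q * 'X), (fun q => q^`()), idfun, (fun q : {poly k} => q`_0 : k^o).
have Xn n : iter n (fun q : {poly k} => q * 'X) 1 = 'X^n.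
  by elim: n => [|n /= ->]; rewrite ?expr0 // exprSr.
split.
- split=> [a x y|a x y|//|a x y]; first by rewrite mulrDl scalerAl.
    by rewrite derivD derivZ.
  by rewrite coefD coefZ.
- by split=> // x; rewrite scale1r.
- split=> // [x|]; last by rewrite derivC.
  by rewrite derivM derivX mulr1 scale1r addrC.
- by split=> [|x]; rewrite ?coefC // coefMX.
- move=> q; set S := lspan _; have hS : submod S by exact: lspan_submod.
  rewrite -[q]coefK poly_def.
  apply: (big_ind S) => [|x y|i _]; [by case: hS|exact: submodD|apply: (submodZ _ hS)].
  by apply: lspan_gen; exists i; rewrite Xn.
Qed.

Lemma one_odd_variable : exists (G : lmodType k) o sg dd t vac,
  @one_variable true G o sg dd t vac.
Proof.
exists (k^o * k^o)%type, (1, 0), (fun x => (0, x.1)), (fun x => (x.2, 0)),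
  (fun x => (x.1, - x.2)), (fun x => x.1).
have z2 (a : k) (x y : (k^o * k^o)%type) :
  a *: x + y = (a * x.1 + y.1, a * x.2 + y.2) by case: x y => ? ? [].
split.
- split=> a x y //; rewrite !z2 //= ?mulr0 ?addr0 //.
  by rewrite mulrN opprD.
- split=> [[a b]||[a b]|[a b]] //=; rewrite ?opprK ?oppr0 // expr1 scaleN1r.
    by rewrite -[RHS]/(- 0, - a) oppr0.
  by rewrite -[RHS]/(- - b, - 0) oppr0 opprK.
- split=> // [[a b]]; rewrite expr1 scaleN1r.
  by rewrite -[RHS]/(a - 0, b - b) subr0 subrr.
- by [].
- move=> [a b]; set S := lspan _; have hS : submod S by exact: lspan_submod.
  have -> : (a, b) = a *: ((1, 0) : (k^o * k^o)%type) + b *: (0, 1).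
    rewrite -[_ *: (1, 0)]/(a * 1, a * 0) -[_ *: (0, 1)]/(b * 0, b * 1).
    by rewrite -[_ + _]/(a * 1 + b * 0, a * 0 + b * 1) !mulr1 !mulr0 addr0 add0r.
  apply: (submodD hS); apply: (submodZ _ hS); apply: lspan_gen.
    by exists 0%N.
  by exists 1%N.
Qed.

Variable p : nat -> bool.

(** Polynomials in s variables with parities p 0, ..., p (s - 1); the
    operators of index >= s vanish. *)
Definition koszul_variables (s : nat) (F : lmodType k) (o : F)
    (sg dd : nat -> F -> F) (t : F -> F) (vac : F -> k^o) : Prop :=
  [/\ [/\ forall j, linear (sg j), forall j, linear (dd j), linear t & linear vac],
      [/\ forall x, t (t x) = x, t o = o,
          forall j x, t (sg j x) = (-1) ^+ p j *: sg j (t x) &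
          forall j x, t (dd j x) = (-1) ^+ p j *: dd j (t x)],
      [/\ forall i j x, sg i (sg j x) = (-1) ^+ (p i && p j) *: sg j (sg i x),
          forall i j x, dd i (dd j x) = (-1) ^+ (p i && p j) *: dd j (dd i x),
          forall i j x, i != j -> dd i (sg j x) = (-1) ^+ (p i && p j) *: sg j (dd i x) &
          forall j x, (j < s)%N -> dd j (sg j x) = x + (-1) ^+ p j *: sg j (dd j x)],
      [/\ forall j, dd j o = 0, vac o = 1, forall j x, vac (sg j x) = 0,
          forall j x, (s <= j)%N -> sg j x = 0 & forall j x, (s <= j)%N -> dd j x = 0] &
      forall x, lspan [set y | exists w, y = foldr sg o w] x].

Lemma koszul_variables0 : exists F o sg dd t vac,
  @koszul_variables 0 F o sg dd t vac.
Proof.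
exists k^o, 1, (fun _ => \0), (fun _ => \0), idfun, idfun.
split.
- by split=> // j a x y; rewrite /= scaler0 addr0.
- by split=> // j x; rewrite /= scaler0.
- by split=> // *; rewrite /= scaler0.
- by split.
- move=> x; have -> : x = x *: (1 : k^o) by rewrite /GRing.scale /= mulr1.
  by apply: (submodZ _ (lspan_submod _)); apply: lspan_gen; exists [::].
Qed.

Lemma tmap_comm (F G : lmodType k) f g f' g' (a b z : bool) : z = a (+) b ->
    linear f -> linear g -> linear f' -> linear g' ->
    (forall x : F, f (f' x) = (-1) ^+ a *: f' (f x)) ->
    (forall y : G, g (g' y) = (-1) ^+ b *: g' (g y)) ->
  forall x, tmap f g (tmap f' g' x) = (-1) ^+ z *: tmap f' g' (tmap f g x).
Proof.
move=> -> lf lg lf' lg' ef eg; apply: tens_eq => [c x y|c x y|x y].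
- by rewrite (tmap_linear f' g') (tmap_linear f g).
- rewrite (tmap_linear f g) (tmap_linear f' g') scalerDr !scalerA.
  by rewrite (mulrC c).
- rewrite (tmapE _ _ lf lg) (tmapE _ _ lf' lg') (tmapE _ _ lf lg) (tmapE _ _ lf' lg').
  by rewrite ef eg (linZ _ _ (tp_linearl _)) (linZ _ _ (tp_linearr _)) scalerA -signr_addb.
Qed.

Section OneMoreVariable.
Variables (s : nat) (F G : lmodType k) (t : F -> F).
Hypothesis lt : linear t.
Hypothesis tt : forall x, t (t x) = x.

(* The operators of the first s variables and of the last one on the two
   factors of F (x) G; the twist makes odd variables anticommute. *)
Let tpw (x : F) := if p s then t x else x.
Definition left_factor (f : nat -> F -> F) j x : F :=
  if (j < s)%N then f j x else if j == s then tpw x else 0.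
Definition right_factor (g : G -> G) (j : nat) (y : G) : G :=
  if (j < s)%N then y else g y.

Lemma left_factor_linear f j : (forall j, linear (f j)) -> linear (left_factor f j).
Proof.
move=> hf a x y; rewrite /left_factor /tpw; case: ifP => _; first exact: hf.
case: ifP => _; last by rewrite scaler0 addr0.
by case: (p s); rewrite ?lt.
Qed.

Lemma right_factor_linear g j : linear g -> linear (right_factor g j).
Proof. by move=> hg a x y; rewrite /right_factor; case: ifP => _ //; exact: hg. Qed.

Lemma left_factor0 f j x : (s < j)%N -> left_factor f j x = 0.
Proof. by move=> h; rewrite /left_factor ltnNge (ltnW h) gtn_eqF. Qed.

Lemma left_factor_t f j x : linear (f j) ->
  (forall x, t (f j x) = (-1) ^+ p j *: f j (t x)) ->
  t (left_factor f j x) = (-1) ^+ ((j < s)%N && p j) *: left_factor f j (t x).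
Proof.
move=> lf tf; rewrite /left_factor /tpw; case: ltngtP => [_|_|_] /=; rewrite ?scale1r.
- exact: tf.
- exact: (lin0 lt).
- by case: (p s).
Qed.

Lemma left_factor_comm f f' i j x : linear (f i) -> linear (f' j) ->
  (forall x, t (f i x) = (-1) ^+ p i *: f i (t x)) ->
  (forall x, t (f' j x) = (-1) ^+ p j *: f' j (t x)) ->
  ((i < s)%N -> (j < s)%N -> forall x, f i (f' j x) = (-1) ^+ (p i && p j) *: f' j (f i x)) ->
  left_factor f i (left_factor f' j x) =
  (-1) ^+ ((p i && p j) && ~~ ((i == s) && (j == s))) *: left_factor f' j (left_factor f i x).
Proof.
move=> lf lf' tf tf' ff'; rewrite /left_factor /tpw.
have tw (b : bool) (g : F -> F) x1 : (forall x, t (g x) = (-1) ^+ b *: g (t x)) ->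
    (if p s then t (g x1) else g x1) = (-1) ^+ (p s && b) *: g (if p s then t x1 else x1).
  by move=> h; case: (p s); rewrite /= ?scale1r.
case: (ltngtP i s) => [ai|ai|->]; case: (ltngtP j s) => [aj|aj|->]; rewrite ?andbT ?andbF ?eqxx ?scale1r //=.
- exact: ff'.
- by rewrite (lin0 lf) scaler0.
- rewrite (tw _ _ _ tf) scalerA andbC -signr_addb addbb scale1r //.
- by rewrite (lin0 lf') scaler0.
- by rewrite ?scaler0.
- by rewrite ?scaler0; case: (p s); rewrite ?(lin0 lt) ?scaler0.
- by rewrite (tw _ _ _ tf').
- by rewrite scaler0; case: (p s); rewrite ?(lin0 lt).
Qed.

End OneMoreVariable.

Lemma koszul_variablesS s : (exists F o sg dd t vac,
    @koszul_variables s F o sg dd t vac) ->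
  exists F o sg dd t vac, @koszul_variables s.+1 F o sg dd t vac.
Proof.
move=> [F [o [sg [dd [t [vac [[lsg ldd lt lvac] [tt to tsg tdd] [ss d2 ds dsj] [ddo vo vs sg0 dd0] sp]]]]]]].
have [G [oG [sG [dG [tG [vG [[lsG ldG ltG lvG] [ttG toG tsG tdG] [ssG ddG dsG doG] [voG vsG] spG]]]]]]] :
  exists G o sg dd t vac, @one_variable (p s) G o sg dd t vac.
  by case: (p s); [exact: one_odd_variable|exact: one_even_variable].
have [V [lV VE]] : exists V : tens F G -> k^o, linear V /\ forall x g, V (tp x g) = vac x * vG g.
  apply: tens_lift => [g a x y|x a g h].
    by rewrite lvac mulrDl -scalerAl.
  by rewrite lvG mulrDr -scalerAr.
pose A := left_factor s t sg; pose A' := left_factor s t dd.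
pose B := right_factor s sG; pose B' := right_factor s dG.
have lA j : linear (A j) by exact: left_factor_linear.
have lA' j : linear (A' j) by exact: left_factor_linear.
have lB j : linear (B j) by exact: right_factor_linear.
have lB' j : linear (B' j) by exact: right_factor_linear.
have EA j x g : tmap (A j) (B j) (tp x g) = tp (A j x) (B j g) := tmapE x g (lA j) (lB j).
have EA' j x g : tmap (A' j) (B' j) (tp x g) = tp (A' j x) (B' j g) := tmapE x g (lA' j) (lB' j).
have Et x g : tmap t tG (tp x g) = tp (t x) (tG g) := tmapE x g lt ltG.
have T0l (g : G) : tp (0 : F) g = 0 := lin0 (tp_linearl g).
have T0r (x : F) : tp x (0 : G) = 0 := lin0 (tp_linearr x).
have MA j := tmap_linear (A j) (B j); have MA' j := tmap_linear (A' j) (B' j).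
have Mt := tmap_linear t tG.
have comm_id (b : bool) (h : G -> G) y : h y = (-1) ^+ (b && false) *: h y.
  by rewrite andbF scale1r.
exists (tens F G), (tp o oG), (fun j => tmap (A j) (B j)), (fun j => tmap (A' j) (B' j)),
  (tmap t tG), V.
have tB j g : tG (B j g) = (-1) ^+ (~~ (j < s)%N && (p s)) *: B j (tG g).
  by rewrite /B /right_factor; case: ifP => _; rewrite ?scale1r ?tsG.
have tB' j g : tG (B' j g) = (-1) ^+ (~~ (j < s)%N && (p s)) *: B' j (tG g).
  by rewrite /B' /right_factor; case: ifP => _; rewrite ?scale1r ?tdG.
have Ax0 j x : (s < j)%N -> tmap (A j) (B j) x = 0.
  move=> sj; move: x; apply: tens_eq => [||x g]; [exact: MA|by move=> a x y; rewrite scaler0 addr0|].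
  by rewrite EA {1}/A left_factor0 // T0l.
have Ax0' j x : (s < j)%N -> tmap (A' j) (B' j) x = 0.
  move=> sj; move: x; apply: tens_eq => [||x g]; [exact: MA'|by move=> a x y; rewrite scaler0 addr0|].
  by rewrite EA' {1}/A' left_factor0 // T0l.
have BB i j (g : G) : B i (B j g) = (-1) ^+ ((i == s) && (j == s) && p s) *: B j (B i g) \/ (s < i)%N \/ (s < j)%N.
  rewrite /B /right_factor; case: (ltngtP i s) => [ai|ai|_]; [left|by right; left|].
    by rewrite ?andbF /= scale1r.
  case: (ltngtP j s) => [aj|aj|_]; [left|by right; right|left].
    by rewrite ?andbF /= scale1r.
  by rewrite /=; case: (p s) ssG => [h|_]; rewrite ?scale1r // !(h isT) scaler0.
have BB' i j (g : G) : B' i (B' j g) = (-1) ^+ ((i == s) && (j == s) && p s) *: B' j (B' i g) \/ (s < i)%N \/ (s < j)%N.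
  rewrite /B' /right_factor; case: (ltngtP i s) => [ai|ai|_]; [left|by right; left|].
    by rewrite ?andbF /= scale1r.
  case: (ltngtP j s) => [aj|aj|_]; [left|by right; right|left].
    by rewrite ?andbF /= scale1r.
  by rewrite /=; case: (p s) ddG => [h|_]; rewrite ?scale1r // !(h isT) scaler0.
have sgn i j : (p i && p j) = (((p i && p j) && ~~ ((i == s) && (j == s))) (+) ((i == s) && (j == s) && p s)).
  case: eqP => [->|_] /=; last by rewrite andbT addbF.
  case: eqP => [->|_] /=; last by rewrite andbT addbF.
  by rewrite andbF andbb.
split.
- split=> [j|j||]; [exact: MA|exact: MA'|exact: Mt|exact: lV].
- split.
  + apply: tens_eq => [a x y|a x y|x g]; [by rewrite !Mt|by []|].
    by rewrite !Et tt ttG.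
  + by rewrite Et to toG.
  + move=> j x; have [sj|js] := ltnP s j.
      by rewrite !(Ax0 j _ sj) (lin0 Mt) scaler0.
    apply: (tmap_comm (a := (j < s)%N && p j) (b := ~~ (j < s)%N && p s)) => //.
      by move: js; rewrite leq_eqVlt => /orP[/eqP ->|->]; rewrite ?ltnn //= addbF.
    by move=> y; apply: left_factor_t.
  + move=> j x; have [sj|js] := ltnP s j.
      by rewrite !(Ax0' j _ sj) (lin0 Mt) scaler0.
    apply: (tmap_comm (a := (j < s)%N && p j) (b := ~~ (j < s)%N && p s)) => //.
      by move: js; rewrite leq_eqVlt => /orP[/eqP ->|->]; rewrite ?ltnn //= addbF.
    by move=> y; apply: left_factor_t.
- split.
  + move=> i j x; have [si|si] := ltnP s i; first by rewrite !(Ax0 i _ si) (lin0 (MA j)) scaler0.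
    have [sj|sj] := ltnP s j; first by rewrite !(Ax0 j _ sj) (lin0 (MA i)) scaler0.
    apply: (tmap_comm (sgn i j)) => //.
      by move=> y; apply: left_factor_comm.
    by move=> g; case: (BB i j g) => // -[]; rewrite ltnNge ?si ?sj.
  + move=> i j x; have [si|si] := ltnP s i; first by rewrite !(Ax0' i _ si) (lin0 (MA' j)) scaler0.
    have [sj|sj] := ltnP s j; first by rewrite !(Ax0' j _ sj) (lin0 (MA' i)) scaler0.
    apply: (tmap_comm (sgn i j)) => //.
      by move=> y; apply: left_factor_comm.
    by move=> g; case: (BB' i j g) => // -[]; rewrite ltnNge ?si ?sj.
  + move=> i j x ij; have [si|si] := ltnP s i; first by rewrite !(Ax0' i _ si) (lin0 (MA j)) scaler0.
    have [sj|sj] := ltnP s j; first by rewrite !(Ax0 j _ sj) (lin0 (MA' i)) scaler0.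
    have ijs : (i == s) && (j == s) = false.
      by case: (i =P s) => //= ei; apply: contraNF ij => /eqP ej; rewrite ei ej.
    apply: (tmap_comm (sgn i j)) => //.
      by move=> y; apply: left_factor_comm => // _ _ z; apply: ds.
    move=> g; rewrite ijs scale1r /B' /B /right_factor.
    move: ijs; case: (ltngtP i s) si => // ei _; case: (ltngtP j s) sj => // ej _ //.
  + move=> j x0; rewrite ltnS leq_eqVlt => hj; move: x0; apply: tens_eq => [||x g].
    * exact: (linear_comp2 (MA' j) (MA j)).
    * have lid : linear (@idfun (tens F G)) by [].
      exact: (linear_add2 lid (linear_scale2 _ (linear_comp2 (MA j) (MA' j)))).
    rewrite EA EA' EA' EA /A /A' /B /B' /left_factor /right_factor; case/orP: hj => [/eqP ->|js].
      rewrite ltnn eqxx dsG (linD _ _ (tp_linearr _)) (linZ _ _ (tp_linearr _)).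
      by case: (p s); rewrite ?tt.
    by rewrite js dsj // (linD _ _ (tp_linearl g)) (linZ _ _ (tp_linearl g)).
- split.
  + move=> j; rewrite EA' /A' /B' /left_factor /right_factor.
    by case: ltngtP => _; rewrite ?ddo ?doG ?T0l ?T0r.
  + by rewrite VE vo voG mulr1.
  + move=> j; apply: tens_eq => [a x y|a x y|x g]; [by rewrite MA lV|by rewrite scaler0 addr0|].
    rewrite EA VE /A /B /left_factor /right_factor; case: ltngtP => _; rewrite ?vs ?vsG ?mul0r ?mulr0 //.
  + by move=> j x0 sj; exact: (Ax0 j x0 sj).
  + by move=> j x0 sj; exact: (Ax0' j x0 sj).
- set SS := lspan _; have hSS : submod SS by exact: lspan_submod.
  have iterE n : iter n (tmap (A s) (B s)) (tp o oG) = tp o (iter n sG oG).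
    elim: n => //= n ->; rewrite EA /A /B /left_factor /right_factor ltnn eqxx.
    by rewrite to; case: (p s).
  have gen w n : SS (tp (foldr sg o w) (iter n sG oG)).
    elim: w => [|j w IH] /=.
      apply: lspan_gen; exists (nseq n s); rewrite -iterE.
      by elim: n => //= n ->.
    have [sj|js] := leqP s j.
      by rewrite sg0 // T0l; case: hSS.
    suff H : SS `<=` [set y | SS (tmap (A j) (B j) y)].
      by have := H _ IH; rewrite /= EA /A /B /left_factor /right_factor js.
    apply: lspan_min; first by apply: (submod_preim (MA j) hSS).
    by move=> _ [w' ->] /=; apply: lspan_gen; exists (j :: w').
  apply: tens_ind => // x g; move: (sp x) (spG g).
  apply: lspan_bilin => [g'|x'||_ _ [w ->] [n ->]] //.
  + exact: tp_linearl.
  + exact: tp_linearr.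
Qed.

Lemma koszul_variables_exist s : exists F o sg dd t vac,
  @koszul_variables s F o sg dd t vac.
Proof. by elim: s => [|s IH]; [exact: koszul_variables0|exact: koszul_variablesS]. Qed.

End KoszulVariables.

(** * The algebra of linear endomorphisms *)

Section Endo.
Variables (k : fieldType) (M : lmodType k).

(** The nonzero vector x0 is a parameter, so that 1 != 0 in the algebra. *)
Record endo (x0 : M) (hx0 : x0 != 0) := Endo {
  efun :> M -> M;
  efun_linear : linear efun }.

Variables (x0 : M) (hx0 : x0 != 0).
Local Notation E := (endo hx0).

Lemma endo_ext (f g : E) : (forall x, f x = g x) -> f = g.
Proof.
case: f g => f hf [g hg] /= /funext e; case: _ / e hg => hg.
by congr Endo; apply: Prop_irrelevance.
Qed.

HB.instance Definition _ := gen_eqMixin E.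
HB.instance Definition _ := gen_choiceMixin E.

Let c0 : linear (fun _ : M => 0 : M). Proof. by move=> a x y; rewrite scaler0 addr0. Qed.
Let cN (f : E) : linear (fun x => - f x).
Proof. by move=> a x y; rewrite efun_linear opprD scalerN. Qed.
Let cD (f g : E) : linear (fun x => f x + g x).
Proof. by move=> a x y; rewrite !efun_linear scalerDr addrACA. Qed.
Let cM (f g : E) : linear (fun x => f (g x)).
Proof. by move=> a x y; rewrite !efun_linear. Qed.
Let c1 : linear (fun x : M => x). Proof. by []. Qed.
Let cZ (c : k) (f : E) : linear (fun x => c *: f x).
Proof. by move=> a x y; rewrite efun_linear scalerDr !scalerA mulrC. Qed.

Let e0 : E := Endo hx0 c0.
Let eN (f : E) : E := Endo hx0 (cN f).
Let eD (f g : E) : E := Endo hx0 (cD f g).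
Let eM (f g : E) : E := Endo hx0 (cM f g).
Let e1 : E := Endo hx0 c1.
Let eZ (c : k) (f : E) : E := Endo hx0 (cZ c f).

Fact eDA : associative eD. Proof. by move=> f g h; apply: endo_ext => x /=; rewrite addrA. Qed.
Fact eDC : commutative eD. Proof. by move=> f g; apply: endo_ext => x /=; rewrite addrC. Qed.
Fact eD0 : left_id e0 eD. Proof. by move=> f; apply: endo_ext => x /=; rewrite add0r. Qed.
Fact eDN : left_inverse e0 eN eD. Proof. by move=> f; apply: endo_ext => x /=; rewrite addNr. Qed.
HB.instance Definition _ := GRing.isZmodule.Build E eDA eDC eD0 eDN.

Fact eMA : associative eM. Proof. by move=> f g h; apply: endo_ext. Qed.
Fact eM1l : left_id e1 eM. Proof. by move=> f; apply: endo_ext. Qed.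
Fact eM1r : right_id e1 eM. Proof. by move=> f; apply: endo_ext. Qed.
Fact eMDl : left_distributive eM +%R. Proof. by move=> f g h; apply: endo_ext. Qed.
Fact eMDr : right_distributive eM +%R.
Proof. by move=> f g h; apply: endo_ext => x; exact: (linD _ _ (efun_linear f)). Qed.
Fact eM10 : e1 != 0.
Proof. by apply/eqP => /(congr1 (fun f : E => f x0)) /= /eqP; apply/negP. Qed.
HB.instance Definition _ := GRing.Zmodule_isNzRing.Build E eMA eM1l eM1r eMDl eMDr eM10.

Fact eZA (a b : k) (f : E) : eZ a (eZ b f) = eZ (a * b) f.
Proof. by apply: endo_ext => x /=; rewrite scalerA. Qed.
Fact eZ1 : left_id 1 eZ. Proof. by move=> f; apply: endo_ext => x /=; rewrite scale1r. Qed.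
Fact eZDr : right_distributive eZ +%R.
Proof. by move=> a f g; apply: endo_ext => x; exact: scalerDr. Qed.
Fact eZDl (f : E) : {morph eZ^~ f : a b / a + b}.
Proof. by move=> a b; apply: endo_ext => x; exact: scalerDl. Qed.
HB.instance Definition _ := GRing.Zmodule_isLmodule.Build k E eZA eZ1 eZDr eZDl.

Fact eZAl (a : k) (f g : E) : a *: (f * g) = a *: f * g.
Proof. by apply: endo_ext. Qed.
HB.instance Definition _ := GRing.Lmodule_isLalgebra.Build k E eZAl.
Fact eZAr (a : k) (f g : E) : a *: (f * g) = f * (a *: g).
Proof. by apply: endo_ext => x; rewrite -[RHS]/(f (a *: g x)) (linZ _ _ (efun_linear f)). Qed.
HB.instance Definition _ := GRing.Lalgebra_isAlgebra.Build k E eZAr.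

Lemma endoM (f g : E) x : (f * g) x = f (g x). Proof. by []. Qed.
Lemma endoD (f g : E) x : (f + g) x = f x + g x. Proof. by []. Qed.
Lemma endoN (f : E) x : (- f) x = - f x. Proof. by []. Qed.
Lemma endoZ a (f : E) x : (a *: f) x = a *: f x. Proof. by []. Qed.
Lemma endo1 x : (1 : E) x = x. Proof. by []. Qed.
Lemma endo0 x : (0 : E) x = 0. Proof. by []. Qed.

Lemma endo_sum (I : Type) (r : seq I) (f : I -> E) x :
  (\sum_(i <- r) f i) x = \sum_(i <- r) f i x.
Proof. by elim/big_rec2: _ => //= i y g _ <-. Qed.

Lemma endo_comb a (f g f' g' : E) x :
  (f * g - a *: (f' * g')) x = f (g x) - a *: f' (g' x).
Proof. by []. Qed.

Lemma endo_linearl x : linear (fun f : E => f x). Proof. by []. Qed.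

End Endo.

(** * Operators on a triple tensor product *)

Section TripleOperators.
Variables (k : fieldType) (L N F : lmodType k).
Notation K := (tens L (tens N F)).

Definition tp3 a n (f : F) : K := tp a (tp n f).

Lemma tp3_tp a n f : tp3 a n f = tp a (tp n f). Proof. by []. Qed.

Lemma tens3_eq (X : lmodType k) (f g : K -> X) : linear f -> linear g ->
  (forall a n x, f (tp3 a n x) = g (tp3 a n x)) -> f =1 g.
Proof.
move=> hf hg h; apply: tens_eq => // a; apply: tens_eq => [c x y|c x y|n x]; last exact: h.
  by rewrite tp_linearr hf.
by rewrite tp_linearr hg.
Qed.

Lemma tp3_linear1 n x : linear (fun a => tp3 a n x). Proof. exact: tp_linearl. Qed.
Lemma tp3_linear2 a x : linear (fun n => tp3 a n x).
Proof. by move=> c m n; rewrite /tp3 tp_linearl tp_linearr. Qed.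
Lemma tp3_linear3 a n : linear (fun x => tp3 a n x).
Proof. by move=> c m x; rewrite /tp3 !tp_linearr. Qed.

Variables (x0 : K) (hx0 : x0 != 0).
Notation E := (endo hx0).

Definition op3 (f : L -> L) (g : N -> N) (h : F -> F) : E :=
  Endo hx0 (tmap_linear f (tmap g h)).

Lemma op3E f g h a n x : linear f -> linear g -> linear h ->
  op3 f g h (tp3 a n x) = tp3 (f a) (g n) (h x).
Proof. by move=> *; rewrite /op3 /= tmapE //; [rewrite tmapE|exact: tmap_linear]. Qed.

Lemma endo3_ext (f g : E) : (forall a n x, f (tp3 a n x) = g (tp3 a n x)) -> f = g.
Proof.
by move=> h; apply: endo_ext; apply: tens3_eq => //; apply: efun_linear.
Qed.

Lemma op3_comm f g h f' g' h' (a b c : bool) :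
    linear f -> linear g -> linear h -> linear f' -> linear g' -> linear h' ->
    (forall x, f (f' x) = (-1) ^+ a *: f' (f x)) ->
    (forall x, g (g' x) = (-1) ^+ b *: g' (g x)) ->
    (forall x, h (h' x) = (-1) ^+ c *: h' (h x)) ->
  op3 f g h * op3 f' g' h' = (-1) ^+ (a (+) (b (+) c)) *: (op3 f' g' h' * op3 f g h).
Proof.
move=> lf lg lh lf' lg' lh' ef eg eh; apply: endo3_ext => x y z.
rewrite endoZ !endoM !op3E // ef eg eh.
rewrite (linZ _ _ (tp3_linear1 _ _)) (linZ _ _ (tp3_linear2 _ _)) (linZ _ _ (tp3_linear3 _ _)).
by rewrite !scalerA -!signr_addb addbA.
Qed.

End TripleOperators.

(** * The contraction operator *)

Section OddSum.
Opaque tau.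
Variables (k : fieldType) (E : algType k) (ep : E).
Hypothesis epep : ep * ep = 1.
Hypothesis char0 : [pchar k] =i pred0.
Notation tau := (tau ep).
Notation ad_odd := (ad_odd ep).
(* nn j behaves as the derivative with respect to r j. *)
Variables (l r sig : nat -> E) (e : nat -> bool) (nn : nat -> E) (s : nat).
Notation lop := (letter_op l r sig).
Notation lpar := (letter_parity e).
Hypothesis lop_comm : forall x y,
  lop x * lop y = (-1) ^+ (lpar x && lpar y) *: (lop y * lop x).
Hypothesis tau_lop : forall x, tau (lop x) = (-1) ^+ lpar x *: lop x.
Hypothesis tau_nn : forall j, tau (nn j) = (-1) ^+ e j *: nn j.
Hypothesis nn_nn : forall i j, nn i * nn j = (-1) ^+ (e i && e j) *: (nn j * nn i).
Hypothesis nn_l : forall i j, nn i * l j = (-1) ^+ (e i && e j) *: (l j * nn i).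
Hypothesis nn_sig : forall i j, nn i * sig j = (-1) ^+ (e i && ~~ e j) *: (sig j * nn i).
Hypothesis nn_r : forall i j, (j < s)%N ->
  nn i * r j = (i == j)%:R + (-1) ^+ (e i && e j) *: (r j * nn i).
Hypothesis big0 : forall j, (s <= j)%N -> r j = 0 /\ sig j = 0.

(** The de Rham differential with respect to the right letters: it exchanges r
    j for sig j. *)
Definition gam_sum : E := \sum_(j < s) sig j * nn j.
Notation gam := gam_sum.

Let tau_sig j : tau (sig j) = (-1) ^+ (~~ e j) *: sig j := tau_lop (SS j).

Lemma tau_term j : tau (sig j * nn j) = - (sig j * nn j).
Proof.
rewrite tauM // tau_sig tau_nn -scalerAl -scalerAr scalerA -signr_addb.
by case: (e j); rewrite /= expr1 scaleN1r.
Qed.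

Lemma tau_gam_sum : tau gam = - gam.
Proof.
rewrite /gam (big_morph tau (fun x y => linD x y (tau_linear ep)) (lin0 (tau_linear ep))).
by rewrite -sumrN; apply: eq_bigr => j _; apply: tau_term.
Qed.

Lemma term_anticomm i j :
  (sig i * nn i) * (sig j * nn j) = - ((sig j * nn j) * (sig i * nn i)).
Proof.
have Q x y z u (a : bool) : y * z = (-1) ^+ a *: (z * y) ->
    (x * y) * (z * u) = (-1) ^+ a *: (x * z * (y * u)) :> E.
  by move=> h; rewrite -mulrA (mulrA y) h -scalerAl -scalerAr !mulrA.
rewrite (Q _ _ _ _ _ (nn_sig i j)) (Q _ _ _ _ _ (nn_sig j i)).
have := lop_comm (SS i) (SS j); rewrite /= => ->.
rewrite (nn_nn i j) -scalerAl -scalerAr !scalerA -!signr_addb -scaleN1r scalerA.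
congr (_ *: _); rewrite -[-1](expr1 (-1)) -(signr_addb _ true).
by case: (e i); case: (e j).
Qed.

Lemma gam_sum_sq : gam * gam = 0.
Proof.
apply: (add_self_eq0 char0); rewrite {1 2}/gam.
have E1 : gam * gam = \sum_(i < s) \sum_(j < s) (sig i * nn i) * (sig j * nn j).
  by rewrite mulr_suml; apply: eq_bigr => i _; rewrite mulr_sumr.
have E2 : gam * gam = - (gam * gam).
  rewrite {1}E1 exchange_big E1 /= -sumrN; apply: eq_bigr => i _.
  by rewrite -sumrN; apply: eq_bigr => j _; rewrite term_anticomm.
by rewrite [X in X + _]E2 addNr.
Qed.

Lemma ad_gam_sum X : ad_odd gam X = \sum_(j < s) ad_odd (sig j * nn j) X.
Proof.
have hl := ad_odd_linearl ep X.
exact: (big_morph (ad_odd ^~ X) (fun x y => linD x y hl) (lin0 hl)).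
Qed.

Lemma gam_sum_l j : ad_odd gam (l j) = 0.
Proof.
rewrite ad_gam_sum big1 // => i _; rewrite /ad_odd.
have := tau_lop (LL j); rewrite /= => ->.
rewrite -mulrA nn_l -scalerAr (mulrA (sig i)); have := lop_comm (SS i) (LL j); rewrite /= => ->.
rewrite -!scalerAl -mulrA scalerA -signr_addb.
by case: (e i); case: (e j); rewrite /= ?expr0 ?expr1 subrr.
Qed.

Lemma gam_sum_sig j : ad_odd gam (sig j) = 0.
Proof.
rewrite ad_gam_sum big1 // => i _; rewrite /ad_odd tau_sig.
rewrite -mulrA nn_sig -scalerAr (mulrA (sig i)); have := lop_comm (SS i) (SS j); rewrite /= => ->.
rewrite -!scalerAl -mulrA scalerA -signr_addb.
by case: (e i); case: (e j); rewrite /= ?expr0 ?expr1 subrr.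
Qed.

Lemma gam_sum_r j : ad_odd gam (r j) = sig j.
Proof.
have [sj|js] := leqP s j.
  by have [-> ->] := big0 sj; rewrite (lin0 (ad_odd_linear ep gam)).
have T i : ad_odd (sig i * nn i) (r j) = sig i * (i == j)%:R.
  rewrite /ad_odd; have := tau_lop (RR j); rewrite /= => ->.
  rewrite -mulrA nn_r // mulrDr -scalerAr (mulrA (sig i)); have := lop_comm (SS i) (RR j); rewrite /= => ->.
  rewrite -!scalerAl -mulrA scalerA -signr_addb -addrA.
  by case: (e i); case: (e j); rewrite /= ?expr0 ?expr1 subrr addr0.
rewrite ad_gam_sum (bigD1 (Ordinal js)) //= T eqxx mulr1 big1 ?addr0 // => i hi.
rewrite T; have -> : (nat_of_ord i == j) = false; last by rewrite mulr0.
by apply: contraNF hi => /eqP ij; apply/eqP/val_inj.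
Qed.

End OddSum.

(** * From right letters to left letters *)

Definition is_LL x := if x is LL _ then true else false.
Definition is_RR x := if x is RR _ then true else false.
Definition nL (w : seq letter) := count is_LL w.
Definition nR (w : seq letter) := count is_RR w.

Section Descent.
Opaque tau.
Variables (k : fieldType) (char0 : [pchar k] =i pred0).
Variables (K : lmodType k) (x0 : K) (hx0 : x0 != 0).
Notation E := (endo hx0).
Variable ep : E.
Hypothesis epep : ep * ep = 1.
Notation tau := (tau ep).
Notation ad_odd := (ad_odd ep).
Variables (l r sig : nat -> E) (e : nat -> bool).
Notation lop := (letter_op l r sig).
Notation wop := (word_op l r sig).
Notation lpar := (letter_parity e).
Notation W := (words l r sig predT).
Hypothesis lop_comm : forall x y,
  lop x * lop y = (-1) ^+ (lpar x && lpar y) *: (lop y * lop x).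
Hypothesis tau_lop : forall x, tau (lop x) = (-1) ^+ lpar x *: lop x.

Definition WF i j : set E :=
  lspan [set X | exists w, [/\ (i <= nL w)%N, (j <= nR w)%N & X = wop w]].

Let hWF i j : submod (WF i j). Proof. exact: lspan_submod. Qed.

Lemma WF_gen w i j : (i <= nL w)%N -> (j <= nR w)%N -> WF i j (wop w).
Proof. by move=> h h'; apply: lspan_gen; exists w. Qed.

Lemma WF_mono i j i' j' : (i' <= i)%N -> (j' <= j)%N -> WF i j `<=` WF i' j'.
Proof.
move=> hi hj; apply: lspan_sub => _ [w [h h' ->]].
by apply: WF_gen; [apply: leq_trans h|apply: leq_trans h'].
Qed.

Lemma WF_mul i j i' j' X Y : WF i j X -> WF i' j' Y -> WF (i + i') (j + j') (X * Y).
Proof.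
apply: lspan_bilin => [y|x||_ _ [w [h h' ->]] [v [g g' ->]]].
- exact: mul_linear_l.
- exact: mul_linear_r.
- exact: hWF.
by rewrite -wop_cat; apply: WF_gen; rewrite /nL /nR count_cat leq_add.
Qed.

Lemma WF_tau i j X : WF i j X -> WF i j (tau X).
Proof.
apply: lspan_lin => [||_ [w [h h' ->]]]; [exact: tau_linear|exact: hWF|].
by rewrite (tau_wop epep tau_lop); apply: (submodZ _ (hWF i j)); apply: WF_gen.
Qed.

Lemma W_WF X : W X -> WF 0 0 X.
Proof. by apply: lspan_sub => _ [w [_ ->]]; apply: WF_gen. Qed.

Lemma WF_W i j X : WF i j X -> W X.
Proof. by apply: lspan_sub => _ [w [_ _ ->]]; apply: W_gen; rewrite all_predT. Qed.

(** Applied to the brackets with d, g and theta, each of which shifts the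
    filtration by letters in its own way; U is the shifted filtration. *)
Lemma word_derivation (U : nat -> nat -> set E) (T tw : E -> E) :
    (forall i j, submod (U i j)) ->
    (forall i j i' j' X Y, WF i j X -> U i' j' Y -> U (i + i')%N (j + j')%N (X * Y)) ->
    (forall i j i' j' X Y, U i j X -> WF i' j' Y -> U (i + i')%N (j + j')%N (X * Y)) ->
    (forall i j i' j', (i' <= i)%N -> (j' <= j)%N -> U i j `<=` U i' j') ->
    linear T -> T 1 = 0 ->
    (forall X Y, T (X * Y) = T X * Y + tw X * T Y) ->
    (forall i j X, WF i j X -> WF i j (tw X)) ->
    (forall x, U (nat_of_bool (is_LL x)) (nat_of_bool (is_RR x)) (T (lop x))) ->
  forall i j X, WF i j X -> U i j (T X).
Proof.
move=> hU Ul Ur Um lT T1 TM htw hT i j.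
apply: lspan_lin => [//||_ [w [hi hj ->]]]; first exact: hU.
apply: (Um _ _ _ _ hi hj) => {i j hi hj}.
elim: w => [|x w IH]; first by rewrite /word_op big_nil T1; case: (hU 0%N 0%N).
rewrite wop_cons TM; apply: (submodD (hU _ _)).
  by apply: (Ur _ _ (nL w) (nR w)); [exact: hT|exact: WF_gen].
apply: (Ul _ _ (nL w) (nR w)) => //; apply: htw.
by rewrite -wop1; apply: WF_gen; rewrite /= addn0.
Qed.

Variables (g d theta : E) (D : nat -> seq (k * seq nat)).
Hypothesis d_sq : d * d = 0.
Hypothesis thetaE : theta = d * g + g * d.
Hypothesis hD : forall j, words_below j (D j).
Hypothesis d_l : forall j, ad_odd d (l j) = evalw l (D j).
Hypothesis d_r : forall j, ad_odd d (r j) = evalw r (D j).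
Hypothesis d_sig : forall j, W (ad_odd d (sig j)).
Hypothesis g_l : forall j, ad_odd g (l j) = 0.
Hypothesis g_r : forall j, ad_odd g (r j) = sig j.
Hypothesis g_sig : forall j, ad_odd g (sig j) = 0.
Hypothesis th_l : forall j, ad_even theta (l j) = 0.
Hypothesis th_r : forall j, words_lr l r sig predT (ad_even theta (r j)).
Hypothesis th_sig : forall j, ad_even theta (sig j) = sig j.
Hypothesis eig_rl : forall j, eig (ad_even theta) true [set 0] (r j - l j).
Hypothesis eig_words : forall X, W X -> eig (ad_even theta) false [set 0] X.

Lemma evalw_letters (c : nat -> letter) (ic jc : nat) (f : nat -> E) j :
  (forall a, f a = lop (c a)) ->
  (forall a, nat_of_bool (is_LL (c a)) = ic /\ nat_of_bool (is_RR (c a)) = jc) -> WF ic jc (evalw f (D j)).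
Proof.
move=> fE hc; rewrite /evalw big_seq; apply: (big_ind (WF ic jc)) => [|X Y|p pD].
- by case: (hWF ic jc).
- exact: submodD.
apply: (submodZ _ (hWF _ _)); have /allP/(_ p pD)/andP[] := hD j.
have -> : \prod_(a <- p.2) f a = wop (map c p.2).
  by rewrite /word_op big_map; apply: eq_bigr => a _.
case: p.2 => // a w _ _; apply: WF_gen; rewrite /= ?(proj1 (hc a)) ?(proj2 (hc a)) leq_addr //.
Qed.

Lemma d_WF i j X : WF i j X -> WF i j (ad_odd d X).
Proof.
apply: (@word_derivation WF (ad_odd d) tau) => [//||||||||x].
- by move=> *; apply: WF_mul.
- by move=> *; apply: WF_mul.
- by move=> *; apply: WF_mono.
- exact: ad_odd_linear.
- exact: ad_odd1.
- by move=> X' Y; apply: ad_oddM.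
- exact: WF_tau.
- case: x => a /=.
  + by rewrite d_l; apply: (evalw_letters (c := LL)).
  + by rewrite d_r; apply: (evalw_letters (c := RR)).
  + apply: W_WF; exact: d_sig.
Qed.

Lemma g_WF i j X : WF i j X -> WF i j.-1 (ad_odd g X).
Proof.
apply: (@word_derivation (fun i j => WF i j.-1) (ad_odd g) tau) => [//||||||||x].
- move=> a b a' b' X1 Y h h'; apply: WF_mono (WF_mul h h') => //.
  by case: b' {h'} => [|b'] /=; rewrite ?addn0 ?leq_pred // addnS.
- move=> a b a' b' X1 Y h h'; apply: WF_mono (WF_mul h h') => //.
  by case: b {h} => [|b] //=; exact: leq_pred.
- by move=> a b a' b' ha hb; apply: WF_mono => //; rewrite -!subn1 leq_sub2r.
- exact: ad_odd_linear.
- exact: ad_odd1.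
- by move=> X' Y; apply: ad_oddM.
- exact: WF_tau.
- case: x => a /=.
  + by rewrite g_l; case: (hWF 1 0).
  + by rewrite g_r; apply: W_WF; apply: (W_lop (x := SS a)).
  + by rewrite g_sig; case: (hWF 0 0).
Qed.

Definition WF' i j : set E := setaddm (WF i j) (WF i.+1 0).
Let hWF' i j : submod (WF' i j). Proof. exact: setaddm_submod. Qed.

Lemma th_WF i j X : WF i j X -> WF' i j (ad_even theta X).
Proof.
apply: (@word_derivation WF' (ad_even theta) idfun) => [//||||||||x] //.
- move=> a b a' b' X1 Y h [y [z [hy hz ->]]]; exists (X1 * y), (X1 * z).
  rewrite mulrDr; split=> //; first exact: WF_mul.
  by have := WF_mul h hz; rewrite addnS; apply: WF_mono.
- move=> a b a' b' X1 Y [y [z [hy hz ->]]] h; exists (y * Y), (z * Y).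
  rewrite mulrDl; split=> //; first exact: WF_mul.
  by have := WF_mul hz h; rewrite addSn; apply: WF_mono.
- move=> a b a' b' ha hb _ [y [z [hy hz ->]]]; exists y, z; split=> //.
    exact: WF_mono hy.
  exact: WF_mono hz.
- exact: ad_even_linear.
- by rewrite /ad_even mulr1 mul1r subrr.
- by move=> X' Y; apply: ad_evenM.
- case: x => a /=.
  + by rewrite th_l; case: (hWF' 1 0).
  + move: (th_r a); apply: lspan_min => // _ [w [_ hw ->]].
    have : (0 < nL w)%N || (0 < nR w)%N.
      by elim: w hw => // -[] a' w IH //= _; rewrite /nL /nR /= ?orbT.
    case/orP => h; first by apply: setaddmr => //; apply: WF_gen.
    by apply: setaddml => //; apply: WF_gen.
  + by rewrite th_sig; apply: setaddml => //; apply: W_WF; apply: (W_lop (x := SS a)).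
Qed.

(* B is the space of the generators of K on which g vanishes; the last
   hypothesis is an induction principle along d. *)
Variable B : set K.
Hypothesis B_g : forall b, B b -> g b = 0.
Hypothesis B_d : forall b, B b ->
  lspan [set x | exists w b', B b' /\ x = wop (map RR w) b'] (d b).
Hypothesis B_closure : forall S : set K, submod S ->
  (forall b, B b ->
     lspan [set x | exists w b', [/\ B b', S b' & x = wop (map RR w) b']] (d b) -> S b) ->
  B `<=` S.

Definition FK i j : set K := lspan [set x | exists X b, [/\ WF i j X, B b & x = X b]].
Let hF i j : submod (FK i j). Proof. exact: lspan_submod. Qed.

Lemma FK_gen i j X b : WF i j X -> B b -> FK i j (X b).
Proof. by move=> hX hb; apply: lspan_gen; exists X, b. Qed.

Lemma FK_mono i j i' j' : (i' <= i)%N -> (j' <= j)%N -> FK i j `<=` FK i' j'.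
Proof.
move=> hi hj; apply: lspan_sub => _ [X [b [h h' ->]]].
by apply: FK_gen => //; apply: WF_mono h.
Qed.

Lemma FK_act i j i' j' X v : WF i j X -> FK i' j' v -> FK (i + i') (j + j') (X v).
Proof.
move=> hX; apply: (lspan_lin (efun_linear X)) => // _ [Y [b [hY hb ->]]].
by rewrite -endoM; apply: FK_gen => //; apply: WF_mul.
Qed.

Lemma d_base b : B b -> FK 0 0 (d b).
Proof.
move=> hb; move: (B_d hb); apply: lspan_sub => _ [w [b' [hb' ->]]].
by apply: FK_gen => //; apply: WF_gen.
Qed.

Lemma ad_oddE (T X : E) v : T (X v) = ad_odd T X v + tau X (T v).
Proof. by rewrite /ad_odd endoD endoN !endoM subrK. Qed.

Lemma d_FK i j v : FK i j v -> FK i j (d v).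
Proof.
apply: (lspan_lin (efun_linear d)) => // _ [X [b [hX hb ->]]].
rewrite ad_oddE; apply: (submodD (hF _ _)); first by apply: FK_gen => //; exact: d_WF.
by rewrite -[i]addn0 -[j]addn0; apply: FK_act; [apply: WF_tau|apply: d_base].
Qed.

Lemma g_FK i j v : FK i j v -> FK i j.-1 (g v).
Proof.
apply: (lspan_lin (efun_linear g)) => // _ [X [b [hX hb ->]]].
rewrite ad_oddE (B_g hb) (lin0 (efun_linear _)) addr0.
by apply: FK_gen => //; exact: g_WF.
Qed.

Lemma theta_base b : B b -> theta b = g (d b).
Proof. by move=> hb; rewrite thetaE endoD !endoM (B_g hb) (lin0 (efun_linear _)) add0r. Qed.

Let FK' i j : set K := setaddm (FK i j) (FK i.+1 0).

Lemma theta_FK i j v : FK i j v -> FK' i j (theta v).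
Proof.
apply: (lspan_lin (efun_linear theta)); first exact: setaddm_submod.
move=> _ [X [b [hX hb ->]]].
have -> : theta (X b) = ad_even theta X b + X (theta b).
  by rewrite /ad_even endoD endoN !endoM subrK.
have [y [z [hy hz ->]]] := th_WF hX; apply: submodD; first exact: setaddm_submod.
  by exists (y b), (z b); split; [apply: FK_gen|apply: FK_gen|].
apply: setaddml => //; rewrite -[i]addn0 -[j]addn0; apply: FK_act => //.
rewrite theta_base //; exact: (g_FK (d_base hb)).
Qed.

Let lth : linear theta := efun_linear theta.
Let z0 : submod [set (0 : K)]. Proof. exact: submod_zero. Qed.

Let hE0 b : submod (eig theta b [set 0]).
Proof. by apply: eig_submod => // v ->; rewrite /= (lin0 lth). Qed.

Lemma eig_act bb X v : eig (ad_even theta) bb [set 0] X -> eig theta false [set 0] v ->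
  eig theta bb [set 0] (X v).
Proof.
apply: (@eig_bilinear k _ _ _ (ad_even theta) theta theta (fun X v => (X : E) v)) => //.
- exact: ad_even_linear.
- by move=> Y; apply: efun_linear.
- by move=> Y u; rewrite /ad_even endoD endoN !endoM subrK.
Qed.

(** By induction along d: theta b = g (d b) is a combination of words applied
    to the generators that precede b. *)
Lemma eig_base b X : B b -> W X -> eig theta false [set 0] (X b).
Proof.
move=> hb; move: X; pose S : set K := [set v | forall X, W X -> eig theta false [set 0] (X v)].
suff : B `<=` S by move/(_ _ hb) => h X; exact: h.
apply: B_closure => [|{}b {}hb hd X hX].
  split=> [X _|a u v hu hv X hX].
    by rewrite (lin0 (efun_linear X)); case: (hE0 false).
  by rewrite efun_linear; case: (hE0 false) => _; apply; [apply: hu|apply: hv].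
apply: eig_act; first exact: eig_words.
apply: (@eig_cons _ _ theta false [set 0] 0) => //; rewrite scale0r subr0 theta_base //.
move: hd; apply: (lspan_lin (efun_linear g)); first exact: hE0.
move=> _ [w [b' [hb' Sb' ->]]].
rewrite ad_oddE (B_g hb') (lin0 (efun_linear _)) addr0; apply: Sb'.
by apply: (WF_W (i := 0) (j := 0)); apply: (@g_WF 0 0); apply: WF_gen.
Qed.

Hypothesis direct : forall i j v, FK i j v -> FK i.+1 0 v -> FK i.+1 j v.

Lemma front_RR w : (0 < nR w)%N ->
  exists a c w', [/\ wop w = c *: (r a * wop w'), nL w' = nL w & (nR w').+1 = nR w].
Proof.
elim: w => // x w IH /=; case: (boolP (is_RR x)) => hx.
  case: x hx => // a _ _; exists a, 1, w; rewrite scale1r wop_cons /=; split=> //.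
rewrite add0n => /IH[a [c [w' [h1 h2 h3]]]].
exists a, ((-1) ^+ (lpar x && e a) * c), (x :: w').
rewrite !wop_cons /= h1 h2 -h3 (negbTE hx); split=> //.
have := lop_comm x (RR a); rewrite /= => h.
by rewrite -scalerAr mulrA h -scalerAl !scalerA -mulrA (mulrC c).
Qed.

(** A right letter is the sum of r a - l a, on which theta has positive
    eigenvalues, and of a left letter. *)
Lemma eig_FK i j v : FK i j.+1 v -> eig theta true (FK i.+1 0) v.
Proof.
have Dth u : FK i.+1 0 u -> FK i.+1 0 (theta u).
  move=> /theta_FK; apply: setaddm_min => //.
  exact: FK_mono.
have hE : submod (eig theta true (FK i.+1 0)) by exact: eig_submod.
apply: lspan_min => // _ [X [b [hX hb ->]]].
move: X hX; apply: lspan_lin => // _ [w [hi hj ->]].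
have [|a [c [w' [-> h1 h2]]]] := @front_RR w; first by apply: leq_trans hj.
rewrite endoZ; apply: (submodZ _ hE); rewrite endoM.
have -> : r a (wop w' b) = (r a - l a) (wop w' b) + l a (wop w' b).
  by rewrite endoD endoN subrK.
have hw' : WF i 0 (wop w') by apply: WF_gen; rewrite ?h1.
apply: (submodD hE).
  apply: (@eig_mod _ _ _ _ [set 0]) => [_ -> |]; first by case: (hF i.+1 0).
  apply: eig_act => //; apply: eig_base => //; exact: WF_W hw'.
exists [::] => //=; rewrite -add1n; apply: (@FK_act 1 0 i 0); last exact: FK_gen.
by have := @WF_gen [:: LL a] 1 0 isT isT; rewrite wop1.
Qed.

(** Modulo one more left letter, t = theta v = d (g v) for some v, because
    theta is invertible; and g removes one right letter from v. *)
Lemma descent_step i j t : FK i j.+1 t -> d t = 0 ->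
  exists y, FK i j y /\ FK i.+1 j (t - d y).
Proof.
move=> ht dt; have hD1 : submod (FK i.+1 0) by [].
have dth v : d v = 0 -> theta v = d (g v).
  by move=> h; rewrite thetaE endoD !endoM h (lin0 (efun_linear g)) addr0.
have dd v : d (d v) = 0 by rewrite -endoM d_sq.
pose S : set K := FK' i j.+1 `&` [set v | d v = 0].
have hS : submod S.
  apply: submodI; first exact: setaddm_submod.
  exact: (submod_ker (efun_linear d)).
have Sth v : S v -> S (theta v).
  move=> [hv dv]; split; last by rewrite /= dth.
  case: hv => y [z [hy hz ->]]; rewrite (linD _ _ lth).
  apply: submodD; [exact: setaddm_submod|exact: theta_FK|].
  apply: setaddmr => //; move: (theta_FK hz); apply: setaddm_min => //.
  exact: FK_mono.
have St : S t by split=> //; apply: setaddml.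
have [v' [[hv dv] hD']] := eig_inverse lth char0 hS hD1 Sth St (eig_FK ht).
case: hv dv hD' => v1 [v2 [h1 h2 ->]] dv hD'.
have hg1 : FK i j (g v1) by exact: (g_FK h1).
exists (g v1); split=> //; apply: direct.
  apply: (submodB (hF _ _)); last exact: d_FK.
  by apply: FK_mono ht => //.
have -> : t - d (g v1) = (t - theta (v1 + v2)) + d (g v2).
  rewrite (dth _ dv) (linD _ _ (efun_linear g)) (linD _ _ (efun_linear d)).
  by rewrite opprD addrA addrNK.
apply: (submodD hD1) => //; apply: d_FK; exact: (g_FK h2).
Qed.

(** Each of the a steps trades a right letter for a left letter. *)
Lemma descent a b t : FK 0 (a + b) t -> d t = 0 ->
  exists y t', [/\ FK 0 b y, FK a b t', d t' = 0 & t = t' + d y].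
Proof.
have dd v : d (d v) = 0 by rewrite -endoM d_sq.
suff H i : (i <= a)%N -> FK 0 (a + b) t -> d t = 0 ->
    exists y t', [/\ FK 0 b y, FK i (a - i + b) t', d t' = 0 & t = t' + d y].
  by move=> h1 h2; have := H a (leqnn a) h1 h2; rewrite subnn.
elim: i => [_|i IH ia] ht dt.
  exists 0, t; rewrite subn0 (lin0 (efun_linear d)) addr0; split=> //; by case: (hF 0 b).
have [y [t' [hy ht' dt' ->]]] := IH (ltnW ia) ht dt.
have e1 : (a - i + b = (a - i.+1 + b).+1)%N by rewrite -addSn -subSn // subSS.
rewrite e1 in ht'; have [z [hz hz']] := descent_step ht' dt'.
exists (y + z), (t' - d z); split=> //.
- apply: (submodD (hF _ _)) => //; apply: FK_mono hz => //; exact: leq_addl.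
- by rewrite (linB _ _ (efun_linear d)) dt' dd subr0.
- by rewrite (linD _ _ (efun_linear d)) [d y + _]addrC addrA subrK.
Qed.

End Descent.

(** * Descent in a Koszul module *)

Section ListWords.
Opaque tau tmap tens tp tp3 ad_odd.
Variables (k : fieldType) (L : cdga k) (N : dgmod L) (ws : nat -> L) (G : set N).

Definition list_word (v : seq nat) : L := \prod_(i <- v) ws i.
Definition list_words i : set L :=
  lspan [set a | exists v, (i <= size v)%N /\ a = list_word v].
Definition list_mod j : set N :=
  lspan [set n | exists v y, [/\ (j <= size v)%N, G y & n = act (list_word v) y]].

Lemma list_words_submod i : submod (list_words i). Proof. exact: lspan_submod. Qed.
Lemma list_mod_submod j : submod (list_mod j). Proof. exact: lspan_submod. Qed.

Lemma list_mod_mono i j : (i <= j)%N -> list_mod j `<=` list_mod i.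
Proof.
move=> ij; apply: lspan_sub => _ [v [y [hv hy ->]]].
by apply: lspan_gen; exists v, y; split=> //; apply: leq_trans hv.
Qed.

Lemma list_word_cat u v : list_word (u ++ v) = list_word u * list_word v.
Proof. by rewrite /list_word big_cat. Qed.

Lemma list_mod_act i j a n : list_words i a -> list_mod j n -> list_mod (i + j) (act a n).
Proof.
apply: lspan_bilin => [y|x||_ _ [u [hu ->]] [v [y [hv hy ->]]]].
- exact: act_linearl.
- exact: act_linearr.
- exact: lspan_submod.
rewrite -actM -list_word_cat; apply: lspan_gen; exists (u ++ v), y.
by rewrite size_cat leq_add.
Qed.

Lemma list_words1 : list_words 0 1.
Proof. by apply: lspan_gen; exists [::]; rewrite /list_word big_nil. Qed.

Lemma list_mod0 y : G y -> list_mod 0 y.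
Proof.
by move=> hy; apply: lspan_gen; exists [::], y; rewrite /list_word big_nil act1.
Qed.

End ListWords.

Section KoszulDescent.
Opaque tau tmap tens tp tp3 ad_odd.
Variables (k : fieldType) (char0 : [pchar k] =i pred0).
Variables (L : cdga k) (N : dgmod L) (F : lmodType k).
Notation K := (tens L (tens N F)).
Variables (x0 : K) (hx0 : x0 != 0).
Notation E := (endo hx0).
Variables (s : nat) (ws : nat -> L) (e : nat -> bool) (D : nat -> seq (k * seq nat)).
Variables (o : F) (sg df : nat -> F -> F) (vac : F -> k^o).
Variables (G : set N).

Variable ep : E.
Hypothesis epep : ep * ep = 1.
Notation tau := (tau ep).
Notation twist := (twist ep).
Notation ad_odd := (ad_odd ep).
Variables (l r sig dd : nat -> E) (A : L -> E).
Notation lop := (letter_op l r sig).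
Notation wop := (word_op l r sig).
Notation lpar := (letter_parity e).
Notation W := (words l r sig).
Notation lw := (list_words ws).
Notation J := (list_mod ws G).
Notation lword := (list_word ws).

(* The letters ws j act on L by l j and on N by r j; sig j and dd j act on F,
   and A is the action of L on K. The differentials of the elements of G are
   combinations of words in the letters applied to G. *)
Hypothesis ws_eps : forall j, eps (ws j) = (-1) ^+ e j *: ws j.
Hypothesis hD : forall j, words_below j (D j).
Hypothesis adws : forall j, ad (ws j) = evalw ws (D j).
Hypothesis G_meps : forall y, G y -> G (meps y).
Hypothesis G_md : forall y, G y -> J 0 (md y).
Hypothesis G_closure : forall S : set N, submod S ->
  (forall y, G y ->
     lspan [set x | exists v y', [/\ G y', S y' & x = act (lword v) y']] (md y) -> S y) ->
  G `<=` S.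
Hypothesis sg_linear : forall j, linear (sg j).
Hypothesis F_span : forall x, lspan [set y | exists w, y = foldr sg o w] x.
Hypothesis df_o : forall j, df j o = 0.
Hypothesis df_sg : forall i j x, i != j ->
  df i (sg j x) = (-1) ^+ (~~ e i && ~~ e j) *: sg j (df i x).
Hypothesis df_sgj : forall j x, (j < s)%N -> df j (sg j x) = x + (-1) ^+ (~~ e j) *: sg j (df j x).
Hypothesis sg_sg : forall i j x, sg i (sg j x) = (-1) ^+ (~~ e i && ~~ e j) *: sg j (sg i x).
Hypothesis sg_big : forall j x, (s <= j)%N -> sg j x = 0.
Hypothesis vac_o : vac o = 1.

Let ew (b : bool) (a : L) := if b then eps a else a.
Let mw (b : bool) (n : N) := if b then meps n else n.
Hypothesis lE : forall j a n x, l j (tp3 a n x) = tp3 (ws j * a) n x.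
Hypothesis rE : forall j a n x, r j (tp3 a n x) = tp3 (ew (e j) a) (act (ws j) n) x.
Hypothesis sE : forall j a n x,
  sig j (tp3 a n x) = tp3 (ew (~~ e j) a) (mw (~~ e j) n) (sg j x).
Hypothesis ddE : forall j a n x,
  dd j (tp3 a n x) = tp3 (ew (~~ e j) a) (mw (~~ e j) n) (df j x).
Hypothesis AE : forall b a n x, A b (tp3 a n x) = tp3 (b * a) n x.

Hypothesis lop_comm : forall x y,
  lop x * lop y = (-1) ^+ (lpar x && lpar y) *: (lop y * lop x).
Hypothesis tau_lop : forall x, tau (lop x) = (-1) ^+ lpar x *: lop x.
Variables (d0 g d theta : E) (om : nat -> E).
Hypothesis d0E : forall a n x, d0 (tp3 a n x) = tp3 (ad a) n x + tp3 (eps a) (md n) x.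
Hypothesis dE : d = d0 + \sum_(j < s) om j * dd j.
Hypothesis d_sq : d * d = 0.
Hypothesis om_below : forall j, (j < s)%N -> W (below j.+1) (om j).
Hypothesis om_sig : forall j, (j < s)%N -> W (sig_below j) (om j).
Hypothesis tau_om : forall j, (j < s)%N -> tau (om j) = (-1) ^+ e j *: om j.

Variable mu : K -> N.
Hypothesis mu_linear : linear mu.
Hypothesis muE : forall a n x, mu (tp3 a n x) = vac x *: act a n.
Hypothesis mu_om : forall j v, (j < s)%N -> mu (om j v) = 0.

Hypothesis A_lop : forall (c : bool) a x, eps a = (-1) ^+ c *: a ->
  A a * lop x = (-1) ^+ (c && lpar x) *: (lop x * A a).
Hypothesis A_dd : forall (c : bool) a j, eps a = (-1) ^+ c *: a ->
  dd j * A a = (-1) ^+ (c && ~~ e j) *: (A a * dd j).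

Hypothesis thetaE : theta = d * g + g * d.
Hypothesis d_l : forall j, ad_odd d (l j) = evalw l (D j).
Hypothesis d_r : forall j, ad_odd d (r j) = evalw r (D j).
Hypothesis d_sig : forall j, W predT (ad_odd d (sig j)).
Hypothesis g_l : forall j, ad_odd g (l j) = 0.
Hypothesis g_r : forall j, ad_odd g (r j) = sig j.
Hypothesis g_sig : forall j, ad_odd g (sig j) = 0.
Hypothesis th_l : forall j, ad_even theta (l j) = 0.
Hypothesis th_r : forall j, words_lr l r sig predT (ad_even theta (r j)).
Hypothesis th_sig : forall j, ad_even theta (sig j) = sig j.
Hypothesis eig_rl : forall j, eig (ad_even theta) true [set 0] (r j - l j).
Hypothesis eig_words : forall X, W predT X -> eig (ad_even theta) false [set 0] X.
Hypothesis g_base : forall y, G y -> g (tp3 1 y o) = 0.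

Let hJ j : submod (J j). Proof. exact: list_mod_submod. Qed.
Let hlw j : submod (lw j). Proof. exact: list_words_submod. Qed.

Let ewP (S : set L) b a : (forall a, S a -> S (eps a)) -> S a -> S (ew b a).
Proof. by case: b => //= h; apply: h. Qed.
Let mwP (S : set N) b a : (forall a, S a -> S (meps a)) -> S a -> S (mw b a).
Proof. by case: b => //= h; apply: h. Qed.

Lemma eps_lword v : exists c : bool, eps (lword v) = (-1) ^+ c *: lword v.
Proof.
elim: v => [|j v [c IH]]; first by exists false; rewrite /list_word big_nil eps1 scale1r.
exists (e j (+) c); rewrite /list_word big_cons epsM ws_eps.
by rewrite -/(lword v) IH -scalerAl -scalerAr scalerA -signr_addb.
Qed.

Lemma lw_eps i a : lw i a -> lw i (eps a).
Proof.
apply: lspan_lin => [||_ [v [hv ->]]]; [exact: eps_linear|exact: hlw|].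
have [c ->] := eps_lword v; apply: (submodZ _ (hlw i)).
by apply: lspan_gen; exists v.
Qed.

Lemma J_meps j n : J j n -> J j (meps n).
Proof.
apply: lspan_lin => [||_ [v [y [hv hy ->]]]]; [exact: meps_linear|exact: hJ|].
rewrite meps_act; have [c ->] := eps_lword v.
rewrite (linZ _ _ (act_linearl _)); apply: (submodZ _ (hJ j)).
by apply: lspan_gen; exists v, (meps y); split=> //; apply: G_meps.
Qed.

Lemma lw_mul i j a b : lw i a -> lw j b -> lw (i + j) (a * b).
Proof.
apply: lspan_bilin => [y|x||_ _ [u [hu ->]] [v [hv ->]]].
- exact: mul_linear_l.
- exact: mul_linear_r.
- exact: hlw.
rewrite -list_word_cat; apply: lspan_gen; exists (u ++ v).
by rewrite size_cat leq_add.
Qed.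

Lemma lw_mono i j : (i <= j)%N -> lw j `<=` lw i.
Proof.
move=> ij; apply: lspan_sub => _ [v [hv ->]]; apply: lspan_gen; exists v.
by split=> //; apply: leq_trans hv.
Qed.

Lemma lw_letter j : lw 1 (ws j).
Proof. by apply: lspan_gen; exists [:: j]; rewrite /list_word big_seq1. Qed.

Lemma lw_ad_letter j : lw 1 (ad (ws j)).
Proof.
rewrite adws /evalw big_seq; apply: (big_ind (lw 1)) => [|x y|p pD].
- by case: (hlw 1).
- exact: submodD.
apply: (submodZ _ (hlw 1)); have /allP/(_ p pD)/andP[h _] := hD j.
by apply: lspan_gen; exists p.2; split=> //; case: p.2 h.
Qed.

Lemma lw_ad i a : lw i a -> lw i (ad a).
Proof.
apply: lspan_lin => [||_ [v [hv ->]]]; [exact: ad_linear|exact: hlw|].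
apply: (lw_mono hv) => {hv}; elim: v => [|j v IH].
  by rewrite /list_word big_nil ad1; case: (hlw 0).
rewrite /list_word big_cons ad_mul -/(lword v) /= -add1n; apply: (submodD (hlw _)).
  by apply: lw_mul; [exact: lw_ad_letter|apply: lspan_gen; exists v].
by apply: lw_mul => //; apply: lw_eps; exact: lw_letter.
Qed.

Lemma J_md j n : J j n -> J j (md n).
Proof.
apply: lspan_lin => [||_ [v [y [hv hy ->]]]]; [exact: md_linear|exact: hJ|].
have lv : lw j (lword v) by apply: lspan_gen; exists v.
rewrite md_actE; apply: (submodD (hJ j)).
  by rewrite -[j]addn0; apply: list_mod_act; [apply: lw_ad|apply: list_mod0].
by rewrite -[j]addn0; apply: list_mod_act; [apply: lw_eps|apply: G_md].
Qed.

Definition base : set K := [set b | exists y, G y /\ b = tp3 1 y o].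
Notation FK := (FK l r sig base).
(** A description of FK by tensors, to which projections of the first factor
    apply. *)
Definition FT i j : set K :=
  lspan [set x | exists a n z, [/\ lw i a, J j n & x = tp3 a n z]].
Let hFT i j : submod (FT i j). Proof. exact: lspan_submod. Qed.
Let hFK i j : submod (FK i j). Proof. exact: lspan_submod. Qed.

Lemma FT_gen i j a n z : lw i a -> J j n -> FT i j (tp3 a n z).
Proof. by move=> h h'; apply: lspan_gen; exists a, n, z. Qed.

Lemma FT_l i j x v : FT i j v -> FT i.+1 j (l x v).
Proof.
apply: (lspan_lin (efun_linear _)) => // _ [a [n [z [ha hn ->]]]].
by rewrite lE; apply: FT_gen => //; rewrite -add1n; apply: lw_mul => //; exact: lw_letter.
Qed.

Lemma FT_r i j x v : FT i j v -> FT i j.+1 (r x v).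
Proof.
apply: (lspan_lin (efun_linear _)) => // _ [a [n [z [ha hn ->]]]].
rewrite rE; apply: FT_gen; first by apply: (@ewP (lw i)) => // b; exact: lw_eps.
by rewrite -add1n; apply: list_mod_act => //; exact: lw_letter.
Qed.

Lemma FT_s i j x v : FT i j v -> FT i j (sig x v).
Proof.
apply: (lspan_lin (efun_linear _)) => // _ [a [n [z [ha hn ->]]]].
rewrite sE; apply: FT_gen; first by apply: (@ewP (lw i)) => // b; exact: lw_eps.
by apply: (@mwP (J j)) => // b; exact: J_meps.
Qed.

Lemma FT_mono i j i' j' : (i' <= i)%N -> (j' <= j)%N -> FT i j `<=` FT i' j'.
Proof.
move=> hi hj; apply: lspan_sub => _ [a [n [z [ha hn ->]]]].
by apply: FT_gen; [exact: (lw_mono hi ha)|exact: (list_mod_mono hj hn)].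
Qed.

Lemma FK_FT i j : FK i j `<=` FT i j.
Proof.
apply: lspan_min => // _ [X [b [hX [y [hy ->]] ->]]].
move: X hX; apply: (lspan_lin (@endo_linearl _ _ _ hx0 _)) => // _ [w [hi hj ->]].
apply: (FT_mono hi hj) => {i j hi hj}; elim: w => [|x w IH].
  rewrite /word_op big_nil; apply: FT_gen; first exact: list_words1.
  exact: list_mod0.
rewrite wop_cons endoM; case: x => j /=.
- exact: FT_l.
- exact: FT_r.
- exact: FT_s.
Qed.

Lemma rword_base v n x : wop (map RR v) (tp3 1 n x) = tp3 1 (act (lword v) n) x.
Proof.
elim: v => [|j v IH]; first by rewrite /word_op /list_word !big_nil act1.
rewrite /= wop_cons endoM IH /= rE /list_word big_cons actM.
by rewrite /ew eps1; case: (e j).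
Qed.

Lemma lword_base v a n x : wop (map LL v) (tp3 a n x) = tp3 (lword v * a) n x.
Proof.
elim: v => [|j v IH]; first by rewrite /word_op /list_word !big_nil mul1r.
by rewrite /= wop_cons endoM IH /= lE /list_word big_cons mulrA.
Qed.

(** The signs are absorbed by the involution of N. *)
Lemma sword_base c y x : exists b : bool,
  wop (map SS c) (tp3 1 (mw b y) x) = tp3 1 y (foldr sg x c).
Proof.
elim: c y => [|j c IH] y; first by exists false; rewrite /word_op big_nil.
have [b hb] := IH (mw (~~ e j) y); exists ((~~ e j) (+) b).
rewrite /= wop_cons endoM.
have mwmw : mw (~~ e j (+) b) y = mw b (mw (~~ e j) y).
  by rewrite /mw; case: (e j); case: b {hb} => //=; rewrite meps_meps.
rewrite mwmw hb /= sE /ew eps1 /mw; case: (e j) => //=.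
by rewrite meps_meps.
Qed.

Lemma FT_FK i j : FT i j `<=` FK i j.
Proof.
apply: lspan_min => // _ [a [n [z [ha hn ->]]]].
move: a ha; apply: (lspan_lin (tp3_linear1 n z)) => // _ [u [hu ->]].
move: n hn; apply: (lspan_lin (tp3_linear2 _ z)) => // _ [v [y [hv hy ->]]].
move: (F_span z); apply: (lspan_lin (tp3_linear3 _ _)) => // _ [c ->].
have [b hb] := sword_base c y o.
have -> : tp3 (lword u) (act (lword v) y) (foldr sg o c) =
    wop (map LL u ++ map RR v ++ map SS c) (tp3 1 (mw b y) o).
  by rewrite !wop_cat !endoM hb rword_base lword_base mulr1.
apply: FK_gen; last by exists (mw b y); split=> //; apply: (@mwP G) => // n; exact: G_meps.
have cL (f : nat -> letter) q : (forall x, is_LL (f x)) -> count is_LL (map f q) = size q.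
  by move=> h; rewrite count_map; elim: q => //= x q ->; rewrite h.
have cR (f : nat -> letter) q : (forall x, is_RR (f x)) -> count is_RR (map f q) = size q.
  by move=> h; rewrite count_map; elim: q => //= x q ->; rewrite h.
apply: WF_gen; rewrite /nL /nR !count_cat.
  by rewrite (cL LL) // (leq_trans hu) // leq_addr.
by rewrite (cR RR) // addnCA (leq_trans hv) // leq_addr.
Qed.

(** The projection of the first factor onto the words of length > i fixes v
    and maps FK i j to FK i.+1 j. *)
Lemma FK_direct i j v : FK i j v -> FK i.+1 0 v -> FK i.+1 j v.
Proof.
move=> /FK_FT h1 /FK_FT h2; apply: FT_FK.
have [psi [lpsi psiS psi1]] := linear_projection (hlw i.+1).
have lT := tmap_linear psi (@idfun (tens N F)).
have lid : linear (@idfun (tens N F)) by [].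
have TE a n z : tmap psi idfun (tp3 a n z) = tp3 (psi a) n z by exact: tmapE.
have <- : tmap psi idfun v = v.
  move: h2; apply: (@lin_ext_span _ _ _ _ (tmap psi idfun) idfun) => // _ [a [n [z [ha hn ->]]]].
  by rewrite TE psi1.
move: h1; apply: (lspan_lin lT) => // _ [a [n [z [ha hn ->]]]].
by rewrite TE; apply: FT_gen.
Qed.

Lemma dd_base j a n : dd j (tp3 a n o) = 0.
Proof. by rewrite ddE df_o (lin0 (tp3_linear3 _ _)). Qed.

Lemma d_base_E n : d (tp3 1 n o) = tp3 1 (md n) o.
Proof.
rewrite dE endoD d0E ad1 eps1 (lin0 (tp3_linear1 _ _)) add0r endo_sum big1 ?addr0 // => j _.
by rewrite endoM dd_base (lin0 (efun_linear _)).
Qed.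

Lemma base_d b : base b ->
  lspan [set x | exists w b', base b' /\ x = wop (map RR w) b'] (d b).
Proof.
move=> [y [hy ->]]; rewrite d_base_E; set S := lspan _.
have hS : submod S by exact: lspan_submod.
move: (G_md hy); apply: (lspan_lin (tp3_linear2 1 o)) => // _ [v [y' [_ hy' ->]]].
rewrite -rword_base; apply: lspan_gen; exists v, (tp3 1 y' o); split=> //.
by exists y'.
Qed.

Lemma base_closure (S : set K) : submod S ->
  (forall b, base b ->
     lspan [set x | exists w b', [/\ base b', S b' & x = wop (map RR w) b']] (d b) -> S b) ->
  base `<=` S.
Proof.
move=> hS h; suff H : G `<=` [set y | S (tp3 1 y o)] by move=> _ [y [/H hy ->]].
apply: G_closure; first exact: (submod_preim (tp3_linear2 1 o) hS).
move=> y hy hd; apply: h; first by exists y.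
rewrite d_base_E; move: hd; apply: (lspan_lin (tp3_linear2 1 o)); first exact: lspan_submod.
move=> _ [v [y' [hy' Sy' ->]]]; rewrite -rword_base; apply: lspan_gen.
by exists v, (tp3 1 y' o); split=> //; exists y'.
Qed.

Lemma mu_md v : mu (d v) = md (mu v).
Proof.
rewrite dE endoD endo_sum (linD _ _ mu_linear).
rewrite (big_morph mu (fun x y => linD x y mu_linear) (lin0 mu_linear)).
rewrite big1 ?addr0 => [|j _]; last by rewrite endoM; apply: mu_om.
move: v; apply: tens3_eq => [a x y|a x y|a n z].
- by rewrite (efun_linear d0) mu_linear.
- by rewrite mu_linear md_linear.
rewrite d0E (linD _ _ mu_linear) !muE (linZ _ _ (@md_linear _ _ _)) md_actE.
by rewrite scalerDr.
Qed.

Lemma mu_A a v : mu (A a v) = act a (mu v).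
Proof.
move: v; apply: tens3_eq => [c x y|c x y|b n z].
- by rewrite (efun_linear (A a)) mu_linear.
- by rewrite mu_linear act_linearr.
by rewrite AE !muE actM (linZ _ _ (act_linearr _)).
Qed.

Lemma mu_FK j v : FK 0 j v -> J j (mu v).
Proof.
move=> /FK_FT; apply: (lspan_lin mu_linear) => // _ [a [n [z [ha hn ->]]]].
by rewrite muE; apply: (submodZ _ (hJ j)); apply: (list_mod_act ha hn).
Qed.

(** The descent is applied to 1 (x) x (x) 1, which mu maps to x. *)
Lemma koszul_descent a b x : J (a + b) x -> md x = 0 ->
  exists t y, [/\ FT a b t, d t = 0, J b y & x = mu t + md y].
Proof.
move=> hx dx.
have ht : FK 0 (a + b) (tp3 1 x o).
  by apply: FT_FK; apply: FT_gen => //; exact: list_words1.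
have dt : d (tp3 1 x o) = 0 by rewrite d_base_E dx (lin0 (tp3_linear2 _ _)).
have Bg v : base v -> g v = 0 by move=> [y [hy ->]]; exact: g_base.
have [y [t [hy ht' dt' e1]]] := descent char0 epep lop_comm tau_lop d_sq
  thetaE hD d_l d_r d_sig g_l g_r g_sig th_l th_r th_sig eig_rl eig_words Bg base_d
  base_closure FK_direct ht dt.
exists t, (mu y); split=> //; [exact: FK_FT|exact: mu_FK|].
by rewrite -mu_md -(linD _ _ mu_linear) -e1 muE vac_o scale1r act1.
Qed.

(* K is a semifree module over L, on the generators 1 (x) N (x) F. *)
Lemma A_linearl v : linear (A ^~ v).
Proof.
move=> c a b; move: v.
apply: (@tens3_eq _ _ _ _ _ (A (c *: a + b)) (fun v => c *: A a v + A b v)) => [||a' n z].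
- exact: efun_linear.
- exact: (linear_add2 (linear_scale2 c (efun_linear _)) (efun_linear _)).
- rewrite !AE mulrDl -scalerAl; exact: (tp3_linear1 n z).
Qed.

Lemma A_mul a b v : A (a * b) v = A a (A b v).
Proof.
move: v; apply: (@tens3_eq _ _ _ _ _ (A (a * b)) (fun v => A a (A b v))) => [||a' n z].
- exact: efun_linear.
- exact: (linear_comp2 (efun_linear _) (efun_linear _)).
- rewrite !AE mulrA; exact: erefl.
Qed.

Lemma A_1 v : A 1 v = v.
Proof.
move: v; apply: (@tens3_eq _ _ _ _ _ (A 1) idfun) => [|//|a' n z]; first exact: efun_linear.
rewrite AE mul1r; exact: erefl.
Qed.

Lemma d0_A a v : d0 (A a v) = A (ad a) v + A (eps a) (d0 v).
Proof.
move: v; apply: (@tens3_eq _ _ _ _ _ (fun v => d0 (A a v))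
  (fun v => A (ad a) v + A (eps a) (d0 v))) => [||b n z].
- exact: (linear_comp2 (efun_linear _) (efun_linear _)).
- exact: (linear_add2 (efun_linear _) (linear_comp2 (efun_linear _) (efun_linear _))).
rewrite !AE !d0E (linD _ _ (efun_linear (A (eps a)))) !AE ad_mul epsM.
rewrite (linD _ _ (tp3_linear1 n z)) addrA; exact: erefl.
Qed.

Lemma d_A a v : d (A a v) = A (ad a) v + A (eps a) (d v).
Proof.
move: a; apply: gca_ind => [|n a ha].
  apply: submod_eq_lin; first exact: (linear_comp2 (efun_linear d) (A_linearl v)).
  exact: (linear_add2 (linear_comp2 (A_linearl v) (@ad_linear _ L))
    (linear_comp2 (A_linearl (d v)) (@eps_linear _ L))).
have ea : eps a = (-1) ^+ odd n *: a by rewrite (epsE ha) signr_odd.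
rewrite dE !endoD d0_A (linD _ _ (efun_linear _)) addrA; congr (_ + _).
rewrite !endo_sum (big_morph _ (fun x y => linD x y (efun_linear (A (eps a)))) (lin0 (efun_linear _))).
apply: eq_bigr => -[j js] _ /=.
have h1 : dd j (A a v) = (-1) ^+ (odd n && ~~ e j) *: A a (dd j v).
  exact: (congr1 (fun h : E => h v) (A_dd j ea)).
have h2 : A a (om j (dd j v)) = (-1) ^+ (odd n && e j) *: om j (A a (dd j v)).
  have tw : twist (odd n) (om j) = (-1) ^+ (odd n && e j) *: om j.
    by apply: twist_sign; exact: tau_om.
  have := supercomm_W epep tau_lop (fun x _ => A_lop x ea) (om_below js).
  rewrite tw -scalerAl => h; exact: (congr1 (fun h : E => h (dd j v)) h).
rewrite h1 (linZ _ _ (efun_linear (om j))) ea.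
have -> : A ((-1) ^+ odd n *: a) (om j (dd j v)) = (-1) ^+ odd n *: A a (om j (dd j v)).
  exact: (linZ _ _ (A_linearl _)).
rewrite h2 scalerA -signr_addb.
congr ((-1) ^+ _ *: _); by case: (odd n); case: (e j).
Qed.

Definition K_gen : set K := [set y | exists z, y = tp 1 z].
Definition K_gen_mod b : set K :=
  [set y | exists z, lspan [set u | exists n x, J b n /\ u = tp n x] z /\ y = tp 1 z].

Lemma K_tensor : is_tensor K_gen (fun a v => A a v).
Proof.
move=> X f fl fr.
have ltp : linear (fun z : tens N F => tp (1 : L) z) by exact: tp_linearr.
have At a z : A a (tp 1 z) = tp a z.
  move: z; apply: tens_eq => [c x y|c x y|n x].
  - by rewrite tp_linearr (efun_linear (A a)).
  - by rewrite tp_linearr.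
  by rewrite -!tp3_tp AE mulr1.
have [|a|h [lh hE]] := @tens_lift k L (tens N F) X (fun a z => f a (tp 1 z)).
- by move=> z; apply: fl; exists z.
- by move=> c x y; rewrite tp_linearr fr //; [exists x|exists y].
pose h' : {linear K -> X} := HB.pack h (GRing.isLinear.Build _ _ _ _ _ lh).
exists h'; split=> [a _ [z ->]|g' hg' v]; first by rewrite At; exact: hE.
move: v; apply: tens_eq => [c x y|//|a z]; first by rewrite linearP.
by rewrite /= hE -At; apply: hg'; exists z.
Qed.

Lemma K_gen_mod_submod b : submod (K_gen_mod b).
Proof.
have hS := lspan_submod [set u : tens N F | exists n x, J b n /\ u = tp n x].
split; first by exists 0; rewrite (lin0 (tp_linearr _)); split=> //; case: hS.
move=> c _ _ [z [hz ->]] [z' [hz' ->]]; exists (c *: z + z').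
by rewrite tp_linearr; split=> //; case: hS => _; apply.
Qed.

Lemma K_gen_mod_gen b n x : J b n -> K_gen_mod b (tp3 1 n x).
Proof. by move=> h; exists (tp n x); split=> //; apply: lspan_gen; exists n, x. Qed.

Lemma foldr_sg_linear c : linear (fun z => foldr sg z c).
Proof. by elim: c => [a x y //|j c IH a x y /=]; rewrite IH sg_linear. Qed.

Section Closure.
Variables (b : nat) (S : set K).
Hypothesis hS : submod S.
Hypothesis S_gen : forall y, K_gen_mod b y ->
  lspan [set x | exists a v, S v /\ x = A a v] (d y) -> S y.
Let AS : set K := lspan [set x | exists a v, S v /\ x = A a v].
Let hAS : submod AS. Proof. exact: lspan_submod. Qed.
Let good : set F := [set z | forall n, J b n -> S (tp3 1 n z)].

Let hgood : submod good.
Proof.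
split=> [n _|c x y hx hy n hn]; first by rewrite (lin0 (tp3_linear3 _ _)); case: hS.
by rewrite tp3_linear3; case: hS => _; apply; [apply: hx|apply: hy].
Qed.

Let AS_sub v : S v -> AS v.
Proof. by move=> h; apply: lspan_gen; exists 1, v; rewrite A_1. Qed.

(* The differential of 1 (x) n (x) z is made of 1 (x) md n (x) z and of the om
   j applied to derivatives of z; the odd letters that occur in om j have
   index < j. *)
Let good_step z :
  (forall j c, (j < s)%N -> all (fun i => i < j)%N c -> good (foldr sg (df j z) c)) -> good z.
Proof.
move=> h.
have om_AS j n : (j < s)%N -> J b n -> AS (om j (dd j (tp3 1 n z))).
  move=> js hn; rewrite ddE.
  have -> : ew (~~ e j) 1 = 1 by rewrite /ew eps1; case: ifP.
  have {}hn : J b (mw (~~ e j) n) by apply: (@mwP (J b)) => // y; exact: J_meps.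
  move: (om_sig js); apply: (lspan_lin (@endo_linearl _ _ _ hx0 _)) => // _ [w [hw ->]].
  suff [a' [n' [c [hn' hc ->]]]] : exists a' n' c, [/\ J b n', all (fun i => i < j)%N c &
      wop w (tp3 1 (mw (~~ e j) n) (df j z)) = tp3 a' n' (foldr sg (df j z) c)].
    have -> : tp3 a' n' (foldr sg (df j z) c) = A a' (tp3 1 n' (foldr sg (df j z) c)).
      by rewrite AE mulr1.
    by apply: lspan_gen; exists a', (tp3 1 n' (foldr sg (df j z) c)); split=> //; exact: h.
  elim: w hw => [_|x w IH /= /andP[hx hw]].
    by exists 1, (mw (~~ e j) n), [::]; rewrite /word_op big_nil.
  have [a' [n' [c [hn' hc e1]]]] := IH hw.
  rewrite wop_cons endoM e1; case: x hx => i hi /=.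
  - by exists (ws i * a'), n', c; rewrite lE.
  - exists (ew (e i) a'), (act (ws i) n'), c; rewrite rE; split=> //.
    by apply: (list_mod_mono (leqnSn b)); rewrite -add1n; apply: list_mod_act => //; exact: lw_letter.
  - exists (ew (~~ e i) a'), (mw (~~ e i) n'), (i :: c); rewrite sE /= hc andbT; split=> //.
    by apply: (@mwP (J b)) => // y; exact: J_meps.
have dz n : d (tp3 1 n z) = tp3 1 (md n) z + \sum_(j < s) om j (dd j (tp3 1 n z)).
  rewrite dE endoD d0E ad1 eps1 (lin0 (tp3_linear1 _ _)) add0r endo_sum.
  by congr (_ + _); apply: eq_bigr => j _; rewrite endoM.
have sumAS n : J b n -> AS (\sum_(j < s) om j (dd j (tp3 1 n z))).
  by move=> hn; apply: submod_big => // -[j js] _; exact: om_AS.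
(* Cocycles come first, because md n is one. *)
have cocycle n : J b n -> md n = 0 -> S (tp3 1 n z).
  move=> hn dn; apply: S_gen; first exact: K_gen_mod_gen.
  by rewrite dz dn (lin0 (tp3_linear2 _ _)) add0r; exact: sumAS.
move=> n hn; apply: S_gen; first exact: K_gen_mod_gen.
rewrite dz; apply: (submodD hAS); last exact: sumAS.
by apply: AS_sub; apply: cocycle; [exact: J_md|rewrite md_md].
Qed.

(* Induction on the number of variables that z is multiplied with: the powers
   of the last one are adjoined one by one. *)
Let good_words i : (i <= s)%N -> forall z, (forall j, (j < i)%N -> df j z = 0) ->
  (forall j c, (i <= j < s)%N -> all (fun a => a < j)%N c -> good (foldr sg (df j z) c)) ->
  forall c, all (fun a => a < i)%N c -> good (foldr sg z c).
Proof.
elim: i => [_ z _ hz [_|] //|i IH si z z0 hz].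
  by apply: good_step => j c js hc; exact: hz.
have {}IH := IH (ltnW si).
have it_df j m : j != i ->
    exists c : bool, df j (iter m (sg i) z) = (-1) ^+ c *: iter m (sg i) (df j z).
  move=> ji; elim: m => [|m [c e1]]; first by exists false; rewrite scale1r.
  exists (~~ e j && ~~ e i (+) c); rewrite /= df_sg // e1 (linZ _ _ (sg_linear i)).
  by rewrite scalerA -signr_addb.
have zi : df i z = 0 by apply: z0.
have it_dfi m : exists c : k, df i (iter m.+1 (sg i) z) = c *: iter m (sg i) z.
  elim: m => [|m [c e1]].
    by exists 1; rewrite /= df_sgj // zi (lin0 (sg_linear i)) scaler0 addr0 scale1r.
  exists (1 + (-1) ^+ (~~ e i) * c); rewrite [iter m.+2 _ _]/= df_sgj // e1.
  by rewrite (linZ _ _ (sg_linear i)) scalerDl scale1r scalerA.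
have H m : forall c, all (fun a => a < i)%N c -> good (foldr sg (iter m (sg i) z) c).
  elim: m => [|m IHm]; apply: IH.
  - by move=> j ji; apply: z0; rewrite ltnS ltnW.
  - move=> j c /andP[]; rewrite leq_eqVlt => /orP[/eqP <- _ _|ij js hc].
      by rewrite zi (lin0 (foldr_sg_linear c)); case: hgood.
    by apply: hz => //; rewrite ij.
  - move=> j ji; have [c ->] := it_df j m.+1 (negbT (ltn_eqF ji)).
    rewrite z0 ?ltnS 1?ltnW //; have -> : iter m.+1 (sg i) 0 = 0.
      by elim: m.+1 => //= m' ->; rewrite (lin0 (sg_linear i)).
    by rewrite scaler0.
  - move=> j c /andP[]; rewrite leq_eqVlt => /orP[/eqP <- _ hc|ij js hc].
      have [c' ->] := it_dfi m; rewrite (linZ _ _ (foldr_sg_linear c)).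
      by apply: (submodZ _ hgood); exact: IHm.
    have [c' ->] := it_df j m.+1 (negbT (gtn_eqF ij)).
    rewrite (linZ _ _ (foldr_sg_linear c)); apply: (submodZ _ hgood).
    have -> : foldr sg (iter m.+1 (sg i) (df j z)) c = foldr sg (df j z) (c ++ nseq m.+1 i).
      by rewrite foldr_cat; congr foldr; elim: m.+1 => //= m' ->.
    apply: hz; first by rewrite ij.
    by rewrite all_cat hc; apply/allP => q /nseqP[-> _].
move=> c hc; pose T := lspan [set y | exists m c, all (fun a => a < i)%N c /\
  y = foldr sg (iter m (sg i) z) c].
have hT : submod T by exact: lspan_submod.
suff : T (foldr sg z c) by apply: lspan_min => // _ [m [c' [hc' ->]]]; exact: H.
elim: c hc => [_|j c IHc /= /andP[ji hc]].
  by apply: lspan_gen; exists 0%N, [::].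
move: (IHc hc); apply: (lspan_lin (sg_linear j)) => // _ [m [c' [hc' ->]]].
move: ji; rewrite ltnS leq_eqVlt => /orP[/eqP ->|ji]; last first.
  by apply: lspan_gen; exists m, (j :: c'); rewrite /= ji.
have [c0 ->] : exists c0 : bool, sg i (foldr sg (iter m (sg i) z) c') =
    (-1) ^+ c0 *: foldr sg (iter m.+1 (sg i) z) c'.
  elim: c' {hc'} => [|a c' [c0 e1]] /=; first by exists false; rewrite scale1r.
  exists (~~ e i && ~~ e a (+) c0); rewrite sg_sg e1 (linZ _ _ (sg_linear a)).
  by rewrite scalerA -signr_addb.
by apply: (submodZ _ hT); apply: lspan_gen; exists m.+1, c'.
Qed.

(** The closure principle for the generators of K over J b, as required for
    lifting. *)
Lemma K_gen_closed : K_gen_mod b `<=` S.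
Proof.
have all_good z : good z.
  move: (F_span z); apply: lspan_min => // _ [c ->].
  case: (boolP (all (fun a => a < s)%N c)) => hc.
    apply: (good_words (leqnn s)) => // j c' /andP[sj js].
    by rewrite ltnNge sj in js.
  have -> : foldr sg o c = 0; last by case: hgood.
  elim: c hc => //= j c IHc; rewrite negb_and -leqNgt => /orP[sj|hc].
    exact: sg_big.
  by rewrite IHc // (lin0 (sg_linear j)).
move=> _ [z [hz ->]]; move: z hz; apply: lspan_lin => //; first exact: tp_linearr.
by move=> _ [n [x [hn ->]]]; rewrite -tp3_tp; exact: all_good.
Qed.

End Closure.

Section Lift.
Variables (Q : dgmod L) (f : Q -> N) (JJ : set N) (I : set L) (a b : nat).
Hypothesis fl : linear f.
Hypothesis fa : forall a q, f (act a q) = act a (f q).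
Hypothesis fd : forall q, f (md q) = md (f q).
Hypothesis hJJ : submod JJ.
Hypothesis JJa : forall a m, JJ m -> JJ (act a m).
Hypothesis fJ : forall q, JJ (f q).
Hypothesis finj : forall q, md q = 0 -> (exists m, JJ m /\ f q = md m) ->
  exists z, q = md z.
Hypothesis fsurj : forall m, JJ m -> md m = 0 ->
  exists q, md q = 0 /\ exists m', JJ m' /\ m = f q + md m'.
Hypothesis J_JJ : J b `<=` JJ.
Hypothesis lw_I : lw a `<=` I.
Hypothesis Q_exact : forall q : Q, md q = 0 ->
  lspan [set x | exists a q', I a /\ x = act a q'] q -> exists z, q = md z.

(** The descent turns x into a cocycle t of K in which a letters act on L. The
    map mu from K to N lifts to Q up to homotopy, and the lift of t is a
    boundary by the hypothesis on Q. *)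
Lemma koszul_exact x : J (a + b) x -> md x = 0 -> exists y, JJ y /\ x = md y.
Proof.
move=> hx dx; have [t [y [ht dt hy ->]]] := koszul_descent hx dx.
have ht' : lspan [set x | exists a0 y0, [/\ I a0, K_gen_mod b y0 & x = A a0 y0]] t.
  move: ht; apply: lspan_sub => _ [a' [n [z [ha' hn ->]]]].
  apply: lspan_gen; exists a', (tp3 1 n z); split; [exact: lw_I|exact: K_gen_mod_gen|].
  by rewrite AE mulr1.
have ddv v : d (d v) = 0 by rewrite -endoM d_sq.
have gen_sub : K_gen_mod b `<=` K_gen by move=> _ [z [_ ->]]; exists z.
have mu_JJ v : K_gen_mod b v -> JJ (mu v).
  move=> [z [hz ->]]; apply: J_JJ; move: z hz.
  apply: lspan_lin; first exact: (linear_comp2 mu_linear (@tp_linearr _ _ _ _)).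
    exact: hJ.
  move=> _ [n [z [hn ->]]]; rewrite -tp3_tp muE act1.
  exact: (submodZ _ (hJ b)).
have closed (S : set K) (hS : submod S) (_ : S `<=` K_gen_mod b) hS' :=
  @K_gen_closed b S hS hS'.
have [q [m [hq dq hm e1]]] : exists q m, [/\ lspan [set x | exists a q', I a /\ x = act a q'] q,
    md q = 0, JJ m & mu t - f q = md m].
  exact: (lift_cocycle (fun a => efun_linear (A a)) A_mul (efun_linear d) ddv d_A fl fa fd hJJ
    JJa fJ finj fsurj K_tensor (K_gen_mod_submod b) gen_sub mu_linear mu_A mu_md mu_JJ closed
    ht' dt).
have [z ez] := Q_exact dq hq.
exists (f z + m + y); split.
  apply: (submodD hJJ); last exact: J_JJ.
  by apply: (submodD hJJ).
rewrite !(linD _ _ (@md_linear _ _ _)) -fd -ez -e1; congr (_ + _).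
by rewrite addrC subrK.
Qed.

End Lift.

End KoszulDescent.

(** * The Koszul module of a finite list of letters *)

(** A copy of linearity which proof search does not unfold. *)
Variant is_lin (k : fieldType) (M N : lmodType k) (f : M -> N) : Prop :=
  IsLin of linear f.

Lemma is_linP (k : fieldType) (M N : lmodType k) (f : M -> N) : is_lin f -> linear f.
Proof. by case. Qed.

Lemma cancel3 (V : zmodType) (x u v : V) : x + u + v - (u + v) = x.
Proof. by rewrite opprD addrACA addrK subrr addr0. Qed.

Lemma cancel4 (V : zmodType) (x u v : V) : u + (x + v) - (u + v) = x.
Proof. by rewrite addrCA addrK. Qed.

Lemma tau_comm (k : fieldType) (E : algType k) (ep X : E) (b : bool) : ep * ep = 1 ->
  ep * X = (-1) ^+ b *: (X * ep) -> tau ep X = (-1) ^+ b *: X.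
Proof. by move=> h0 h; rewrite /tau h -scalerAl -mulrA h0 mulr1. Qed.

Lemma ad_odd_sign (k : fieldType) (E : algType k) (ep T X : E) (b : bool) :
  tau ep X = (-1) ^+ b *: X -> ad_odd ep T X = T * X - (-1) ^+ b *: (X * T).
Proof. by move=> h; rewrite /ad_odd h scalerAl. Qed.

Section SignOperators.
Opaque tau tmap tens tp ad_odd.
Variables (k : fieldType) (L : cdga k) (N : dgmod L).

Definition epb (b : bool) (a : L) : L := if b then eps a else a.
Definition mepb (b : bool) (n : N) : N := if b then meps n else n.

Lemma epb_linear b : linear (epb b).
Proof. by case: b => // a x y; rewrite /epb eps_linear. Qed.
Lemma mepb_linear b : linear (mepb b).
Proof. by case: b => // a x y; rewrite /mepb meps_linear. Qed.
Lemma epbK b a : epb b (epb b a) = a. Proof. by case: b => //=; apply: eps_eps. Qed.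
Lemma mepbK b n : mepb b (mepb b n) = n. Proof. by case: b => //=; apply: meps_meps. Qed.
Lemma epbM b x y : epb b (x * y) = epb b x * epb b y.
Proof. by case: b => //=; apply: epsM. Qed.
Lemma epb1 b : epb b 1 = 1 :> L. Proof. by case: b => //=; apply: eps1. Qed.
Lemma epb_epb b c a : epb b (epb c a) = epb c (epb b a). Proof. by case: b; case: c. Qed.
Lemma epb_eps b a : epb b (eps a) = eps (epb b a). Proof. by case: b. Qed.
Lemma epb_addb b c a : epb b (epb c a) = epb (b (+) c) a.
Proof. by case: b; case: c => //=; rewrite eps_eps. Qed.
Lemma mepb_mepb b c n : mepb b (mepb c n) = mepb c (mepb b n). Proof. by case: b; case: c. Qed.
Lemma mepb_act b a n : mepb b (act a n) = act (epb b a) (mepb b n).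
Proof. by case: b => //=; apply: meps_act. Qed.
Lemma ad_epb b (a : L) : ad (epb b a) = (-1) ^+ b *: epb b (ad a).
Proof. by case: b => /=; rewrite ?scale1r // ad_eps expr1 scaleN1r. Qed.
Lemma md_mepb b n : md (mepb b n) = (-1) ^+ b *: mepb b (md n).
Proof. by case: b => /=; rewrite ?scale1r // md_meps expr1 scaleN1r. Qed.

End SignOperators.

Section KoszulComplex.
Opaque tau tmap tens tp ad_odd.
Variables (k : fieldType) (char0 : [pchar k] =i pred0).
Variables (L : cdga k) (N : dgmod L) (s : nat) (ws : nat -> L) (e : nat -> bool).
Variables (D : nat -> seq (k * seq nat)) (dN : nat -> N -> N).
Hypothesis ws_eps : forall j, eps (ws j) = (-1) ^+ e j *: ws j.
Hypothesis ws_big : forall j, (s <= j)%N -> ws j = 0.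
Hypothesis ws_comm : forall j a, ws j * a = epb (e j) a * ws j.
Hypothesis hD : forall j, words_below j (D j).
Hypothesis adws : forall j, ad (ws j) = evalw ws (D j).
Definition par_word (v : seq nat) : bool := foldr (fun a b => e a (+) b) false v.
Hypothesis D_par : forall j p, p \in D j -> par_word p.2 = ~~ e j.
Hypothesis dN_linear : forall j, is_lin (dN j).
Hypothesis meps_dN : forall j n, meps (dN j n) = (-1) ^+ e j *: dN j (meps n).
Hypothesis dN_dN : forall i j n,
  dN i (dN j n) = (-1) ^+ (e i && e j) *: dN j (dN i n).
Hypothesis dN_ws : forall i j n, (j < s)%N ->
  dN i (act (ws j) n) = (if i == j then n else 0) + (-1) ^+ (e i && e j) *: act (ws j) (dN i n).

Variables (F : lmodType k) (o : F) (sg df : nat -> F -> F) (t : F -> F) (vac : F -> k^o).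
Hypothesis hF : koszul_variables (fun j => ~~ e j) s o sg df t vac.

Notation K := (tens L (tens N F)).

(** The odd variables are set to 0, and L acts on N. *)
Lemma eval_vac_exists : exists mu : K -> N, linear mu /\
  forall a n x, mu (tp3 a n x) = vac x *: act a n.
Proof.
have [[lsg ldf lt lvac] _ _ _ _] := hF.
have H a : exists g : tens N F -> N, linear g /\ forall n x, g (tp n x) = vac x *: act a n.
  apply: (tens_lift (f := fun n x => vac x *: act a n)) => [x c m n|n c x y].
    by rewrite act_linearr scalerDr !scalerA mulrC.
  by rewrite lvac scalerDl -[c *: vac x]/(c * vac x) scalerA.
pose g a := sval (cid (H a)).
have gl a : linear (g a) by rewrite /g; case: cid => h [].
have gE a n x : g a (tp n x) = vac x *: act a n.
  by rewrite /g; case: cid => h [/= _ ->].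
have [mu [ml mE]] : exists mu : K -> N, linear mu /\ forall a y, mu (tp a y) = g a y.
  apply: tens_lift => // y c a b; move: y; apply: tens_eq => // [c' x y|n x].
    by rewrite !gl !scalerDr !scalerA addrACA (mulrC c).
  by rewrite !gE act_linearl scalerDr !scalerA (mulrC c).
by exists mu; split=> // a n x; rewrite /tp3 mE gE.
Qed.

Definition mu : K -> N := sval (cid eval_vac_exists).
Lemma mu_linear : linear mu. Proof. by rewrite /mu; case: cid => h []. Qed.
Lemma muE a n x : mu (tp3 a n x) = vac x *: act a n.
Proof. by rewrite /mu; case: cid => h [/= _ ->]. Qed.

Variables (n0 : N) (hn0 : n0 != 0).

Lemma base_neq0 : tp3 (1 : L) n0 o != 0.
Proof.
apply/eqP => /(congr1 mu); rewrite (lin0 mu_linear) muE act1.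
have [_ _ _ [_ -> _ _ _] _] := hF; rewrite scale1r => /eqP.
by apply/negP.
Qed.
Notation E := (endo base_neq0).
Notation op := (op3 base_neq0).

Notation lin f := (is_lin f).
Let lid (V : lmodType k) : lin (@idfun V). Proof. by split. Qed.
Let lmul (a : L) : lin (fun x : L => a * x).
Proof. by split=> c x y; rewrite mulrDr scalerAr. Qed.
Let leps : lin (@eps _ L). Proof. by split; apply: eps_linear. Qed.
Let lad : lin (@ad _ L). Proof. by split; apply: ad_linear. Qed.
Let lmd : lin (@md _ L N). Proof. by split; apply: md_linear. Qed.
Let lepb b : lin (@epb _ L b). Proof. by split; apply: epb_linear. Qed.
Let lmepb b : lin (@mepb _ L N b). Proof. by split; apply: mepb_linear. Qed.
Let lmeps : lin (@meps _ L N). Proof. by split; apply: meps_linear. Qed.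
Let lact a : lin (@act _ L N a). Proof. by split; apply: act_linearr. Qed.
Let lsg j : lin (sg j). Proof. by split; case: hF => -[]. Qed.
Let ldf j : lin (df j). Proof. by split; case: hF => -[]. Qed.
Let lt : lin t. Proof. by split; case: hF => -[]. Qed.
Let lvac : lin vac. Proof. by split; case: hF => -[]. Qed.
#[local] Hint Resolve lid lmul leps lad lmd lepb lmepb lmeps lact lsg ldf lt lvac dN_linear : core.

(** Koszul signs: an odd operator on a factor is accompanied by the sign
    involutions of the factors to its left. *)
Definition Lop j : E := op (fun a => ws j * a) idfun idfun.
Definition Rop j : E := op (epb (e j)) (act (ws j)) idfun.
Definition Sop j : E := op (epb (~~ e j)) (mepb (~~ e j)) (sg j).
Definition Dop j : E := op (epb (~~ e j)) (mepb (~~ e j)) (df j).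
Definition Nop j : E := op (epb (e j)) (dN j) idfun.
Definition Eop : E := op (@eps _ L) (@meps _ L N) t.
Definition d0op : E := op (@ad _ L) idfun idfun + op (@eps _ L) (@md _ L N) idfun.
Definition Aop (a : L) : E := op (fun x => a * x) idfun idfun.
Opaque op3.

Notation tau := (tau Eop).
Notation lop := (letter_op Lop Rop Sop).
Notation lpar := (letter_parity e).
Notation ad_odd := (ad_odd Eop).

Lemma opE f g h a n x : lin f -> lin g -> lin h ->
  op f g h (tp3 a n x) = tp3 (f a) (g n) (h x).
Proof. by case=> lf [lg] [lh]; apply: op3E. Qed.

Lemma op_comm f g h f' g' h' (a b c z : bool) : z = a (+) (b (+) c) ->
    lin f -> lin g -> lin h -> lin f' -> lin g' -> lin h' ->
    (forall x, f (f' x) = (-1) ^+ a *: f' (f x)) ->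
    (forall x, g (g' x) = (-1) ^+ b *: g' (g x)) ->
    (forall x, h (h' x) = (-1) ^+ c *: h' (h x)) ->
  op f g h * op f' g' h' = (-1) ^+ z *: (op f' g' h' * op f g h).
Proof. by move=> -> [lf] [lg] [lh] [lf'] [lg'] [lh']; apply: op3_comm. Qed.

Let sym (V : lmodType k) (b : bool) (x y : V) : x = (-1) ^+ b *: y -> y = (-1) ^+ b *: x.
Proof. by move=> ->; rewrite scalerA -signr_addb addbb scale1r. Qed.

Let cid' (V : lmodType k) (x : V) : x = (-1) ^+ false *: x. Proof. by rewrite scale1r. Qed.

Lemma epb_ws b j : epb b (ws j) = (-1) ^+ (b && e j) *: ws j.
Proof. by case: b => /=; rewrite ?scale1r // ws_eps. Qed.

(* Commutation rules of the operators on the three factors. *)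
Let c_wep b j x : ws j * epb b x = (-1) ^+ (b && e j) *: epb b (ws j * x).
Proof. by apply: sym; rewrite epbM epb_ws scalerAl. Qed.
Let c_epw b j x : epb b (ws j * x) = (-1) ^+ (b && e j) *: (ws j * epb b x).
Proof. exact/sym/c_wep. Qed.
Let c_ww i j : ws i * ws j = (-1) ^+ (e i && e j) *: (ws j * ws i).
Proof. by rewrite ws_comm epb_ws scalerAl. Qed.
Let c_ww' i j x : ws i * (ws j * x) = (-1) ^+ (e i && e j) *: (ws j * (ws i * x)).
Proof. by rewrite mulrA c_ww -scalerAl mulrA. Qed.
Let c_act b j (n : N) : act (ws j) (mepb b n) = (-1) ^+ (b && e j) *: mepb b (act (ws j) n).
Proof. by apply: sym; rewrite mepb_act epb_ws (linZ _ _ (act_linearl _)). Qed.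
Let c_act' b j (n : N) : mepb b (act (ws j) n) = (-1) ^+ (b && e j) *: act (ws j) (mepb b n).
Proof. exact/sym/c_act. Qed.
Let c_aa i j (n : N) : act (ws i) (act (ws j) n) = (-1) ^+ (e i && e j) *: act (ws j) (act (ws i) n).
Proof. by rewrite -actM c_ww (linZ _ _ (act_linearl _)) actM. Qed.
Let c_dN b j (n : N) : mepb b (dN j n) = (-1) ^+ (b && e j) *: dN j (mepb b n).
Proof. by case: b => /=; rewrite ?scale1r // meps_dN. Qed.
Let c_dN' b j (n : N) : dN j (mepb b n) = (-1) ^+ (b && e j) *: mepb b (dN j n).
Proof. exact/sym/c_dN. Qed.
Let c_epep b c x : epb b (epb c x) = (-1) ^+ false *: epb c (epb b x) :> L.
Proof. by rewrite epb_epb scale1r. Qed.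
Let c_mm b c x : mepb b (mepb c x) = (-1) ^+ false *: mepb c (mepb b x) :> N.
Proof. by rewrite mepb_mepb scale1r. Qed.
Let c_ss i j x : sg i (sg j x) = (-1) ^+ (~~ e i && ~~ e j) *: sg j (sg i x).
Proof. by case: hF => _ _ []. Qed.
Let c_ff i j x : df i (df j x) = (-1) ^+ (~~ e i && ~~ e j) *: df j (df i x).
Proof. by case: hF => _ _ []. Qed.
Let c_fs i j x : i != j -> df i (sg j x) = (-1) ^+ (~~ e i && ~~ e j) *: sg j (df i x).
Proof. by case: hF => _ _ [_ _ h _ _ _ ij]; apply: h. Qed.
Let c_ts j x : t (sg j x) = (-1) ^+ (~~ e j) *: sg j (t x).
Proof. by case: hF => _ []. Qed.
Let c_tf j x : t (df j x) = (-1) ^+ (~~ e j) *: df j (t x).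
Proof. by case: hF => _ []. Qed.

Lemma Eop_sq : Eop * Eop = 1.
Proof.
apply: endo3_ext => a n x; rewrite endoM endo1 (opE _ _ _ leps lmeps lt) (opE _ _ _ leps lmeps lt) eps_eps meps_meps.
by case: hF => _ [-> _ _ _].
Qed.

Let zA b : b = b (+) (false (+) false). Proof. by case: b. Qed.
Let zB b : b = false (+) (b (+) false). Proof. by case: b. Qed.
Let zC b : b = false (+) (false (+) b). Proof. by case: b. Qed.
Let cN (f : N -> N) n : f (idfun n) = (-1) ^+ false *: idfun (f n).
Proof. exact: cid'. Qed.
Let cN' (f : N -> N) n : idfun (f n) = (-1) ^+ false *: f (idfun n).
Proof. exact: cid'. Qed.
Let cF (f : F -> F) n : f (idfun n) = (-1) ^+ false *: idfun (f n).
Proof. exact: cid'. Qed.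
Let cF' (f : F -> F) n : idfun (f n) = (-1) ^+ false *: f (idfun n).
Proof. exact: cid'. Qed.

Lemma lop_commE x y : lop x * lop y = (-1) ^+ (lpar x && lpar y) *: (lop y * lop x).
Proof.
case: x => i; case: y => j; rewrite /letter_op /letter_parity.
- apply: (op_comm (zA _) (lmul _) (lid _) (lid _) (lmul _) (lid _) (lid _) (c_ww' i j)); [exact: cN|exact: cF].
- rewrite andbC.
  apply: (op_comm (zA _) (lmul _) (lid _) (lid _) (lepb _) (lact _) (lid _) (c_wep (e j) i)); [exact: cN'|exact: cF].
- rewrite andbC.
  apply: (op_comm (zA _) (lmul _) (lid _) (lid _) (lepb _) (lmepb _) (lsg _) (c_wep (~~ e j) i)); [exact: cN'|exact: cF'].
- apply: (op_comm (zA _) (lepb _) (lact _) (lid _) (lmul _) (lid _) (lid _) (c_epw (e i) j)); [exact: cN|exact: cF].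
- apply: (op_comm (zB _) (lepb _) (lact _) (lid _) (lepb _) (lact _) (lid _) (c_epep _ _) (c_aa i j)); exact: cF.
- rewrite andbC.
  apply: (op_comm (zB _) (lepb _) (lact _) (lid _) (lepb _) (lmepb _) (lsg _) (c_epep _ _) (c_act _ i)); exact: cF'.
- apply: (op_comm (zA _) (lepb _) (lmepb _) (lsg _) (lmul _) (lid _) (lid _) (c_epw (~~ e i) j)); [exact: cN|exact: cF].
- apply: (op_comm (zB _) (lepb _) (lmepb _) (lsg _) (lepb _) (lact _) (lid _) (c_epep _ _) (c_act' _ j)); exact: cF.
- exact: (op_comm (zC _) (lepb _) (lmepb _) (lsg _) (lepb _) (lmepb _) (lsg _) (c_epep _ _) (c_mm _ _) (c_ss i j)).
Qed.

Lemma tau_lopE x : tau (lop x) = (-1) ^+ lpar x *: lop x.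
Proof.
apply: (tau_comm Eop_sq); case: x => j; rewrite /letter_op /letter_parity.
- apply: (op_comm (zA _) leps lmeps lt (lmul _) (lid _) (lid _) (c_epw true j)); [exact: cN|exact: cF].
- apply: (op_comm (zB _) leps lmeps lt (lepb _) (lact _) (lid _) (c_epep true _) (c_act' true j)); exact: cF.
- exact: (op_comm (zC _) leps lmeps lt (lepb _) (lmepb _) (lsg _) (c_epep true _) (c_mm true _) (c_ts j)).
Qed.

Lemma tau_Nop j : tau (Nop j) = (-1) ^+ e j *: Nop j.
Proof.
apply: (tau_comm Eop_sq).
apply: (op_comm (zB _) leps lmeps lt (lepb _) (dN_linear _) (lid _) (c_epep true _) (c_dN true j)); exact: cF.
Qed.

Lemma tau_Dop j : tau (Dop j) = (-1) ^+ (~~ e j) *: Dop j.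
Proof.
apply: (tau_comm Eop_sq).
exact: (op_comm (zC _) leps lmeps lt (lepb _) (lmepb _) (ldf _) (c_epep true _) (c_mm true _) (c_tf j)).
Qed.

Lemma Dop_lop j x : (if x is SS i then i != j else true) ->
  Dop j * lop x = (-1) ^+ (~~ e j && lpar x) *: (lop x * Dop j).
Proof.
case: x => i; rewrite /letter_op /letter_parity => ij.
- apply: (op_comm (zA _) (lepb _) (lmepb _) (ldf _) (lmul _) (lid _) (lid _) (c_epw (~~ e j) i)); [exact: cN|exact: cF].
- apply: (op_comm (zB _) (lepb _) (lmepb _) (ldf _) (lepb _) (lact _) (lid _) (c_epep _ _) (c_act' _ i)); exact: cF.
- rewrite eq_sym in ij.
  exact: (op_comm (zC _) (lepb _) (lmepb _) (ldf _) (lepb _) (lmepb _) (lsg _) (c_epep _ _) (c_mm _ _) (fun x => c_fs x ij)).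
Qed.

Lemma Dop_Dop i j : Dop i * Dop j = (-1) ^+ (~~ e i && ~~ e j) *: (Dop j * Dop i).
Proof.
exact: (op_comm (zC _) (lepb _) (lmepb _) (ldf _) (lepb _) (lmepb _) (ldf _) (c_epep _ _) (c_mm _ _) (c_ff i j)).
Qed.

Lemma Nop_Nop i j : Nop i * Nop j = (-1) ^+ (e i && e j) *: (Nop j * Nop i).
Proof.
apply: (op_comm (zB _) (lepb _) (dN_linear _) (lid _) (lepb _) (dN_linear _) (lid _) (c_epep _ _) (dN_dN i j)); exact: cF.
Qed.

Lemma Nop_Lop i j : Nop i * Lop j = (-1) ^+ (e i && e j) *: (Lop j * Nop i).
Proof.
apply: (op_comm (zA _) (lepb _) (dN_linear _) (lid _) (lmul _) (lid _) (lid _) (c_epw _ j)); [exact: cN|exact: cF].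
Qed.

Lemma Nop_Sop i j : Nop i * Sop j = (-1) ^+ (e i && ~~ e j) *: (Sop j * Nop i).
Proof.
rewrite andbC.
apply: (op_comm (zB _) (lepb _) (dN_linear _) (lid _) (lepb _) (lmepb _) (lsg _) (c_epep _ _) (c_dN' _ i)); exact: cF'.
Qed.

Lemma LopE j a n x : Lop j (tp3 a n x) = tp3 (ws j * a) n x.
Proof. exact: (opE _ _ _ (lmul _) (lid _) (lid _)). Qed.
Lemma RopE j a n x : Rop j (tp3 a n x) = tp3 (epb (e j) a) (act (ws j) n) x.
Proof. exact: (opE _ _ _ (lepb _) (lact _) (lid _)). Qed.
Lemma SopE j a n x : Sop j (tp3 a n x) = tp3 (epb (~~ e j) a) (mepb (~~ e j) n) (sg j x).
Proof. exact: (opE _ _ _ (lepb _) (lmepb _) (lsg _)). Qed.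
Lemma DopE j a n x : Dop j (tp3 a n x) = tp3 (epb (~~ e j) a) (mepb (~~ e j) n) (df j x).
Proof. exact: (opE _ _ _ (lepb _) (lmepb _) (ldf _)). Qed.
Lemma NopE j a n x : Nop j (tp3 a n x) = tp3 (epb (e j) a) (dN j n) x.
Proof. exact: (opE _ _ _ (lepb _) (dN_linear _) (lid _)). Qed.
Lemma AopE a' a n x : Aop a' (tp3 a n x) = tp3 (a' * a) n x.
Proof. exact: (opE _ _ _ (lmul _) (lid _) (lid _)). Qed.
Lemma d0opE a n x : d0op (tp3 a n x) = tp3 (ad a) n x + tp3 (eps a) (md n) x.
Proof.
rewrite /d0op endoD; congr (_ + _); first exact: (opE _ _ _ lad (lid _) (lid _)).
exact: (opE _ _ _ leps lmd (lid _)).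
Qed.

Let tD1 a b n x : tp3 (a + b) n x = tp3 a n x + tp3 b n x :> K := linD a b (tp3_linear1 n x).
Let tZ1 c a n x : tp3 (c *: a) n x = c *: tp3 a n x :> K := linZ c a (tp3_linear1 n x).
Let tD2 a m n x : tp3 a (m + n) x = tp3 a m x + tp3 a n x :> K := linD m n (tp3_linear2 a x).
Let tZ2 c a n x : tp3 a (c *: n) x = c *: tp3 a n x :> K := linZ c n (tp3_linear2 a x).
Let tD3 a n x y : tp3 a n (x + y) = tp3 a n x + tp3 a n y :> K := linD x y (tp3_linear3 a n).
Let tZ3 c a n x : tp3 a n (c *: x) = c *: tp3 a n x :> K := linZ c x (tp3_linear3 a n).
Let t01 n x : tp3 0 n x = 0 :> K := lin0 (tp3_linear1 n x).
Let t02 a x : tp3 a 0 x = 0 :> K := lin0 (tp3_linear2 a x).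

Opaque Lop Rop Sop Dop Nop Aop d0op Eop tp3.

Lemma Dop_Sop j : (j < s)%N -> Dop j * Sop j = 1 + (-1) ^+ (~~ e j) *: (Sop j * Dop j).
Proof.
move=> js; apply: endo3_ext => a n x; rewrite endoD endoZ !endoM endo1.
rewrite SopE DopE DopE SopE !epbK !mepbK; have [_ _ [_ _ _ h] _ _] := hF; rewrite (h _ _ js).
rewrite tD3 tZ3; exact: erefl.
Qed.

Lemma Nop_Rop i j : (j < s)%N -> Nop i * Rop j =
  (i == j)%:R + (-1) ^+ (e i && e j) *: (Rop j * Nop i).
Proof.
move=> js; apply: endo3_ext => a n x; rewrite endoD endoZ !endoM.
rewrite RopE NopE NopE RopE.
rewrite (dN_ws _ _ js).
rewrite tD2 tZ2 epb_epb; congr (_ + _).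
case: (i =P j) => [->|_]; first by rewrite epbK.
exact: t02.
Qed.

Lemma ops_big j : (s <= j)%N -> Rop j = 0 /\ Sop j = 0.
Proof.
move=> sj; split; apply: endo3_ext => a n x; rewrite endo0.
  by rewrite RopE (ws_big sj) (lin0 (act_linearl _)) t02.
have [_ _ _ [_ _ _ h _] _] := hF.
by rewrite SopE (h _ _ sj) (lin0 (tp3_linear3 _ _)).
Qed.

Definition gop : E := gam_sum Sop Nop s.

Lemma tau_gop : tau gop = - gop.
Proof. exact: (tau_gam_sum Eop_sq s tau_lopE tau_Nop). Qed.
Lemma gop_sq : gop * gop = 0.
Proof. exact: (gam_sum_sq char0 s lop_commE Nop_Nop Nop_Sop). Qed.
Lemma gop_l j : ad_odd gop (Lop j) = 0.
Proof. exact: (gam_sum_l s lop_commE tau_lopE Nop_Lop). Qed.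
Lemma gop_sig j : ad_odd gop (Sop j) = 0.
Proof. exact: (gam_sum_sig s lop_commE tau_lopE Nop_Sop). Qed.
Lemma gop_r j : ad_odd gop (Rop j) = Sop j.
Proof. exact: (gam_sum_r lop_commE tau_lopE Nop_Rop ops_big). Qed.

Lemma EopE a n x : Eop (tp3 a n x) = tp3 (eps a) (meps n) (t x).
Proof. exact: (opE _ _ _ leps lmeps lt). Qed.

Lemma tau_d0op : tau d0op = - d0op.
Proof.
rewrite -scaleN1r -(expr1 (-1)); apply: (tau_comm (b := true) Eop_sq).
rewrite expr1 scaleN1r; apply: endo3_ext => a n x.
rewrite endoN !endoM d0opE EopE d0opE (linD _ _ (efun_linear _)) !EopE.
rewrite ad_eps md_meps -!scaleN1r tZ1 tZ2 -scalerDr scalerA mulrNN mulr1 scale1r.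
exact: erefl.
Qed.

Lemma d0op_sq : d0op * d0op = 0.
Proof.
apply: endo3_ext => a n x; rewrite endoM d0opE (linD _ _ (efun_linear _)) !d0opE.
rewrite ad_ad md_md t01 t02 add0r addr0 ad_eps -scaleN1r tZ1 scaleN1r subrr.
exact: erefl.
Qed.

Let adE (T X : E) (b : bool) v : tau X = (-1) ^+ b *: X ->
  ad_odd T X v = T (X v) - (-1) ^+ b *: X (T v).
Proof. move=> h; rewrite (ad_odd_sign _ h); exact: endo_comb. Qed.

Lemma d0op_epb j (f : F -> F) (X : E) : linear f ->
  (forall a n x, X (tp3 a n x) = tp3 (epb (~~ e j) a) (mepb (~~ e j) n) (f x)) ->
  tau X = (-1) ^+ (~~ e j) *: X ->
  ad_odd d0op X = 0.
Proof.
move=> lf XE tX; apply: endo3_ext => a n x.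
rewrite (adE _ _ tX) XE !d0opE (linD _ _ (efun_linear X)) !XE.
rewrite ad_epb md_mepb tZ1 tZ2 epb_eps scalerDr subrr endo0; exact: erefl.
Qed.

Lemma d0op_sig j : ad_odd d0op (Sop j) = 0.
Proof. exact: (d0op_epb (is_linP (lsg j)) (SopE j) (tau_lopE (SS j))). Qed.
Lemma d0op_dd j : ad_odd d0op (Dop j) = 0.
Proof. exact: (d0op_epb (is_linP (ldf j)) (DopE j) (tau_Dop j)). Qed.

Lemma evalw_Lop (l : seq (k * seq nat)) a n x :
  evalw Lop l (tp3 a n x) = tp3 (evalw ws l * a) n x.
Proof.
have P v : (\prod_(i <- v) Lop i) (tp3 a n x) = tp3 ((\prod_(i <- v) ws i) * a) n x.
  elim: v => [|i v IH]; first by rewrite !big_nil mul1r.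
  rewrite !big_cons endoM IH LopE mulrA; exact: erefl.
rewrite /evalw endo_sum mulr_suml.
rewrite (big_morph (fun b => tp3 b n x) (fun x y => tD1 x y _ _) (t01 _ _)).
apply: eq_bigr => i _; rewrite endoZ P -scalerAl tZ1; exact: erefl.
Qed.

Lemma evalw_Rop j a n x :
  evalw Rop (D j) (tp3 a n x) = tp3 (epb (~~ e j) a) (act (evalw ws (D j)) n) x.
Proof.
have P v : (\prod_(i <- v) Rop i) (tp3 a n x) =
    tp3 (epb (par_word v) a) (act (\prod_(i <- v) ws i) n) x.
  elim: v => [|i v IH]; first by rewrite !big_nil act1.
  rewrite !big_cons endoM IH RopE actM epb_addb; exact: erefl.
rewrite /evalw endo_sum.
rewrite (big_morph (fun b => act b n) (fun x y => linD x y (act_linearl n)) (lin0 (act_linearl n))).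
rewrite (big_morph (fun n => tp3 _ n x) (fun x y => tD2 _ x y _) (t02 _ _)).
rewrite big_seq [RHS]big_seq; apply: eq_bigr => i hi.
rewrite endoZ P (D_par hi) (linZ _ _ (act_linearl n)) tZ2; exact: erefl.
Qed.

Lemma d0op_l j : ad_odd d0op (Lop j) = evalw Lop (D j).
Proof.
apply: endo3_ext => a n x; rewrite evalw_Lop.
have tL : tau (Lop j) = (-1) ^+ e j *: Lop j := tau_lopE (LL j).
rewrite (adE _ _ tL).
rewrite LopE !d0opE (linD _ _ (efun_linear (Lop j))) !LopE.
have -> : ad (ws j * a) = evalw ws (D j) * a + (-1) ^+ e j *: (ws j * ad a).
  rewrite ad_mul adws ws_eps scalerAl; exact: erefl.
have -> : eps (ws j * a) = (-1) ^+ e j *: (ws j * eps a).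
  rewrite epsM ws_eps scalerAl; exact: erefl.
rewrite tD1 !tZ1 scalerDr; exact: cancel3.
Qed.

Lemma d0op_r j : ad_odd d0op (Rop j) = evalw Rop (D j).
Proof.
apply: endo3_ext => a n x; rewrite evalw_Rop.
have tR : tau (Rop j) = (-1) ^+ e j *: Rop j := tau_lopE (RR j).
rewrite (adE _ _ tR).
rewrite RopE !d0opE (linD _ _ (efun_linear (Rop j))) !RopE md_actE adws ad_epb ws_eps.
rewrite tZ1 tD2 (linZ _ _ (act_linearl _)) tZ2 epb_eps scalerDr.
have -> : epb (~~ e j) a = eps (epb (e j) a).
  rewrite -[RHS]/(epb true _) epb_addb; exact: erefl.
exact: cancel4.
Qed.

Let lmu : linear mu := mu_linear.

Lemma mu_L j v : mu (Lop j v) = act (ws j) (mu v).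
Proof.
move: v; apply: (@tens3_eq _ _ _ _ _ (fun v => mu (Lop j v)) (fun v => act (ws j) (mu v))) => [||a n x].
- exact: (linear_comp2 lmu (efun_linear _)).
- exact: (linear_comp2 (act_linearr (ws j)) lmu).
rewrite LopE !muE actM (linZ _ _ (act_linearr _)); exact: erefl.
Qed.

Lemma mu_R j v : mu (Rop j v) = act (ws j) (mu v).
Proof.
move: v; apply: (@tens3_eq _ _ _ _ _ (fun v => mu (Rop j v)) (fun v => act (ws j) (mu v))) => [||a n x].
- exact: (linear_comp2 lmu (efun_linear _)).
- exact: (linear_comp2 (act_linearr (ws j)) lmu).
rewrite RopE !muE (linZ _ _ (act_linearr _)) -!actM ws_comm; exact: erefl.
Qed.

Lemma mu_S j v : mu (Sop j v) = 0.
Proof.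
move: v; apply: (@tens3_eq _ _ _ _ _ (fun v => mu (Sop j v)) (fun _ => 0)) => [||a n x].
- exact: (linear_comp2 lmu (efun_linear _)).
- by move=> c x y; rewrite scaler0 addr0.
rewrite SopE muE; have [_ _ _ [_ _ h _ _] _] := hF; rewrite h scale0r; exact: erefl.
Qed.

Lemma mu_gop v : mu (gop v) = 0.
Proof.
rewrite /gop /gam_sum endo_sum.
rewrite (big_morph mu (fun x y => linD x y lmu) (lin0 lmu)); apply: big1 => j _.
rewrite endoM; exact: mu_S.
Qed.

Lemma mu_null_word P (X : E) v : words Lop Rop Sop P X -> mu v = 0 -> mu (X v) = 0.
Proof.
move=> hX hv; suff H : words Lop Rop Sop P `<=` [set X : E | mu (X v) = 0] by exact: H.
apply: lspan_min.
  split=> [|c x y h1 h2]; first exact: (lin0 lmu).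
  change (mu (x v) = 0) in h1; change (mu (y v) = 0) in h2.
  change (mu (c *: x v + y v) = 0).
  rewrite lmu h1 h2 scaler0 addr0; exact: erefl.
move=> _ [w [_ ->]] /=; elim: w => [|x w IH]; first by rewrite /word_op big_nil.
rewrite wop_cons endoM; case: x => j.
- rewrite -[letter_op _ _ _ _]/(Lop j) mu_L IH; exact: (lin0 (act_linearr _)).
- rewrite -[letter_op _ _ _ _]/(Rop j) mu_R IH; exact: (lin0 (act_linearr _)).
- exact: mu_S.
Qed.

Lemma A_lopE (c : bool) a x : eps a = (-1) ^+ c *: a ->
  Aop a * lop x = (-1) ^+ (c && lpar x) *: (lop x * Aop a).
Proof.
move=> ea; have eb b : epb b a = (-1) ^+ (b && c) *: a.
  by case: b; rewrite /= ?scale1r.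
have ep b y : a * epb b y = (-1) ^+ (c && b) *: epb b (a * y).
  rewrite epbM eb -scalerAl scalerA -signr_addb (andbC b) addbb scale1r; exact: erefl.
case: x => j; rewrite /letter_op /letter_parity.
- apply: (op_comm (zA _) (lmul _) (lid _) (lid _) (lmul _) (lid _) (lid _)); [|exact: cN|exact: cF].
  move=> y; rewrite !mulrA ws_comm eb -!scalerAl scalerA -signr_addb (andbC (e j)) addbb scale1r.
  exact: erefl.
- apply: (op_comm (zA _) (lmul _) (lid _) (lid _) (lepb _) (lact _) (lid _) (ep _)); [exact: cN'|exact: cF].
- apply: (op_comm (zA _) (lmul _) (lid _) (lid _) (lepb _) (lmepb _) (lsg _) (ep _)); [exact: cN'|exact: cF'].
Qed.

Lemma A_ddE (c : bool) a j : eps a = (-1) ^+ c *: a ->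
  Dop j * Aop a = (-1) ^+ (c && ~~ e j) *: (Aop a * Dop j).
Proof.
move=> ea; have eb b : epb b a = (-1) ^+ (b && c) *: a.
  by case: b; rewrite /= ?scale1r.
rewrite andbC.
apply: (op_comm (zA _) (lepb _) (lmepb _) (ldf _) (lmul _) (lid _) (lid _)); [|exact: cN|exact: cF].
move=> y; rewrite epbM eb -scalerAl; exact: erefl.
Qed.

Lemma ops_big3 j : (s <= j)%N -> [/\ Lop j = 0, Rop j = 0 & Sop j = 0].
Proof.
move=> sj; have [h1 h2] := ops_big sj; split=> //; apply: endo3_ext => a n x.
rewrite LopE (ws_big sj) mul0r endo0; exact: t01.
Qed.

Section Exactness.
Variables (G : set N) (Q : dgmod L) (f : Q -> N) (JJ : set N) (I : set L) (a b : nat).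
Notation J := (list_mod ws G).
Hypothesis G_meps : forall y, G y -> G (meps y).
Hypothesis G_md : forall y, G y -> J 0 (md y).
Hypothesis G_closure : forall S : set N, submod S ->
  (forall y, G y ->
     lspan [set x | exists v y', [/\ G y', S y' & x = act (list_word ws v) y']] (md y) -> S y) ->
  G `<=` S.
Hypothesis G_dN : forall j y, G y -> dN j y = 0.
Hypothesis fl : linear f.
Hypothesis fa : forall a q, f (act a q) = act a (f q).
Hypothesis fd : forall q, f (md q) = md (f q).
Hypothesis hJJ : submod JJ.
Hypothesis JJa : forall a m, JJ m -> JJ (act a m).
Hypothesis fJ : forall q, JJ (f q).
Hypothesis finj : forall q, md q = 0 -> (exists m, JJ m /\ f q = md m) ->
  exists z, q = md z.
Hypothesis fsurj : forall m, JJ m -> md m = 0 ->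
  exists q, md q = 0 /\ exists m', JJ m' /\ m = f q + md m'.
Hypothesis J_JJ : J b `<=` JJ.
Hypothesis lw_I : list_words ws a `<=` I.
Hypothesis Q_exact : forall q : Q, md q = 0 ->
  lspan [set x | exists a q', I a /\ x = act a q'] q -> exists z, q = md z.

(** The operators on K satisfy the relations from which the perturbed
    differential was built. *)
Lemma koszul_exactness x : J (a + b) x -> md x = 0 -> exists y, JJ y /\ x = md y.
Proof.
have [om [Yv [d [theta [[dE tE dsq] [o1 o2 o3 o4 o5] [d_l d_r d_s] [t1 t2 t3 t4 t5]]]]]] :=
  perturbed_differential Eop_sq char0 lop_commE tau_lopE tau_gop gop_sq gop_l gop_r gop_sig
    tau_d0op d0op_sq d0op_l d0op_r d0op_sig d0op_dd hD tau_Dop Dop_lop Dop_Sop Dop_Dop ops_big3.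
(* mu identifies left letters with right letters and kills gamma, hence also
   the correction [gamma, Yv j]. *)
have mu_om j v : (j < s)%N -> mu (om j v) = 0.
  move=> js; rewrite (o4 _ js) !endoD !endoN !(linD _ _ lmu) !(linN _ lmu) mu_R mu_L subrr sub0r.
  have := congr1 mu (ad_oddE Eop gop (Yv j) v).
  rewrite mu_gop (linD _ _ lmu) (mu_null_word (W_tau Eop_sq tau_lopE (o5 _ js)) (mu_gop v)) addr0 => <-.
  exact: oppr0.
have g_base y : G y -> gop (tp3 1 y o) = 0.
  move=> hy; rewrite /gop /gam_sum endo_sum; apply: big1 => j _.
  rewrite endoM NopE (G_dN _ hy) t02; exact: (lin0 (efun_linear _)).
have [_ _ [F1 F2 F3 F4] [F5 F6 F7 F8 F9] F10] := hF.
exact: (koszul_exact char0 Eop_sq ws_eps hD adws G_meps G_md G_closure (fun j => is_linP (lsg j))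
  F10 F5 F3 F4 F1 F8 F6 LopE RopE SopE DopE AopE lop_commE tau_lopE d0opE dE dsq o1 o2 o3
  mu_linear muE mu_om A_lopE A_ddE tE d_l d_r d_s gop_l gop_r gop_sig t1 t2 t3 t4 t5 g_base
  fl fa fd hJJ JJa fJ finj fsurj J_JJ lw_I Q_exact).
Qed.

End Exactness.

End KoszulComplex.

(** * Projection onto a subquotient *)

Section QuotientFacts.
Variables (k : fieldType) (E L : cdga k) (j : gca_hom L E) (P : dgmod E).
Variables (T N : set P) (h : dg_pair j T N).
Notation Q := (subquot_dgmod h).

Definition qproj (x : P) : Q := sqproj _ _ x.

Let hT : submod T. Proof. by case: (dgpT h). Qed.
Let hN : submod N. Proof. by case: (dgpN h). Qed.

Lemma qproj_lin a x y : T x -> T y -> qproj (a *: x + y) = a *: qproj x + qproj y.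
Proof. exact: sqproj_linear. Qed.

Lemma qproj_surj (C : Q) : exists x, T x /\ C = qproj x.
Proof. by exists (sqrep C); split; [exact: sqrep_in|rewrite /qproj sqrepK]. Qed.

Lemma qproj_eq0 x : T x -> (qproj x = 0 <-> N x).
Proof. exact: sqproj_eq0. Qed.

Lemma qproj0 : qproj 0 = 0.
Proof. by apply/qproj_eq0; [case: hT|case: hN]. Qed.

Lemma qproj_eq x y : T x -> T y -> N (x - y) -> qproj x = qproj y.
Proof. exact: sqproj_eq. Qed.

Lemma qproj_act l x : T x -> act l (qproj x) = qproj (act (j l) x).
Proof.
move=> hx; apply: sqproj_eq.
- by apply: (dgp_actT h); exact: sqrep_in.
- exact: (dgp_actT h).
rewrite -(linB _ _ (act_linearr _)); apply: (dgp_actN h); exact: sqprojK.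
Qed.

Lemma qproj_md x : T x -> md (qproj x) = qproj (md x).
Proof.
move=> hx; apply: sqproj_eq.
- by apply: (dgp_dT h); exact: sqrep_in.
- exact: (dgp_dT h).
rewrite -(linB _ _ (@md_linear _ _ _)); apply: (dgp_dN h); exact: sqprojK.
Qed.

Lemma qproj_deg i x : T x -> mdeg i x -> mdeg i (qproj x).
Proof. by move=> hx dx; exists x. Qed.

Lemma qproj_sub (S : set Q) (R : set P) : submod S -> submod R -> R `<=` T ->
  submod [set x | T x /\ S (qproj x)].
Proof.
move=> hS hR RT; split=> [|a x y [hx sx] [hy sy]].
  by rewrite /= qproj0; split; [case: hT|case: hS].
by split; [case: hT => _; apply|rewrite qproj_lin //; case: hS => _; apply].
Qed.

Lemma qproj_image (R : set P) : submod R -> R `<=` T ->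
  submod [set C | exists x, R x /\ C = qproj x].
Proof.
move=> hR RT; split; first by exists 0; rewrite qproj0; split=> //; case: hR.
move=> a _ _ [x [hx ->]] [y [hy ->]]; exists (a *: x + y).
by rewrite qproj_lin; [split=> //; case: hR => _; apply|exact: RT|exact: RT].
Qed.

Lemma qproj_meps x : T x -> T (meps x) /\ meps (qproj x) = qproj (meps x).
Proof.
move=> hx; pose R := [set x | T x /\ (T (meps x) /\ meps (qproj x) = qproj (meps x))].
suff H : T `<=` R by case: (H _ hx).
case: (dgpT h) => _ /subset_trans; apply; apply: lspan_min.
  split=> [|a y z [hy [my ey]] [hz [mz ez]]].
    by rewrite /R /= (lin0 (@meps_linear _ _ _)) qproj0 (lin0 (@meps_linear _ _ _)); split; [case: hT|split; [case: hT|]].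
  have hT' := proj2 hT; split; first exact: hT'.
  rewrite meps_linear; split; first exact: hT'.
  by rewrite !qproj_lin // meps_linear ey ez.
move=> y [hy [i di]]; have hZ : T ((-1) ^ i *: y) by exact: submodZ.
rewrite /R /= (mepsE di) (mepsE (qproj_deg hy di)); split=> //; split=> //.
rewrite -[_ *: y]addr0 qproj_lin //; last by case: hT.
by rewrite qproj0 addr0.
Qed.

Lemma q_operator (f : P -> P) : linear f -> (forall x, T x -> T (f x)) ->
    (forall x, N x -> N (f x)) ->
  exists g : Q -> Q, linear g /\ forall x, T x -> g (qproj x) = qproj (f x).
Proof.
move=> lf fT fN; pose g (C : Q) := qproj (f (sqrep C)).
have gE x : T x -> g (qproj x) = qproj (f x).
  move=> hx; apply: qproj_eq; [apply: fT; exact: sqrep_in|exact: fT|].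
  by rewrite -(linB _ _ lf); apply: fN; exact: sqprojK.
exists g; split=> // a C D.
have [x [hx ->]] := qproj_surj C; have [y [hy ->]] := qproj_surj D.
rewrite -qproj_lin // !gE //; last by case: hT => _; apply.
by rewrite lf qproj_lin //; apply: fT.
Qed.

End QuotientFacts.

(** * Dual numbers and derivations *)

Section DualNumbers.
Variables (k : fieldType) (A : gca k) (h : nat).

(** The dual numbers A + eta A, where eta has degree h. The argument makes the
    algebra structure depend on h, which enters through the sign in the
    product. *)
Definition dual_of (_ : nat) : Type := (A * A)%type.
Notation dual := (dual_of h).
Definition tweps (a : A) : A := iter h (@eps k A) a.

Lemma tweps_linear : linear tweps.
Proof. by rewrite /tweps; elim: h => // n IH a x y; rewrite !iterS IH eps_linear. Qed.
Lemma twepsM x y : tweps (x * y) = tweps x * tweps y.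
Proof. by rewrite /tweps; elim: h => //= n ->; rewrite epsM. Qed.
Lemma tweps1 : tweps 1 = 1.
Proof. by rewrite /tweps; elim: h => //= n ->; rewrite eps1. Qed.
Lemma twepsE n x : adeg n x -> tweps x = (-1) ^+ (n * h) *: x.
Proof.
move=> hx; rewrite /tweps; elim: h => [|m IH] /=; first by rewrite muln0 scale1r.
by rewrite IH (linZ _ _ (@eps_linear _ _)) (epsE hx) scalerA mulnS addnC exprD.
Qed.

HB.instance Definition _ := GRing.Lmodule.copy dual (A * A)%type.

Definition dmul (x y : dual) : dual := (x.1 * y.1, x.2 * y.1 + tweps x.1 * y.2).
Definition done_ : dual := (1, 0).

Lemma dmulA : associative dmul.
Proof.
move=> x y z; rewrite /dmul /= twepsM !mulrA; congr (_, _).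
by rewrite mulrDl mulrDr !mulrA addrA.
Qed.
Lemma dmul1l : left_id done_ dmul.
Proof. by case=> a b; rewrite /dmul /= !mul1r tweps1 mul0r add0r mul1r. Qed.
Lemma dmul1r : right_id done_ dmul.
Proof. by case=> a b; rewrite /dmul /= !mulr1 mulr0 addr0. Qed.
Lemma dmulDl : left_distributive dmul +%R.
Proof.
move=> x y z; rewrite /dmul /= (linD _ _ tweps_linear) !mulrDl; congr (_, _).
by rewrite addrACA.
Qed.
Lemma dmulDr : right_distributive dmul +%R.
Proof. by move=> x y z; rewrite /dmul /= !mulrDr; congr (_, _); rewrite addrACA. Qed.
Lemma d1neq0 : done_ != 0.
Proof. by apply/eqP => -[/eqP]; rewrite oner_eq0. Qed.
HB.instance Definition _ := GRing.Zmodule_isNzRing.Build dual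
  dmulA dmul1l dmul1r dmulDl dmulDr d1neq0.

Lemma dscaleAl (a : k) (x y : dual) : a *: (dmul x y) = dmul (a *: x) y.
Proof.
rewrite /dmul /=.
rewrite (linZ _ _ tweps_linear) -!scalerAl -scalerDr; exact: erefl.
Qed.
HB.instance Definition _ := GRing.Lmodule_isLalgebra.Build k dual dscaleAl.
Lemma dscaleAr (a : k) (x y : dual) : a *: (dmul x y) = dmul x (a *: y).
Proof.
rewrite /dmul /=.
rewrite -!scalerAr -scalerDr; exact: erefl.
Qed.
HB.instance Definition _ := GRing.Lalgebra_isAlgebra.Build k dual dscaleAr.

Definition adeg_shift (n : nat) : set A := if (h <= n)%N then adeg (n - h) else [set 0].

Lemma adeg_shift_submod n : submod (adeg_shift n).
Proof.
rewrite /adeg_shift; case: ifP => _; last exact: submod_zero.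
exact: (deg_submod (adeg_grading A)).
Qed.

Lemma adeg_shiftM m n x y : adeg m x -> adeg_shift n y ->
  adeg_shift (m + n) (x * y) /\ adeg_shift (m + n) (y * x).
Proof.
rewrite /adeg_shift; case: leqP => hn hx.
  move=> hy; rewrite (leq_trans hn (leq_addl m n)) -addnBA //; split; first exact: adegM.
  by rewrite addnC; apply: adegM.
move=> ->; rewrite mulr0 mul0r; split; exact: (proj1 (adeg_shift_submod _)).
Qed.

Definition ddeg (n : nat) : set dual := [set x | adeg n x.1 /\ adeg_shift n x.2].

Lemma ddeg_grading : is_grading ddeg.
Proof.
have [h1 h2 h3] := adeg_grading A; split.
- move=> n; have [a0 al] := h1 n; have [b0 bl] := adeg_shift_submod n; split=> // a x y [x1 x2] [y1 y2].
  by split; [apply: al|apply: bl].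
- move=> [a b]; set S := lspan _; have hS : submod S by exact: lspan_submod.
  have -> : (a, b) = ((a, 0) : dual) + (0, b) by rewrite -[RHS]/(a + 0, 0 + b) addr0 add0r.
  apply: (submodD hS).
    have lf : linear (fun a : A => (a, 0) : dual).
      by move=> c x y; rewrite -[RHS]/(c *: x + y, c *: 0 + 0) scaler0 addr0.
    move: (h2 a); apply: (lspan_lin lf) => // x [n hx]; apply: lspan_gen; exists n.
    by split=> //; exact: (proj1 (adeg_shift_submod _)).
  have lf : linear (fun b : A => (0, b) : dual).
    by move=> c x y; rewrite -[RHS]/(c *: 0 + 0, c *: x + y) scaler0 addr0.
  move: (h2 b); apply: (lspan_lin lf) => // x [n hx]; apply: lspan_gen; exists (n + h)%N.
  by split; [case: (h1 (n + h)%N)|rewrite /adeg_shift leq_addl addnK].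
- move=> s c us hc e0 i si.
  have s1 : \sum_(i <- s) (c i).1 = 0.
    have := congr1 fst e0; rewrite (big_morph (fun x : dual => x.1) (id1 := 0) (op1 := +%R)) //.
  have s2 : \sum_(i <- s) (c i).2 = 0.
    have := congr1 snd e0; rewrite (big_morph (fun x : dual => x.2) (id1 := 0) (op1 := +%R)) //.
  have c1 : (c i).1 = 0.
    by apply: (h3 s (fun i => (c i).1)) => // n; case: (hc n).
  suff c2 : (c i).2 = 0 by rewrite [c i]surjective_pairing c1 c2.
  have [hi|hi] := leqP h i; last first.
    by have [_] := hc i; rewrite /adeg_shift leqNgt hi.
  pose t := [seq (i - h)%N | i <- s & (h <= i)%N].
  have ut : uniq t.
    rewrite map_inj_in_uniq ?filter_uniq // => a b; rewrite !mem_filter => /andP[ha _] /andP[hb _] e1.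
    by rewrite -(subnK ha) e1 subnK.
  have := h3 t (fun m => (c (m + h)%N).2) ut _ _ (i - h)%N; rewrite subnK //; apply.
  + by move=> m; have [_] := hc (m + h)%N; rewrite /adeg_shift leq_addl addnK.
  + rewrite big_map big_filter -[RHS]s2 [RHS](bigID (fun i => h <= i)%N) /=.
    rewrite [X in _ = _ + X]big1 ?addr0 => [|m]; last first.
      by rewrite -ltnNge => hm; have [_] := hc m; rewrite /adeg_shift leqNgt hm.
    by apply: eq_bigr => m hm; rewrite subnK.
  + by apply/mapP; exists i => //; rewrite mem_filter hi.
Qed.

Lemma ddeg1 : ddeg 0 1.
Proof. by split; [exact: adeg1|exact: (proj1 (adeg_shift_submod _))]. Qed.

Lemma ddegM m n x y : ddeg m x -> ddeg n y -> ddeg (m + n) (x * y).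
Proof.
move=> [x1 x2] [y1 y2]; split; first exact: adegM.
have hS := adeg_shift_submod (m + n); apply: (submodD hS).
  by rewrite addnC; case: (adeg_shiftM y1 x2).
rewrite (twepsE x1) -scalerAl; apply: (submodZ _ hS).
by case: (adeg_shiftM x1 y2).
Qed.

Lemma shift_comm m n x y : adeg m x -> adeg_shift n y ->
  y * x = (-1) ^+ (m * n) *: (tweps x * y).
Proof.
move=> hx; rewrite (twepsE hx) /adeg_shift; case: leqP => hn; last first.
  by move=> ->; rewrite mul0r mulr0 scaler0.
move=> hy; rewrite (adegC hx hy) -scalerAl scalerA -exprD -mulnDr.
congr (_ *: _); rewrite -signr_odd -[RHS]signr_odd; congr (_ ^+ _); congr nat_of_bool.
by rewrite !oddM; congr andb; rewrite oddD oddB.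
Qed.

Lemma ddegC m n x y : ddeg m x -> ddeg n y -> y * x = (-1) ^+ (m * n) *: (x * y).
Proof.
move=> [x1 x2] [y1 y2]; rewrite -[y * x]/(dmul y x) -[x * y]/(dmul x y) /dmul.
rewrite -[RHS]/((-1) ^+ (m * n) *: (x.1 * y.1), (-1) ^+ (m * n) *: (x.2 * y.1 + tweps x.1 * y.2)).
rewrite (adegC x1 y1) (shift_comm x1 y2) scalerDr addrC; congr (_, _ + _).
by rewrite (shift_comm y1 x2) scalerA mulnC -exprD addnn -signr_odd odd_double scale1r.
Qed.

Definition dual_gca : gca k := Gca ddeg_grading ddeg1 ddegM ddegC.

End DualNumbers.

Lemma tweps_epb (k : fieldType) (A : cdga k) h (x : A) : tweps h x = epb (odd h) x.
Proof.
rewrite /tweps; elim: h => //= n ->; rewrite /epb; case: (odd n) => //=.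
by rewrite eps_eps.
Qed.

Section Derivations.
Variables (k : fieldType) (A : cdga k) (V : set A).
Hypothesis Vf : free_gca V.

(** The derivations with constant coefficients, of parity e. *)
Definition derivation (e : bool) (xi : A -> k^o) (delta : A -> A) : Prop :=
  [/\ linear delta, forall x y, delta (x * y) = delta x * y + epb e x * delta y,
      forall v, V v -> delta v = xi v *: 1 &
      forall x, eps (delta x) = (-1) ^+ e *: delta (eps x)].

Lemma word_ind (S : set A) : submod S -> S 1 ->
  (forall n v x, V v -> adeg n v -> S x -> S (v * x)) -> forall x, S x.
Proof.
move=> hS S1 SM x; move: (free_gen Vf x); apply: lspan_min => // _ [s [_ sV ->]].
elim: s sV => [_|v s IH sV]; first by rewrite big_nil.
rewrite big_cons; have {}IH : S (\prod_(w <- s) w).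
  by apply: IH => w ws; apply: sV; rewrite inE ws orbT.
case: Vf => -[_ hV] _; move: (hV _ (sV v (mem_head _ _))).
apply: (@lspan_lin k A A _ S (fun v => v * \prod_(w <- s) w)) => // [|u [uV [n un]]].
  exact: mul_linearl.
exact: (SM n).
Qed.

(** The map v |-> v + eta xi(v) extends to a morphism from the free algebra to
    the dual numbers, and its component on eta is the derivation. *)
Lemma derivation_exists h (xi : A -> k^o) : linear xi ->
  (forall m v, V v -> adeg m v -> m != h -> xi v = 0) ->
  exists delta, derivation (odd h) xi delta.
Proof.
move=> lxi xi0; pose C := dual_gca A h.
pose f (v : A) : C := (v, xi v *: 1).
have [|n v Vv hv|g [gV _]] := (proj2 Vf) C f.
- move=> a x y _ _; rewrite /f lxi scalerDl -scalerA; exact: erefl.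
- split=> //=; rewrite /adeg_shift; have [->|nh] := eqVneq n h.
    rewrite leqnn subnn; apply: (submodZ _ (deg_submod (adeg_grading A) _)); exact: adeg1.
  rewrite (xi0 _ _ Vv hv nh) scale0r; have := adeg_shift_submod A h n; rewrite /adeg_shift.
  by case.
have gl : linear (g : A -> C) by move=> a x y; rewrite linearP.
have gM x y : g (x * y) = dmul (g x) (g y) :> dual_of A h by rewrite rmorphM.
have g1 : g 1 = (1, 0) :> dual_of A h by rewrite rmorph1.
have gfst x : (g x).1 = x.
  move: x; apply: word_ind; [|by rewrite g1|move=> n v x Vv _ e1].
    by apply: submod_eq_lin => // a x y; rewrite gl.
  by rewrite gM /= e1 (gV _ Vv).
exists (fun x => (g x).2); split.
- by move=> a x y; rewrite gl.
- by move=> x y; rewrite gM /= !gfst tweps_epb.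
- by move=> v Vv; rewrite (gV _ Vv).
- apply: gca_ind => [|n x hx].
    apply: submod_eq_lin => a x y; first by rewrite gl /= eps_linear.
    by rewrite eps_linear gl /= scalerDr !scalerA mulrC.
  have [_] := gca_hom_deg g hx; rewrite (epsE hx) (linZ _ _ gl) /= scalerA /adeg_shift.
  case: leqP => hn; last by move=> ->; rewrite (lin0 (@eps_linear _ _)) scaler0.
  move=> /epsE ->; congr (_ *: _); rewrite -exprD -signr_odd -[RHS]signr_odd.
  by congr (_ ^+ _); rewrite oddB // oddD oddb addbC.
Qed.

Variables (e1 e2 : bool) (xi1 xi2 : A -> k^o) (delta1 delta2 : A -> A).
Hypothesis h1 : derivation e1 xi1 delta1.
Hypothesis h2 : derivation e2 xi2 delta2.

Lemma derivation1 e xi delta : derivation e xi delta -> delta 1 = 0.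
Proof.
move=> [_ dM _ _]; have := dM 1 1; rewrite epb1 !mulr1 mul1r => h.
by apply: (addrI (delta 1)); rewrite addr0 -h.
Qed.

Lemma derivation_epb e xi delta b x : derivation e xi delta ->
  delta (epb b x) = (-1) ^+ (b && e) *: epb b (delta x).
Proof.
move=> [_ _ _ de]; case: b => /=; last by rewrite scale1r.
by rewrite de scalerA -signr_addb addbb scale1r.
Qed.

(** The graded commutator of two derivations is a derivation, and it vanishes
    on V because both take scalar values there. *)
Lemma derivation_comm x :
  delta1 (delta2 x) = (-1) ^+ (e1 && e2) *: delta2 (delta1 x).
Proof.
have [l1 m1 v1 p1] := h1; have [l2 m2 v2 p2] := h2.
move: x; apply: word_ind.
- apply: submod_eq_lin; first exact: (linear_comp2 l1 l2).
  exact: (linear_scale2 _ (linear_comp2 l2 l1)).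
- by rewrite (derivation1 h1) (derivation1 h2) (lin0 l1) (lin0 l2) scaler0.
move=> n v x Vv _ IH; rewrite m1 m2 (linD _ _ l1) (linD _ _ l2) !m1 !m2.
rewrite (derivation_epb e2 v h1) (derivation_epb e1 v h2) (v1 _ Vv) (v2 _ Vv).
rewrite !(linZ _ _ l1) !(linZ _ _ l2) (derivation1 h1) (derivation1 h2) !scaler0 !mul0r !add0r.
rewrite !(linZ _ _ (@epb_linear _ A _)) !epb1 !mulr_algl IH.
rewrite (andbC e2) epb_epb; set s := (-1) ^+ (e1 && e2).
have ss : s * s = 1 by rewrite /s -signr_addb addbb.
rewrite -!scalerAl !mul1r -scalerAr !scalerDr (scalerA s s) ss scale1r.
by rewrite addrCA.
Qed.

End Derivations.

(** * Derivations of a column *)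

Section GradedSub.
Variable k : fieldType.

Lemma graded_eps (A : gca k) (S : set A) : graded_sub (@adeg k A) S ->
  forall x, S x -> S (eps x).
Proof.
move=> [hS hS'] x /hS'; apply: (lspan_lin (@eps_linear _ A) hS) => y [Sy [n hy]].
by rewrite (epsE hy); apply: (submodZ _ hS).
Qed.

Lemma graded_epb (A : cdga k) (S : set A) b : graded_sub (@adeg k A) S ->
  forall x, S x -> S (epb b x).
Proof. by case: b => // hS x; apply: (graded_eps hS). Qed.

Lemma graded_meps (A : cdga k) (P : dgmod A) (S : set P) : graded_sub (@mdeg k A P) S ->
  forall x, S x -> S (meps x).
Proof.
move=> [hS hS'] x /hS'; apply: (lspan_lin (@meps_linear _ _ P) hS) => y [Sy [n hy]].
by rewrite (mepsE hy); apply: (submodZ _ hS).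
Qed.

Lemma gca_hom_eps (A B : gca k) (g : gca_hom A B) x : g (eps x) = eps (g x).
Proof.
move: x; apply: gca_ind => [|n x hx].
  apply: submod_eq_lin => a x y; first by rewrite eps_linear linearP.
  by rewrite linearP eps_linear.
by rewrite (epsE hx) (epsE (gca_hom_deg g hx)) linearZ.
Qed.

Lemma epb_homog (A : cdga k) n (b : bool) (x : A) : adeg n x -> epb b x = (-1) ^+ (b && odd n) *: x.
Proof. by case: b => [/epsE|]; rewrite /= ?scale1r // => ->; rewrite signr_odd. Qed.

Lemma epb_deg (A : cdga k) n b (x : A) : adeg n x -> adeg n (epb b x).
Proof.
by move=> hx; rewrite (epb_homog b hx); apply: (submodZ _ (deg_submod (adeg_grading A) _)).
Qed.

End GradedSub.

Section ModuleDerivations.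
Variables (k : fieldType) (B E L : cdga k) (i : cdga_hom B E) (j : gca_hom L E).
Variables (Z : set B) (W : set L) (P : dgmod E) (U : set P).
Hypotheses (hZ : sullivan Z) (hV : relative_sullivan W i j) (hU : semifree_on U).

Definition mon (b : B) (l : L) (u : P) : P := act (i b * j l) u.

Lemma mon_linear1 l u : linear (fun b => mon b l u).
Proof. by move=> a x y; rewrite /mon linearP mulrDl -scalerAl act_linearl. Qed.
Lemma mon_linear2 b u : linear (fun l => mon b l u).
Proof. by move=> a x y; rewrite /mon linearP mulrDr -scalerAr act_linearl. Qed.
Let F := Pge i j Z W U.
Let Zf : free_gca Z. Proof. by case: hZ => -[]. Qed.
Let Wf : free_gca W. Proof. by case: hV => _ []. Qed.
Let Zg p : graded_sub (@adeg k B) (word_ge Z p).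
Proof. by apply: word_ge_graded; case: Zf. Qed.
Let Ug : graded_sub (@mdeg k E P) U. Proof. by case: hU. Qed.
Let hF p q : submod (F p q). Proof. exact: lspan_submod. Qed.

Lemma mon_Pge p b l u : word_ge Z p b -> U u -> F p 0 (mon b l u).
Proof.
by move=> hb hu; apply: lspan_gen; exists b, l, u; split=> //; apply: free_gen.
Qed.

(** Elements of L can be moved past homogeneous elements of the base. *)
Lemma Pge_mon_ind p (S : set P) : submod S ->
  (forall n b l u, word_ge Z p b -> adeg n b -> U u -> S (mon b l u)) -> F p 0 `<=` S.
Proof.
move=> hS h; apply: lspan_min => // _ [b [l [u [hb _ hu ->]]]].
have := proj2 (Zg p) _ hb; apply: (lspan_lin (mon_linear1 l u)) => // x [hx [n dx]].
exact: (h n).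
Qed.

Lemma j_i_comm n (l : L) (b : B) : adeg n b -> j l * i b = i b * j (epb (odd n) l).
Proof.
move=> hb; rewrite (gca_homog_eps (j l) (gca_hom_deg i hb)); congr (_ * _).
rewrite -tweps_epb /tweps; elim: n {hb} => //= n ->.
by rewrite -gca_hom_eps.
Qed.

Lemma act_mon n l b l' u : adeg n b ->
  act (j l) (mon b l' u) = mon b (epb (odd n) l * l') u.
Proof. by move=> hb; rewrite /mon -actM mulrA (j_i_comm l hb) rmorphM mulrA. Qed.

Lemma meps_mon b l u : meps (mon b l u) = mon (eps b) (eps l) (meps u).
Proof. by rewrite /mon meps_act epsM !gca_hom_eps. Qed.

(** From the universal properties of B (x) L and of (B (x) L) (x) U. *)
Lemma module_map (f : B -> B) (g : L -> L) : linear f -> linear g ->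
  exists phi : P -> P, linear phi /\
    forall b l u, U u -> phi (mon b l u) = mon (f b) (g l) u.
Proof.
move=> lf lg; have [_ _ tE _ _] := hV; have [_ tP _] := hU.
have [||DE [DEE _]] := tE E (fun b l => i (f b) * j (g l)).
- by move=> l _ a x y; rewrite lf linearP mulrDl scalerAl.
- by move=> b a x y _ _; rewrite lg linearP mulrDr scalerAr.
have [||DP [DPE _]] := tP P (fun x u => act (DE x) u).
- by move=> u _ a x y; rewrite linearP act_linearl.
- by move=> x a u v _ _; rewrite act_linearr.
exists DP; split; first by move=> a x y; rewrite linearP.
by move=> b l u hu; rewrite /mon DPE // DEE.
Qed.

Variable p : nat.
Notation N := (Ppq hZ hV hU p 0).
Notation T := (setaddm (F p 0) (F p.+1 0)).
Definition column_class (x : P) : N := qproj (Ppq_pair hZ hV hU p 0) x.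

Lemma Pge_T : F p 0 `<=` T. Proof. by apply: setaddml. Qed.
Lemma T_Pge : T `<=` F p 0.
Proof. by apply: setaddm_min => //; apply: (Pge_sub hZ hV hU). Qed.

Lemma cls_mon_ind (S : set N) : submod S ->
  (forall n b l u, word_ge Z p b -> adeg n b -> U u -> S (column_class (mon b l u))) ->
  forall x, S x.
Proof.
move=> hS h x; have [y [Ty ->]] := qproj_surj x.
suff H : F p 0 `<=` [set y | T y /\ S (column_class y)] by case: (H _ (T_Pge Ty)).
apply: Pge_mon_ind; first by apply: (@qproj_sub _ _ _ _ _ _ _ _ S (F p 0)) => //; exact: Pge_T.
move=> n b l u hb hn hu; split; first by apply: Pge_T; apply: mon_Pge.
exact: (h n).
Qed.

Lemma cls_lin a x y : F p 0 x -> F p 0 y -> column_class (a *: x + y) = a *: column_class x + column_class y.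
Proof. by move=> /Pge_T hx /Pge_T hy; apply: qproj_lin. Qed.

Lemma cls_act l x : F p 0 x -> act l (column_class x) = column_class (act (j l) x).
Proof. by move=> /Pge_T; apply: qproj_act. Qed.

Lemma cls_meps x : F p 0 x -> meps (column_class x) = column_class (meps x).
Proof. by move=> /Pge_T /(qproj_meps (Ppq_pair hZ hV hU p 0)) []. Qed.

Lemma cls_md x : F p 0 x -> md (column_class x) = column_class (md x).
Proof. by move=> /Pge_T; apply: qproj_md. Qed.

Lemma cls_eq0 x : F p 0 x -> (column_class x = 0 <-> F p.+1 0 x).
Proof. by move=> /Pge_T; apply: qproj_eq0. Qed.

Lemma clsZ a x : F p 0 x -> column_class (a *: x) = a *: column_class x.
Proof.
move=> hx; rewrite -[a *: x]addr0 cls_lin //; last by case: (hF p 0).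
by rewrite /column_class qproj0 addr0.
Qed.

Lemma clsD x y : F p 0 x -> F p 0 y -> column_class (x + y) = column_class x + column_class y.
Proof. by move=> hx hy; rewrite -[x in LHS]scale1r cls_lin // scale1r. Qed.

(** The operator id (x) delta (x) id on a column, with its Koszul sign. *)
Definition quotient_derivation (e : bool) (delta : L -> L) (dN : N -> N) : Prop :=
  linear dN /\ forall b l u, word_ge Z p b -> U u ->
    dN (column_class (mon b l u)) = column_class (mon (epb e b) (delta l) u).

Lemma quotient_derivation_exists e (delta : L -> L) : linear delta ->
  exists dN, quotient_derivation e delta dN.
Proof.
move=> ld; have [dP [lP PE]] := module_map (@epb_linear k B e) ld.
have Fq q x : F q 0 x -> F q 0 (dP x).
  suff H : F q 0 `<=` [set x | F q 0 (dP x)] by move=> /H.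
  apply: lspan_min; first exact: (submod_preim lP (hF q 0)).
  move=> _ [b [l [u [hb _ hu ->]]]] /=; rewrite -/(mon b l u) PE //.
  by apply: mon_Pge => //; apply: (graded_epb _ (Zg _)).
have [|x|dN [lN NE]] := @q_operator _ _ _ _ _ _ _ (Ppq_pair hZ hV hU p 0) dP lP.
- by move=> x /T_Pge/Fq/Pge_T.
- exact: Fq.
exists dN; split=> // b l u hb hu; rewrite /column_class NE ?PE //.
by apply: Pge_T; apply: mon_Pge.
Qed.

Section Properties.
Variables (e : bool) (xi : L -> k^o) (delta : L -> L) (dN : N -> N).
Hypothesis hd : derivation W e xi delta.
Hypothesis hN : quotient_derivation e delta dN.

Let lN : linear dN. Proof. by case: hN. Qed.
Let NE b l u : word_ge Z p b -> U u ->
  dN (column_class (mon b l u)) = column_class (mon (epb e b) (delta l) u).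
Proof. by case: hN => _; apply. Qed.

Lemma quotient_derivation_act l x :
  dN (act l x) = act (delta l) x + act (epb e l) (dN x).
Proof.
have [ld dM _ _] := hd; move: x; apply: cls_mon_ind.
  apply: submod_eq_lin; first exact: (linear_comp2 lN (act_linearr l)).
  exact: (linear_add2 (act_linearr _) (linear_comp2 (act_linearr _) lN)).
move=> n b l' u hb hn hu.
have hb' : word_ge Z p (epb e b) by apply: (graded_epb _ (Zg _)).
have hp := mon_Pge.
rewrite cls_act ?(act_mon _ _ _ hn) ?NE //; last exact: hp.
rewrite !cls_act ?(act_mon _ _ _ hn) ?(act_mon _ _ _ (epb_deg e hn)); try exact: hp.
rewrite (dM (epb (odd n) l)) (derivation_epb (odd n) l hd).
rewrite (linD _ _ (mon_linear2 _ _)) clsD; [|exact: hp|exact: hp].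
rewrite epb_epb; congr (_ + _); rewrite (epb_homog e hn) (andbC e).
rewrite -scalerAl (linZ _ _ (mon_linear2 _ _)) (linZ _ _ (mon_linear1 _ _)) scalerA.
by rewrite -signr_addb addbb scale1r.
Qed.

Lemma quotient_derivation_meps x : meps (dN x) = (-1) ^+ e *: dN (meps x).
Proof.
have [ld dM _ de] := hd; move: x; apply: cls_mon_ind.
  apply: submod_eq_lin; first exact: (linear_comp2 (@meps_linear _ _ _) lN).
  exact: (linear_scale2 _ (linear_comp2 lN (@meps_linear _ _ _))).
move=> n b l u hb hn hu.
have hb' : word_ge Z p (epb e b) by apply: (graded_epb _ (Zg _)).
have hu' : U (meps u) by apply: (graded_meps Ug).
have hb'' : word_ge Z p (eps b) by apply: (graded_eps (Zg _)).
rewrite NE // !cls_meps ?meps_mon ?NE //; try exact: mon_Pge.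
rewrite de (linZ _ _ (mon_linear2 _ _)) clsZ; last first.
  by apply: mon_Pge => //; apply: (graded_eps (Zg _)).
by rewrite epb_eps.
Qed.

Lemma quotient_derivation_gen z u : word_ge Z p z -> U u -> dN (column_class (act (i z) u)) = 0.
Proof.
move=> hz hu; have -> : act (i z) u = mon z 1 u by rewrite /mon rmorph1 mulr1.
rewrite NE // (derivation1 hd) (lin0 (mon_linear2 _ _)); exact: qproj0.
Qed.

End Properties.

Lemma quotient_derivation_comm e1 e2 xi1 xi2 (delta1 delta2 : L -> L) (dN1 dN2 : N -> N) x :
  derivation W e1 xi1 delta1 -> derivation W e2 xi2 delta2 ->
  quotient_derivation e1 delta1 dN1 -> quotient_derivation e2 delta2 dN2 ->
  dN1 (dN2 x) = (-1) ^+ (e1 && e2) *: dN2 (dN1 x).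
Proof.
move=> d1 d2 [l1 E1] [l2 E2]; move: x; apply: cls_mon_ind.
  apply: submod_eq_lin; first exact: (linear_comp2 l1 l2).
  exact: (linear_scale2 _ (linear_comp2 l2 l1)).
move=> n b l u hb hn hu.
have hb' e : word_ge Z p (epb e b) by apply: (graded_epb _ (Zg _)).
rewrite E2 // E1 // E1 // E2 // (derivation_comm Wf d1 d2) (linZ _ _ (mon_linear2 _ _)).
rewrite clsZ; last by apply: mon_Pge => //; apply: (graded_epb _ (Zg _)).
by rewrite epb_epb.
Qed.

End ModuleDerivations.

(** * Closed lists of letters *)

Section Functionals.
Variables (k : fieldType) (M : lmodType k).

Lemma functional_off (S : set M) (x : M) : submod S -> ~ S x ->
  exists chi : M -> k^o, [/\ linear chi, forall y, S y -> chi y = 0 & chi x = 1].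
Proof.
move=> hS nx; pose G : set (M * k^o)%type := [set p | S (p.1 - p.2 *: x)].
have hG : submod G.
  split=> [|a [y c] [z d] h1 h2]; rewrite /G /mkset /=.
    by rewrite scale0r subr0; case: hS.
  have -> : a *: y + z - (a *: c + d) *: x = a *: (y - c *: x) + (z - d *: x).
    by rewrite scalerDl scalerBr -scalerA opprD addrACA.
  by case: hS => _; apply.
have sG : single_valued G.
  move=> c; rewrite /G /mkset /= sub0r => h; apply: contrapT => /eqP c0; apply: nx.
  have -> : x = - c^-1 *: (- (c *: x)).
    by rewrite scalerN scaleNr opprK scalerA mulVf // scale1r.
  exact: (submodZ _ hS).
have [chi [lchi chiG]] := linear_extension hG sG.
exists chi; split=> //; last by apply: chiG; rewrite /G /mkset /= scale1r subrr; case: hS.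
by move=> y hy; apply: chiG; rewrite /G /mkset /= scale0r subr0.
Qed.

Lemma dual_functional (w : nat -> M) (s j : nat) :
  (forall i, (i < s)%N -> ~ lspan [set x | exists2 a, (a < i)%N & x = w a] (w i)) ->
  exists xi : M -> k^o, linear xi /\ forall i, (i < s)%N -> xi (w i) = (i == j)%:R.
Proof.
elim: s => [_|s IH hw].
  by exists (fun=> 0); split=> // a x y; rewrite scaler0 addr0.
have [i hi|xi [lxi xiE]] := IH; first by apply: hw; apply: ltnW.
have [chi [lchi chi0 chi1]] := functional_off (lspan_submod _) (hw s (ltnSn s)).
exists (fun x => xi x + ((s == j)%:R - xi (w s)) *: chi x); split.
  exact: (linear_add2 lxi (linear_scale2 _ lchi)).
move=> i; rewrite ltnS leq_eqVlt => /orP[/eqP ->|hi].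
  by rewrite chi1 [_ *: 1]mulr1 addrC subrK.
rewrite chi0 ?scaler0 ?addr0 ?xiE //.
by apply: lspan_gen; exists i.
Qed.

End Functionals.

Section Augmentation.
Variables (k : fieldType) (A : cdga k).

Let hp : submod (@posdeg k A). Proof. exact: lspan_submod. Qed.

Lemma scalar_posdeg (c : k) : @posdeg k A (c *: 1) -> c = 0.
Proof.
move=> h; have : c *: (1 : A) = 0.
  apply: posdeg_deg0 => //; apply: (submodZ _ (deg_submod (adeg_grading A) _)); exact: adeg1.
by move/eqP; rewrite scaler_eq0 oner_eq0 orbF => /eqP.
Qed.

Lemma augmentation : exists aug : A -> k^o,
  [/\ linear aug, aug 1 = 1 & forall x, posdeg x -> aug x = 0].
Proof.
have [|chi [h1 h2 h3]] := @functional_off k A (@posdeg k A) 1 hp.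
  by rewrite -[1]scale1r => /scalar_posdeg/eqP; rewrite oner_eq0.
by exists chi.
Qed.

End Augmentation.

Section ClosedLists.
Variables (k : fieldType) (char0 : [pchar k] =i pred0).
Variables (L : cdga k) (W : set L) (FW : nat -> set L).
Hypotheses (Wf : free_gca W) (Wp : in_posdeg W).
Hypothesis FWf : filtration (@adeg k L) W FW.
Hypothesis FW_ad : forall r w, FW r.+1 w -> subalg (FW r) (ad w).

Implicit Types ws : seq (nat * L).

Definition letter_of ws i : L := (nth (0%N, 0) ws i).2.
Definition deg_of ws i : nat := (nth (0%N, 0) ws i).1.
Definition words_before ws j : set L :=
  lspan [set x | exists v, all (fun a => a < j)%N v /\ x = list_word (letter_of ws) v].

(** The finitely generated Sullivan subalgebras of L on which Koszul modules
    are built. The lists contain the degrees of the letters. *)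
Definition closed_list ws : Prop := forall i, (i < size ws)%N ->
  [/\ W (letter_of ws i), adeg (deg_of ws i) (letter_of ws i),
      ~ lspan [set x | exists2 a, (a < i)%N & x = letter_of ws a] (letter_of ws i) &
      words_before ws i (ad (letter_of ws i))].

Definition extends ws ws' : Prop := closed_list ws' /\ exists t, ws' = ws ++ t.

Lemma letter_of_big ws i : (size ws <= i)%N -> letter_of ws i = 0.
Proof. by move=> h; rewrite /letter_of nth_default. Qed.

Lemma extends_refl ws : closed_list ws -> extends ws ws.
Proof. by move=> h; split=> //; exists [::]; rewrite cats0. Qed.

Lemma extends_trans ws ws' ws'' : extends ws ws' -> extends ws' ws'' -> extends ws ws''.
Proof. by move=> [_ [t e1]] [h [t' e2]]; split=> //; exists (t ++ t'); rewrite e2 e1 catA. Qed.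

Let Wsub : submod W. Proof. by case: Wf => -[]. Qed.

Lemma letter_of_W ws i : closed_list ws -> W (letter_of ws i).
Proof.
move=> h; have [hi|hi] := ltnP i (size ws); first by case: (h i hi).
by rewrite letter_of_big //; case: Wsub.
Qed.

(** If S is monotone, finitely many memberships can be realized by one list,
    since every list can be extended further; this replaces a choice of a
    basis of W. *)
Definition eventually_in (M : lmodType k) (S : seq (nat * L) -> set M) : set M :=
  [set x | forall ws, closed_list ws -> exists ws', extends ws ws' /\ S ws' x].

Lemma eventually_in_submod (M : lmodType k) (S : seq (nat * L) -> set M) :
  (forall ws, submod (S ws)) -> (forall ws ws', extends ws ws' -> S ws `<=` S ws') ->
  submod (eventually_in S).
Proof.
move=> hS mS; split=> [ws h|a x y hx hy ws h].
  by exists ws; split; [exact: extends_refl|case: (hS ws)].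
have [ws1 [e1 s1]] := hx ws h; have [ws2 [e2 s2]] := hy ws1 (proj1 e1).
exists ws2; split; first exact: extends_trans e1 e2.
by case: (hS ws2) => _; apply => //; apply: mS s1.
Qed.

Lemma list_word_extends ws ws' v : extends ws ws' ->
  list_word (letter_of ws') v = list_word (letter_of ws) v \/
  list_word (letter_of ws) v = 0.
Proof.
move=> [_ [t ->]]; case: (boolP (all (fun i => i < size ws)%N v)) => hv.
  left; rewrite /list_word; apply: eq_big_seq => i iv.
  by rewrite /letter_of nth_cat (allP hv _ iv).
right; elim: v hv => //= i v IH; rewrite negb_and -leqNgt /list_word big_cons => /orP[hi|/IH].
  by rewrite letter_of_big // mul0r.
by rewrite /list_word => ->; rewrite mulr0.
Qed.

Lemma list_words_extends ws ws' c : extends ws ws' ->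
  list_words (letter_of ws) c `<=` list_words (letter_of ws') c.
Proof.
move=> h; apply: lspan_min; first exact: lspan_submod.
move=> _ [v [hv ->]]; have [<-|->] := list_word_extends v h.
  by apply: lspan_gen; exists v.
by case: (list_words_submod (letter_of ws') c).
Qed.

Definition letters_span ws : set L := lspan [set x | exists i, x = letter_of ws i].

Lemma letters_span_extends ws ws' : extends ws ws' -> letters_span ws `<=` letters_span ws'.
Proof.
move=> [_ [t ->]]; apply: lspan_min; first exact: lspan_submod.
move=> _ [i ->]; have [hi|hi] := ltnP i (size ws).
  by apply: lspan_gen; exists i; rewrite /letter_of nth_cat hi.
by rewrite letter_of_big //; case: (lspan_submod [set x | exists i, x = letter_of (ws ++ t) i]).
Qed.

Lemma letters_span_words ws : letters_span ws `<=` list_words (letter_of ws) 1.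
Proof.
apply: lspan_min; first exact: lspan_submod.
by move=> _ [i ->]; apply: lspan_gen; exists [:: i]; rewrite /list_word big_seq1.
Qed.

Lemma list_words_mul ws a b x y : list_words (letter_of ws) a x ->
  list_words (letter_of ws) b y -> list_words (letter_of ws) (a + b) (x * y).
Proof.
apply: lspan_bilin => [z|z||_ _ [u [hu ->]] [v [hv ->]]].
- exact: mul_linearl.
- exact: mul_linearr.
- exact: lspan_submod.
rewrite -list_word_cat; apply: lspan_gen; exists (u ++ v).
by rewrite size_cat leq_add.
Qed.

Lemma words_eventually (S : set L) c : S `<=` eventually_in letters_span ->
  word_ge S c `<=` eventually_in (fun ws => list_words (letter_of ws) c).
Proof.
move=> hS; apply: lspan_min.
  apply: eventually_in_submod => [ws|ws ws']; first exact: lspan_submod.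
  exact: list_words_extends.
move=> _ [v [cv vS ->]] ws hws.
suff [ws' [e h]] : exists ws', extends ws ws' /\
    list_words (letter_of ws') (size v) (\prod_(w <- v) w).
  exists ws'; split=> //; move: h; apply: lspan_min; first exact: lspan_submod.
  by move=> _ [u [hu ->]]; apply: lspan_gen; exists u; split=> //; apply: leq_trans hu.
elim: v vS {cv} => [_|w v IH vS].
  exists ws; split; first exact: extends_refl.
  by rewrite big_nil; apply: lspan_gen; exists [::]; rewrite /list_word big_nil.
have [|ws1 [e1 h1]] := IH; first by move=> x xv; apply: vS; rewrite inE xv orbT.
have [ws2 [e2 h2]] := hS w (vS w (mem_head _ _)) ws1 (proj1 e1).
exists ws2; split; first exact: extends_trans e1 e2.
rewrite big_cons -[size _]/(1 + size v)%N; apply: list_words_mul.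
  exact: letters_span_words.
exact: (list_words_extends e2).
Qed.

(** A homogeneous letter which is not yet in the span can be appended to a
    list for which its differential is a combination of words. *)
Lemma filtration_eventually r : FW r `<=` eventually_in letters_span.
Proof.
have [FW0 FWg _ _] := FWf.
have hE : submod (eventually_in letters_span).
  by apply: eventually_in_submod => [ws|ws ws']; [exact: lspan_submod|exact: letters_span_extends].
elim: r => [|r IH]; first by rewrite FW0 => _ ->; case: hE.
have [_ hF] := FWg r.+1; apply: (subset_trans hF); apply: lspan_min => // w [Fw [n dw]] ws hws.
have [ws1 [[h1 [t e1]] a1]] := words_eventually IH (FW_ad Fw) hws.
case: (pselect (letters_span ws1 w)) => hw; first by exists ws1; split=> //; split=> //; exists t.
have lo i : (i < size ws1)%N -> nth (0%N, 0) (rcons ws1 (n, w)) i = nth (0%N, 0) ws1 i.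
  by move=> hi; rewrite nth_rcons hi.
have lw : nth (0%N, 0) (rcons ws1 (n, w)) (size ws1) = (n, w).
  by rewrite nth_rcons ltnn eqxx.
exists (rcons ws1 (n, w)); split; last first.
  by apply: lspan_gen; exists (size ws1); rewrite /letter_of lw.
split; last by exists (rcons t (n, w)); rewrite e1 rcons_cat.
move=> i; rewrite size_rcons ltnS leq_eqVlt => /orP[/eqP ->|hi].
  rewrite /deg_of /letter_of lw /=; split=> //.
  - by case: FWf => _ _ _ ->; exists r.+1.
  - apply: contra_not hw; apply: lspan_min; first exact: lspan_submod.
    by move=> _ [a ha ->]; rewrite lo //; apply: lspan_gen; exists a.
  - move: a1; apply: lspan_min; first exact: lspan_submod.
    move=> _ [v [_ ->]]; case: (boolP (all (fun i => i < size ws1)%N v)) => hv.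
      apply: lspan_gen; exists v; split=> //; rewrite /list_word; apply: eq_big_seq => a av.
      by rewrite /letter_of lo // (allP hv _ av).
    suff -> : list_word (letter_of ws1) v = 0 by case: (lspan_submod [set x | exists v0,
       all (fun a => a < size ws1)%N v0 /\ x = list_word (letter_of (rcons ws1 (n, w))) v0]).
    elim: v hv => //= a v IHv; rewrite negb_and -leqNgt /list_word big_cons => /orP[ha|/IHv].
      by rewrite letter_of_big // mul0r.
    by rewrite /list_word => ->; rewrite mulr0.
have [w1 w2 w3 w4] := h1 i hi.
rewrite /deg_of /letter_of lo //; split=> //.
- apply: contra_not w3; apply: lspan_min; first exact: lspan_submod.
  by move=> _ [a ha ->]; rewrite lo ?(ltn_trans ha) //; apply: lspan_gen; exists a.
- move: w4; apply: lspan_min; first exact: lspan_submod.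
  move=> _ [v [hv ->]]; apply: lspan_gen; exists v; split=> //.
  rewrite /list_word; apply: eq_big_seq => a av.
  by rewrite /letter_of lo // (ltn_trans (allP hv _ av)).
Qed.

Lemma word_eventually c : word_ge W c `<=` eventually_in (fun ws => list_words (letter_of ws) c).
Proof.
apply: words_eventually; have [_ _ _ ->] := FWf => w [r _ hr].
exact: (filtration_eventually hr).
Qed.

Lemma closed_nil : closed_list [::]. Proof. by []. Qed.

(** The words of the wrong parity and the empty word are removed by projecting
    onto one parity and by subtracting the augmentation; both leave the
    differential of a letter unchanged. *)
Lemma closed_differential ws : closed_list ws ->
  exists D : nat -> seq (k * seq nat), [/\ forall j, words_below j (D j),
    forall j, ad (letter_of ws j) = evalw (letter_of ws) (D j) &
    forall j p, p \in D j -> par_word (fun i => odd (deg_of ws i)) p.2 = ~~ odd (deg_of ws j)].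
Proof.
move=> hws; set e := fun i => odd (deg_of ws i).
have two0 : (2%:R : k) != 0 by have /pcharf0P -> := char0.
have eps_letter i : eps (letter_of ws i) = (-1) ^+ e i *: letter_of ws i.
  have [hi|hi] := ltnP i (size ws).
    by have [_ /epsE -> _ _] := hws i hi; rewrite signr_odd.
  by rewrite letter_of_big // (lin0 (@eps_linear _ _)) scaler0.
have eps_word v : eps (list_word (letter_of ws) v) = (-1) ^+ par_word e v *: list_word (letter_of ws) v.
  elim: v => [|a v IH]; first by rewrite /list_word big_nil eps1 scale1r.
  rewrite /list_word big_cons epsM eps_letter -/(list_word _ v) IH -scalerAl -scalerAr.
  by rewrite scalerA -signr_addb.
have [aug [laug aug1 aug0]] := augmentation L.
have H j : exists Dj : seq (k * seq nat), [/\ words_below j Dj,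
    ad (letter_of ws j) = evalw (letter_of ws) Dj &
    forall p, p \in Dj -> par_word e p.2 = ~~ e j].
  have [hj|hj] := leqP (size ws) j.
    exists [::]; split=> //; rewrite letter_of_big // (lin0 (@ad_linear _ _)).
    by rewrite /evalw big_nil.
  have [_ dj _ aj] := hws j hj.
  pose R : set L := [set x | exists Dj : seq (k * seq nat), [/\ words_below j Dj,
    x = evalw (letter_of ws) Dj & forall p, p \in Dj -> par_word e p.2 = ~~ e j]].
  have hR : submod R.
    split; first by exists [::]; rewrite /evalw big_nil.
    move=> a x y [D1 [b1 e1 p1]] [D2 [b2 e2 p2]].
    exists ([seq (a * p.1, p.2) | p <- D1] ++ D2); split.
    - by rewrite /words_below all_cat all_map; apply/andP.
    - rewrite /evalw big_cat big_map e1 e2 /evalw scaler_sumr; congr (_ + _).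
      by apply: eq_bigr => p _; rewrite scalerA.
    - move=> p; rewrite mem_cat => /orP[/mapP[q hq ->]|]; [exact: (p1 q hq)|exact: p2].
  (* y1 is the projection onto the parity of the differential, and pr also
     removes the scalars. *)
  pose y1 (x : L) := 2%:R^-1 *: (x + (-1) ^+ (~~ e j) *: eps x).
  pose pr (x : L) := y1 x - aug (y1 x) *: 1.
  have ly1 : linear y1.
    apply: linear_scale2; apply: (linear_add2 (f := idfun)) => //.
    by apply: linear_scale2; exact: eps_linear.
  have lpr : linear pr.
    move=> a x y; rewrite /pr ly1 laug scalerDl -[(a *: aug (y1 x)) *: 1]scalerA.
    by rewrite scalerBr opprD addrACA.
  have half x : (-1) ^+ (~~ e j) *: eps x = x -> y1 x = x.
    move=> ex; rewrite /y1 ex -mulr2n -scaler_nat scalerA mulVf // scale1r //.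
  have half0 x : (-1) ^+ (~~ e j) *: eps x = - x -> y1 x = 0.
    by move=> ex; rewrite /y1 ex subrr scaler0.
  have e_ad : pr (ad (letter_of ws j)) = ad (letter_of ws j).
    have ea : y1 (ad (letter_of ws j)) = ad (letter_of ws j).
      apply: half; have := ad_eps (letter_of ws j).
      rewrite eps_letter (linZ _ _ (@ad_linear _ _)) => h.
      have -> : eps (ad (letter_of ws j)) = - ((-1) ^+ e j *: ad (letter_of ws j)).
        by rewrite h opprK.
      by rewrite scalerN scalerA -signr_addb; case: (e j); rewrite /= expr1 scaleN1r opprK.
    by rewrite /pr ea aug0 ?scale0r ?subr0 //; exact: ad_posdeg.
  suff : R (pr (ad (letter_of ws j))) by rewrite e_ad.
  move: aj; apply: (lspan_lin lpr) => // _ [v [hv ->]].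
  have [hp|hp] := eqVneq (par_word e v) (~~ e j); last first.
    suff -> : pr (list_word (letter_of ws) v) = 0 by case: hR.
    rewrite /pr half0 ?(lin0 laug) ?scale0r ?subr0 // eps_word scalerA -signr_addb.
    have -> : ~~ e j (+) par_word e v = true.
      by move: hp; case: (par_word e v); case: (e j).
    by rewrite scaleN1r.
  have y1v : y1 (list_word (letter_of ws) v) = list_word (letter_of ws) v.
    by apply: half; rewrite eps_word scalerA -signr_addb hp addbb scale1r.
  case: v hv hp y1v => [|a v] hv hp y1v.
    rewrite /pr y1v /list_word big_nil aug1 scale1r subrr; by case: hR.
  have -> : pr (list_word (letter_of ws) (a :: v)) = list_word (letter_of ws) (a :: v).
    rewrite /pr y1v aug0 ?scale0r ?subr0 //; apply: (word1_posdeg Wf Wp).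
    apply: lspan_gen; exists (map (letter_of ws) (a :: v)); split=> //.
      by move=> w /mapP[b _ ->]; exact: letter_of_W.
    by rewrite big_map.
  exists [:: (1, a :: v)]; split.
  - by rewrite /words_below /= -/(all _ (a :: v)) andbT; move: hv => /=.
  - by rewrite /evalw big_seq1 scale1r.
  - by move=> p; rewrite inE => /eqP ->.
have /choice [D hD] := H.
by exists D; split=> j; [case: (hD j)|case: (hD j)|move=> p; case: (hD j) => _ _; apply].
Qed.

End ClosedLists.

(** * Generators of a column *)

Section Columns.
Variable k : fieldType.
Variables (B E L : cdga k) (i : cdga_hom B E) (j : gca_hom L E).
Variables (Z : set B) (W : set L) (P : dgmod E) (U : set P).
Hypotheses (hZ : sullivan Z) (hV : relative_sullivan W i j) (hU : semifree_on U).

Let F := Pge i j Z W U.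
Let Zf : free_gca Z. Proof. by case: hZ => -[]. Qed.
Let Zp : in_posdeg Z. Proof. by case: hZ. Qed.
Let Wf : free_gca W. Proof. by case: hV => _ []. Qed.
Let Wp : in_posdeg W. Proof. by case: hV => _ []. Qed.
Let Zg p : graded_sub (@adeg k B) (word_ge Z p).
Proof. by apply: word_ge_graded; case: Zf. Qed.
Let Ug : graded_sub (@mdeg k E P) U. Proof. by case: hU. Qed.
Let hF p q : submod (F p q). Proof. exact: lspan_submod. Qed.

(** The differential of the fiber is the image of that of LV under the
    augmentation of the base. *)
Lemma fiber_filtration : exists FW, filtration (@adeg k L) W FW /\
  forall r w, FW r.+1 w -> subalg (FW r) (ad w).
Proof.
have [_ _ tE [FW [FWf FWd]] fib] := hV; exists FW; split=> // r w hw.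
have [aug [laug aug1 aug0]] := augmentation B.
have [||R [RE _]] := tE L (fun b l => aug b *: l).
- by move=> l _ c x y; rewrite laug scalerDl -scalerA.
- by move=> b c x y _ _; rewrite scalerDr !scalerA mulrC.
have lR : linear R by move=> c x y; rewrite linearP.
have Rj l : R (j l) = l by rewrite -[j l]mul1r -(rmorph1 i) RE // aug1 scale1r.
have R0 x : lspan [set x | exists b l, posdeg b /\ x = i b * j l] x -> R x = 0.
  suff H : lspan [set x | exists b l, posdeg b /\ x = i b * j l] `<=` [set x | R x = 0] by move=> /H.
  apply: lspan_min; first exact: (submod_ker lR).
  by move=> _ [b [l [hb ->]]] /=; rewrite RE // aug0 // scale0r.
have <- : R (ad (j w)) = ad w.
  by rewrite -[in RHS](Rj (ad w)) -[ad (j w)](subrK (j (ad w))) (linD _ _ lR) R0 // add0r.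
have hS : submod (subalg (FW r)) by exact: lspan_submod.
move: (FWd r w hw); apply: (lspan_lin lR) => // _ [c [b [l [hb hl ->]]]].
by rewrite RE //; apply: (submodZ _ hS).
Qed.

Variable p : nat.
Notation N := (Ppq hZ hV hU p 0).
Notation cls := (@column_class _ _ _ _ _ _ _ _ _ _ hZ hV hU p).

(** A column is generated over L by the words of length >= p in Z applied to
    U. *)
Definition ZU : set P := lspan [set x | exists z u, [/\ word_ge Z p z, U u & x = act (i z) u]].
Definition Ycls : set N := [set C | exists x, ZU x /\ C = cls x].

Let mon1 z u : act (i z) (u : P) = mon i j z 1 u.
Proof. by rewrite /mon rmorph1 mulr1. Qed.

Lemma ZU_Pge : ZU `<=` F p 0.
Proof.
apply: lspan_min => // _ [z [u [hz hu ->]]]; rewrite mon1.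
exact: mon_Pge.
Qed.

Lemma ZU_gen z u : word_ge Z p z -> U u -> ZU (act (i z) u).
Proof. by move=> hz hu; apply: lspan_gen; exists z, u. Qed.

Let hZU : submod ZU. Proof. exact: lspan_submod. Qed.

Lemma Ycls_submod : submod Ycls.
Proof.
apply: (@qproj_image _ _ _ _ _ _ _ (Ppq_pair hZ hV hU p 0) ZU) => //.
by move=> x /ZU_Pge; apply: Pge_T.
Qed.

Lemma cls_ZU_ind (S : set N) : submod S ->
  (forall z u, word_ge Z p z -> U u -> S (cls (act (i z) u))) -> Ycls `<=` S.
Proof.
move=> hS h _ [x [hx ->]].
suff H : ZU `<=` [set x | F p 0 x /\ S (cls x)] by case: (H _ hx).
apply: lspan_min => [|_ [z [u [hz hu ->]]]].
  split=> [|a x' y [Fx Sx] [Fy Sy]].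
    by split; [case: (hF p 0)|rewrite /column_class qproj0; case: hS].
  by split; [case: (hF p 0) => _; apply|rewrite cls_lin //; case: hS => _; apply].
by split; [apply: ZU_Pge; exact: ZU_gen|exact: h].
Qed.

Lemma Ycls_gen z u : word_ge Z p z -> U u -> Ycls (cls (act (i z) u)).
Proof. by move=> hz hu; exists (act (i z) u); split=> //; apply: ZU_gen. Qed.

Lemma Ycls_meps y : Ycls y -> Ycls (meps y).
Proof.
move: y; apply: cls_ZU_ind; first exact: (submod_preim (@meps_linear _ _ _) Ycls_submod).
move=> z u hz hu /=; rewrite cls_meps; last by apply: ZU_Pge; exact: ZU_gen.
rewrite meps_act -gca_hom_eps; apply: Ycls_gen; first exact: (graded_eps (Zg p)).
exact: (graded_meps Ug).
Qed.

Lemma cls_mon n z l u : word_ge Z p z -> adeg n z -> U u ->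
  cls (mon i j z l u) = act (epb (odd n) l) (cls (act (i z) u)).
Proof.
move=> hz dz hu; rewrite cls_act; last by apply: ZU_Pge; exact: ZU_gen.
by rewrite -actM (j_i_comm i j _ dz) epbK.
Qed.

(** The closure principle for these generators: by induction along the
    filtration of U, where the cocycles of the base are treated before the
    other elements, to which ad z belongs. *)
Lemma Ycls_closed (S : set N) : submod S ->
  (forall y, Ycls y -> lspan [set x | exists l s, S s /\ x = act l s] (md y) -> S y) ->
  Ycls `<=` S.
Proof.
move=> hS hcl; set LS := fun md_y => lspan [set x | exists l s, S s /\ x = act l s] md_y.
have hLS : submod LS by exact: lspan_submod.
have LS_S s : S s -> LS s by move=> h; apply: lspan_gen; exists 1, s; rewrite act1.
have [_ _ [FU [[FU0 FUg FUm UE] FUd]]] := hU.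
have FUU r u : FU r u -> U u by rewrite UE => h; exists r.
apply: cls_ZU_ind => // z u hz hu.
have [r _ hr] : (\bigcup_r FU r) u by rewrite -UE.
elim: r z u hz hu hr => [|r IH] z u hz hu hr.
  move: hr; rewrite FU0 => ->; rewrite (lin0 (act_linearr _)) /column_class qproj0; by case: hS.
pose SF : set P := [set x | F p 0 x /\ LS (cls x)].
have hSF : submod SF.
  split=> [|a x y [Fx Sx] [Fy Sy]].
    by split; [case: (hF p 0)|rewrite /column_class qproj0; case: hLS].
  by split; [case: (hF p 0) => _; apply|rewrite cls_lin //; case: hLS => _; apply].
have monSF z' l v : word_ge Z p z' -> FU r v -> SF (mon i j z' l v).
  move=> hz' hv; have hvU := FUU _ _ hv.
  have := proj2 (Zg p) _ hz'; apply: (lspan_lin (mon_linear1 i j l v)) => // x [hx [n dx]].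
  split; first exact: mon_Pge.
  rewrite (cls_mon _ hx dx hvU); apply: lspan_gen; exists (epb (odd n) l), (cls (act (i x) v)).
  by split=> //; apply: IH.
have mdSF z' : word_ge Z p z' -> SF (act (i z') (md u)).
  move=> hz'; have := FUd _ _ hr; apply: (lspan_lin (act_linearr (i z'))) => // _ [a [v [hv ->]]].
  rewrite -actM; have [_ _ tE _ _] := hV.
  have tg : lspan [set e | exists b l, setT l /\ e = i b * j l] a.
    apply: (tensor_gen _ _ _ tE); first by split.
    - by move=> l c b b'; rewrite linearP mulrDl -scalerAl.
    - by move=> b c l l'; rewrite linearP mulrDr -scalerAr.
  move: tg; apply: (lspan_lin (f := fun a => act (i z' * a) v)) => //.
    by move=> c x y; rewrite mulrDr -scalerAr act_linearl.
  move=> _ [b [l [_ ->]]]; rewrite mulrA -rmorphM; apply: monSF => //.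
  by rewrite -[p]addn0; apply: word_geM => //; exact: (free_gen Zf).
have Fi z' : word_ge Z p z' -> F p 0 (act (i z') u).
  by move=> h; apply: ZU_Pge; exact: ZU_gen.
have mdE z' : word_ge Z p z' -> md (cls (act (i z') u)) =
    cls (act (i (ad z')) u) + cls (act (i (eps z')) (md u)).
  move=> h; have he : word_ge Z p (eps z') by exact: (graded_eps (Zg p)).
  have ha : word_ge Z p (ad z') by exact: (ad_word Zf Zp h).
  rewrite cls_md ?md_actE; last exact: Fi.
  rewrite -cdga_hom_d -gca_hom_eps clsD //; first exact: Fi.
  by case: (mdSF _ he).
have mdLS z' : word_ge Z p z' -> LS (cls (act (i (eps z')) (md u))).
  by move=> h; case: (mdSF _ (graded_eps (Zg p) h)).
have cocycle z' : word_ge Z p z' -> ad z' = 0 -> S (cls (act (i z') u)).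
  move=> h az; apply: hcl; first exact: Ycls_gen.
  rewrite mdE // az rmorph0 (lin0 (act_linearl _)) /column_class qproj0 add0r.
  exact: mdLS.
apply: hcl; first exact: Ycls_gen.
rewrite mdE //; apply: (submodD hLS); last exact: mdLS.
by apply: LS_S; apply: cocycle; [exact: (ad_word Zf Zp hz)|exact: ad_ad].
Qed.

(** Gw ws is the least subspace of Ycls closed in this sense: only words in ws
    occur in the iterated differentials of its elements. *)
Definition list_closed (ws : seq (nat * L)) (S : set N) : Prop :=
  forall y, Ycls y -> lspan [set x | exists v y', S y' /\
    x = act (list_word (letter_of ws) v) y'] (md y) -> S y.
Definition Gw (ws : seq (nat * L)) : set N :=
  [set n | Ycls n /\ forall S, submod S -> list_closed ws S -> S n].
Notation lword ws := (list_word (letter_of ws)).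
Notation J ws := (list_mod (letter_of ws) (Gw ws)).

Lemma Gw_submod ws : submod (Gw ws).
Proof.
split=> [|a x y [Yx hx] [Yy hy]].
  by split=> [|S [S0 _] _ //]; case: Ycls_submod.
split; first by case: Ycls_submod => _; apply.
by move=> S hS hc; case: (hS) => _; apply; [apply: hx|apply: hy].
Qed.

Lemma Gw_closed ws y : Ycls y -> J ws 0 (md y) -> Gw ws y.
Proof.
move=> Yy hd; split=> // S hS hc; apply: (hc) => //; move: hd; apply: lspan_sub.
by move=> _ [v [y' [_ [_ hy'] ->]]]; apply: lspan_gen; exists v, y'; split=> //; exact: (hy' S hS hc).
Qed.

Lemma Gw_closure ws (S : set N) : submod S ->
  (forall y, Gw ws y -> lspan [set x | exists v y', [/\ Gw ws y', S y' &
     x = act (lword ws v) y']] (md y) -> S y) -> Gw ws `<=` S.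
Proof.
move=> hS h n [Yn hn]; suff : (Gw ws `&` S) n by case.
apply: hn; first by apply: submodI => //; exact: Gw_submod.
move=> y Yy hd; have Gy : Gw ws y.
  apply: Gw_closed => //; move: hd; apply: lspan_sub => _ [v [y' [[Gy' _] ->]]].
  by apply: lspan_gen; exists v, y'.
split=> //; apply: h => //; move: hd; apply: lspan_sub => _ [v [y' [[Gy' Sy'] ->]]].
by apply: lspan_gen; exists v, y'.
Qed.

Lemma Gw_md ws y : Gw ws y -> J ws 0 (md y).
Proof.
move: y; apply: Gw_closure.
  exact: (submod_preim (@md_linear _ _ _) (list_mod_submod _ _ _)).
move=> y _; apply: lspan_sub => _ [v [y' [Gy' _ ->]]].
by apply: lspan_gen; exists v, y'.
Qed.

Lemma letter_eps ws a : closed_list W ws ->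
  eps (letter_of ws a) = (-1) ^+ odd (deg_of ws a) *: letter_of ws a.
Proof.
move=> hws; have [hi|hi] := ltnP a (size ws).
  by have [_ /epsE -> _ _] := hws a hi; rewrite signr_odd.
by rewrite letter_of_big // (lin0 (@eps_linear _ _)) scaler0.
Qed.

Lemma Gw_meps ws y : closed_list W ws -> Gw ws y -> Gw ws (meps y).
Proof.
move=> hws; move: y; apply: Gw_closure.
  exact: (submod_preim (@meps_linear _ _ _) (Gw_submod _)).
move=> y [Yy _] hd /=; apply: Gw_closed; first exact: Ycls_meps.
have hJ := list_mod_submod (letter_of ws) (Gw ws) 0.
rewrite md_meps; apply: (submodN hJ).
move: hd; apply: (lspan_lin (@meps_linear _ _ _)) => // _ [v [y' [_ Gy' ->]]].
rewrite meps_act; have [c ->] := eps_lword (fun a => letter_eps a hws) v.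
rewrite (linZ _ _ (act_linearl _)); apply: (submodZ _ hJ).
by apply: lspan_gen; exists v, (meps y').
Qed.

Lemma lspan_lword_extends ws ws' (S S' : set N) : extends W ws ws' -> S `<=` S' ->
  lspan [set x | exists v y', S y' /\ x = act (lword ws v) y'] `<=`
  lspan [set x | exists v y', S' y' /\ x = act (lword ws' v) y'].
Proof.
move=> e SS; apply: lspan_sub => _ [v [y' [hy' ->]]].
have [<-|->] := list_word_extends v e; first by apply: lspan_gen; exists v, y'; split=> //; apply: SS.
rewrite (lin0 (act_linearl _)).
by case: (lspan_submod [set x | exists v0 y', S' y' /\ x = act (lword ws' v0) y']).
Qed.

Lemma Gw_extends ws ws' : extends W ws ws' -> Gw ws `<=` Gw ws'.
Proof.
move=> e n [Yn hn]; split=> // S hS hc; apply: hn => // y Yy hd; apply: hc => //.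
exact: (lspan_lword_extends e (@subset_refl _ S) hd).
Qed.

Lemma J_extends c ws ws' : extends W ws ws' -> J ws c `<=` J ws' c.
Proof.
move=> e; apply: lspan_sub => _ [v [y' [hv hy' ->]]].
have [<-|->] := list_word_extends v e.
  by apply: lspan_gen; exists v, y'; split=> //; apply: (Gw_extends e).
by rewrite (lin0 (act_linearl _)); case: (list_mod_submod (letter_of ws') (Gw ws') c).
Qed.

Lemma J_eventually_submod c :
  submod (eventually_in W (fun ws => J ws c)).
Proof.
by apply: eventually_in_submod => [ws|ws ws']; [exact: list_mod_submod|exact: J_extends].
Qed.

Lemma Gw_eventually_submod : submod (eventually_in W Gw).
Proof.
by apply: eventually_in_submod => [ws|ws ws']; [exact: Gw_submod|exact: Gw_extends].
Qed.

Lemma act_eventually c l y : word_ge W c l -> eventually_in W Gw y ->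
  eventually_in W (fun ws => J ws c) (act l y).
Proof.
have [FW [FWf FWd]] := fiber_filtration.
move=> hl hy ws hws.
have [ws1 [e1 h1]] := word_eventually FWf FWd hl hws.
have [ws2 [e2 h2]] := hy ws1 (proj1 e1).
exists ws2; split; first exact: extends_trans e1 e2.
rewrite -[c]addn0; apply: list_mod_act; last exact: list_mod0.
exact: (list_words_extends e2).
Qed.

Lemma Ycls_eventually : Ycls `<=` eventually_in W Gw.
Proof.
apply: Ycls_closed; first exact: Gw_eventually_submod.
move=> y Yy hd ws hws.
have : eventually_in W (fun ws => J ws 0) (md y).
  move: hd; apply: lspan_min; first exact: J_eventually_submod.
  by move=> _ [l [s [hs ->]]]; apply: act_eventually => //; exact: (free_gen Wf).
move=> /(_ ws hws) [ws' [e h]]; exists ws'; split=> //.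
exact: Gw_closed.
Qed.

(** Every element of a column involves only finitely many letters, with the
    wordlength it has in W. *)
Lemma column_eventually c x : F p c x -> eventually_in W (fun ws => J ws c) (cls x).
Proof.
have hE := J_eventually_submod c.
suff H : F p c `<=` [set x | F p 0 x /\ eventually_in W (fun ws => J ws c) (cls x)].
  by move=> /H [].
apply: lspan_min.
  split=> [|a x' y [Fx Sx] [Fy Sy]].
    by split; [case: (hF p 0)|rewrite /column_class qproj0; case: hE].
  by split; [case: (hF p 0) => _; apply|rewrite cls_lin //; case: hE => _; apply].
move=> _ [z [l [u [hz hl hu ->]]]]; rewrite -/(mon i j z l u); split; first exact: mon_Pge.
suff H : word_ge Z p `<=` [set z | word_ge Z p z /\ eventually_in W (fun ws => J ws c) (cls (mon i j z l u))].
  by case: (H _ hz).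
apply: (subset_trans (proj2 (Zg p))); apply: lspan_min.
  have hZ0 : submod (word_ge Z p) by exact: lspan_submod.
  split=> [|a x' y [Fx Sx] [Fy Sy]].
    by split; [case: hZ0|rewrite (lin0 (mon_linear1 i j l u)) /column_class qproj0; case: hE].
  split; first by case: hZ0 => _; apply.
  by rewrite mon_linear1 cls_lin; [case: hE => _; apply|exact: mon_Pge|exact: mon_Pge].
move=> z' [hz' [n dz']]; split=> //; rewrite (cls_mon l hz' dz' hu).
apply: act_eventually; first by apply: (graded_epb _ _) hl; apply: word_ge_graded; case: Wf.
by apply: Ycls_eventually; exact: Ycls_gen.
Qed.

End Columns.

(** * Exactness of the columns *)

Section ColumnExact.
Variables (k : fieldType) (char0 : [pchar k] =i pred0).
Variables (B E L : cdga k) (i : cdga_hom B E) (j : gca_hom L E).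
Variables (Z : set B) (W : set L) (P : dgmod E) (U : set P).
Hypotheses (hZ : sullivan Z) (hV : relative_sullivan W i j) (hU : semifree_on U).

Let F := Pge i j Z W U.
Let Wf : free_gca W. Proof. by case: hV => _ []. Qed.
Let Wp : in_posdeg W. Proof. by case: hV => _ []. Qed.
Let hF p q : submod (F p q). Proof. exact: lspan_submod. Qed.

Variable p : nat.
Notation N := (Ppq hZ hV hU p 0).
Notation cls := (@column_class _ _ _ _ _ _ _ _ _ _ hZ hV hU p).

(** Letters of a closed list are independent, so that there are functionals of
    L dual to them; the degree projection makes them homogeneous. *)
Lemma dual_derivations (ws : seq (nat * L)) : closed_list W ws ->
  exists dN : nat -> N -> N,
  [/\ forall a, is_lin (dN a),
      forall a n, meps (dN a n) = (-1) ^+ odd (deg_of ws a) *: dN a (meps n),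
      forall a b n, dN a (dN b n) =
        (-1) ^+ (odd (deg_of ws a) && odd (deg_of ws b)) *: dN b (dN a n),
      forall a b n, (b < size ws)%N -> dN a (act (letter_of ws b) n) =
        (if a == b then n else 0) +
        (-1) ^+ (odd (deg_of ws a) && odd (deg_of ws b)) *: act (letter_of ws b) (dN a n) &
      forall a y, Ycls y -> dN a y = 0].
Proof.
move=> hws; set e := fun a => odd (deg_of ws a).
have one a : (a < size ws)%N -> exists xi : L -> k^o, [/\ linear xi,
    forall b, (b < size ws)%N -> xi (letter_of ws b) = (b == a)%:R &
    forall m v, adeg m v -> m != deg_of ws a -> xi v = 0].
  move=> ha; have [b hb|xi [lxi xiE]] := @dual_functional k L (letter_of ws) (size ws) a.
    by case: (hws b hb).
  have [pr [lpr prE]] := grading_scaling (fun n => (n == deg_of ws a)%:R : k) (adeg_grading L).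
  exists (fun x => xi (pr x)); split.
  - exact: (linear_comp2 lxi lpr).
  - move=> b hb; have [_ db _ _] := hws b hb; rewrite (prE _ _ db) (linZ _ _ lxi) xiE //.
    case: (eqVneq b a) => [->|_]; last by rewrite scaler0.
    by rewrite eqxx scale1r.
  - by move=> m v dv nm; rewrite (prE _ _ dv) (negbTE nm) scale0r (lin0 lxi).
have two a : exists D : (L -> k^o) * (L -> L) * (N -> N), (a < size ws)%N ->
    [/\ derivation W (e a) D.1.1 D.1.2, quotient_derivation (e a) D.1.2 D.2 &
     forall b, (b < size ws)%N -> D.1.1 (letter_of ws b) = (b == a)%:R].
  case: (ltnP a (size ws)) => ha; last by exists (fun=> 0, id, id).
  have [xi [lxi xi1 xi0]] := one a ha.
  have [|delta hd] := @derivation_exists k L W Wf (deg_of ws a) xi lxi.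
    by move=> m v _; apply: xi0.
  have ld : linear delta by case: hd.
  have [dN hdN] := quotient_derivation_exists hZ hV hU p (e a) ld.
  by exists (xi, delta, dN).
have /choice [D hD] := two.
exists (fun a n => if (a < size ws)%N then (D a).2 n else 0); split.
- move=> a; split=> c x y; case: ifP => ha; last by rewrite scaler0 addr0.
  by have [_ [h _] _] := hD a ha; exact: h.
- move=> a n; case: ifP => ha; last by rewrite scaler0 (lin0 (@meps_linear _ _ _)).
  by have [h1 h2 _] := hD a ha; exact: (quotient_derivation_meps h1 h2).
- move=> a b n; case: ifP => ha; case: ifP => hb; rewrite ?scaler0 //.
  + have [h1 h2 _] := hD a ha; have [h3 h4 _] := hD b hb.
    exact: (quotient_derivation_comm n h1 h3 h2 h4).
  + by have [_ [h _] _] := hD a ha; rewrite (lin0 h).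
  + by have [_ [h _] _] := hD b hb; rewrite (lin0 h) scaler0.
- move=> a b n hb; case: ifP => ha; last first.
    rewrite (lin0 (act_linearr _)) scaler0 addr0; case: eqP => // ab.
    by rewrite ab hb in ha.
  have [h1 h2 h3] := hD a ha; rewrite (quotient_derivation_act h1 h2).
  have [Wb db _ _] := hws b hb.
  have [_ _ hv _] := h1; rewrite (hv _ Wb) h3 // (epb_homog _ db).
  rewrite !(linZ _ _ (act_linearl _)) act1; congr (_ + _).
  by rewrite eq_sym; case: eqP => _; rewrite ?scale1r ?scale0r.
- move=> a y hy; case: ifP => // ha; have [h1 h2 _] := hD a ha.
  move: y hy; apply: cls_ZU_ind; first exact: (submod_ker (proj1 h2)).
  by move=> z u hz hu; exact: (quotient_derivation_gen h1 h2).
Qed.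

Variables (a b : nat) (Q : dgmod L) (f : dg_hom Q (Ppq hZ hV hU p b)).
Hypothesis fq : quasi_iso f.
Hypothesis Q_exact : forall q : Q, md q = 0 ->
  lspan [set x | exists a' q', word_ge W a a' /\ x = act a' q'] q -> exists z, q = md z.

Notation clsb := (qproj (Ppq_pair hZ hV hU p b)).
Let Tb : set P := setaddm (F p b) (F p.+1 0).
Let T0 : set P := setaddm (F p 0) (F p.+1 0).
Let hTb : submod Tb. Proof. exact: setaddm_submod. Qed.
Let Tb0 : Tb `<=` T0.
Proof.
apply: setaddm_min; first exact: setaddm_submod.
  by move=> x hx; apply: setaddml => //; apply: (Pge_sub hZ hV hU (leqnn p) (leq0n b)).
by apply: setaddmr.
Qed.

(* The inclusion of P^(p, >= b) into P^(p, >= 0). *)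
Let incl (C : Ppq hZ hV hU p b) : N := cls (sqrep C).

Let inclE x : Tb x -> incl (clsb x) = cls x.
Proof.
move=> hx; have [_ _ dT _ _ _ _] := Ppq_pair hZ hV hU p b.
apply: (@qproj_eq _ _ _ _ _ _ _ (Ppq_pair hZ hV hU p 0)); [apply: Tb0; exact: sqrep_in|exact: Tb0|].
exact: (sqprojK _ _ hx).
Qed.

Let JJ : set N := [set C | exists x, Tb x /\ C = cls x].

Let JJ_incl C : JJ (incl C).
Proof. by have [x [hx ->]] := qproj_surj C; exists x; rewrite inclE. Qed.

Let incl_linear : linear incl.
Proof.
move=> c C D; have [x [hx ->]] := qproj_surj C; have [y [hy ->]] := qproj_surj D.
rewrite -qproj_lin // !inclE //; last by case: hTb => _; apply.
by rewrite /column_class qproj_lin //; apply: Tb0.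
Qed.

Let incl_act l C : incl (act l C) = act l (incl C).
Proof.
have [x [hx ->]] := qproj_surj C; have h := Ppq_pair hZ hV hU p b.
rewrite qproj_act // !inclE //; last exact: (dgp_actT h).
by rewrite /column_class qproj_act //; apply: Tb0.
Qed.

Let incl_md C : incl (md C) = md (incl C).
Proof.
have [x [hx ->]] := qproj_surj C; have h := Ppq_pair hZ hV hU p b.
rewrite qproj_md // !inclE //; last exact: (dgp_dT h).
by rewrite /column_class qproj_md //; apply: Tb0.
Qed.

Let incl_inj C : incl C = 0 -> C = 0.
Proof.
have [x [hx ->]] := qproj_surj C; rewrite inclE // => /(qproj_eq0 (Ppq_pair hZ hV hU p 0) (Tb0 hx)) h.
exact/qproj_eq0.
Qed.

Let JJE m : JJ m -> exists C, m = incl C.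
Proof. by move=> [x [hx ->]]; exists (clsb x); rewrite inclE. Qed.

(** All the letters that matter for x belong to a closed list. The Koszul
    module of this list maps to the resolution Q of P^(p, >= b), in which the
    cocycles made of words of length >= a are boundaries. *)
Lemma column_exact x : F p (a + b) x -> F p.+1 0 (md x) ->
  exists y, F p b y /\ F p.+1 0 (x - md y).
Proof.
move=> hx dx.
have hx0 : F p 0 x by apply: (Pge_sub hZ hV hU (leqnn p) (leq0n (a + b))).
suff [m [[y [[y1 [y2 [h1 h2 ->]]] ->]] ex]] : exists m, JJ m /\ cls x = md m.
  have Fy1 : F p 0 y1 by apply: (Pge_sub hZ hV hU (leqnn p) (leq0n b)).
  have Fy2 : F p 0 y2 by apply: (Pge_sub hZ hV hU (leqnSn p) (leqnn 0)).
  have dF r z : F r 0 z -> F r 0 (md z).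
    move=> /(Pge_md hZ hV hU); apply: setaddm_min => //.
    exact: (Pge_sub hZ hV hU (leqnSn r) (leqnn 0)).
  exists y1; split=> //; apply/(cls_eq0 hZ hV hU).
    by apply: (submodB (hF _ _)) => //; exact: dF.
  have -> : x - md y1 = x - md (y1 + y2) + md y2.
    by rewrite (linD _ _ (@md_linear _ _ _)) opprD addrA subrK.
  have Fs : F p 0 (y1 + y2) by exact: (submodD (hF _ _)).
  have c2 : cls (md y2) = 0.
    by apply/cls_eq0; [exact: dF|exact: dF].
  rewrite clsD; [|by apply: (submodB (hF _ _)) => //; exact: dF|exact: dF].
  rewrite c2 addr0; have -> : x - md (y1 + y2) = (-1) *: md (y1 + y2) + x.
    by rewrite scaleN1r addrC.
  by rewrite cls_lin //; [rewrite ex -cls_md // scaleN1r addNr|exact: dF].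
(* A nonzero element serves to form the algebra of endomorphisms of the Koszul
   module. *)
case: (pselect (exists n0 : N, n0 != 0)) => [[n0 hn0]|nz]; last first.
  have z C : C = 0 :> N by apply: contrapT => /eqP h; apply: nz; exists C.
  exists 0; rewrite [cls x]z [md _]z; split=> //; exists 0; split; first by case: hTb.
  by rewrite /column_class qproj0.
have [ws [[hws _] hJ]] := column_eventually hZ hV hU hx (closed_nil W).
have [D [hD adD parD]] := closed_differential char0 Wf Wp hws.
have [dN [dN1 dN2 dN3 dN4 dN5]] := dual_derivations hws.
have [Fk [o [sg [dd [t [vac hk]]]]]] :=
  @koszul_variables_exist k (fun a => ~~ odd (deg_of ws a)) (size ws).
have ws_comm a' l : letter_of ws a' * l = epb (odd (deg_of ws a')) l * letter_of ws a'.
  have [hi|hi] := ltnP a' (size ws); last by rewrite letter_of_big // mul0r mulr0.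
  have [_ da _ _] := hws a' hi.
  by rewrite (gca_homog_eps _ da) -/(tweps _ _) tweps_epb epbK.
have lf : linear (fun q => incl (f q)) by exact: (linear_comp2 incl_linear (@dg_hom_linear _ _ _ _ f)).
have dx0 : md (cls x) = 0 by rewrite cls_md //; apply/cls_eq0 => //; case: (dgp_dT (Ppq_pair hZ hV hU p 0) (setaddml (hF p.+1 0) hx0)) => y [z [h1 h2 ->]]; apply: (submodD (hF _ _)) => //; exact: (Pge_sub hZ hV hU (leqnSn p) (leqnn 0)).
apply: (koszul_exactness char0 (s := size ws) (ws := letter_of ws) (e := fun a => odd (deg_of ws a))
  (D := D) (dN := dN) (fun a => letter_eps a hws) (@letter_of_big _ _ ws) ws_comm hD adD parD dN1 dN2
  dN3 dN4 hk hn0 (G := Gw (hZ := hZ) (hV := hV) (hU := hU) (p := p) ws) (f := fun q => incl (f q)) (JJ := JJ) (I := word_ge W a)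
  (a := a) (b := b)) hJ dx0.
- by move=> y; apply: Gw_meps.
- exact: Gw_md.
- by move=> S hS h; apply: Gw_closure.
- by move=> a' y [hy _]; exact: dN5.
- exact: lf.
- by move=> l q; rewrite dg_hom_act incl_act.
- by move=> q; rewrite dg_hom_d incl_md.
- exact: (qproj_image _ hTb Tb0).
- move=> l m /JJE[C ->]; rewrite -incl_act; exact: JJ_incl.
- by move=> q; exact: JJ_incl.
- move=> q dq [m [/JJE[C ->]]]; rewrite -incl_md => e1.
  apply: (proj1 fq) => //; exists C; apply/eqP; rewrite -subr_eq0; apply/eqP.
  by apply: incl_inj; rewrite (linB _ _ incl_linear) e1 subrr.
- move=> m /JJE[C ->]; rewrite -incl_md => /incl_inj dC.
  have [q [dq [C' eC]]] := proj2 fq C dC.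
  exists q; split=> //; exists (incl C'); split; first exact: JJ_incl.
  by rewrite -incl_md -(linD _ _ incl_linear) -eC.
- apply: lspan_min; first exact: (qproj_image _ hTb Tb0).
  move=> _ [v [y [hv [hy _] ->]]].
  move: y hy; apply: cls_ZU_ind.
    exact: (submod_preim (act_linearr _) (qproj_image _ hTb Tb0)).
  move=> z u hz hu; rewrite /mkset cls_act; last by apply: (ZU_Pge hV); apply: ZU_gen.
  exists (act (j (list_word (letter_of ws) v)) (act (i z) u)); split=> //.
  apply: setaddml => //.
  have h : word_ge W b (list_word (letter_of ws) v).
    apply: lspan_gen; exists (map (letter_of ws) v); rewrite size_map big_map; split=> //.
    by move=> w /mapP[c _ ->]; exact: letter_of_W.
  have := Pge_act hZ hV hU (@word_ge1 k B Z) h (ZU_Pge hV (ZU_gen hz hu)).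
  by rewrite add0n addn0 rmorph1 mul1r.
- apply: lspan_min; first exact: lspan_submod.
  move=> _ [v [hv ->]]; apply: lspan_gen; exists (map (letter_of ws) v).
  rewrite size_map big_map; split=> //.
  by move=> w /mapP[c _ ->]; exact: letter_of_W.
- exact: Q_exact.
Qed.

End ColumnExact.

(** * The Toomer invariant *)

Section ToomerInj.
Variables (k : fieldType) (A : cdga k) (V : set A).

Lemma toomer_inj_mono (P : dgmod A) m n : (m <= n)%N -> toomer_inj V P m -> toomer_inj V P n.
Proof.
move=> mn h x dx [y hy]; apply: h => //; exists y; move: hy; apply: lspan_sub.
move=> _ [a [z [ha ->]]]; apply: lspan_gen; exists a, z; split=> //.
exact: (word_ge_sub _ ha).
Qed.

Lemma toomer_semifree_Some (P : dgmod A) m : toomer_semifree V P = Some m -> toomer_inj V P m.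
Proof.
rewrite /toomer_semifree; case: pselect => // h [<-].
by case: ex_minnP => n /asboolP.
Qed.

Lemma toomer_semifree_le (P : dgmod A) n : toomer_inj V P n -> enat_le (toomer_semifree V P) n.
Proof.
move=> hn; rewrite /toomer_semifree; case: pselect => [h|[]]; last by exists n; apply/asboolP.
exists (ex_minn h) => //; case: ex_minnP => m _; apply; exact/asboolP.
Qed.

Lemma toomer_inj0 (P : dgmod A) m q : toomer_inj V P m -> md q = 0 ->
  lspan [set x | exists a y, word_ge V m.+1 a /\ x = act a y] q -> exists z, q = md z :> P.
Proof. by move=> h dq hq; apply: h => //; exists 0; rewrite (lin0 (@md_linear _ _ _)) subr0. Qed.

End ToomerInj.

(** * Restriction to the base *)

Section OverBase.
Variables (k : fieldType).
Variables (B E L : cdga k) (i : cdga_hom B E) (j : gca_hom L E).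
Variables (Z : set B) (W : set L) (P : dgmod E) (U : set P).
Hypotheses (Zf : free_gca Z) (hV : relative_sullivan W i j) (hU : semifree_on U).

Let Wf : free_gca W. Proof. by case: hV => _ []. Qed.
Let hUs : submod U. Proof. by case: hU => -[]. Qed.

Let act_sub (S : set P) x : submod S -> submod [set a : E | S (act a x)].
Proof. by move=> hS; apply: (submod_preim (act_linearl x)). Qed.

Lemma E_span (a : E) : lspan [set e | exists b l, setT l /\ e = i b * j l] a.
Proof.
have [_ _ hT _ _] := hV; apply: (tensor_gen _ _ _ hT); first by split.
- by move=> l c b b'; rewrite linearP mulrDl -scalerAl.
- by move=> b c l l'; rewrite linearP mulrDr -scalerAr.
Qed.

(** P is B (x) Y as a graded module over B, by [base_tensor]. *)
Definition base_gens : set P := lspan [set x | exists l u, U u /\ x = act (j l) u].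
Notation Y := base_gens.
Let hY : submod Y. Proof. exact: lspan_submod. Qed.

Lemma base_gens_gen l u : U u -> Y (act (j l) u).
Proof. by move=> hu; apply: lspan_gen; exists l, u. Qed.

Lemma base_gens_act l y : Y y -> Y (act (j l) y).
Proof.
apply: (lspan_lin (act_linearr _)) => // _ [l' [u [hu ->]]].
by rewrite -actM -rmorphM; exact: base_gens_gen.
Qed.

Lemma P_ind (S : set P) : submod S -> (forall b l u, U u -> S (act (i b) (act (j l) u))) ->
  forall x, S x.
Proof.
move=> hS h x; have [_ hT _] := hU.
move: (tensor_gen hUs (@act_linearl _ _ P) (@act_linearr _ _ P) hT x).
apply: lspan_min => // {x} _ [a [u [hu ->]]].
move: (E_span a); apply: (lspan_min (act_sub u hS)) => {a} _ [b [l [_ ->]]].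
by rewrite /mkset actM; exact: h.
Qed.

Lemma base_tensor : is_tensor Y (fun (b : B) (y : P) => act (i b) y).
Proof.
move=> X f fl fr; have [_ _ tE _ _] := hV; have [_ tP _] := hU.
have gx u : exists g : {linear E -> X}, U u -> forall b l, g (i b * j l) = f b (act (j l) u).
  case: (pselect (U u)) => hu; last by exists \0.
  have [||g [gE _]] := tE X (fun b l => f b (act (j l) u)).
  - by move=> l _; apply: fl; exact: base_gens_gen.
  - move=> b c l l' _ _; rewrite linearP act_linearl fr //; exact: base_gens_gen.
  by exists g => _ b l; rewrite gE.
have /choice [g gE] := gx.
have [||h [hE _]] := tP X (fun a u => g u a).
- by move=> u _ a x y; rewrite linearP.
- move=> a c u v hu hv; have huv : U (c *: u + v) by case: hUs => _; apply.
  move: (E_span a).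
  apply: (@lin_ext_span _ _ _ _ (g (c *: u + v)) (fun a => c *: g u a + g v a)).
  + by move=> c' x y; rewrite linearP.
  + by apply: linear_add2; [apply: linear_scale2|] => c' x y; rewrite linearP.
  move=> _ [b [l [_ ->]]]; rewrite !gE // act_linearr fr //; exact: base_gens_gen.
have lh : linear h by move=> c x y; rewrite linearP.
exists h; split.
  move=> b y hy; pose S : set P := [set y | Y y /\ h (act (i b) y) = f b y].
  suff : S y by case.
  move: hy; apply: lspan_min.
    split=> [|c x z [Yx ex] [Yz ez]].
      split; first by case: hY.
      have := fr b (-1) 0 0 (proj1 hY) (proj1 hY); rewrite scaler0 addr0 scaleN1r addNr => ->.
      by rewrite (lin0 (act_linearr _)) (lin0 lh).
    split; first by case: hY => _; apply.
    by rewrite act_linearr lh ex ez fr.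
  move=> _ [l [u [hu ->]]]; split; first exact: base_gens_gen.
  by rewrite -actM hE // gE.
move=> h' h'E; apply: P_ind.
  by apply: submod_eq_lin => // c x y; rewrite linearP.
move=> b l u hu; rewrite h'E; last exact: base_gens_gen.
by rewrite -actM hE // gE.
Qed.

Section Closure.
Variable S : set P.
Hypothesis hS : submod S.
Hypothesis S_closed : forall y, Y y ->
  lspan [set x | exists b v, S v /\ x = act (i b) v] (md y) -> S y.
Variable FW : nat -> set L.
Hypothesis FWf : filtration (@adeg k L) W FW.
Hypothesis FWd : forall r w, FW r.+1 w -> lspan [set x | exists (c : k) (b : B) (l : L),
  [/\ posdeg b, subalg (FW r) l & x = i (c *: 1 + b) * j l]] (ad (j w)).

Let FWg r : graded_sub (@adeg k L) (FW r). Proof. by case: FWf. Qed.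
Let sub r := subalg (FW r).
Let hsub r : submod (sub r). Proof. exact: lspan_submod. Qed.
Let span_B (X : set P) : set P := lspan [set x | exists b v, X v /\ x = act (i b) v].
Let hspan X : submod (span_B X). Proof. exact: lspan_submod. Qed.

Let subM r x y : sub r x -> sub r y -> sub r (x * y).
Proof. by move=> hx hy; exact: (@word_geM k L (FW r) 0 0 x y hx hy). Qed.

Let sub1 r : sub r 1. Proof. exact: word_ge1. Qed.

Let FW_le r r' : (r <= r')%N -> FW r `<=` FW r'.
Proof.
have [_ _ Fm _] := FWf; move=> /subnK <-; elim: (r' - r)%N => [//|n IH].
by rewrite addSn; apply: subset_trans IH _; exact: Fm.
Qed.

Let sub_le r r' : (r <= r')%N -> sub r `<=` sub r'.
Proof.
move=> h; apply: lspan_sub => _ [s [hs sF ->]]; apply: lspan_gen; exists s; split=> //.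
by move=> v vs; apply: (FW_le h); exact: sF.
Qed.

Let sub_epb r b x : sub r x -> sub r (epb b x).
Proof. by apply: graded_epb; apply: word_ge_graded; exact: FWg. Qed.

(* If these subspaces satisfy the closure principle at stage r, they do so at
   stage r.+1. *)
Let Sk r : set P := [set v | Y v /\ forall l, sub r l -> S (act (j l) v)].

Let hSk r : submod (Sk r).
Proof.
split=> [|a x y [Yx hx] [Yy hy]].
  by split=> [|l _]; [case: hY|rewrite (lin0 (act_linearr _)); case: hS].
split; first by case: hY => _; apply.
by move=> l hl; rewrite act_linearr; case: hS => _; apply; [exact: hx|exact: hy].
Qed.

Let Sk_act r r' l v : (r <= r')%N -> sub r' l -> Sk r' v -> Sk r (act (j l) v).
Proof.
move=> rr' hl [Yv hv]; split; first exact: base_gens_act.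
move=> l' hl'; rewrite -actM -rmorphM; apply: hv; apply: subM => //.
exact: (sub_le rr').
Qed.

Let act_swap n w b x : adeg n w -> act (j w) (act (i b) x) = act (i (epb (odd n) b)) (act (j w) x) :> P.
Proof.
move=> dw; rewrite -!actM; congr act.
have := gca_homog_eps (i (epb (odd n) b)) (gca_hom_deg j dw).
have -> : iter n (@eps k E) (i (epb (odd n) b)) = i b.
  rewrite -[iter _ _ _]/(tweps n _) tweps_epb.
  have -> : epb (odd n) (i (epb (odd n) b)) = i (epb (odd n) (epb (odd n) b)).
    by case: (odd n) => //=; rewrite !gca_hom_eps.
  by rewrite epbK.
by move=> ->.
Qed.

Let act_swap_fiber n w l x : adeg n w -> act (j w) (act (j l) x) = act (j (epb (odd n) l)) (act (j w) x) :> P.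
Proof.
move=> dw; rewrite -!actM -!rmorphM; congr (act (j _) x).
rewrite (gca_homog_eps (epb (odd n) l) dw) -[iter _ _ _]/(tweps n _) tweps_epb epbK.
by [].
Qed.

Let step r : (forall y, Y y -> span_B (Sk r) (md y) -> Sk r y) ->
  forall y, Y y -> span_B (Sk r.+1) (md y) -> Sk r.+1 y.
Proof.
move=> IH y Yy hy.
(* Multiples of y by products of less than n letters of stage r.+1, along with
   what is known to be in Sk r.+1. The differential of a product of n letters
   applied to y has its coefficients in X n, so that induction on n applies. *)
pose X n : set P := lspan [set x | Sk r.+1 x \/ exists l v, [/\ sub r l,
  (size v < n)%N, forall w, w \in v -> FW r.+1 w /\ exists m, adeg m w &
  x = act (j l) (act (j (\prod_(w <- v) w)) y)]].
have hX n : submod (X n) by exact: lspan_submod.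
have Xmono n : X n `<=` X n.+1.
  apply: lspan_sub => x [h|[l [v [hl hv vF ->]]]]; apply: lspan_gen; [by left|right].
  by exists l, v; split=> //; exact: ltnW.
have letterX n w m x : FW r.+1 w -> adeg m w -> X n x -> X n.+1 (act (j w) x).
  move=> Fw dw; apply: (lspan_lin (act_linearr _)) => // z [h|[l [v [hl hv vF ->]]]].
    apply: lspan_gen; left; apply: Sk_act h => //.
    apply: lspan_gen; exists [:: w]; rewrite big_seq1; split=> //.
    by move=> w'; rewrite inE => /eqP ->.
  rewrite (act_swap_fiber _ _ dw); apply: lspan_gen; right.
  exists (epb (odd m) l), (w :: v); split=> //.
  - exact: sub_epb.
  - by move=> w'; rewrite inE => /orP[/eqP ->|/vF //]; split=> //; exists m.
  - by rewrite big_cons rmorphM actM.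
have letterBX n w m x : FW r.+1 w -> adeg m w -> span_B (X n) x -> span_B (X n.+1) (act (j w) x).
  move=> Fw dw; apply: (lspan_lin (act_linearr _)) => // _ [b [v [hv ->]]].
  rewrite (act_swap _ _ dw); apply: lspan_gen; exists (epb (odd m) b), (act (j w) v).
  by split=> //; exact: (letterX _ _ m).
have dword v : (forall w, w \in v -> FW r.+1 w /\ exists m, adeg m w) ->
    span_B (X (size v)) (md (act (j (\prod_(w <- v) w)) y)).
  elim: v => [_|w v IHv vF].
    rewrite big_nil rmorph1 act1; move: hy; apply: lspan_sub => _ [b [z [hz ->]]].
    by apply: lspan_gen; exists b, z; split=> //; apply: lspan_gen; left.
  have [Fw [m dw]] := vF w (mem_head _ _).
  have vF' w' : w' \in v -> FW r.+1 w' /\ exists m, adeg m w'.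
    by move=> h; apply: vF; rewrite inE h orbT.
  rewrite big_cons rmorphM actM md_actE; apply: (submodD (hspan _)).
    move: (FWd Fw).
    apply: (lspan_lin (f := fun a => act a (act (j (\prod_(w <- v) w)) y)) (act_linearl _)) => //.
    move=> _ [c [b [l [_ hl ->]]]]; rewrite actM.
    apply: lspan_gen; exists (c *: 1 + b), (act (j l) (act (j (\prod_(w <- v) w)) y)).
    by split=> //; apply: lspan_gen; right; exists l, v.
  rewrite -gca_hom_eps (epsE dw) linearZ (linZ _ _ (act_linearl _)).
  by apply: (submodZ _ (hspan _)); apply: (letterBX _ _ m) => //; exact: IHv.
have Yprod v : Y (act (j (\prod_(w <- v) w)) y) by exact: base_gens_act.
have XS n : X n `<=` Sk r.
  elim: n => [|n IHn]; apply: lspan_min => // x [h|[l [v [hl hv vF ->]]]] //.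
  - by have := Sk_act (leqnSn r) (@sub1 r.+1) h; rewrite rmorph1 act1.
  - by have := Sk_act (leqnSn r) (@sub1 r.+1) h; rewrite rmorph1 act1.
  apply: (Sk_act (leqnn r) hl); apply: IH => //.
  move: (dword v vF); apply: lspan_sub => _ [b [z [hz ->]]].
  apply: lspan_gen; exists b, z; split=> //; apply: IHn.
  have : X (size v) `<=` X n; last by apply.
  move: hv; rewrite ltnS => /subnK <-; elim: (n - size v)%N => [//|q IHq].
  by rewrite addSn; apply: subset_trans IHq _.
split=> // l hl.
suff H : sub r.+1 `<=` [set l | S (act (j l) y)] by exact: H.
have hS' : submod [set l : L | S (act (j l) y)].
  apply: (submod_preim (f := fun l : L => act (j l) y)) => // c x z.
  by rewrite linearP act_linearl.
apply: lspan_min => // _ [v [_ vF ->]].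
(* The letters can be replaced one by one by homogeneous ones, which are
   collected in v1. *)
suff Hv v1 v2 : (forall w, w \in v1 -> FW r.+1 w /\ exists m, adeg m w) ->
    (forall w, w \in v2 -> FW r.+1 w) ->
    S (act (j (\prod_(w <- v1) w * \prod_(w <- v2) w)) y).
  by have := Hv [::] v (fun w => fun h => ltac:(by [])) vF; rewrite big_nil mul1r.
elim: v2 v1 => [|w v2 IHv] v1 h1 h2.
  rewrite big_nil mulr1.
  have [_ h] : Sk r (act (j (\prod_(w <- v1) w)) y).
    apply: (XS (size v1).+1); apply: lspan_gen; right; exists 1, v1.
    by rewrite rmorph1 act1.
  by have := h 1 (@sub1 r); rewrite rmorph1 act1.
rewrite big_cons.
have := proj2 (FWg r.+1) w (h2 w (mem_head _ _)).
apply: (lspan_lin (f := fun w => act (j (\prod_(w <- v1) w * (w * \prod_(w <- v2) w))) y)) => //.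
  by move=> c x z; rewrite mulrDl mulrDr -scalerAl -scalerAr linearP act_linearl.
move=> x [Fx [m dx]].
have -> : \prod_(w <- v1) w * (x * \prod_(w <- v2) w) =
    \prod_(w <- v1 ++ [:: x]) w * \prod_(w <- v2) w by rewrite big_cat big_seq1 mulrA.
apply: IHv.
  move=> w'; rewrite mem_cat inE => /orP[/h1 //|/eqP ->]; split=> //; by exists m.
by move=> w' hw'; apply: h2; rewrite inE hw' orbT.
Qed.

Let Sk_closed r y : Y y -> span_B (Sk r) (md y) -> Sk r y.
Proof.
elim: r y => [|r IH]; last exact: step.
move=> y Yy hy; split=> //.
have S1 v : Sk 0 v -> S v by move=> [_ h]; have := h 1 (@sub1 0); rewrite rmorph1 act1.
have Sy : S y.
  apply: S_closed => //; move: hy; apply: lspan_sub => _ [b [v [hv ->]]].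
  by apply: lspan_gen; exists b, v; split=> //; exact: S1.
move=> l; apply: (lspan_lin (f := fun l => act (j l) y)) => //.
  by move=> c x z; rewrite linearP act_linearl.
move=> _ [[|w v] [_ vF ->]]; first by rewrite big_nil rmorph1 act1.
have := vF w (mem_head _ _); have [-> _ _ _] := FWf => ->.
by rewrite big_cons mul0r rmorph0 (lin0 (act_linearl _)); case: hS.
Qed.

(** The closure principle for Y over the base, by induction along the
    filtration of U and, at each stage, along that of W. *)
Lemma base_gens_closed : Y `<=` S.
Proof.
have [_ _ [FU [[FU0 FUg FUm UE] FUd]]] := hU.
have [_ _ _ WE] := FWf.
have all_sub (l : L) : exists r, sub r l.
  pose R : set L := [set l | exists r, sub r l].
  have hR : submod R.
    split; first by exists 0%N; case: (hsub 0).
    move=> c x y [r hx] [r' hy]; exists (maxn r r').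
    case: (hsub (maxn r r')) => _; apply; [exact: (sub_le (leq_maxl r r'))|exact: (sub_le (leq_maxr r r'))].
  have : word_ge W 0 `<=` R; last by apply; exact: free_gen.
  apply: lspan_min => // _ [v [_ vW ->]]; elim: v vW => [_|w v IH vW].
    by exists 0%N; rewrite big_nil; exact: sub1.
  have [|r hr] := IH; first by move=> x xv; apply: vW; rewrite inE xv orbT.
  have : W w by apply: vW; exact: mem_head.
  rewrite WE => -[r' _ hw]; exists (maxn r r'); rewrite big_cons; apply: subM.
    apply: (sub_le (leq_maxr r r')); apply: lspan_gen; exists [:: w]; rewrite big_seq1; split=> //.
    by move=> x; rewrite inE => /eqP ->.
  exact: (sub_le (leq_maxl r r')).
have FUU r u : FU r u -> U u by rewrite UE => h; exists r.
have SU r u : FU r u -> forall q, Sk q u.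
  elim: r u => [u|r IH u hu q]; first by rewrite FU0 => -> q; case: (hSk q).
  have Yu v : U v -> Y v by move=> hv; rewrite -[v]act1 -(rmorph1 j); exact: base_gens_gen.
  apply: Sk_closed; first by apply: Yu; exact: FUU hu.
  move: (FUd _ _ hu); apply: lspan_min => // _ [a [v [hv ->]]].
  move: (E_span a); apply: (lspan_min (act_sub v (hspan _))) => _ [b [l [_ ->]]].
  rewrite /mkset actM; apply: lspan_gen; exists b, (act (j l) v); split=> //.
  have [r' hl] := all_sub l; apply: (Sk_act (leq_maxl q r')); last exact: IH.
  exact: (sub_le (leq_maxr q r')).
apply: lspan_min => // _ [l [u [hu ->]]].
have [r _ hr] : (\bigcup_r FU r) u by rewrite -UE.
have [q hl] := all_sub l; have [_ h] := SU _ _ hr q; exact: h.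
Qed.

End Closure.

(** P is semifree over B, so that its identity lifts to any resolution Q up to
    homotopy, compatibly with the wordlength in Z. *)
Lemma toomer_restrict m : toomer Z (restrict i P) (Some m) -> toomer_inj Z (restrict i P) m.
Proof.
move=> [Q [f [[_ fq] /toomer_semifree_Some hQ]]] x dx [y hy].
have [_ _ _ [FW [FWf FWd]] _] := hV.
pose t : P := x - md y.
have dt : md t = 0 by rewrite (linB _ _ (@md_linear _ _ _)) dx md_md subr0.
have hspan : submod (lspan [set z | exists b v, [/\ word_ge Z m.+1 b, Y v & z = act (i b) v]]).
  exact: lspan_submod.
have ht : lspan [set z | exists b v, [/\ word_ge Z m.+1 b, Y v & z = act (i b) v]] t.
  move: hy; apply: lspan_min => // _ [b [v [hb ->]]].
  move: v; apply: P_ind; first exact: (submod_preim (act_linearr (i b)) hspan).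
  move=> b' l u hu; apply: lspan_gen; exists (b * b'), (act (j l) u); split.
  - by rewrite -[m.+1]addn0; apply: word_geM => //; exact: (free_gen Zf).
  - exact: base_gens_gen.
  - by rewrite rmorphM actM.
have aM a b v : act (i (a * b)) v = act (i a) (act (i b) v) :> P by rewrite rmorphM actM.
have dA a v : md (act (i a) v) = act (i (ad a)) v + act (i (eps a)) (md v) :> P.
  by rewrite md_actE cdga_hom_d gca_hom_eps.
have closed (S : set P) : submod S -> S `<=` Y ->
  (forall y, Y y -> lspan [set x | exists a v, S v /\ x = act (i a) v] (md y) -> S y) -> Y `<=` S.
  by move=> hS _ hc; exact: (base_gens_closed hS hc FWf FWd).
have setTs : submod [set: restrict i P] by split.
have idl : linear (fun x : P => x : restrict i P) by [].
have finj q : md q = 0 -> (exists m0 : restrict i P, setT m0 /\ f q = md m0) -> exists z, q = md z.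
  by move=> dq [m0 [_ e1]]; apply: (proj1 fq) => //; exists m0.
have fsurj (m0 : restrict i P) : setT m0 -> md m0 = 0 ->
    exists q, md q = 0 /\ exists m', setT m' /\ m0 = f q + md m'.
  by move=> _ /(proj2 fq) [q [dq [z ez]]]; exists q; split=> //; exists z.
have [q [m' [hq dq _ e1]]] := lift_cocycle (T := P) (aT := fun b v => act (i b) v) (dT := @md _ E P)
  (fun b => act_linearr (i b)) aM (@md_linear _ _ P) (@md_md _ _ P) dA (@dg_hom_linear _ _ _ _ f)
  (@dg_hom_act _ _ _ _ f) (@dg_hom_d _ _ _ _ f) setTs (fun _ _ _ => I) (fun _ => I) finj fsurj
  base_tensor hY (@subset_refl _ Y) idl (fun _ _ => erefl) (fun _ => erefl) (fun _ _ => I) closed ht dt.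
have [z ez] := toomer_inj0 hQ dq hq.
exists (f z + m' + y); rewrite !(linD _ _ (@md_linear _ _ _)) -dg_hom_d -ez -[md m']e1.
by rewrite addrCA subrr addr0 /t subrK.
Qed.

End OverBase.

(** * Descent through the columns *)

Section Main.
Variables (k : fieldType) (char0 : [pchar k] =i pred0).
Variables (B E L : cdga k) (i : cdga_hom B E) (j : gca_hom L E).
Variables (Z : set B) (W : set L) (P : dgmod E) (U : set P).
Hypotheses (hZ : sullivan Z) (hV : relative_sullivan W i j) (hU : semifree_on U).

Let F := Pge i j Z W U.
Let Zf : free_gca Z. Proof. by case: hZ => -[]. Qed.
Let Zp : in_posdeg Z. Proof. by case: hZ. Qed.
Let Wf : free_gca W. Proof. by case: hV => _ []. Qed.
Let Wp : in_posdeg W. Proof. by case: hV => _ []. Qed.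
Let Zg p : graded_sub (@adeg k B) (word_ge Z p).
Proof. by apply: word_ge_graded; case: Zf. Qed.
Let Wg p : graded_sub (@adeg k L) (word_ge W p).
Proof. by apply: word_ge_graded; case: Wf. Qed.
Let hF p q : submod (F p q). Proof. exact: lspan_submod. Qed.
Let Fsub p q p' q' : (p' <= p)%N -> (q' <= q)%N -> F p q `<=` F p' q'.
Proof. exact: (Pge_sub hZ hV hU). Qed.

Notation mon := (mon i j).

Lemma Pge_d_stable r x : F r 0 x -> F r 0 (md x).
Proof.
by move=> /(Pge_md hZ hV hU); apply: setaddm_min => //; apply: Fsub.
Qed.

Definition FE p q : set E :=
  lspan [set x | exists z w, [/\ word_ge Z p z, word_ge W q w & x = i z * j w]].
(** In GE p q and GP p q, at least p letters are in Z and the total wordlength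
    is at least p + q. *)
Definition GE p q : set E := lspan [set x | exists s, FE (p + s) (q - s) x].
Definition GP p q : set P := lspan [set x | exists s, F (p + s) (q - s) x].

Let hFE p q : submod (FE p q). Proof. exact: lspan_submod. Qed.
Let hGE p q : submod (GE p q). Proof. exact: lspan_submod. Qed.
Let hGP p q : submod (GP p q). Proof. exact: lspan_submod. Qed.

Lemma FE_gen p q z w : word_ge Z p z -> word_ge W q w -> FE p q (i z * j w).
Proof. by move=> hz hw; apply: lspan_gen; exists z, w. Qed.

Lemma FE_sub p q p' q' : (p' <= p)%N -> (q' <= q)%N -> FE p q `<=` FE p' q'.
Proof.
move=> hp hq; apply: lspan_sub => _ [z [w [hz hw ->]]].
by apply: FE_gen; [exact: (word_ge_sub hp)|exact: (word_ge_sub hq)].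
Qed.

Lemma FE_mul p q p' q' x y : FE p q x -> FE p' q' y -> FE (p + p') (q + q') (x * y).
Proof.
apply: lspan_bilin => [y'|x'||_ _ [z [w [hz hw ->]]] [z' [w' [hz' hw' ->]]]].
- exact: mul_linearl.
- exact: mul_linearr.
- exact: hFE.
have := proj2 (Zg p') _ hz'.
apply: (lspan_lin (f := fun z' => i z * j w * (i z' * j w'))) => //.
  by move=> a b c; rewrite linearP mulrDl mulrDr -scalerAl -scalerAr.
move=> b [hb [n db]]; rewrite -mulrA [j w * _]mulrA (j_i_comm i j _ db).
rewrite -mulrA -rmorphM mulrA -rmorphM; apply: FE_gen; first exact: word_geM.
by apply: word_geM => //; exact: (graded_epb _ (Wg q)).
Qed.

Lemma GE_sub p q q' : (q' <= q)%N -> GE p q `<=` GE p q'.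
Proof.
move=> h; apply: lspan_sub => x [s hs]; apply: lspan_gen; exists s.
by apply: FE_sub hs => //; exact: leq_sub2r.
Qed.

Lemma FE_GE p q : FE p q `<=` GE p q.
Proof. by move=> x hx; apply: lspan_gen; exists 0%N; rewrite addn0 subn0. Qed.

Lemma GE_mul p q p' q' x y : GE p q x -> GE p' q' y -> GE (p + p') (q + q') (x * y).
Proof.
apply: lspan_bilin => [y'|x'||x' y' [s hs] [s' hs']].
- exact: mul_linearl.
- exact: mul_linearr.
- exact: hGE.
apply: lspan_gen; exists (s + s')%N; rewrite addnACA.
apply: FE_sub (FE_mul hs hs') => //.
by rewrite leq_subLR addnACA leq_add // -leq_subLR.
Qed.

Lemma FE_act p q p' q' a x : FE p q a -> F p' q' x -> F (p + p') (q + q') (act a x).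
Proof.
move=> ha hx; move: a ha; apply: (lspan_lin (act_linearl x)) => // _ [z [w [hz hw ->]]].
exact: (Pge_act hZ hV hU).
Qed.

Lemma GE_act p q a x : GE p q a -> GP p q (act a x).
Proof.
apply: (lspan_lin (act_linearl x)) => // y [s hs]; apply: lspan_gen; exists s.
have := FE_act hs (Pge_total hZ hV hU x); by rewrite !addn0.
Qed.

Lemma GP_sub p q q' : (q' <= q)%N -> GP p q `<=` GP p q'.
Proof.
move=> h; apply: lspan_sub => x [s hs]; apply: lspan_gen; exists s.
by apply: Fsub hs => //; exact: leq_sub2r.
Qed.

Lemma F_GP p q : F p q `<=` GP p q.
Proof. by move=> x hx; apply: lspan_gen; exists 0%N; rewrite addn0 subn0. Qed.

Lemma GP_F p q : GP p q `<=` F p 0.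
Proof. by apply: lspan_min => // x [s]; apply: Fsub => //; exact: leq_addr. Qed.

Lemma GP_split p q : GP p q `<=` setaddm (F p q) (GP p.+1 q.-1).
Proof.
apply: lspan_min; first exact: setaddm_submod.
move=> x [[|s] hs]; first by apply: setaddml; rewrite ?addn0 ?subn0 in hs *.
apply: setaddmr => //; apply: lspan_gen; exists s.
by rewrite addSnnS -subn1 -subnDA add1n.
Qed.

(** The curvature of the trivialization LV = B (x) L; it vanishes if the
    differential is that of the tensor product. *)
Definition curv (l : L) : E := ad (j l) - j (ad l).

Lemma curv_linear : linear curv.
Proof.
move=> a x y; rewrite /curv linearP !ad_linear linearP scalerBr.
by rewrite opprD addrACA.
Qed.

Lemma curvM x y : curv (x * y) = curv x * j y + j (eps x) * curv y.
Proof.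
rewrite /curv rmorphM !ad_mul rmorphD !rmorphM -gca_hom_eps mulrBl mulrBr.
by rewrite opprD addrACA.
Qed.

(** The curvature is a derivation, and so it acts on one letter of a word at a
    time. *)
Lemma curv_letters c : (c <= 1)%N -> (forall w, W w -> GE 1 (1 - c) (curv w)) ->
  forall q w, word_ge W q w -> GE 1 (q - c) (curv w).
Proof.
move=> c1 hc q; apply: (lspan_lin curv_linear) => // _ [s [hs sW ->]].
apply: (GE_sub (leq_sub2r c hs)) => {hs}; elim: s sW => [_|w s IH sW].
  rewrite big_nil /curv rmorph1 !ad1 rmorph0 subrr; by case: (hGE 1 (0 - c)).
rewrite big_cons curvM.
have hw := sW w (mem_head _ _).
have sW' : forall v, v \in s -> W v by move=> v vs; apply: sW; rewrite inE vs orbT.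
have hp : word_ge W (size s) (\prod_(v <- s) v) by apply: lspan_gen; exists s.
apply: (submodD (hGE _ _)).
  have h1 : FE 0 (size s) (j (\prod_(v <- s) v)).
    by rewrite -[j _]mul1r -(rmorph1 i); apply: FE_gen => //; exact: word_ge1.
  have := GE_mul (hc w hw) (FE_GE h1); rewrite addn0 addnC => h2.
  by apply: GE_sub h2; rewrite /= addnBA // addn1.
have h1 : FE 0 1 (j (eps w)).
  rewrite -[j _]mul1r -(rmorph1 i); apply: FE_gen; first exact: word_ge1.
  by apply: (graded_eps (Wg 1)); exact: word_geV.
have := GE_mul (FE_GE h1) (IH sW'); rewrite add0n => h2.
by apply: GE_sub h2; rewrite /= leq_subLR addnCA -[(size s).+1]add1n leq_add2l -leq_subLR.
Qed.

Lemma curv_FE10 w : FE 1 0 (curv w).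
Proof.
have [_ _ _ _ fib] := hV; move: (fib w); apply: lspan_sub => _ [b [l [hb ->]]].
by apply: FE_gen; [exact: (posdeg_word1 Zf Zp)|exact: (free_gen Wf)].
Qed.

Lemma curv_general w : GE 1 (1 - 1) (curv w).
Proof. by apply: FE_GE; exact: curv_FE10. Qed.

Notation V := (sum_gens i j Z W).

Lemma sum_gens_GE m : word_ge V m `<=` GE 0 m.
Proof.
apply: lspan_min => // _ [s [hs sV ->]]; apply: (GE_sub hs) => {hs}.
elim: s sV => [_|v s IH sV].
  rewrite big_nil -[1]mul1r -{1}(rmorph1 i) -(rmorph1 j); apply: FE_GE; apply: FE_gen; exact: word_ge1.
rewrite big_cons; apply: (@GE_mul 0 1 0 (size s)); last first.
  by apply: IH => x xs; apply: sV; rewrite inE xs orbT.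
have [z [w [hz hw ->]]] := sV v (mem_head _ _); apply: (submodD (hGE _ _)).
  apply: lspan_gen; exists 1%N; rewrite -[i z]mulr1 -(rmorph1 j).
  by apply: FE_gen; [exact: word_geV|exact: word_ge1].
apply: FE_GE; rewrite -[j w]mul1r -(rmorph1 i).
by apply: FE_gen; [exact: word_ge1|exact: word_geV].
Qed.

(** By minimality, the differential of a letter w has total wordlength >= 2.
    Its part without letters of Z is the differential in the fiber, as the
    projection to the fiber shows, and the other part is the curvature. *)
Lemma curv_minimal : minimal_sullivan V -> forall w, W w -> GE 1 (1 - 0) (curv w).
Proof.
move=> [_ hmin] w hw; pose R11 : set E := setaddm (FE 1 1) (FE 2 0).
have hR : submod R11 by exact: setaddm_submod.
have RG : R11 `<=` GE 1 1.
  apply: setaddm_min => //; first exact: FE_GE.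
  by move=> x hx; apply: lspan_gen; exists 1%N.
suff : R11 (curv w) by move/RG.
have [aug [laug aug1 aug0]] := augmentation B.
have scalar_part z : word_ge Z 1 (z - aug z *: 1).
  have h1 : submod (word_ge Z 1) by exact: lspan_submod.
  have lf : linear (fun z : B => z - aug z *: 1).
    move=> a x1 y1; rewrite laug scalerDl -[(a *: aug x1) *: 1]scalerA.
    by rewrite scalerBr opprD addrACA.
  move: (free_gen Zf z); apply: (lspan_lin lf) => // _ [[|v s] [_ sZ ->]].
    rewrite big_nil aug1 scale1r subrr; by case: h1.
  have h2 : word_ge Z 1 (\prod_(x <- v :: s) x) by apply: lspan_gen; exists (v :: s).
  by rewrite aug0 ?scale0r ?subr0 //; exact: (word1_posdeg Zf Zp).
have Vw : V (j w).
  have [Zs _] := proj1 Zf.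
  by exists 0, w; rewrite rmorph0 add0r; split=> //; case: Zs.
have split_word (x : E) : GE 0 2 x -> exists l r, R11 r /\ x = j l + r.
  pose S : set E := [set x | exists l r, R11 r /\ x = j l + r].
  have hS : submod S.
    split; first by exists 0, 0; rewrite rmorph0 addr0; split=> //; case: hR.
    move=> a _ _ [l [r [hr ->]]] [l' [r' [hr' ->]]]; exists (a *: l + l'), (a *: r + r').
    by rewrite linearP scalerDr addrACA; split=> //; case: hR => _; apply.
  have SR y : R11 y -> S y by move=> hy; exists 0, y; rewrite rmorph0 add0r.
  suff H : GE 0 2 `<=` S by apply: H.
  apply: lspan_min => // y [[|[|[|s]]]].
  - apply: lspan_min => // _ [z [w' [_ hw' ->]]].
    have [b [hb ->]] : exists b, word_ge Z 1 b /\ z = aug z *: 1 + b.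
      exists (z - aug z *: 1); split; last by rewrite addrC subrK.
      exact: scalar_part.
    rewrite linearD linearZ rmorph1 mulrDl -scalerAl mul1r.
    exists (aug z *: w'), (i b * j w'); rewrite linearZ; split=> //.
    apply: setaddml => //; apply: FE_gen => //; exact: (word_ge_sub (isT : 1 <= 2)%N).
  - by move=> hy; apply: SR; apply: setaddml.
  - by move=> hy; apply: SR; apply: setaddmr.
  - move=> hy; apply: SR; apply: setaddmr => //; apply: FE_sub hy => //.
have [l [r [hr e1]]] : exists l r, R11 r /\ ad (j w) = j l + r.
  by apply: split_word; apply: sum_gens_GE; exact: hmin.
have e2 : curv w = j (l - ad w) + r by rewrite /curv e1 linearB addrAC.
have [R [lR RE]] : exists R : E -> L, linear R /\ forall b l, R (i b * j l) = aug b *: l.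
  have [_ _ tE _ _] := hV.
  have [||R [RE _]] := tE L (fun b l => aug b *: l).
  - by move=> l' _ c x y; rewrite laug scalerDl -scalerA.
  - by move=> b c x y _ _; rewrite scalerDr !scalerA mulrC.
  by exists R; split=> [c x y|b l']; [rewrite linearP|rewrite RE].
have R0 x : FE 1 0 x -> R x = 0.
  suff H : FE 1 0 `<=` [set x | R x = 0] by move=> /H.
  apply: lspan_min; first exact: (submod_ker lR).
  move=> _ [z [l' [hz _ ->]]] /=; rewrite RE aug0 ?scale0r //.
  exact: (word1_posdeg Zf Zp).
have r10 : FE 1 0 r.
  move: hr; apply: setaddm_min => //; exact: FE_sub.
have Rj l' : R (j l') = l' by rewrite -[j l']mul1r -(rmorph1 i) RE aug1 scale1r.
have := R0 _ (curv_FE10 w); rewrite e2 (linD _ _ lR) Rj (R0 _ r10) addr0 => ->.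
by rewrite rmorph0 add0r.
Qed.

Section Descent.
Variable c : nat.
Hypothesis c1 : (c <= 1)%N.
Hypothesis hc : forall w, W w -> GE 1 (1 - c) (curv w).

Lemma Pge_md_GP p q x : F p q x -> setaddm (F p q) (GP p.+1 (q - c)) (md x).
Proof.
have hT : submod (setaddm (F p q) (GP p.+1 (q - c))) by exact: setaddm_submod.
suff H : F p q `<=` [set x | setaddm (F p q) (GP p.+1 (q - c)) (md x)] by move=> /H.
apply: lspan_min; first exact: (submod_preim (@md_linear _ _ _) hT).
move=> _ [z [w [u [hz hw hu ->]]]]; rewrite /mkset md_actE ad_mul -cdga_hom_d -!gca_hom_eps.
have inF z' w' v : word_ge Z p z' -> word_ge W q w' -> F p q (act (i z' * j w') v).
  move=> hz' hw'; have := Pge_act hZ hV hU hz' hw' (Pge_total hZ hV hU v).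
  by rewrite !addn0.
have hez : word_ge Z p (eps z) by exact: (graded_eps (Zg p)).
have hew : word_ge W q (eps w) by exact: (graded_eps (Wg q)).
apply: (submodD hT); last first.
  apply: setaddml => //; rewrite epsM -!gca_hom_eps; exact: inF.
rewrite (linD _ _ (act_linearl u)); apply: (submodD hT).
  by apply: setaddml => //; apply: inF => //; exact: (ad_word Zf Zp).
have -> : ad (j w) = j (ad w) + curv w by rewrite /curv addrC subrK.
rewrite mulrDr (linD _ _ (act_linearl u)); apply: (submodD hT).
  by apply: setaddml => //; apply: inF => //; exact: (ad_word Wf Wp).
apply: setaddmr => //; apply: GE_act.
have h1 : FE p 0 (i (eps z)).
  by rewrite -[i _]mulr1 -(rmorph1 j); apply: FE_gen => //; exact: word_ge1.
have := GE_mul (FE_GE h1) (curv_letters c1 hc hw).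
by rewrite addn1 add0n.
Qed.

(** The projection of the first factor onto the words of length > p in Z fixes
    x and maps F p q to F p.+1 q. *)
Lemma Pge_inter p q x : F p q x -> F p.+1 0 x -> F p.+1 q x.
Proof.
move=> h1 h2; have [psi [lpsi psiS psi1]] := linear_projection (proj1 (Zg p.+1)).
have [phi [lphi phiE]] := module_map hV hU lpsi (fun a (x y : L) => erefl (a *: x + y)).
have <- : phi x = x.
  move: h2; apply: (@lin_ext_span _ _ _ _ phi idfun) => // _ [z [w [u [hz hw hu ->]]]].
  by rewrite -/(mon z w u) phiE // psi1.
move: h1; apply: (lspan_lin lphi) => // _ [z [w [u [hz hw hu ->]]]].
by rewrite -/(mon z w u) phiE //; apply: lspan_gen; exists (psi z), w, u.
Qed.

Variable n : nat.
Hypothesis hn : forall p q, exists e, toomer W (Ppq hZ hV hU p q) e /\ enat_le e n.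

(** The leading part x0 of x is a cocycle of the column P^(p, >= 0). By
    exactness it is there the differential of some y of wordlength >= q; the
    part of md y that leaves the column is controlled by the curvature. *)
Lemma column_step p q x : GP p (n.+1 + q) x -> md x = 0 ->
  exists y, GP p.+1 (q - c) (x - md y).
Proof.
move=> /GP_split [x0 [x1 [h0 h1 ->]]] dx.
have [e [[Q [f [[_ fq] eQ]]] [m' em mn]]] := hn p q.
rewrite em in eQ; have tQ := toomer_inj_mono mn (toomer_semifree_Some eQ).
have Fx1 : F p.+1 0 x1 by exact: (GP_F h1).
have dx0 : F p.+1 0 (md x0).
  have -> : md x0 = - md x1.
    by apply/eqP; rewrite -addr_eq0 -(linD _ _ (@md_linear _ _ _)) dx.
  by apply: (submodN (hF _ _)); exact: Pge_d_stable.
have [y [hy hxy]] := column_exact char0 fq (fun q' => toomer_inj0 tQ) h0 dx0.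
exists y; have [y0 [y1 [hy0 hy1 ey]]] := Pge_md_GP hy.
have -> : x0 + x1 - md y = (x0 - y0) + (x1 - y1) by rewrite ey opprD addrACA.
apply: (submodD (hGP _ _)).
  apply: (GP_sub (leq_subr c q)); apply: F_GP; apply: Pge_inter.
    by apply: (submodB (hF _ _)) => //; apply: Fsub h0 => //; exact: leq_addl.
  have -> : x0 - y0 = (x0 - md y) + y1 by rewrite ey opprD addrA subrK.
  by apply: (submodD (hF _ _)) => //; exact: (GP_F hy1).
apply: (submodB (hGP _ _)) => //; apply: GP_sub h1.
by rewrite addSn /= (leq_trans (leq_subr _ _)) // leq_addl.
Qed.

Lemma column_steps r p q x : md x = 0 -> GP p q x -> (r * (n.+1 + c) <= q + c)%N ->
  exists y, F (p + r) 0 (x - md y).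
Proof.
elim: r p q x => [|r IH] p q x dx hx hq.
  by exists 0; rewrite (lin0 (@md_linear _ _ _)) subr0 addn0; exact: (GP_F hx).
have hq' : (n.+1 + r * (n.+1 + c) <= q)%N.
  by move: hq; rewrite mulSn addnAC leq_add2r.
have nq : (n.+1 <= q)%N by apply: leq_trans hq'; exact: leq_addr.
rewrite -(subnKC nq) in hx; have [y hy] := column_step hx dx.
have dxy : md (x - md y) = 0 by rewrite (linB _ _ (@md_linear _ _ _)) dx md_md subr0.
have hq2 : (r * (n.+1 + c) <= q - n.+1 - c + c)%N.
  apply: (@leq_trans (q - n.+1)); first by rewrite leq_subRL.
  by rewrite addnC -leq_subLR.
have [y' hy'] := IH _ _ _ dxy hy hq2.
exists (y + y'); rewrite (linD _ _ (@md_linear _ _ _)) opprD addrA addnS -addSn.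
by [].
Qed.

(** The m + 1 steps lead from column 0 to column m + 1, which consists of the
    words of length > m in Z applied to P. *)
Lemma toomer_bound m N : toomer Z (restrict i P) (Some m) ->
  (m.+1 * (n.+1 + c) <= N.+1 + c)%N -> toomer_inj V P N.
Proof.
move=> /(toomer_restrict Zf hV hU) hm hN x dx [y hy].
have dxy : md (x - md y) = 0 by rewrite (linB _ _ (@md_linear _ _ _)) dx md_md subr0.
have hG : GP 0 N.+1 (x - md y).
  move: hy; apply: lspan_min => // _ [a [v [ha ->]]].
  by apply: GE_act; exact: sum_gens_GE.
have [y' hy'] := column_steps dxy hG hN.
have dxy' : md (x - md y - md y') = 0.
  by rewrite (linB _ _ (@md_linear _ _ _)) dxy md_md subr0.
have hq : lspan [set v | exists b w, word_ge Z m.+1 b /\ v = act (i b) w] (x - md y - md y').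
  move: hy'; apply: lspan_sub => _ [b [w [u [hb _ hu ->]]]].
  by apply: lspan_gen; exists b, (act (j w) u); rewrite actM.
have [z ez] := @toomer_inj0 _ _ _ (restrict i P) m (x - md y - md y') hm dxy' hq.
exists (z + y' + y); rewrite !(linD _ _ (@md_linear _ _ _)).
by rewrite -[md z]ez !subrK.
Qed.

End Descent.

End Main.

Theorem theorem3p8 (k : fieldType) (char0 : [pchar k] =i pred0)
    (LZ LV LW : cdga k) (Z : set LZ) (W : set LW)
    (i : cdga_hom LZ LV) (j : gca_hom LW LV)
    (hZ : sullivan Z) (hV : relative_sullivan W i j)
    (P : dgmod LV) (U : set P) (hU : semifree_on U)
    (m : nat) (hm : toomer Z (restrict i P) (Some m))
    (n : nat)
    (hn : forall p q : nat, exists e : option nat,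
        toomer W (Ppq hZ hV hU p q) e /\ enat_le e n) :
  enat_le (toomer_semifree (sum_gens i j Z W) P) ((m + 1) * (n + 2) - 2)%N /\
  (minimal_sullivan (sum_gens i j Z W) ->
   enat_le (toomer_semifree (sum_gens i j Z W) P) ((m + 1) * (n + 1) - 1)%N).
Proof.
split=> [|hmin]; apply: toomer_semifree_le.
- apply: (toomer_bound char0 (c := 1) (leqnn 1) _ hn hm).
    by move=> w _; exact: curv_general.
  have h2 : (2 <= (m + 1) * (n + 2))%N by rewrite addn1 addn2.
  have -> : (((m + 1) * (n + 2) - 2).+1 + 1 = (m + 1) * (n + 2))%N.
    by move: h2; set X := (_ * _)%N => h2; rewrite addn1 -addn2 subnK.
  by rewrite !addn1 addn2.
- apply: (toomer_bound char0 (c := 0) isT (curv_minimal hZ hV hmin) hn hm).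
  have h1 : (1 <= (m + 1) * (n + 1))%N by rewrite !addn1.
  have -> : (((m + 1) * (n + 1) - 1).+1 + 0 = (m + 1) * (n + 1))%N.
    by move: h1; set X := (_ * _)%N => h1; rewrite addn0 -addn1 subnK.
  by rewrite !addn1 addn0.
Qed.
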